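(* Let $d\ge3$ be an integer, $M$ a finite set and $p\in\mathcal I_e(M)$. If for all couplings $q\in\mathcal I_e(M^2)$ of $p$ and $p$ we have $\Sigma(q)\le2\Sigma(p)$, then $$\underline h(\mu(p))=\bar h(\mu(p))=\Sigma(p)$$ and $\mu(p)$ is strongly typical.
   Context: **Processes.** $T_d$ is the infinite $d$-regular tree with root $o$, whose neighbors are labeled $1,\dots,d$. $\mathcal I_d(M)$ is the set of probability measures on $M^{T_d}$ invariant under all automorphisms of $T_d$. $E_1=\{o,1\}$. **Vertex-Markov processes.** A probability measure on $M^{T_d}$ is vertex-Markov if, conditioned on the value at a vertex, the processes on the pending subtrees of that vertex are independent (for every vertex). $\mathcal I_e(M)$ is the set of probability measures on $M^{E_1}$ invariant by switching the two sides of the edge $\{o,1\}$. For $p\in\mathcal I_e(M)$, $\mu(p)$ is the unique vertex-Markov process in $\mathcal I_d(M)$ whose restriction to $E_1$ is $p$. $H$ is Shannon entropy (natural logarithm). For $X$ with law in $\mathcal I_d(M)$, $\Sigma_e(X)=\frac d2H(X_{E_1})-(d-1)H(X_o)$, and for $p\in\mathcal I_e(M)$, $\Sigma(p)=\Sigma_e(\mu(p))$, i.e. $\Sigma(p)=\frac d2H(p)-(d-1)H(p_o)$ with $p_o$ the marginal of $p$ at $o$ (same definitions with color set $M^2$). A coupling of $p$ and $p$ is a probability measure on $M^{E_1}\times M^{E_1}\cong(M^2)^{E_1}$ with both marginals equal to $p$. **Random labeling and topology.** Let $\mathbb N=\{1,2,\dots\}$ and $\mathbb N^f=\bigcup_{k\ge0}\mathbb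 N^k$ with $\mathbb N^0=\{o\}$. A rooted $M$-colored graph $(G,f,v)$ is a connected graph $G$ with a map $f$ from its vertices to $M$ and a distinguished vertex $v$. If $G$ is locally finite, its randomly labeled version is the isomorphic random rooted colored graph on a subset of $\mathbb N^f$ given by the breadth-first search from the root with ties broken uniformly at random: the root gets label $o$, and the $j$-th offspring of the vertex labeled $(i_1,\dots,i_{k-1})$ gets label $(i_1,\dots,i_{k-1},j)$. $\mathcal G^\bullet_M$ is the set of rooted colored graphs arising as such labelings, with metric $\sum_{r\ge0}2^{-r}\mathbf 1_{g_r\ne g'_r}$, where $g_r$ is the restriction of $g$ to vertices at distance at most $r$ from the root. Fix a distance $\mathrm d$ on $\mathcal P(\mathcal G^\bullet_M)$ (probability measures) generating the weak topology (e.g. Lévy–Prohorov; the notions below do not depend on this choice). $T_d$ is built on a subset of $\mathbb N^f$ in this way, and $\mu\in\mathcal I_d(M)$ is identified with the law of $(T_d,X,o)$, $X\sim\mu$. For $\nu\in\mathcal P(\mathcal G^\bullet_M)$, $\nu_r$ is the law of the restriction to vertices at distance at most $r$ from the root. For a finite graph $G$ with vertex set $V$ and $f:V\to M$, $\mathrm{distr}_G(f)=\frac1{|V|}\sum_{v\in V}\mathrm{distr}_{G,v}(f)$, where $\mathrm{distr}_{G,v}(f)$ is the law of the randomly labeled version of the connected component of $v$ in $(G,f)$, rooted at $v$. **Sofic entropies and typicality.** For $n\ge d+1$ with $nd$ even, $\mathcal G_n(d)$ is the set of simple $d$-regular graphs on $[n]=\{1,\dots,n\}$ and $G_n$ is uniform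 on $\mathcal G_n(d)$; all limits in $n$ are along such $n$. For $\mu\in\mathcal I_d(M)$, $\epsilon>0$, $r\ge0$, set $\mathcal F_G(\mu,r,\epsilon)=\{f\in M^n:\mathrm d(\mathrm{distr}_G(f)_r,\mu_r)\le\epsilon\}$ and $H_G(\mu,r,\epsilon)=\frac1n\log|\mathcal F_G(\mu,r,\epsilon)|\in\{-\infty\}\cup[0,\infty)$. For $0<\alpha<1$, let $h_n(\mu,r,\epsilon,\alpha)=\sup\{h\in\{-\infty\}\cup[0,\infty):\mathbb P(H_{G_n}(\mu,r,\epsilon)\ge h)\ge\alpha\}$, $\bar h(\mu,r,\alpha)=\lim_{\epsilon\to0}\limsup_{n}h_n(\mu,r,\epsilon,\alpha)$ and $\underline h(\mu,r,\alpha)=\lim_{\epsilon\to0}\liminf_n h_n(\mu,r,\epsilon,\alpha)$. These do not depend on $\alpha\in(0,1)$; the common values are $\bar h(\mu,r)$ and $\underline h(\mu,r)$. They are non-increasing in $r$, and $\bar h(\mu)=\lim_{r\to\infty}\bar h(\mu,r)$, $\underline h(\mu)=\lim_{r\to\infty}\underline h(\mu,r)$. $\mu$ is strongly typical if $\lim_{\epsilon\to0}\lim_{n\to\infty}\mathbb P(\exists f\in M^n:\mathrm d(\mathrm{distr}_{G_n}(f),\mu)\le\epsilon)=1$. *)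

(* Defs.v *)
From HB Require Import structures.
From mathcomp Require Import all_boot all_order all_algebra all_fingroup.
From mathcomp Require Import all_classical all_reals all_analysis.
Import Order.TTheory GRing.Theory Num.Theory.
Import numFieldNormedType.Exports.

Set Implicit Arguments.
Unset Strict Implicit.
Unset Printing Implicit Defensive.

Local Open Scope classical_set_scope.
Local Open Scope ring_scope.

#[short(type="pointedFinType")]
HB.structure Definition PointedFinite := { T of Finite T & Pointed T }.

(* The order in which breadth-first search visits the labels: by length, then
   lexicographically. *)
Definition shortlex (x y : seq nat) : bool :=
  ((size x :: x : seqlexi nat) <= (size y :: y : seqlexi nat))%O.

(* [c] gives the colour of the labels that are vertices and [None] for the
   others, [e] is the edge relation.  The predicate says that the labels are
   those of a breadth-first search from [[::]]: every other vertex is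
   [rcons l j], the [j]-th offspring (counted from 1) of its neighbour [l]
   that is visited first.  In particular the graph is connected and the
   length of a label is the distance to the root. *)
Record is_bfs (M : Type) (c : seq nat -> option M) (e : rel (seq nat)) : Prop :=
  IsBfs {
    bfs_root : c [::];
    bfs_dom : forall x y, e x y -> c x /\ c y;
    bfs_sym : symmetric e;
    bfs_irr : irreflexive e;
    bfs_locfin : forall x, finite_set [set y | e x y];
    bfs_child : forall l j, c (rcons l j) ->
      [/\ (0 < j)%N, e l (rcons l j)
        & forall i, (0 < i <= j)%N -> c (rcons l i)];
    bfs_first : forall l j x, e x (rcons l j) -> shortlex l x }.

Record bfs_graph (M : Type) := BfsGraph {
  gcol : seq nat -> option M;
  gadj : rel (seq nat);
  gP : is_bfs gcol gadj }.

Lemma bfs_graph_eq (M : Type) (g h : bfs_graph M) :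
  gcol g = gcol h -> gadj g = gadj h -> g = h.
Proof.
case: g h => c e P [c' e' P'] /= ec ee; case: _ / ec P' => P'.
case: _ / ee P' => P'; congr BfsGraph; exact: Prop_irrelevance.
Qed.

Lemma shortlex_refl x : shortlex x x.
Proof. exact: lexx. Qed.

Lemma shortlex_size x y : (size x < size y)%N -> shortlex x y.
Proof.
move=> xy; rewrite /shortlex.
by rewrite Order.SeqLexiOrder.lexi_cons /= !leEnat (ltnW xy) leqNgt xy.
Qed.

Lemma shortlex_total : total shortlex.
Proof. by move=> x y; exact: le_total. Qed.

Lemma shortlex_trans : transitive shortlex.
Proof. by move=> y x z; exact: le_trans. Qed.

Section restriction.
Context {M : Type} (r : nat) (g : bfs_graph M).

Definition restr_col (x : seq nat) : option M :=
  if (size x <= r)%N then gcol g x else None.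

Definition restr_adj : rel (seq nat) :=
  fun x y => [&& (size x <= r)%N, (size y <= r)%N & gadj g x y].

Lemma restr_is_bfs : is_bfs restr_col restr_adj.
Proof.
have P := gP g; split.
- exact: (bfs_root P).
- move=> x y /and3P[xr yr /(bfs_dom P)[cx cy]].
  by rewrite /restr_col xr yr.
- by move=> x y; rewrite /restr_adj (bfs_sym P) andbCA.
- by move=> x; rewrite /restr_adj (bfs_irr P) !andbF.
- move=> x; apply: sub_finite_set (bfs_locfin P x) => y /=.
  by case/and3P.
- move=> l j; rewrite /restr_col size_rcons; case: ifP => // lr.
  move=> /(bfs_child P)[j0 elj sib]; split=> //.
    by rewrite /restr_adj size_rcons lr (ltnW lr).
  by move=> i ij; rewrite size_rcons lr; exact: sib.
- by move=> l j x /and3P[_ _ /(bfs_first P)].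
Qed.

Definition restr : bfs_graph M := BfsGraph restr_is_bfs.

End restriction.

Section labelling.
Variables (V : finType) (adj : rel V) (s : seq V) (v : V).
Implicit Type L : V -> option (seq nat).

(* Label of the neighbour of [u] that is visited first, among the neighbours
   labelled by [L]. *)
Definition first_label L (u : V) : option (seq nat) :=
  ohead (sort shortlex (pmap L [seq x <- enum V | adj x u])).

(* The unlabelled vertices whose first labelled neighbour has label [l],
   listed according to the priority list [s]. *)
Definition offspring L (l : seq nat) : seq V :=
  [seq u <- s | ~~ L u & first_label L u == Some l].

Definition bfs_step L (w : V) : option (seq nat) :=
  if L w is Some l then Some l
  else omap (fun l => rcons l (index w (offspring L l)).+1) (first_label L w).

(* Labels of the vertices at distance at most [k] from [v]. *)
Definition bfs_lab (k : nat) : V -> option (seq nat) :=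
  iter k bfs_step (fun w => if w == v then Some [::] else None).

Definition bfs_label : V -> option (seq nat) := bfs_lab #|V|.

Definition lab_col (M : Type) (f : V -> M) (x : seq nat) : option M :=
  omap f [pick w | bfs_label w == Some x].

Definition lab_adj : rel (seq nat) := fun x y =>
  [exists w, exists w', [&& bfs_label w == Some x, bfs_label w' == Some y
                          & adj w w']].

Hypotheses (us : uniq s) (s_all : forall w, w \in s).
Hypotheses (adjC : symmetric adj) (adjI : irreflexive adj).

Lemma first_labelP L u l : first_label L u = Some l ->
  (exists2 x, adj x u & L x = Some l) /\
  (forall x l', adj x u -> L x = Some l' -> shortlex l l').
Proof.
rewrite /first_label; set t := pmap _ _ => E.
have := sort_sorted shortlex_total t; have memt := mem_sort shortlex t.
case: (sort shortlex t) E memt => //= a t' [->] memt pt; split.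
  have : l \in t by rewrite -memt mem_head.
  rewrite mem_pmap => /mapP[x]; rewrite mem_filter => /andP[xu _] ->.
  by exists x.
move=> x l' xu Lx; have : l' \in t.
  rewrite mem_pmap; apply/mapP; exists x => //.
  by rewrite mem_filter xu mem_enum.
rewrite -memt inE => /predU1P[->|]; first exact: shortlex_refl.
by apply/allP; exact: order_path_min shortlex_trans pt.
Qed.

Lemma first_label_ex L u x : adj x u -> L x -> first_label L u.
Proof.
move=> xu; case Lx : (L x) => [l|]// _; rewrite /first_label.
set t := pmap _ _; have : l \in t.
  by rewrite mem_pmap; apply/mapP; exists x; rewrite // mem_filter xu mem_enum.
by rewrite -(mem_sort shortlex); case: sort.
Qed.

Lemma bfs_labS k w l : bfs_lab k w = Some l -> bfs_lab k.+1 w = Some l.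
Proof. by rewrite /bfs_lab iterS /bfs_step => ->. Qed.

Lemma bfs_lab_mono j k w l : (j <= k)%N ->
  bfs_lab j w = Some l -> bfs_lab k w = Some l.
Proof.
by move=> /subnKC <-; elim: (k - j)%N => [|i IH] Lw; rewrite ?addn0 ?addnS//;
  apply: bfs_labS; exact: IH.
Qed.

Lemma bfs_lab_next k u w : adj u w -> bfs_lab k u -> bfs_lab k.+1 w.
Proof.
move=> uw Lu; rewrite /bfs_lab iterS /bfs_step -/(bfs_lab k).
case: (bfs_lab k w) => //; have := first_label_ex uw Lu.
by case: first_label.
Qed.

Lemma bfs_lab_size k w l : bfs_lab k w = Some l ->
  (size l <= k)%N /\ bfs_lab (size l) w = Some l.
Proof.
elim: k w l => [|k IH] w l.
  by rewrite /bfs_lab /=; case: eqP => // ->  [<-]/=; rewrite eqxx.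
move=> E; have := E; rewrite {1}/bfs_lab iterS /bfs_step -/(bfs_lab k).
case Lw : (bfs_lab k w) => [l'|].
  by move=> [<-]; have [sl ?] := IH _ _ Lw; split=> //; exact: leqW.
case F : first_label => [l0|]//= [El].
have [[u uw Lu] _] := first_labelP F.
have [l0k Lu'] := IH _ _ Lu.
suff sl0 : size l0 = k by rewrite -El size_rcons sl0 El.
apply/eqP; rewrite eqn_leq l0k leqNgt; apply/negP => l0lt.
have : bfs_lab (size l0).+1 w by apply: bfs_lab_next uw _; rewrite Lu'.
case Ew : bfs_lab => [l1|]// _.
by have := bfs_lab_mono l0lt Ew; rewrite Lw.
Qed.

Lemma bfs_lab_rcons k w l j : bfs_lab k w = Some (rcons l j) ->
  [/\ (size l < k)%N, bfs_lab (size l) w = None,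
      first_label (bfs_lab (size l)) w = Some l
    & j = (index w (offspring (bfs_lab (size l)) l)).+1].
Proof.
move=> /bfs_lab_size; rewrite size_rcons => -[lk Lw].
have LN : bfs_lab (size l) w = None.
  case E : bfs_lab => [l'|]//; have [l'l _] := bfs_lab_size E.
  move: (bfs_labS E); rewrite Lw => -[El'].
  by move: l'l; rewrite -El' size_rcons ltnn.
move: Lw; rewrite /bfs_lab iterS /bfs_step -/(bfs_lab _) LN.
by case: first_label => //= a [/rcons_inj[-> <-]]; split.
Qed.

Lemma mem_offspring L l w : ~~ L w -> first_label L w = Some l ->
  w \in offspring L l.
Proof. by move=> LN F; rewrite mem_filter LN F eqxx s_all. Qed.

Lemma bfs_lab_inj k w w' l :
  bfs_lab k w = Some l -> bfs_lab k w' = Some l -> w = w'.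
Proof.
case/lastP: l => [|l j].
  move=> /bfs_lab_size[_ /=]; rewrite /bfs_lab/=; case: eqP => // -> _.
  by move=> /bfs_lab_size[_ /=]; rewrite /bfs_lab/=; case: eqP => // ->.
move=> /bfs_lab_rcons[_ N F ->] /bfs_lab_rcons[_ N' F' [E]].
have wo : w \in offspring (bfs_lab (size l)) l by rewrite mem_offspring// N.
have wo' : w' \in offspring (bfs_lab (size l)) l by rewrite mem_offspring// N'.
by rewrite -(nth_index w wo) E nth_index.
Qed.

Lemma lab_col_some (M : Type) (f : V -> M) w x :
  bfs_label w = Some x -> lab_col f x.
Proof.
by move=> Lw; rewrite /lab_col; case: pickP => //= /(_ w); rewrite Lw eqxx.
Qed.

Lemma lab_is_bfs (M : Type) (f : V -> M) : is_bfs (lab_col f) lab_adj.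
Proof.
split.
- apply: (@lab_col_some _ _ v); apply: (@bfs_lab_mono 0) => //.
  by rewrite /bfs_lab/= eqxx.
- move=> x y /existsP[w /existsP[w' /and3P[/eqP Lw /eqP Lw' _]]].
  by split; [exact: lab_col_some Lw|exact: lab_col_some Lw'].
- move=> x y; apply/idP/idP => /existsP[w /existsP[w' /and3P[Lw Lw' ww']]];
    by apply/existsP; exists w'; apply/existsP; exists w; rewrite Lw Lw' adjC.
- move=> x; apply/negbTE/negP => /existsP[w /existsP[w' /and3P[/eqP Lw /eqP Lw']]].
  by rewrite (bfs_lab_inj Lw Lw') adjI.
- move=> x; apply: (@sub_finite_set _ _ [set y | y \in pmap bfs_label (enum V)]).
    move=> y /existsP[w /existsP[w' /and3P[_ /eqP Lw' _]]] /=.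
    by rewrite mem_pmap -Lw' map_f// mem_enum.
  exact: finite_seq.
- move=> l j; rewrite {1}/lab_col; case: pickP => //= w /eqP Lw _.
  have [lV N F jE] := bfs_lab_rcons Lw; split; first by rewrite jE.
    have [[u uw Lu] _] := first_labelP F.
    apply/existsP; exists u; apply/existsP; exists w; rewrite Lw uw eqxx.
    by rewrite !andbT; apply/eqP; exact: (bfs_lab_mono (ltnW lV) Lu).
  move=> i /andP[i0 ij]; set o := offspring (bfs_lab (size l)) l.
  have wo : w \in o by rewrite mem_offspring// N.
  have io : (i.-1 < size o)%N.
    rewrite (leq_ltn_trans _ (_ : index w o < size o)%N) ?index_mem//.
    by rewrite -ltnS prednK// -jE.
  have : nth w o i.-1 \in o by rewrite mem_nth.
  rewrite {1}mem_filter => /andP[/andP[N' /eqP F'] _].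
  apply: (@lab_col_some _ _ (nth w o i.-1)).
  apply: (@bfs_lab_mono (size l).+1) => //.
  rewrite /bfs_lab iterS /bfs_step -/(bfs_lab _).
  case: (bfs_lab _ _) N' => // _; rewrite F' /= -/o index_uniq//.
    by rewrite prednK.
  by rewrite /o /offspring filter_uniq.
- move=> l j x /existsP[u /existsP[w /and3P[/eqP Lu /eqP Lw uw]]].
  have [lV N F jE] := bfs_lab_rcons Lw.
  have [xl|lx] := leqP (size x) (size l); last exact: shortlex_size.
  have [_ /(bfs_lab_mono xl) Lu'] := bfs_lab_size Lu.
  by have [_ /(_ _ _ uw Lu')] := first_labelP F.
Qed.

End labelling.

(* [R] is only there to be the field in which distances take their values. *)
Definition rooted_graph (R : realType) (M : Type) : Type := bfs_graph M.

HB.instance Definition _ R M := gen_eqMixin (rooted_graph R M).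
HB.instance Definition _ R M := gen_choiceMixin (rooted_graph R M).

Section single_vertex.
Variables (M : Type) (m : M).

Lemma single_is_bfs :
  is_bfs (fun x => if x == [::] then Some m else None) (fun _ _ => false).
Proof.
split=> //; first by move=> x; apply: sub_finite_set (finite_set0 _) => y.
by case.
Qed.

Definition single_vertex := BfsGraph single_is_bfs.

End single_vertex.

HB.instance Definition _ R (M : pointedType) :=
  isPointed.Build (rooted_graph R M) (single_vertex point).

Section graph_metric.
Variables (R : realType) (M : Type).
Implicit Types g h : rooted_graph R M.

Definition graph_dist_term g h (r : nat) : R :=
  2^-1 ^+ r * ((restr r g : rooted_graph R M) != restr r h)%:R.

Definition graph_dist g h : R := limn (series (graph_dist_term g h)).

Let half_gt0 : 0 < 2^-1 :> R. Proof. by rewrite invr_gt0. Qed.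

Lemma graph_dist_term_ge0 g h r : 0 <= graph_dist_term g h r.
Proof. by rewrite mulr_ge0// exprn_ge0// ltW. Qed.

Lemma graph_dist_term_le g h r : graph_dist_term g h r <= 2^-1 ^+ r.
Proof.
by rewrite -[leRHS]mulr1 ler_wpM2l ?exprn_ge0 ?(ltW half_gt0)//; case: eqP.
Qed.

Lemma is_cvg_graph_dist g h : cvgn (series (graph_dist_term g h)).
Proof.
apply: (@series_le_cvg _ _ (geometric 1 2^-1)).
- exact: graph_dist_term_ge0.
- by move=> n; rewrite /= mul1r exprn_ge0// ltW.
- by move=> n; rewrite /= mul1r graph_dist_term_le.
- by apply: is_cvg_geometric_series; rewrite gtr0_norm// invf_lt1 ?ltr1n.
Qed.

Lemma graph_dist_ge g h r : graph_dist_term g h r <= graph_dist g h.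
Proof.
have nd : nondecreasing_seq (series (graph_dist_term g h)).
  apply/nondecreasing_seqP => n; rewrite -subr_ge0 /series/= big_nat_recr//=.
  by rewrite addrAC subrr add0r graph_dist_term_ge0.
apply: le_trans (nondecreasing_cvgn_le nd (@is_cvg_graph_dist g h) r.+1).
rewrite /series/= big_nat_recr//= lerDr.
by apply: sumr_ge0 => i _; exact: graph_dist_term_ge0.
Qed.

Lemma graph_dist_ltP g h r : graph_dist g h < 2^-1 ^+ r -> restr r g = restr r h.
Proof.
move=> lt; case: (eqVneq (restr r g : rooted_graph R M) (restr r h)) => // ne.
have := le_lt_trans (graph_dist_ge g h r) lt.
by rewrite /graph_dist_term ne mulr1 ltxx.
Qed.

Lemma restr_restr q r (g : bfs_graph M) : (q <= r)%N ->
  restr q (restr r g) = restr q g.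
Proof.
move=> qr; apply: bfs_graph_eq.
  apply/funext => x /=; rewrite /restr_col; case: ifP => // xq.
  by rewrite /= /restr_col (leq_trans xq qr).
apply/funext => x; apply/funext => y /=; rewrite /restr_adj /=.
case xq : (_ <= q)%N => //=; case yq : (_ <= q)%N => //=.
by rewrite /restr_adj !(leq_trans _ qr).
Qed.

Lemma graph_dist_le g h r : restr r g = restr r h -> graph_dist g h <= 2^-1 ^+ r.
Proof.
move=> E; set u := graph_dist_term g h.
have u0 k : (k <= r)%N -> u k = 0.
  move=> kr; rewrite /u /graph_dist_term.
  by rewrite -(restr_restr g kr) E restr_restr// eqxx mulr0.
have le n : series u (r.+1 + n)%N <= 2^-1 ^+ r - 2^-1 ^+ (r + n)%N.
  elim: n => [|n IH].
    rewrite !addn0 subrr /series/= big_nat big1// => i /andP[_ ir]; exact: u0.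
  rewrite addnS /series/= big_nat_recr//=.
  apply: le_trans (lerD IH (graph_dist_term_le g h _)) _.
  rewrite addSn addnS exprS -addrA lerD2l.
  set z := _ ^+ _; have -> //: - z + 2^-1 * z = - (2^-1 * z).
    by rewrite {1}(splitr z) (mulrC _ z) opprD addrNK.
apply: limr_le; first exact: is_cvg_graph_dist.
near=> n; have rn : (r.+1 <= n)%N by near: n; exact: nbhs_infty_ge.
rewrite -/u -(subnKC rn); apply: le_trans (le _) _.
by rewrite lerBlDr lerDl exprn_ge0// ltW.
Unshelve. all: by end_near. Qed.

Let graph_distxx g : graph_dist g g = 0.
Proof.
apply/eqP; rewrite eq_le; apply/andP; split.
  rewrite /graph_dist (_ : series _ = cst 0); last first.
    apply/funext => n; rewrite /series/= big1// => i _.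
    by rewrite /graph_dist_term eqxx mulr0.
  by rewrite lim_cst.
exact: le_trans (graph_dist_term_ge0 g g 0) (graph_dist_ge g g 0).
Qed.

Let graph_dist_positivity g h : graph_dist g h = 0 -> g = h.
Proof.
move=> E; have R_ r : restr r g = restr r h.
  by apply: graph_dist_ltP; rewrite E exprn_gt0.
apply: bfs_graph_eq.
  apply/funext => x; have := congr1 (fun k => gcol k x) (R_ (size x)).
  by rewrite /= /restr_col leqnn.
apply/funext => x; apply/funext => y.
have := congr1 (fun k => gadj k x y) (R_ (maxn (size x) (size y))).
by rewrite /= /restr_adj leq_maxl leq_maxr.
Qed.

Let graph_dist_sym g h : graph_dist g h = graph_dist h g.
Proof.
congr (limn (series _)); apply/funext => r.
by rewrite /graph_dist_term eq_sym.
Qed.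

Let graph_dist_triangle k g h :
  graph_dist g h <= graph_dist g k + graph_dist k h.
Proof.
rewrite /graph_dist -limD; try exact: is_cvg_graph_dist.
rewrite -seriesD; apply: lim_series_le.
- exact: is_cvg_graph_dist.
- by rewrite seriesD; apply: is_cvgD; exact: is_cvg_graph_dist.
- move=> r; rewrite -[leRHS]/(graph_dist_term g k r + graph_dist_term k h r).
  rewrite /graph_dist_term -mulrDr.
  rewrite ler_wpM2l ?exprn_ge0 ?(ltW half_gt0)// -natrD ler_nat.
  case: (eqVneq (restr r g : rooted_graph R M) (restr r k)) => [->|//].
    by rewrite leq_addl.
  by move=> _; rewrite (leq_trans (leq_b1 _))// leq_addr.
Qed.

HB.instance Definition _ := @isMetric.Build R (rooted_graph R M) graph_dist
  graph_distxx graph_dist_positivity graph_dist_sym graph_dist_triangle.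

Lemma nbhs_restr g (U : set (rooted_graph R M)) : nbhs g U ->
  exists r, forall h, restr r g = restr r h -> U h.
Proof.
rewrite -nbhs_ballE => -[e /= e0 gU].
have [r re] : exists r, 2^-1 ^+ r < e.
  have : 2^-1 ^+ n @[n --> \oo] --> (0 : R).
    rewrite (_ : (fun n => _) = geometric 1 2^-1); last first.
      by apply/funext => n /=; rewrite mul1r.
    by apply: cvg_geometric; rewrite gtr0_norm// invf_lt1 ?ltr1n.
  move=> /cvgrPdist_lt /(_ _ e0)[r _ /(_ r (leqnn _))].
  rewrite sub0r normrN ger0_norm ?exprn_ge0 ?(ltW half_gt0)// => re.
  by exists r.
exists r => h gh; apply: gU; rewrite ballEmdist/=.
exact: le_lt_trans (graph_dist_le gh) re.
Qed.

Lemma open_restr (U : set (rooted_graph R M)) (r : nat) :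
  (forall g h, restr r g = restr r h -> U g -> U h) -> open U.
Proof.
move=> H; rewrite openE => g Ug; rewrite /interior -nbhs_ballE.
exists (2^-1 ^+ r) => /=; first by rewrite exprn_gt0.
by move=> h; rewrite ballEmdist/= => /graph_dist_ltP gh; exact: H gh Ug.
Qed.

End graph_metric.

HB.instance Definition _ (R : realType) (M : pointedType) :=
  Measurable.copy (rooted_graph R M)
    (g_sigma_algebraType (@open (rooted_graph R M))).

Section restriction_measurable.
Variables (R : realType) (M : pointedType) (r : nat).

Definition rrestr (g : rooted_graph R M) : rooted_graph R M := restr r g.

Lemma measurable_rrestr : measurable_fun setT rrestr.
Proof.
move=> _ U _; rewrite setTI; apply: sub_sigma_algebra.
apply: (@open_restr _ _ _ r) => g h /= gh.
by rewrite /preimage/= /rrestr gh.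
Qed.

HB.instance Definition _ :=
  isMeasurableFun.Build _ _ _ _ rrestr measurable_rrestr.

End restriction_measurable.

Definition is_offspring (x y : seq nat) : bool :=
  prefix x y && (size y == (size x).+1).

Section regular_tree.
Variable d : nat.

(* The root has [d] offspring, the other vertices have [d - 1]. *)
Definition in_tree (x : seq nat) : bool :=
  if x is i :: t then (0 < i <= d)%N && all (fun j => 0 < j < d)%N t else true.

Definition tree_vertex := {x : seq nat | in_tree x}.

Definition tree_adj (x y : seq nat) : bool :=
  [&& in_tree x, in_tree y & is_offspring x y || is_offspring y x].

Lemma is_offspringP x y : reflect (exists i, y = rcons x i) (is_offspring x y).
Proof.
apply: (iffP andP) => [[/prefixP[t ->]]|[i ->]].
  rewrite size_cat -addn1 eqn_add2l; case: t => [|i []]// _.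
  by exists i; rewrite cats1.
by rewrite -cats1 prefix_prefix size_cat addn1.
Qed.

Lemma in_tree_rcons x i : in_tree (rcons x i) =
  in_tree x && (0 < i <= (if x is [::] then d else d.-1))%N.
Proof.
case: x => [|j x] /=; first by rewrite andbT.
rewrite all_rcons [X in _ && X = _]andbC andbA; congr (_ && _).
by case: d => //=; rewrite leqn0 andbF; case: i.
Qed.

Lemma in_tree_le x : in_tree x -> all (fun i => i <= d)%N x.
Proof.
case: x => //= i x /andP[/andP[_ ->] /=]; apply: sub_all => j /andP[_].
exact: ltnW.
Qed.

Lemma small_words n : exists s : seq (seq nat),
  forall x, all (fun i => i <= d)%N x -> (size x <= n)%N -> x \in s.
Proof.
elim: n => [|n [s sP]]; first by exists [:: [::]] => -[].
exists ([::] :: [seq i :: x | i <- iota 0 d.+1, x <- s]) => -[|i x].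
  by rewrite mem_head.
move=> /andP[id ax] xn; rewrite inE; apply/orP; right.
by apply: (allpairs_f (@cons nat)); [rewrite mem_iota|exact: sP].
Qed.

Section tree_graph.
Context {M : Type} (X : tree_vertex -> M).

Definition tree_col (x : seq nat) : option M := omap X (insub x).

Lemma tree_colE x : tree_col x = in_tree x :> bool.
Proof. by rewrite /tree_col; case: insubP => [? ->|/negbTE ->]. Qed.

Lemma tree_is_bfs : is_bfs tree_col tree_adj.
Proof.
split.
- by rewrite tree_colE.
- by move=> x y /and3P[tx ty _]; rewrite !tree_colE.
- by move=> x y; rewrite /tree_adj andbCA orbC.
- move=> x; rewrite /tree_adj orbb /is_offspring.
  by rewrite eqn_leq ltnn !andbF.
- move=> x; have [s sP] := small_words (size x).+1.
  apply: (@sub_finite_set _ _ [set` s]); last exact: finite_seq.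
  move=> y /= /and3P[_ ty /orP[]] /andP[_ /eqP sy];
    by apply: sP (in_tree_le ty) _; rewrite ?sy// (leq_trans _ (leqnSn _)) ?sy.
- move=> l j; rewrite tree_colE in_tree_rcons => /and3P[tl j0 jd].
  split=> // [|i /andP[i0 ij]].
    rewrite /tree_adj in_tree_rcons tl j0 jd/=; apply/orP; left.
    by apply/is_offspringP; exists j.
  by rewrite tree_colE in_tree_rcons tl i0/= (leq_trans ij).
- move=> l j x /and3P[_ _ /orP[/is_offspringP[i /rcons_inj[-> _]]|]].
    exact: shortlex_refl.
  by case/andP=> _ /eqP E; apply: shortlex_size; rewrite E size_rcons ltnS leqnSn.
Qed.

End tree_graph.

Definition process_space (M : Type) : Type := tree_vertex -> M.

Definition color_events (M : Type) (B : set tree_vertex) :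
    set (set (process_space M)) :=
  [set A | exists2 x, B x & exists m, A = [set X | X x = m]].

End regular_tree.

HB.instance Definition _ d (M : pointedType) :=
  Pointed.copy (process_space d M) (tree_vertex d -> M).

HB.instance Definition _ d (M : pointedType) :=
  Measurable.copy (process_space d M)
    (g_sigma_algebraType (@color_events d M setT)).

Section tree_process.
Variables (R : realType) (d : nat) (M : pointedFinType).

Definition tree_graph (X : process_space d M) : rooted_graph R M :=
  BfsGraph (tree_is_bfs X).

Lemma measurable_finite_support (s : seq (tree_vertex d))
    (A : set (process_space d M)) :
  (forall X X', {in s, X =1 X'} -> A X -> A X') -> measurable A.
Proof.
elim: s A => [|v s IH] A HA.
  have [[X AX]|A0] := pselect (exists X, A X).
    by rewrite (_ : A = setT)//; apply/seteqP; split=> // Y _; exact: HA AX.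
  by rewrite (_ : A = set0)//; apply/seteqP; split=> // Y AY; apply: A0; exists Y.
pose upd (X : process_space d M) m : process_space d M :=
  fun w => if w == v then m else X w.
rewrite (_ : A = \bigcup_(m in [set: M])
    ([set X | X v = m] `&` [set X | A (upd X m)])).
  apply: fin_bigcup_measurable => [|m _]; first exact: finite_finset.
  apply: measurableI.
    by apply: sub_sigma_algebra; exists v => //; exists m.
  apply: IH => X X' E /=; apply: HA => w; rewrite inE /upd.
  by case: eqP => //= _; exact: E.
have updX X m : X v = m -> upd X m = X.
  by move=> <-; apply/funext => w; rewrite /upd; case: eqP => [->|].
apply/seteqP; split=> [X AX|X [m _ [/= Xv]]]; last by rewrite updX.
by exists (X v) => //; split=> //=; rewrite updX.
Qed.

Lemma tree_ball (r : nat) : exists s : seq (tree_vertex d),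
  forall X X', {in s, X =1 X'} ->
    restr r (tree_graph X) = restr r (tree_graph X').
Proof.
have [s sP] := small_words d r; exists (pmap insub s) => X X' E.
apply: bfs_graph_eq => //=; apply/funext => x; rewrite /restr_col /=.
case: ifP => // xr; rewrite /tree_col; case: insubP => //= u tx ux.
rewrite E// mem_pmap_sub (_ : \val u = x)//.
by rewrite sP// in_tree_le.
Qed.

Lemma measurable_tree_graph : measurable_fun setT tree_graph.
Proof.
apply: (@measurability _ _ _ _ _ _ (@open (rooted_graph R M))) => //.
move=> _ [U oU <-]; rewrite setTI.
pose C r := [set X | forall X',
  restr r (tree_graph X) = restr r (tree_graph X') -> U (tree_graph X')].
rewrite (_ : _ @^-1` _ = \bigcup_r C r).
  apply: bigcup_measurable => r _; have [s sP] := tree_ball r.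
  by apply: (@measurable_finite_support s) => X X' /sP E CX Y; rewrite -E => /CX.
apply/seteqP; split=> [X UX|X [r _ CX]]; last exact: CX.
have [r rP] := nbhs_restr (open_nbhs_nbhs (conj oU UX : open_nbhs _ _)).
by exists r => // X' /rP.
Qed.

HB.instance Definition _ :=
  isMeasurableFun.Build _ _ _ _ tree_graph measurable_tree_graph.

End tree_process.

Section processes.
Variables (R : realType) (d : nat) (M : pointedFinType).
Implicit Types mu : probability (process_space d M) R.

Definition vertex_adj : rel (tree_vertex d) :=
  fun x y => tree_adj d (val x) (val y).

Definition tree_automorphism (t : tree_vertex d -> tree_vertex d) : Prop :=
  bijective t /\ forall x y, vertex_adj (t x) (t y) = vertex_adj x y.

Definition invariant mu : Prop :=
  forall t, tree_automorphism t ->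
  forall A : set (process_space d M), measurable A ->
    mu [set X : process_space d M | A (fun x => X (t x))] = mu A.

Definition pending_subtree (v u : tree_vertex d) : set (tree_vertex d) :=
  [set w | exists s, [/\ path vertex_adj u s, last u s = w & v \notin u :: s]].

Definition cond_prob mu (A B : set (process_space d M)) : R :=
  fine (mu (A `&` B)) / fine (mu B).

Definition vertex_markov mu : Prop :=
  forall (v : tree_vertex d) (m : M) (u : 'I_d -> tree_vertex d),
    injective u -> (forall i, vertex_adj v (u i)) ->
  let B := [set X : process_space d M | X v = m] in
  mu B != 0%E ->
  forall A : 'I_d -> set (process_space d M),
    (forall i, <<s color_events (pending_subtree v (u i)) >> (A i)) ->
  cond_prob mu (\bigcap_i A i) B = \prod_i cond_prob mu (A i) B.

Definition edge_restriction mu (p : M * M -> R) : Prop :=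
  forall o v1 : tree_vertex d, val o = [::] -> val v1 = [:: 1%N] ->
  forall a b, mu [set X : process_space d M | X o = a /\ X v1 = b] = (p (a, b))%:E.

(* If [p] satisfies [edge_law], there is exactly one such process, up to the
   values of [mu] on nonmeasurable sets. *)
Definition is_markov_process (p : M * M -> R) mu : Prop :=
  [/\ invariant mu, vertex_markov mu & edge_restriction mu p].

Definition tree_law mu : probability (rooted_graph R M) R :=
  distribution mu (@tree_graph R d M).

End processes.

Section edge_laws.
Variable R : realType.

Definition entropy (T : finType) (q : T -> R) : R := - \sum_x q x * ln (q x).

Section one_color_set.
Variable C : finType.
Implicit Type p : C * C -> R.

Definition edge_law p : Prop :=
  [/\ forall x, 0 <= p x, \sum_x p x = 1 & forall a b, p (a, b) = p (b, a)].

Definition vertex_marginal p (a : C) : R := \sum_b p (a, b).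

Definition Sigma (d : nat) p : R :=
  d%:R / 2 * entropy p - (d%:R - 1) * entropy (vertex_marginal p).

End one_color_set.

(* In [((a, b), (a', b'))], [(a, b)] is the pair of colours of [o] and
   [(a', b')] that of [1]. *)
Definition coupling (M : finType) (p p' : M * M -> R)
    (q : (M * M) * (M * M) -> R) : Prop :=
  (forall a a', \sum_b \sum_b' q ((a, b), (a', b')) = p (a, a')) /\
  (forall b b', \sum_a \sum_a' q ((a, b), (a', b')) = p' (b, b')).

End edge_laws.

Section mixture.
Context disp (T : measurableType disp) (R : realType) (I : finType).
Variable P : I -> probability T R.
Local Open Scope ereal_scope.

(* The average of the [P i]; a dummy value if [I] is empty. *)
Definition mixture (A : set T) : \bar R :=
  if #|I| == 0%N then dirac point A
  else (#|I|%:R^-1)%:E * \sum_(i : I) P i A.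

Let mixture0 : mixture set0 = 0.
Proof.
rewrite /mixture; case: ifP => _; first by rewrite measure0.
by rewrite big1 ?mule0// => i _; rewrite measure0.
Qed.

Let mixture_ge0 A : 0 <= mixture A.
Proof.
rewrite /mixture; case: ifP => _; first exact: measure_ge0.
apply: mule_ge0; first by rewrite lee_fin invr_ge0.
by apply: sume_ge0 => i _; exact: measure_ge0.
Qed.

Let mixture_sigma_additive : semi_sigma_additive mixture.
Proof.
rewrite /mixture; case: (_ == _); first exact: measure_semi_sigma_additive.
pose m (k : nat) : {measure set T -> \bar R} :=
  if (insub k : option 'I_#|I|) is Some i then P (@enum_val I predT i) else mzero.
rewrite (_ : (fun A => _) = mscale ((#|I|%:R : R)^-1)%R%:nng%R (msum m #|I|)).
  exact: measure_semi_sigma_additive.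
apply/funext => A; rewrite /mscale /= /msum; congr (_ * _).
rewrite big_enum_val/=; apply: eq_bigr => i _.
by rewrite /m valK.
Qed.

HB.instance Definition _ := isMeasure.Build _ _ _ mixture
  mixture0 mixture_ge0 mixture_sigma_additive.

Let mixture_setT : mixture setT = 1.
Proof.
rewrite /mixture; case: ifP => [_|/negbT I0]; first exact: probability_setT.
rewrite (eq_bigr (fun=> 1)) => [|i _]; last exact: probability_setT.
rewrite sumEFin sumr_const -EFinM mulVf//.
by rewrite pnatr_eq0.
Qed.

HB.instance Definition _ :=
  Measure_isProbability.Build _ _ _ mixture mixture_setT.

End mixture.

Definition graph_adj (V : finType) (G : {set {set V}}) : rel V :=
  fun x y => (x != y) && ([set x; y]%SET \in G).

Section empirical.
Variables (R : realType) (V : finType) (M : pointedFinType).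
Variables (G : {set {set V}}) (f : V -> M).

Lemma graph_adjC : symmetric (graph_adj G).
Proof. by move=> x y; rewrite /graph_adj eq_sym finset.setUC. Qed.

Lemma graph_adjI : irreflexive (graph_adj G).
Proof. by move=> x; rewrite /graph_adj eqxx. Qed.

Definition priority (s : {perm V}) : seq V := [seq s x | x <- enum V].

Lemma priority_uniq s : uniq (priority s).
Proof. by rewrite map_inj_uniq ?enum_uniq//; exact: perm_inj. Qed.

Lemma mem_priority s w : w \in priority s.
Proof. by rewrite -(permKV s w) map_f// mem_enum. Qed.

Definition labelled_graph (v : V) (s : {perm V}) : rooted_graph R M :=
  BfsGraph (lab_is_bfs v (priority_uniq s) (mem_priority s)
              graph_adjC graph_adjI f).

(* Law of the randomly labelled version of the component of [v]: the ties are
   broken according to a uniform random permutation of [V].  Since the sets of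
   siblings are disjoint, this orders them uniformly and independently. *)
Definition distr_at (v : V) : probability (rooted_graph R M) R :=
  mixture (fun s : {perm V} =>
             (dirac (labelled_graph v s) : probability (rooted_graph R M) R)).

Definition distr : probability (rooted_graph R M) R := mixture distr_at.

End empirical.

Section weak_topology.
Variables (R : realType) (M : pointedType).
Local Notation law := (probability (rooted_graph R M) R).

Definition bounded_continuous (phi : rooted_graph R M -> R) : Prop :=
  continuous phi /\ exists C, forall g, `|phi g| <= C.

Definition weak_nbhs (nu : law) (W : set law) : Prop :=
  exists (s : seq (rooted_graph R M -> R)) (e : R),
    [/\ 0 < e, forall k, (k < size s)%N -> bounded_continuous (nth (cst 0) s k)
      & forall nu' : law,
          (forall k, (k < size s)%N ->
            `|\int[nu']_g nth (cst 0) s k g - \int[nu]_g nth (cst 0) s k g| < e) ->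
          W nu'].

(* [dist] is a distance generating the weak topology.  Elements of [law] are
   set functions that are also defined, with arbitrary values, on nonmeasurable
   sets, so that equality of laws has to be stated on measurable sets. *)
Record weak_distance (dist : law -> law -> R) : Prop := WeakDistance {
  wdist_eq0 : forall nu nu', dist nu nu' = 0 <->
    forall A : set (rooted_graph R M), measurable A -> nu A = nu' A;
  wdist_sym : forall nu nu', dist nu nu' = dist nu' nu;
  wdist_triangle : forall nu1 nu2 nu3,
    dist nu1 nu3 <= dist nu1 nu2 + dist nu2 nu3;
  wdist_nbhs : forall nu W, weak_nbhs nu W <->
    exists2 e, 0 < e & [set nu' | dist nu nu' < e] `<=` W }.

End weak_topology.

Section sofic.
Variables (R : realType) (d : nat) (M : pointedFinType).
Local Notation law := (probability (rooted_graph R M) R).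
Variable dist : law -> law -> R.
Variable mu : probability (process_space d M) R.

(* A simple graph is given by its set of edges. *)
Definition regular_graphs (n : nat) : {set {set {set 'I_n}}} :=
  [set G : {set {set 'I_n}} | [forall e in G, #|e| == 2%N] &&
     [forall x, #|[set y | graph_adj G x y]| == d]]%SET.

Definition prob_regular (n : nat) (A : pred {set {set 'I_n}}) : R :=
  #|[set G in regular_graphs n | A G]%SET|%:R / #|regular_graphs n|%:R.

Definition admissible : set_system nat :=
  within [set n | (d.+1 <= n)%N && ~~ odd (n * d)] \oo.

Definition ball_law (r : nat) (nu : law) : law :=
  distribution nu (@rrestr R M r).

Definition good_colorings n (G : {set {set 'I_n}}) (r : nat) (eps : R) :
    {set {ffun 'I_n -> M}} :=
  [set f : {ffun 'I_n -> M} |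
    dist (ball_law r (distr R G f)) (ball_law r (tree_law mu)) <= eps]%SET.

Definition graph_entropy n (G : {set {set 'I_n}}) (r : nat) (eps : R) : \bar R :=
  ((n%:R^-1)%:E * lne (#|good_colorings G r eps|%:R)%:E)%E.

Definition sofic_h (n r : nat) (eps alpha : R) : \bar R :=
  ereal_sup [set h | (h = -oo%E \/ exists2 x : R, 0 <= x & h = x%:E) /\
    alpha <= prob_regular (fun G : {set {set 'I_n}} =>
                             (h <= graph_entropy G r eps)%E)].

(* By monotonicity in [eps], the limits in the extended reals exist. *)
Definition upper_sofic_at (r : nat) (alpha : R) : \bar R :=
  lim (limf_esup (fun n => sofic_h n r eps alpha) admissible @[eps --> 0^'+]).

Definition lower_sofic_at (r : nat) (alpha : R) : \bar R :=
  lim (limf_einf (fun n => sofic_h n r eps alpha) admissible @[eps --> 0^'+]).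

(* [upper_sofic_at] and [lower_sofic_at] are nonincreasing in [r], so that the
   limits exist; they are the same for all [alpha] in ]0, 1[. *)
Definition upper_sofic (alpha : R) : \bar R :=
  limn (fun r => upper_sofic_at r alpha).

Definition lower_sofic (alpha : R) : \bar R :=
  limn (fun r => lower_sofic_at r alpha).

Definition prob_exists (n : nat) (eps : R) : R :=
  prob_regular (fun G : {set {set 'I_n}} =>
    [exists f : {ffun 'I_n -> M}, dist (distr R G f) (tree_law mu) <= eps]).

Definition strongly_typical : Prop :=
  exists g : R -> R,
    (forall eps, 0 < eps -> prob_exists n eps @[n --> admissible] --> g eps) /\
    g eps @[eps --> 0^'+] --> (1 : R).

End sofic.

(* Main.v *)
Require Import Defs.
From HB Require Import structures.
From mathcomp Require Import all_boot all_order all_algebra all_fingroup.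
From mathcomp Require Import all_classical all_reals all_analysis.
From mathcomp Require Import zify lra measurable_realfun.
Import Order.TTheory GRing.Theory Num.Theory.
Import numFieldNormedType.Exports.

(* Everything is done in the configuration model: uniform perfect matchings of
   the half-edges [V * 'I_d].  By the first moment, the expected number of
   colourings with given edge statistics q is exp (n (Sigma q + o(1))), which
   by Markov's inequality bounds the upper entropy by Sigma p.  Assigning to
   each vertex a whole ball of radius k with the law of mu(p), and matching the
   half-edges consistently, shows that the expected number of colourings whose
   balls of radius k look like mu(p) is at least exp (n (Sigma p - o(1))).
   Pairs of such colourings have the statistics of an approximate coupling of p
   and p, so by hypothesis the second moment is exp (n (2 Sigma p + o(1))), and
   by Paley-Zygmund there are exp (n (Sigma p - o(1))) good colourings with
   probability exp (- o(n)).  Exponential concentration of matchings for the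
   Hamming distance upgrades this to probability 1 - exp (- c n), which
   survives the conditioning on the matching being a simple graph, an event of
   polynomially small probability.  Cycles meeting a bounded neighbourhood are
   controlled in the same way, so that balls of the graph are trees and weak
   neighbourhoods of the law of mu(p) are tested on finitely many balls. *)

Set Implicit Arguments.
Unset Strict Implicit.
Unset Printing Implicit Defensive.

Local Open Scope ring_scope.

(** The planted count reaches the exponent of the first moment because the entropy of the ball law
    minus [d / 2] times that of the law seen along an edge does not depend on the radius: the
    entropy of the deep levels cancels, see [Sigma_types]. Paley-Zygmund alone could give a
    probability tending to 0, since the two moments match only up to exp (o(n)). What rescues it is
    the order of the constants: the density exp (- c n) that concentration tolerates depends on the
    Hamming distance allowed, not on the loss in the moments, which can be made smaller than c.
    Rewiring a small proportion of the half-edges, with the colouring kept, moves the ball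
    statistics by a constant times that proportion. The second obstacle is the labelling: colourings
    are built along the walks of the matching, while the graph only knows a random breadth-first
    search. On a tree-like ball the search amounts to a uniform automorphism of the finite ball, and
    the law of mu(p) on balls is invariant under these, so that both descriptions give the same
    statistics. *)

(** * Integer square roots, as matchings are counted through squares *)

Lemma leq_sqrt k P : (k ^ 2 <= P)%N -> (k <= PeanoNat.Nat.sqrt P)%N.
Proof. by rewrite expnS expn1 => /ssrnat.leP h; apply/ssrnat.leP/PeanoNat.Nat.sqrt_le_square. Qed.

Lemma sqrt_leq P : (PeanoNat.Nat.sqrt P ^ 2 <= P)%N.
Proof. by rewrite expnS expn1; apply/ssrnat.leP; exact: (proj1 (PeanoNat.Nat.sqrt_spec' P)). Qed.

Lemma sqrt_up_leq k P : (P <= k ^ 2)%N -> (PeanoNat.Nat.sqrt_up P <= k)%N.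
Proof.
rewrite expnS expn1 => /ssrnat.leP h.
by apply/ssrnat.leP/PeanoNat.Nat.sqrt_up_le_square => //; exact/ssrnat.leP.
Qed.

Lemma leq_sqrt_up P : (P <= PeanoNat.Nat.sqrt_up P ^ 2)%N.
Proof.
have [->//|P0] := posnP P; rewrite expnS expn1; apply/ssrnat.leP.
by have [] := PeanoNat.Nat.sqrt_up_spec P (elimT ssrnat.leP P0).
Qed.

(** * Perfect matchings and an isoperimetric inequality *)

Section matchings.
Variable H : finType.
Implicit Types (A : {set H}) (m : {perm H}).

(** A matching of [A] is an involution of the whole type whose fixed points form the complement of
    [A]. Matchings of all subsets thus live in one type, which suits inductions that remove one pair
    at a time. *)
Definition pmatch A m : bool :=
  [forall h, (m (m h) == h) && ((m h == h) == (h \notin A))].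

Lemma pmatchP A m :
  reflect (involutive m /\ forall h, (m h == h) = (h \notin A)) (pmatch A m).
Proof.
apply: (iffP forallP) => [P|[P Q] h]; last by rewrite P Q !eqxx.
by split=> h; case/andP: (P h) => /eqP ? /eqP.
Qed.

Lemma pmatch_mem A m h : pmatch A m -> (m h \in A) = (h \in A).
Proof.
case/pmatchP=> P Q; apply: negb_inj; rewrite -!Q P.
by rewrite eq_sym.
Qed.

Lemma pmatch_neq A m h : pmatch A m -> h \in A -> m h \in A :\ h.
Proof.
move=> P hA; rewrite !inE (pmatch_mem _ P) hA andbT.
by case/pmatchP: P => _ ->; rewrite hA.
Qed.

(** Multiplying by [tperm h k] adds the pair to a matching of the rest: such a matching fixes [h]
    and [k], so that the supports are disjoint. *)
Lemma pmatch_tpermM A h k m : h \in A -> k \in A :\ h ->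
  pmatch A (tperm h k * m)%g && ((tperm h k * m)%g h == k) =
  pmatch (A :\ h :\ k) m.
Proof.
move=> hA; rewrite !inE => /andP[kh kA]; rewrite permM tpermL.
apply/andP/idP => [[P /eqP mk]|/pmatchP[P Q]]; last first.
  have mh : m h = h by apply/eqP; rewrite Q !inE eqxx andbF.
  have mk : m k = k by apply/eqP; rewrite Q !inE eqxx.
  split; last by rewrite mk.
  apply/pmatchP; split=> x; rewrite !permM.
    have [->|xh] := eqVneq x h; first by rewrite tpermL mk tpermR mh.
    have [->|xk] := eqVneq x k; first by rewrite tpermR mh tpermL mk.
    rewrite (tpermD (x := h) (y := k) (z := x)) 1?eq_sym// tpermD ?P//.
      by rewrite -[h]mh; apply: contraNN xh => /eqP/perm_inj ->.
    by rewrite -[k]mk; apply: contraNN xk => /eqP/perm_inj ->.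
  case: tpermP => [->|->|/eqP xh /eqP xk].
  - by rewrite mk hA (negbTE kh).
  - by rewrite mh kA eq_sym (negbTE kh).
  by rewrite Q !inE xh xk.
case/pmatchP: P => P Q.
have mh : m h = h.
  by have := P h; rewrite !permM tpermL mk tpermR.
apply/pmatchP; split=> x.
  have [->|xh] := eqVneq x h; first by rewrite !mh.
  have [->|xk] := eqVneq x k; first by rewrite !mk.
  have mxh : h != m x.
    by rewrite -[h]mh eq_sym; apply: contraNN xh => /eqP /perm_inj ->.
  have mxk : k != m x.
    by rewrite -[k]mk eq_sym; apply: contraNN xk => /eqP /perm_inj ->.
  have := P x; rewrite !permM (tpermD (x := h) (y := k) (z := x)) 1?eq_sym//.
  by rewrite tpermD.
rewrite !inE; have [->|xh] := eqVneq x h; first by rewrite mh eqxx andbF.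
have [->|xk] := eqVneq x k; first by rewrite mk eqxx.
by have := Q x; rewrite permM tpermD 1?eq_sym.
Qed.

Lemma sum_pmatch (V : nmodType) (F : {perm H} -> V) A h : h \in A ->
  \sum_(m | pmatch A m) F m =
  \sum_(k in A :\ h) \sum_(m | pmatch (A :\ h :\ k) m) F (tperm h k * m)%g.
Proof.
move=> hA; rewrite (partition_big (fun m : {perm H} => m h) (mem (A :\ h))) /=; last first.
  by move=> m P; exact: pmatch_neq.
apply: eq_bigr => k kA.
rewrite (reindex (fun m => (tperm h k * m)%g)) /=; last first.
  by exists (fun m => (tperm h k * m)%g) => m _; rewrite mulgA tperm2 mul1g.
by apply: eq_bigl => m; rewrite pmatch_tpermM.
Qed.

Lemma card_pmatch_rec A h : h \in A ->
  #|pmatch A| = \sum_(k in A :\ h) #|pmatch (A :\ h :\ k)|.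
Proof.
move=> hA; rewrite -[LHS]sum1_card [LHS](eq_bigl (pmatch A))//.
by rewrite (@sum_pmatch _ (fun=> 1%N) _ _ hA); apply: eq_bigr => k _; rewrite sum1_card.
Qed.

Lemma pmatch0 m : pmatch finset.set0 m = (m == 1%g).
Proof.
apply/pmatchP/eqP => [[_ Q]|->]; last by split=> h; rewrite !perm1// eqxx inE.
by apply/permP => x; rewrite perm1; apply/eqP; rewrite Q inE.
Qed.

Lemma pmatchJ A m (t : {perm H}) : pmatch (t @: A) (m ^ t)%g = pmatch A m.
Proof.
have E h : ((m ^ t)%g (t h) == t h) = (m h == h).
  by rewrite permJ (inj_eq perm_inj).
apply/pmatchP/pmatchP => -[P Q]; split.
- by move=> h; have := P (t h); rewrite !permJ => /perm_inj.
- by move=> h; rewrite -E Q mem_imset//; exact: perm_inj.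
- by move=> h; rewrite -(permKV t h) !permJ P.
- by move=> h; rewrite -(permKV t h) E Q mem_imset//; exact: perm_inj.
Qed.

Lemma sum_pmatchJ (V : nmodType) (F : {perm H} -> V) A (t : {perm H}) :
  \sum_(m | pmatch (t @: A) m) F m = \sum_(m | pmatch A m) F (m ^ t)%g.
Proof.
rewrite (reindex (fun m => m ^ t)%g) /=; last first.
  by exists (fun m => m ^ t^-1)%g => m _; rewrite -conjgM ?mulgV ?mulVg conjg1.
by apply: eq_bigl => m; exact: pmatchJ.
Qed.

(** With [tperm_conj], this transports the matchings in which [h] has partner [k] to those in which
    it has partner [l], at the cost of one switch. *)
Lemma tperm_setD1 A h k l : h \in A -> k \in A :\ h -> l \in A :\ h ->
  [set tperm k l x | x in A :\ h :\ k] = (A :\ h :\ l)%SET.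
Proof.
move=> hA; rewrite !inE => /andP[kh kA] /andP[lh lA].
apply/setP => x; rewrite -(tpermK k l x) mem_imset; last exact: perm_inj.
rewrite !tpermK !inE; case: tpermP => [->|->|/eqP xk /eqP xl].
- by rewrite eq_sym lh lA kh kA.
- by rewrite !eqxx.
- by rewrite xk xl.
Qed.

Lemma tperm_conj h k l m : h != k -> h != l -> m h = h ->
  ((tperm h k * m) ^ tperm k l = tperm h l * m ^ tperm k l)%g.
Proof.
by move=> hk hl mh; rewrite conjMg tpermJ tpermD 1?eq_sym// tpermL.
Qed.

Section weights.
Variable R : realType.

(** After symmetrising in [k] and [l], the ratios enter as [a k / a l + a l / a k], which is at most
    [2 + y ^+ 2]: the first-order terms cancel. This is why a step of the induction costs only a
    second-order factor. *)
Lemma sum_ratio_le (I : finType) (S : {set I}) (a b : I -> R) (c y : R) :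
  0 <= y -> 0 <= c -> (forall k, k \in S -> 0 < a k) ->
  (forall k, k \in S -> a k * b k <= c) ->
  (forall k l, k \in S -> l \in S -> a k <= (1 + y) * a l) ->
  (\sum_(k in S) a k) * (\sum_(k in S) b k) <= #|S|%:R ^+ 2 * (c * (1 + y ^+ 2)).
Proof.
move=> y0 c0 a0 ab aa.
have key k l : k \in S -> l \in S ->
    a k * b l + a l * b k <= 2 * (c * (1 + y ^+ 2)).
  move=> kS lS.
  wlog kl : k l kS lS / a l <= a k.
    have [|/ltW] := leP (a l) (a k) => h W; first exact: W.
    by rewrite addrC; apply: W.
  have ak := a0 _ kS; have al := a0 _ lS; have akl := aa _ _ kS lS.
  have bl : b l <= c / a l by rewrite ler_pdivlMr// mulrC ab.
  have bk : b k <= c / a k by rewrite ler_pdivlMr// mulrC ab.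
  apply: (@le_trans _ _ (a k * (c / a l) + a l * (c / a k))).
    by apply: lerD; rewrite ler_wpM2l// ltW.
  have -> : a k * (c / a l) + a l * (c / a k) =
      c * ((a k ^+ 2 + a l ^+ 2) / (a k * a l)).
    have nk : a k != 0 by rewrite gt_eqF.
    have nl : a l != 0 by rewrite gt_eqF.
    rewrite invfM mulrDl !expr2 mulrDr; congr (_ + _).
      by rewrite -!mulrA [a k * (_ * (_^-1 * _))]mulrCA mulrCA; congr (_ * (_ * _));
        rewrite mulrA divff// mul1r.
    rewrite -!mulrA mulrCA; congr (_ * (_ * _)).
    by rewrite [_^-1 * _^-1]mulrC mulrA divff// mul1r.
  rewrite [leRHS]mulrCA; apply: ler_wpM2l => //; rewrite ler_pdivrMr ?mulr_gt0//.
  have : 0 <= a k - a l by rewrite subr_ge0.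
  have : a k - a l <= y * a l by lra.
  move=> h1 h2.
  have h3 : (a k - a l) ^+ 2 <= y ^+ 2 * (a l * a k).
    apply: (@le_trans _ _ ((y * a l) ^+ 2)).
      by rewrite lerXn2r// nnegrE// mulr_ge0// ltW.
    by rewrite exprMn ler_wpM2l ?exprn_ge0// expr2 ler_wpM2l// ltW.
  have h4 : 0 <= y ^+ 2 * (a l * a k) by apply: mulr_ge0; [exact: exprn_ge0|apply: mulr_ge0;
    exact: ltW].
  lra.
rewrite -(ler_pM2l (ltr0Sn R 1)) mulr_sumr mulr_sumr.
have -> : 2 * (#|S|%:R ^+ 2 * (c * (1 + y ^+ 2))) =
   \sum_(k in S) \sum_(l in S) 2 * (c * (1 + y ^+ 2)) :> R.
  by rewrite !sumr_const -mulrnA -[RHS]mulr_natl natrM; lra.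
have -> : \sum_(i in S) 2 * ((\sum_(k in S) a k) * b i) =
   \sum_(k in S) \sum_(l in S) (a k * b l + a l * b k).
  under [RHS]eq_bigr do rewrite big_split/=.
  rewrite big_split/= [X in _ = X + _]exchange_big/= -big_split/=; apply: eq_bigr => i _.
  by rewrite -!mulr_suml -mulr2n mulr_natl.
by apply: ler_sum => k kS; apply: ler_sum => l lS; exact: key.
Qed.

(* Taking [W m = exp (s * dist m S)] gives Gaussian concentration.  The induction
   reveals the partner of one element at a time; as [W] changes by a factor at
   most [1 + y] when that partner does, each step costs only [1 + y ^+ 2]. *)
Lemma isoperimetric (A : {set H}) (W : {perm H} -> R) (y : R) :
  0 <= y -> (forall m, pmatch A m -> 0 < W m) ->
  (forall m a b, pmatch A m -> a \in A -> b \in A ->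
     W (m ^ tperm a b)%g <= (1 + y) * W m) ->
  (\sum_(m | pmatch A m) W m) * (\sum_(m | pmatch A m) (W m)^-1) <=
  #|pmatch A|%:R ^+ 2 * (1 + y ^+ 2) ^+ #|A|.
Proof.
move=> y0; have yy : 0 <= 1 + y ^+ 2 by rewrite addr_ge0 ?exprn_ge0.
have [N] := ubnP #|A|; elim: N A W => // N IH A W AN W0 WL.
have [->|[h hA]] := set_0Vmem A.
  rewrite !(big_pred1 1%g) => [|m|m]; try exact: pmatch0.
  have -> : #|pmatch finset.set0| = 1%N.
    by rewrite -(card1 (1%g : {perm H})); apply: eq_card => m; exact: pmatch0.
  rewrite cards0 expr0 mulr1.
  have [W1|W1] := eqVneq (W 1%g) 0; first by rewrite W1 mul0r expr1n.
  by rewrite divff ?expr1n.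
rewrite !(sum_pmatch _ hA).
pose a k := \sum_(m | pmatch (A :\ h :\ k) m) W (tperm h k * m)%g.
pose b k := \sum_(m | pmatch (A :\ h :\ k) m) (W (tperm h k * m)%g)^-1.
rewrite -[X in X * _]/(\sum_(k in A :\ h) a k) -[X in _ * X]/(\sum_(k in A :\ h) b k).
have cA k : k \in A :\ h -> (#|A :\ h :\ k| < N)%N.
  move=> kA; rewrite -ltnS (leq_trans _ AN)// ltnS.
  by have := cardsD1 h A; have := cardsD1 k (A :\ h); rewrite hA kA; lia.
pose q := fun k => #|pmatch (A :\ h :\ k)|%:R : R.
have hk k : k \in A :\ h -> h != k by rewrite !inE eq_sym => /andP[].
have mh k m : pmatch (A :\ h :\ k) m -> m h = h.
  by case/pmatchP => _ Q; apply/eqP; rewrite Q !inE eqxx andbF.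
have qE k l : k \in A :\ h -> l \in A :\ h -> q k = q l.
  move=> kA lA; rewrite /q -!sum1_card -!(tperm_setD1 hA kA lA); congr (_%:R).
  by rewrite [RHS](sum_pmatchJ (fun=> 1%N)).
have Pk k m : k \in A :\ h -> pmatch (A :\ h :\ k) m -> pmatch A (tperm h k * m)%g.
  by move=> kA; rewrite -(pmatch_tpermM _ hA kA) => /andP[].
(* Conjugation by [tperm k l] pairs the two fibres term by term, so the conditional sums inherit the
   Lipschitz bound on [W]. *)
have aL k l : k \in A :\ h -> l \in A :\ h -> a l <= (1 + y) * a k.
  move=> kA lA; rewrite /a mulr_sumr -(tperm_setD1 hA kA lA) sum_pmatchJ.
  apply: ler_sum => m P; rewrite -tperm_conj ?hk ?(mh k)//.
  apply: WL; first exact: Pk.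
    by move: kA; rewrite inE => /andP[].
  by move: lA; rewrite inE => /andP[].
have [kA0|[k0 k0A]] := set_0Vmem (A :\ h).
  by rewrite kA0 !big_set0 mul0r mulr_ge0 ?exprn_ge0.
have -> : #|pmatch A|%:R = #|A :\ h|%:R * q k0.
  rewrite (card_pmatch_rec hA) natr_sum (eq_bigr (fun=> q k0)).
    by rewrite sumr_const mulr_natl.
  by move=> k kA; exact: qE.
have q00 : 0 <= q k0 ^+ 2 by rewrite exprn_ge0.
set S := A :\ h; set cc := q k0 ^+ 2 * (1 + y ^+ 2) ^+ #|S :\ k0|.
apply: (@le_trans _ _ (#|S|%:R ^+ 2 * (cc * (1 + y ^+ 2)))); last first.
  have le : (1 + y ^+ 2) ^+ #|S :\ k0|.+1 <= (1 + y ^+ 2) ^+ #|A|.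
    apply: ler_weXn2l; first by rewrite lerDl exprn_ge0.
    by rewrite (cardsD1 h A) hA add1n (cardsD1 k0 S) k0A add1n ltnS leqnSn.
  rewrite [leLHS]exprSr in le.
  have := ler_wpM2l (mulr_ge0 (exprn_ge0 2 (ler0n R #|S|)) q00) le.
  by rewrite exprMn /cc !mulrA.
have [q0|q0] := eqVneq (q k0) 0.
  have a0 k : k \in S -> a k = 0.
    move=> kA; rewrite /a big_pred0// => m; apply/negP => P.
    have : (0 < #|pmatch (A :\ h :\ k)|)%N by apply/card_gt0P; exists m.
    by rewrite -(ltr0n R) -/(q k) (qE _ k0)// q0 ltxx.
  have -> : \sum_(k in S) a k = 0 by exact: big1.
  rewrite mul0r.
  by rewrite mulr_ge0 ?exprn_ge0// mulr_ge0 ?addr_ge0 ?exprn_ge0// /cc mulr_ge0 ?exprn_ge0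
    ?addr_ge0 ?exprn_ge0.
apply: (@sum_ratio_le H S a b cc y) => //.
- by rewrite /cc mulr_ge0 ?exprn_ge0 ?addr_ge0 ?exprn_ge0.
- move=> k kA; have : (0 < #|pmatch (A :\ h :\ k)|)%N.
    rewrite -(ltr0n R) -/(q k) (qE _ k0)// lt_neqAle eq_sym q0 /=; exact: ler0n.
  move=> /card_gt0P[m P]; rewrite /a (bigD1 m)//=; apply: ltr_pwDl.
    by apply: W0; exact: Pk.
  by apply: sumr_ge0 => m' /andP[P' _]; apply/ltW/W0; exact: Pk.
- move=> k kA; rewrite /cc (qE k0 k)//.
  have -> : #|S :\ k0| = #|S :\ k|.
    have := cardsD1 k0 S; rewrite k0A (cardsD1 k) kA !add1n.
    by move=> [].
  apply: IH; first exact: cA.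
    by move=> m P; apply: W0; exact: Pk.
  move=> m u v P uA vA.
  have [uh uk] : u != h /\ u != k by move: uA; rewrite !inE => /and3P[].
  have [vh vk] : v != h /\ v != k by move: vA; rewrite !inE => /and3P[].
  have -> : (tperm h k * m ^ tperm u v = (tperm h k * m) ^ tperm u v)%g.
    by rewrite conjMg tpermJ !tpermD.
  apply: WL; first exact: Pk.
    by move: uA; rewrite !inE => /and3P[].
  by move: vA; rewrite !inE => /and3P[].
- by move=> k l kA lA; exact: aL.
Qed.
End weights.

End matchings.

(** * Counting the matchings compatible with labels *)

Section labelled_matchings.
Variables (H B : finType) (star : B -> B) (lab : H -> B).
Hypothesis starK : involutive star.
Implicit Types (A : {set H}) (m : {perm H}).

(** In the applications [star] is [swap] on ordered pairs of labels, or the identity of [unit] when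
    all matchings are to be counted. *)
Definition consistent A m : bool :=
  pmatch A m && [forall h in A, lab (m h) == star (lab h)].

Definition num_consistent A : nat := #|consistent A|.

Definition cnt A b : nat := #|[set h in A | lab h == b]|.

Lemma consistentE A h k m : h \in A -> k \in A :\ h ->
  consistent A (tperm h k * m)%g && ((tperm h k * m)%g h == k) =
  (lab k == star (lab h)) && consistent (A :\ h :\ k) m.
Proof.
move=> hA kA; rewrite /consistent andbAC pmatch_tpermM// [RHS]andbCA.
case P : (pmatch _ m) => //=.
have [_ Q] := pmatchP _ _ P.
have mh : m h = h by apply/eqP; rewrite Q !inE eqxx andbF.
have mk : m k = k by apply/eqP; rewrite Q !inE eqxx.
move: kA; rewrite !inE => /andP[kh kA].
apply/forall_inP/andP => [L|[/eqP lk /forall_inP L] x xA].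
  split; first by have := L _ hA; rewrite permM tpermL mk.
  apply/forall_inP => x; rewrite !inE => /and3P[xk xh xA].
  by have := L _ xA; rewrite permM tpermD 1?eq_sym.
rewrite permM; case: tpermP => [->|->|/eqP xh /eqP xk].
- by rewrite mk lk.
- by rewrite mh lk starK.
by apply: L; rewrite !inE xh xk.
Qed.

Lemma num_consistent_rec A h : h \in A ->
  num_consistent A = (\sum_(k in A :\ h | lab k == star (lab h)) num_consistent (A :\ h :\ k))%N.
Proof.
move=> hA; rewrite /num_consistent -sum1_card.
rewrite (partition_big (fun m : {perm H} => m h) (mem (A :\ h))) /=; last first.
  by move=> m /andP[P _]; exact: pmatch_neq.
rewrite big_mkcondr; apply: eq_bigr => k kA.
rewrite (reindex (fun m => (tperm h k * m)%g)) /=; last first.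
  by exists (fun m => (tperm h k * m)%g) => m _; rewrite mulgA tperm2 mul1g.
under eq_bigl => m do rewrite [_ \in _]/(consistent _ _) consistentE//.
case: (lab k == _) => /=; last exact: big_pred0.
by rewrite -sum1_card; exact: eq_bigl.
Qed.

Lemma cnt_D1 A h b : h \in A -> cnt A b = ((lab h == b) + cnt (A :\ h) b)%N.
Proof.
move=> hA; rewrite /cnt (cardsD1 h) inE hA /=; congr (_ + _)%N.
by apply: eq_card => x; rewrite !inE andbA.
Qed.

Lemma cnt_gt0 A h : h \in A -> (0 < cnt A (lab h))%N.
Proof. by move=> hA; rewrite (cnt_D1 _ hA) eqxx. Qed.

Lemma prod_fact_D1 A h : h \in A ->
  (\prod_b (cnt A b)`! = cnt A (lab h) * \prod_b (cnt (A :\ h) b)`!)%N.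
Proof.
move=> hA; rewrite (bigD1 (lab h))//= [in RHS](bigD1 (lab h))//= mulnA.
congr (_ * _)%N; first by rewrite (cnt_D1 _ hA) eqxx add1n factS.
by apply: eq_bigr => b hb; rewrite (cnt_D1 _ hA) eq_sym (negbTE hb).
Qed.

Lemma prod_succ_D1 A h : h \in A ->
  (\prod_b (cnt A b).+1 * cnt A (lab h) =
   (cnt A (lab h)).+1 * \prod_b (cnt (A :\ h) b).+1)%N.
Proof.
move=> hA; rewrite (bigD1 (lab h))//= [in RHS](bigD1 (lab h))//=.
have -> : (\prod_(i | i != lab h) (cnt A i).+1 =
          \prod_(i | i != lab h) (cnt (A :\ h) i).+1)%N.
  by apply: eq_bigr => b hb; rewrite (cnt_D1 _ hA) eq_sym (negbTE hb).
by rewrite (cnt_D1 _ hA) eqxx add1n; lia.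
Qed.

(** The condition for a consistent matching to exist: classes exchanged by [star] are matched to
    each other, and a class fixed by [star] is matched within itself. *)
Definition balanced A : Prop :=
  forall b, cnt A b = cnt A (star b) /\ (star b = b -> ~~ odd (cnt A b)).

Lemma consistent_balanced A m : consistent A m -> forall b, cnt A b = cnt A (star b).
Proof.
case/andP=> P /forall_inP L b.
suff le c : (cnt A c <= cnt A (star c))%N by apply/eqP; rewrite eqn_leq le -{2}[b]starK le.
rewrite /cnt -(card_imset _ (@perm_inj _ m)); apply: subset_leq_card.
apply/fintype.subsetP => _ /imsetP[x xc ->]; move: xc; rewrite !inE.
by move=> /andP[xA /eqP lx]; rewrite (pmatch_mem _ P) xA (eqP (L _ xA)) lx eqxx.
Qed.

Section step.
Variables (A : {set H}) (h : H) (hA : h \in A).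
Hypothesis bal : forall b, cnt A b = cnt A (star b).
Let b := lab h.

Lemma card_partners :
  #|[set k in A :\ h | lab k == star b]| = (cnt A b - (star b == b))%N.
Proof.
rewrite bal (cnt_D1 _ hA) -/b eq_sym addKn.
by apply: eq_card => x; rewrite !inE.
Qed.

(** Removing a compatible pair divides the product of factorials by [n * n'], where [n] is the size
    of the class of [h] and [n'] the number of its possible partners. *)
Lemma prod_fact_D2 k : k \in A :\ h -> lab k = star b ->
  (\prod_b (cnt A b)`! =
   cnt A b * (cnt A b - (star b == b)) * \prod_b (cnt (A :\ h :\ k) b)`!)%N.
Proof.
move=> kA lk; rewrite (prod_fact_D1 hA) (prod_fact_D1 kA) mulnA lk -/b.
congr (_ * _ * _)%N; rewrite [in RHS]bal (cnt_D1 _ hA) -/b eq_sym.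
by rewrite addKn.
Qed.

Lemma prod_succ_D2 k : k \in A :\ h -> lab k = star b ->
  let n := cnt A b in let n' := (n - (star b == b))%N in
  (\prod_b (cnt A b).+1 * (n * n') =
   n.+1 * n'.+1 * \prod_b (cnt (A :\ h :\ k) b).+1)%N.
Proof.
move=> kA lk n n'; rewrite mulnA (prod_succ_D1 hA) -/b -/n.
have E : cnt (A :\ h) (lab k) = n'.
  by rewrite /n' /n bal (cnt_D1 _ hA) lk -/b eq_sym addKn.
by have := prod_succ_D1 kA; rewrite E; nia.
Qed.

Lemma bal_D2 k : k \in A :\ h -> lab k = star b ->
  forall c, cnt (A :\ h :\ k) c = cnt (A :\ h :\ k) (star c).
Proof.
move=> kA lk c; have := bal c; rewrite !(cnt_D1 _ hA) !(cnt_D1 _ kA) lk -/b.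
by rewrite !addnA -(can2_eq starK starK) (inj_eq (inv_inj starK)) => E; lia.
Qed.

End step.

(** The exact count is a product of factorials over pairs of classes and of double factorials over
    self-paired ones, roughly the square root of the product of all factorials; hence the square. In
    the induction [h] has [n'] partners and [n' ^ 2 <= n * n']. *)
Lemma num_consistent_upper A : (num_consistent A ^ 2 <= \prod_b (cnt A b)`!)%N.
Proof.
have [N] := ubnP #|A|; elim: N A => // N IH A AN.
have [A0|[h hA]] := set_0Vmem A.
  rewrite big1 => [|b _]; last by rewrite /cnt A0 (_ : [set _ in _ | _] = finset.set0) ?cards0//;
    apply/setP => x; rewrite !inE.
  rewrite -[X in (_ <= X)%N](exp1n 2) leq_sqr /num_consistent.
  rewrite -(card1 (1%g : {perm H})); apply: subset_leq_card.
  by apply/fintype.subsetP => m /andP[]; rewrite A0 pmatch0 inE.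
have [/eqP ->//|] := boolP (num_consistent A == 0)%N.
rewrite -lt0n => /card_gt0P[m /consistent_balanced bal].
have [K0|[k0]] := set_0Vmem [set k in A :\ h | lab k == star (lab h)].
  rewrite (num_consistent_rec hA) big_pred0// => k.
  by have /setP/(_ k) := K0; rewrite !inE => ->.
rewrite inE => /andP[k0A /eqP lk0].
rewrite (prod_fact_D2 hA bal k0A lk0) (num_consistent_rec hA).
set n := cnt A _; set e := nat_of_bool _; set P := (\prod_b _)%N.
have : (\sum_(k in A :\ h | lab k == star (lab h)) num_consistent (A :\ h :\ k) <=
        \sum_(k in A :\ h | lab k == star (lab h)) PeanoNat.Nat.sqrt P)%N.
  apply: leq_sum => k /andP[kA /eqP lk].
  have : (num_consistent (A :\ h :\ k) ^ 2 <= P)%N.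
    have := prod_fact_D2 hA bal kA lk; rewrite (prod_fact_D2 hA bal k0A lk0) -/P.
    have: (0 < n * (n - e))%N.
      rewrite muln_gt0 (cnt_gt0 hA) /= -(card_partners hA bal).
      by apply/card_gt0P; exists k; rewrite inE kA lk eqxx.
    move=> n0 /eqP; rewrite eqn_pmul2l// => /eqP ->; apply: IH.
    rewrite -ltnS (leq_trans _ AN)// ltnS.
    by have := cardsD1 h A; have := cardsD1 k (A :\ h); rewrite hA kA; lia.
  exact: leq_sqrt.
rewrite sum_nat_cond_const (_ : #|_| = (n - e)%N); last first.
  by rewrite -(card_partners hA bal); apply: eq_card => k; rewrite !inE.
move=> le; rewrite -leq_sqr in le; apply: leq_trans le _.
rewrite expnMn; apply: leq_trans (leq_mul (leqnn _) (sqrt_leq P)) _.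
by rewrite leq_mul2r expnS expn1 leq_mul ?leq_subr ?orbT.
Qed.

(** For a self-paired class [n' ^ 2] falls short of [n * n'] by the ratio of [n] to [n - 1]; the
    decrease of the polynomial factor pays for this at each step. *)
Lemma num_consistent_lower A : balanced A ->
  (\prod_b (cnt A b)`! <= num_consistent A ^ 2 * (\prod_b (cnt A b).+1) ^ 2)%N.
Proof.
have [N] := ubnP #|A|; elim: N A => // N IH A AN bal2.
have bal b : cnt A b = cnt A (star b) by case: (bal2 b).
have [A0|[h hA]] := set_0Vmem A.
  rewrite big1 => [|b _]; last by rewrite /cnt A0 (_ : [set _ in _ | _] = finset.set0) ?cards0//;
    apply/setP => x; rewrite !inE.
  rewrite muln_gt0 !expn_gt0 prodn_gt0 ?orbT ?andbT//; apply/orP; left.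
  apply/card_gt0P; exists 1%g; apply/andP; split; first by rewrite A0 pmatch0.
  by apply/forall_inP => x; rewrite A0 inE.
set n := cnt A (lab h); set e := nat_of_bool (star (lab h) == lab h).
have n0 : (0 < n)%N by exact: cnt_gt0.
(* A self-paired class is even, so [h] is not its only element. *)
have ne0 : (0 < n - e)%N.
  rewrite /e /n; case: eqP => [sb|_]; rewrite ?subn0// subn1.
  by have [_ /(_ sb)] := bal2 (lab h); have := cnt_gt0 hA; case: (cnt _ _) => [|[]].
have [k0 /[!inE] /andP[k0A /eqP lk0]] : exists k0, k0 \in [set k in A :\ h | lab k == star (lab h)].
  by apply/card_gt0P; rewrite card_partners.
have k0A' : k0 \in A :\ h by rewrite !inE.
set P := (\prod_b (cnt (A :\ h :\ k0) b)`!)%N.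
set Q := (\prod_b (cnt (A :\ h :\ k0) b).+1)%N.
have Q0 : (0 < Q)%N by exact: prodn_gt0.
have E1 := prod_fact_D2 hA bal k0A' lk0; rewrite -/n -/e -/P in E1.
have E2 := prod_succ_D2 hA bal k0A' lk0; rewrite /= -/n -/e -/Q in E2.
have S k : k \in A :\ h -> lab k = star (lab h) -> (P <= (num_consistent (A :\ h :\ k) * Q) ^ 2)%N.
  move=> kA lk; rewrite expnMn.
  have F1 := prod_fact_D2 hA bal kA lk; have F2 := prod_succ_D2 hA bal kA lk.
  rewrite /= -/n -/e in F1 F2.
  have -> : P = (\prod_b (cnt (A :\ h :\ k) b)`!)%N.
    by apply/eqP; rewrite -(eqn_pmul2l (_ : 0 < n * (n - e))%N) ?muln_gt0 ?n0// -E1 F1.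
  have -> : Q = (\prod_b (cnt (A :\ h :\ k) b).+1)%N.
    by apply/eqP; rewrite -(eqn_pmul2l (_ : 0 < n.+1 * (n - e).+1)%N)// -E2 F2.
  apply: IH.
    by have := cardsD1 h A; have := cardsD1 k (A :\ h); rewrite hA kA; lia.
  move=> b; split; first exact: bal_D2.
  move=> sb; have [_ /(_ sb)] := bal2 b.
  rewrite (cnt_D1 _ hA) (cnt_D1 _ kA) lk.
  have -> : (star (lab h) == b) = (lab h == b) by rewrite (can2_eq starK starK) sb.
  by rewrite addnA oddD addnn odd_double.
have L : ((n - e) ^ 2 * P <= (num_consistent A * Q) ^ 2)%N.
  have := leq_sqr.
  rewrite (num_consistent_rec hA) big_distrl/=.
  have : ((n - e) * PeanoNat.Nat.sqrt_up P <=
    \sum_(k in A :\ h | lab k == star (lab h)) num_consistent (A :\ h :\ k) * Q)%N.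
    rewrite -(card_partners hA bal) -sum_nat_cond_const; apply: leq_sum => k /andP[kA /eqP lk].
    exact/sqrt_up_leq/S.
  move=> le _; rewrite -leq_sqr in le; apply: leq_trans le.
  rewrite expnMn leq_mul2l; apply/orP; right.
  exact: leq_sqrt_up.
rewrite E1; set Q' := (\prod_b (cnt A b).+1)%N in E2 *.
rewrite -(leq_pmul2r (_ : 0 < (n * (n - e)) ^ 2)%N) ?expn_gt0 ?muln_gt0 ?n0 ?ne0//.
rewrite -[X in (_ <= X)%N]mulnA -(expnMn Q') E2.
move: L; rewrite !expnMn => L.
have le : (n - e <= n)%N by exact: leq_subr.
have := leq_mul L (leqnn (n.+1 ^ 2 * (n - e).+1 ^ 2)%N).
have e1 : (e <= 1)%N by rewrite /e; case: (_ == _).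
have : (n * (n - e) * (n * (n - e)) ^ 2 * P <= (n - e) ^ 2 * P * (n.+1 ^ 2 * (n - e).+1 ^ 2))%N.
  rewrite [X in (_ <= X)%N]mulnAC leq_mul2r; apply/orP; right.
  have nq : (n <= (n - e).+1)%N by lia.
  move: (n - e)%N ne0 le nq => q q0 le nq; rewrite !expnS !expn0.
  have h1 : (n * n <= n.+1 * n.+1)%N by rewrite leq_mul.
  have h2 : (n * q <= q.+1 * q.+1)%N by rewrite leq_mul.
  have := leq_mul (leq_mul h1 h2) (leqnn (q * q))%N; lia.
rewrite !expnMn; lia.
Qed.
End labelled_matchings.

(** * Elementary Stirling bounds *)

Section factorial_logarithm.
Variable R : realType.
Implicit Types (k n : nat) (x : R).

Definition xlnx x : R := x * ln x.

Lemma xlnx0 : xlnx 0 = 0. Proof. by rewrite /xlnx mul0r. Qed.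

Lemma ln_le_sub1 x : 0 < x -> ln x <= x - 1.
Proof. by move=> x0; rewrite -ler_expR lnK ?posrE//; have := expR_ge1Dx (x - 1); lra. Qed.

Lemma ln_nat_ge0 k : 0 <= ln (k.+1%:R : R).
Proof. by apply: ln_ge0; rewrite ler1n. Qed.

Lemma ln_fact_lower k : xlnx k%:R - k%:R <= ln (k`!%:R : R).
Proof.
elim: k => [|k IH]; first by rewrite xlnx0 fact0 ln1 subr0.
rewrite factS natrM lnM ?posrE ?ltr0n ?fact_gt0//.
have [->|k0] := posnP k; first by rewrite /xlnx fact0 ln1; lra.
have k0' : 0 < k%:R :> R by rewrite ltr0n.
have h : ln (k.+1%:R : R) - ln k%:R <= k%:R^-1.
  rewrite -ln_div ?posrE ?ltr0n//.
  have -> : k.+1%:R / k%:R = 1 + k%:R^-1 :> R.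
    by rewrite -natr1 mulrDl divff ?gt_eqF// mul1r.
  apply: le_trans (ln_le_sub1 _) _; last by rewrite addrAC subrr add0r.
  by rewrite addr_gt0 ?invr_gt0.
have : k%:R * (ln (k.+1%:R : R) - ln k%:R) <= 1.
  by apply: le_trans (ler_wpM2l (ltW k0') h) _; rewrite divff ?gt_eqF.
move: IH; rewrite /xlnx.
move: (ln k.+1%:R) (ln k%:R) (ln k`!%:R) => a b c; rewrite -natr1; lra.
Qed.

Lemma ln_fact_upper k : ln (k`!%:R : R) <= xlnx k%:R - k%:R + 1 + ln (k.+1%:R).
Proof.
suff H j : ln (j.+1`!%:R : R) <= xlnx j.+1%:R - j.+1%:R + 1 + ln (j.+1%:R).
  case: k => [|k]; first by rewrite xlnx0 fact0 ln1; lra.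
  apply: le_trans (H k) _; rewrite lerD2l ler_ln ?posrE ?ltr0n// ler_nat.
  by [].
elim: j => [|j IH]; first by rewrite /xlnx factS fact0 ln1; lra.
rewrite factS natrM lnM ?posrE ?ltr0n ?fact_gt0//.
set b := ln (j.+2%:R : R) in IH *; set a := ln (j.+1%:R : R) in IH *.
have h : 1 <= j.+2%:R * (b - a).
  have j2 : 0 < j.+2%:R :> R by rewrite ltr0n.
  have : a - b <= - j.+2%:R^-1.
    rewrite /a /b -ln_div ?posrE ?ltr0n//.
    have -> : j.+1%:R / j.+2%:R = 1 - j.+2%:R^-1 :> R.
      by rewrite -[j.+2%:R]natr1 -{1}[j.+1%:R](addrK 1) mulrBl divff ?mul1r// natr1 gt_eqF// ltr0n.
    apply: le_trans (ln_le_sub1 _) _; first by rewrite subr_gt0 invf_lt1// ltr1n.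
    by rewrite addrAC subrr add0r.
  move=> le; have := ler_wpM2l (ltW j2) le.
  by rewrite mulrN divff ?gt_eqF//; lra.
move: IH h; rewrite /xlnx -/a -/b -![j.+2%:R]natr1; lra.
Qed.

End factorial_logarithm.

Lemma sum_pairE (R : nmodType) (I J : finType) (F : I * J -> R) :
  \sum_x F x = \sum_i \sum_j F (i, j).
Proof. by rewrite pair_big/=; apply: eq_bigr => -[]. Qed.

(** * First moment: colourings with given edge statistics *)

Section first_moment.
Variables (R : realType) (V : finType) (d : nat) (C : finType).
Local Notation H := (V * 'I_d)%type.
Implicit Types (m : {perm H}) (f : V -> C) (t : H -> C) (c : C * C -> nat).

Definition swap (T : Type) (x : T * T) : T * T := (x.2, x.1).

Lemma swapK (T : Type) : involutive (@swap T).
Proof. by case. Qed.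

(** Each edge is counted once from either side, so the counts are symmetric and add up to the number
    of half-edges. *)
Definition edge_count m f (x : C * C) : nat :=
  #|[set h : H | (f h.1, f (m h).1) == x]|.

Definition half_edges : nat := #|{: H}|.

Definition config_matchings := [pred m : {perm H} | pmatch [set: H] m].

Definition stat_pairs c : nat :=
  #|[set mf : {perm H} * {ffun V -> C} |
     (mf.1 \in config_matchings) && [forall x, edge_count mf.1 mf.2 x == c x]]|.

(** A colouring of the vertices together with the colour announced across each half-edge. Once these
    are fixed, only a consistent matching remains to be chosen. *)
Definition stat_labels c : {set {ffun V -> C} * {ffun H -> C}} :=
  [set ft : {ffun V -> C} * {ffun H -> C} |
     [forall x, #|[set h : H | (ft.1 h.1, ft.2 h) == x]| == c x]].

(** Every matching is consistent for the constant label in [unit]. *)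
Lemma card_config_matchings_lower : ~~ odd half_edges -> (half_edges`! <=
  #|config_matchings| ^ 2 * half_edges.+1 ^ 2)%N.
Proof.
move=> oN; have cE : forall b : unit, cnt (fun=> tt) [set: H] b = half_edges.
  by move=> b; rewrite /cnt /half_edges -cardsT; apply: eq_card => h; rewrite !inE; case: b.
have := @num_consistent_lower _ unit id (fun=> tt) (fun=> erefl) [set: H].
have big1 (F : unit -> nat) : (\prod_b F b = F tt)%N.
  by rewrite (bigD1 tt)//= big1 ?muln1// => -[].
rewrite !big1 cE; set X := num_consistent _ _ _; have -> : X = #|config_matchings|.
  apply: eq_card => m; rewrite [LHS]/(consistent _ _ _ _) /consistent.
  rewrite [RHS]/(pmatch _ _) -[RHS]andbT; congr (_ && _).
  exact/forall_inP.
by apply => b; rewrite !cE.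
Qed.

(** The matchings over given labels are consistent for [swap], and the sizes of their classes are
    prescribed by [c]. *)
Lemma stat_pairs_le c :
  (stat_pairs c ^ 2 <= #|stat_labels c| ^ 2 * \prod_x (c x)`!)%N.
Proof.
pose tl (mf : {perm H} * {ffun V -> C}) := [ffun h : H => mf.2 (mf.1 h).1].
have le : (stat_pairs c <= \sum_(ft in stat_labels c)
    num_consistent (@swap C) (fun h => (ft.1 h.1, ft.2 h)) [set: H])%N.
  rewrite /stat_pairs -sum1_card.
  rewrite (partition_big (fun mf : {perm H} * {ffun V -> C} => (mf.2, tl mf))
     (mem (stat_labels c))) /=; last first.
    move=> mf; rewrite !inE => /andP[_ /forallP st]; apply/forallP => x /=.
    rewrite -(eqP (st x)) /edge_count; apply/eqP/eq_card => h.
    by rewrite !inE ffunE.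
  apply: leq_sum => -[f t] _; rewrite sum1_card /num_consistent.
  have inj : {in [pred mf | (mf \in [set mf : {perm H} * {ffun V ->
    C} | (mf.1 \in config_matchings) &&
     [forall x, edge_count mf.1 mf.2 x == c x]]) && ((mf.2, tl mf) == (f, t))] &,
       injective (fun mf => mf.1)}.
    move=> [m1 f1] [m2 f2]; rewrite !inE /= => /andP[_ /eqP[-> _]] /andP[_ /eqP[-> _]].
    by move=> ->.
  rewrite -(card_in_image inj); apply: subset_leq_card.
  apply/fintype.subsetP => m /fintype.imageP[mf mfP ->]; move: mf mfP => [m' f'].
  rewrite !inE /= => /andP[/andP[P _] /eqP[ff tt]].
  apply/andP; split=> //; apply/forall_inP => h _.
  have [m'K _] := pmatchP _ _ P.
  by rewrite -ff -tt !ffunE /swap /= m'K.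
rewrite -leq_sqr in le; apply: leq_trans le _.
have : (\sum_(ft in stat_labels c)
    num_consistent (@swap C) (fun h => (ft.1 h.1, ft.2 h)) [set: H] <=
  \sum_(ft in stat_labels c) PeanoNat.Nat.sqrt (\prod_x (c x)`!))%N.
  apply: leq_sum => ft; rewrite inE => /forallP st.
  have := num_consistent_upper (fun h => (ft.1 h.1, ft.2 h)) (@swapK C) [set: H].
  have -> : (\prod_b (cnt (fun h : H => (ft.1 h.1, ft.2 h)) [set: H] b)`! = \prod_x (c x)`!)%N.
    apply: eq_bigr => x _; congr (_`!)%N; rewrite -(eqP (st x)) /cnt.
    by apply: eq_card => h; rewrite !inE.
  exact: leq_sqrt.
rewrite sum_nat_const -leq_sqr => /leq_trans; apply.
rewrite expnMn leq_mul2l; apply/orP; right.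
exact: sqrt_leq.
Qed.

Definition freq c (x : C * C) : R := (c x)%:R / half_edges%:R.

Section count_labels.
Variable c : C * C -> nat.
Hypothesis N0 : (0 < half_edges)%N.
Hypothesis ne : stat_labels c != finset.set0.
Let q := freq c.
Let pi := vertex_marginal q.
Let kappa (x : C * C) := q x / pi x.1.

Let q_ge0 x : 0 <= q x.
Proof. by rewrite divr_ge0. Qed.
Let pi_ge0 a : 0 <= pi a.
Proof. by apply: sumr_ge0 => b _; exact: q_ge0. Qed.
Let N0R : 0 < half_edges%:R :> R. Proof. by rewrite ltr0n. Qed.

Let q_le_pi x : q x <= pi x.1.
Proof.
rewrite /pi /vertex_marginal (bigD1 x.2)//= -surjective_pairing lerDl.
by apply: sumr_ge0 => b _; exact: q_ge0.
Qed.

Let kappa_ge0 x : 0 <= kappa x.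
Proof. by rewrite divr_ge0. Qed.

Lemma sum_cnt_fst (ft : {ffun V -> C} * {ffun H -> C}) a : ft \in stat_labels c ->
  (\sum_b c (a, b) = d * #|[set v | ft.1 v == a]|)%N.
Proof.
rewrite inE => /forallP st; under eq_bigr do rewrite -(eqP (st _)).
transitivity #|[set h : H | ft.1 h.1 == a]|.
  rewrite -[RHS]sum1_card (partition_big ft.2 xpredT)//=; apply: eq_bigr => b _.
  by rewrite -sum1_card; apply: eq_bigl => h; rewrite !inE xpair_eqE.
rewrite mulnC -[X in (_ * X)%N](card_ord d) -cardsT -cardsX; apply: eq_card => h.
by rewrite !inE andbT.
Qed.

Lemma sum_cnt : (\sum_x c x = half_edges)%N.
Proof.
have [ft] := set0Pn _ ne; rewrite inE => /forallP st.
rewrite /half_edges -sum1_card (partition_big (fun h : H => (ft.1 h.1, ft.2 h)) xpredT)//=.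
apply: eq_bigr => x _; rewrite -(eqP (st x)) -sum1_card; apply: eq_bigl => h.
by rewrite !inE.
Qed.

(** Probability of [ft] when the vertex colours are independent of law [pi] and the announced
    colours are independent given them, with kernel [kappa]. It is constant on [stat_labels c], so
    that the total mass bounds their number. *)
Let weight (ft : {ffun V -> C} * {ffun H -> C}) : R :=
  \prod_v pi (ft.1 v) * \prod_h kappa (ft.1 h.1, ft.2 h).

Let sum_q : \sum_x q x = 1.
Proof.
rewrite /q /freq -mulr_suml -natr_sum sum_cnt divff// pnatr_eq0.
by rewrite -lt0n.
Qed.

Let sum_pi : \sum_a pi a = 1.
Proof.
rewrite -sum_q /pi /vertex_marginal pair_big/=; apply: eq_bigr => -[a b] _.
by [].
Qed.

Let weight_ge0 ft : 0 <= weight ft.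
Proof.
by rewrite /weight mulr_ge0//; apply: prodr_ge0 => x _; rewrite ?pi_ge0 ?kappa_ge0.
Qed.

(** Only an inequality, because the row of [kappa] at a colour with [pi] equal to 0 is a division by
    0 and sums to 0. *)
Let sum_weight : \sum_ft weight ft <= 1.
Proof.
rewrite -[leLHS](pair_big xpredT xpredT
  (fun (f : {ffun V -> C}) (t : {ffun H -> C}) => weight (f, t)))/=.
have <- : \prod_(v : V) \sum_a pi a = 1.
  by under eq_bigr do rewrite sum_pi; rewrite big1.
rewrite bigA_distr_bigA/=; apply: ler_sum => f _.
rewrite /weight/= -mulr_sumr -[leRHS]mulr1; apply: ler_wpM2l.
  by apply: prodr_ge0 => x _; rewrite pi_ge0.
rewrite -(bigA_distr_bigA (fun (h : H) b => kappa (f h.1, b)))/=.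
apply: (@le_trans _ _ (\prod_(h : H) (1 : R))); last by rewrite big1.
apply: ler_prod => h _; apply/andP; split.
  by apply: sumr_ge0 => b _; exact: kappa_ge0.
rewrite /kappa/= -mulr_suml -/(pi _).
rewrite -[X in X / _]/(pi (f h.1)).
by have [->|pn] := eqVneq (pi (f h.1)) 0; [rewrite mul0r|rewrite divff].
Qed.

Lemma expR_sum (I : finType) (F : I -> R) : expR (\sum_i F i) = \prod_i expR (F i).
Proof. by apply: (big_morph _ (@expRD R) (@expR0 R)). Qed.

Lemma expR_ln_prod (I J : finType) (g : J -> I) (w : I -> R) :
  (forall j, 0 < w (g j)) ->
  \prod_j w (g j) = expR (\sum_i #|[set j | g j == i]|%:R * ln (w i)).
Proof.
move=> w0; have -> : \prod_j w (g j) = expR (\sum_j ln (w (g j))).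
  by rewrite expR_sum; apply: eq_bigr => j _; rewrite lnK ?posrE.
congr expR; rewrite (partition_big g xpredT)//=; apply: eq_bigr => i _.
rewrite (eq_bigr (fun=> ln (w i))) => [|j /eqP->//].
by rewrite mulr_natl -sumr_const; apply: eq_bigl => j; rewrite inE.
Qed.

Let weightE ft : ft \in stat_labels c ->
  weight ft = expR (- (#|V|%:R * entropy pi) -
                    half_edges%:R * (entropy q - entropy pi)).
Proof.
move=> fts; have NE : half_edges%:R = #|V|%:R * d%:R :> R.
  by rewrite /half_edges card_prod card_ord natrM.
have V0 : (0 < #|V|)%N by move: N0; rewrite /half_edges card_prod; case: (#|V|).
have st := fts; rewrite inE in st; move/forallP in st.
have q_gt0 h : 0 < q (ft.1 h.1, ft.2 h).
  rewrite divr_gt0// ltr0n -(eqP (st _)); apply/card_gt0P; exists h.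
  by rewrite inE.
have d0 : (0 < d)%N by move: N0; rewrite /half_edges card_prod card_ord muln_gt0 => /andP[].
have piE a : pi a = #|[set v | ft.1 v == a]|%:R / #|V|%:R.
  rewrite /pi /vertex_marginal /q /freq -mulr_suml -natr_sum (sum_cnt_fst _ fts).
  by rewrite NE natrM [#|V|%:R * _]mulrC -mulf_div divff ?mul1r// pnatr_eq0 -lt0n.
have pi_gt0 v : 0 < pi (ft.1 v).
  rewrite piE divr_gt0 ?ltr0n//; apply/card_gt0P; exists v.
  by rewrite inE.
have kappa_gt0 h : 0 < kappa (ft.1 h.1, ft.2 h).
  by apply: divr_gt0; [exact: q_gt0|exact: pi_gt0].
rewrite /weight (expR_ln_prod pi_gt0) (expR_ln_prod kappa_gt0) -expRD.
congr expR.
have -> : \sum_i #|[set v | ft.1 v == i]|%:R * ln (pi i) = - (#|V|%:R * entropy pi).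
  rewrite /entropy mulrN opprK mulr_sumr; apply: eq_bigr => a _.
  by rewrite mulrA; congr (_ * _); rewrite piE mulrC divfK// pnatr_eq0 -lt0n.
congr (_ + _); rewrite -mulrN; under eq_bigr do rewrite (eqP (st _)).
have -> : - (entropy q - entropy pi) = \sum_x q x * ln (kappa x).
  rewrite /entropy opprB opprK addrC -sumrN.
  rewrite !sum_pairE.
  rewrite -big_split/=; apply: eq_bigr => a _.
  rewrite /pi /vertex_marginal mulr_suml -sumrN -big_split/=; apply: eq_bigr => b _.
  rewrite -/(vertex_marginal q a) -/(pi a) -mulrBr.
  have [->|q0] := eqVneq (q (a, b)) 0; first by rewrite !mul0r.
  have qp : 0 < q (a, b) by rewrite lt_neqAle eq_sym q0 q_ge0.
  have pp : 0 < pi a by apply: lt_le_trans qp (q_le_pi (a, b)).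
  by rewrite /kappa/= ln_div.
rewrite mulr_sumr; apply: eq_bigr => x _; rewrite mulrA /q /freq [half_edges%:R * _]mulrC.
by rewrite divfK// gt_eqF.
Qed.

Lemma card_stat_labels : (#|stat_labels c|%:R : R) <=
  expR (#|V|%:R * entropy pi + half_edges%:R * (entropy q - entropy pi)).
Proof.
rewrite -[leRHS]invrK -expRN opprD -[leRHS]mul1r ler_pdivlMr ?expR_gt0//.
apply: le_trans sum_weight; rewrite [leLHS]mulr_natl -sumr_const.
rewrite (eq_bigr weight) => [|ft fts]; last by rewrite weightE.
by rewrite [leRHS](bigID (mem (stat_labels c)))/= lerDl sumr_ge0.
Qed.

(** The labels contribute [n H(pi) + N (H(q) - H(pi))] and the proportion of consistent matchings
    contributes [- N H(q) / 2]; with [N = d n] the sum is [n * Sigma d q]. *)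
Lemma stat_pairs_log : ~~ odd half_edges -> (0 < stat_pairs c)%N ->
  ln (stat_pairs c)%:R <= ln #|config_matchings|%:R + #|V|%:R * Sigma d q +
    (#|C|%:R ^+ 2 + 2) * (1 + ln half_edges.+1%:R) :> R.
Proof.
move=> oN s0; have P0 : (0 < #|config_matchings|)%N.
  by move: (card_config_matchings_lower oN); case: #|config_matchings| => //;
    rewrite exp0n// mul0n leqNgt fact_gt0.
have L0 : (0 < #|stat_labels c|)%N by rewrite card_gt0.
have sqln (k : nat) : (0 < k)%N -> ln ((k ^ 2)%N%:R) = 2 * ln (k%:R) :> R.
  by move=> k0; rewrite natrX lnXn ?ltr0n// mulr_natl.
have F0 : (0 < \prod_x (c x)`!)%N by apply: prodn_gt0 => x; exact: fact_gt0.
have h1 : 2 * ln (stat_pairs c)%:R <=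
  2 * ln (#|stat_labels c|%:R) + ln ((\prod_x (c x)`!)%N%:R) :> R.
  rewrite -!sqln// -lnM ?posrE ?ltr0n ?expn_gt0 ?L0// ler_ln ?posrE -?natrM ?ltr0n ?muln_gt0
    ?expn_gt0 ?s0 ?L0//.
  by rewrite ler_nat stat_pairs_le.
have h2 : ln (half_edges`!%:R) <= 2 * ln #|config_matchings|%:R + 2 * ln (half_edges.+1%:R) :> R.
  rewrite -!sqln// -lnM ?posrE ?ltr0n ?expn_gt0 ?P0// ler_ln ?posrE -?natrM ?ltr0n ?muln_gt0
    ?expn_gt0 ?P0 ?fact_gt0//.
  by rewrite ler_nat card_config_matchings_lower.
have h3 := ln_fact_lower R half_edges.
have h4 : ln ((\prod_x (c x)`!)%N%:R : R) <=
   - (half_edges%:R * entropy q) + xlnx (half_edges%:R : R) - half_edges%:R + #|C|%:R ^+ 2 * (1 +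
     ln (half_edges.+1%:R : R)).
  have -> : ln ((\prod_x (c x)`!)%N%:R : R) = \sum_x ln ((c x)`!%:R : R).
    apply: expR_inj; rewrite expR_sum lnK ?posrE ?ltr0n// natr_prod.
    by apply: eq_bigr => x _; rewrite lnK// posrE ltr0n fact_gt0.
  apply: (@le_trans _ _ (\sum_x (half_edges%:R * (q x * ln (q x)) +
     (c x)%:R * (ln (half_edges%:R) - 1) + (1 + ln (half_edges.+1%:R))))).
    apply: ler_sum => x _; apply: le_trans (ln_fact_upper R (c x)) _.
    have cN : (c x <= half_edges)%N by rewrite -sum_cnt (bigD1 x)//= leq_addr.
    have hN : ln (c x).+1%:R <= ln half_edges.+1%:R :> R.
      by rewrite ler_ln ?posrE ?ltr0n// ler_nat ltnS.
    have -> : xlnx (c x)%:R = half_edges%:R * (q x * ln (q x)) + (c x)%:R * ln (half_edges%:R) :> R.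
      rewrite /q /freq /xlnx; have [->|c0] := posnP (c x); first by rewrite !(mul0r, mulr0) addr0.
      rewrite mulrA [half_edges%:R * _]mulrC divfK ?gt_eqF// ln_div ?posrE ?ltr0n//.
      by rewrite -mulrDr subrK.
    lra.
  have KE : \sum_(x : C * C) (1 + ln (half_edges.+1%:R)) = #|C|%:R ^+ 2 * (1 + ln
    (half_edges.+1%:R)) :> R.
    by rewrite sumr_const -[LHS]mulr_natl (eq_card (B := {: C * C}))// card_prod natrM expr2.
  rewrite 2!big_split/= KE.
  rewrite -mulr_suml -mulr_sumr -natr_sum sum_cnt /entropy /xlnx mulrN opprK; lra.
have h5 : ln (#|stat_labels c|%:R : R) <=
  #|V|%:R * entropy pi + half_edges%:R * (entropy q - entropy pi).
  by rewrite -[leRHS]expRK ler_ln ?posrE ?expR_gt0 ?ltr0n// card_stat_labels.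
have NE : half_edges%:R = #|V|%:R * d%:R :> R.
  by rewrite /half_edges card_prod card_ord natrM.
have l0 : 0 <= ln (half_edges.+1%:R) :> R by exact: ln_nat_ge0.
have C0 : 0 <= #|C|%:R ^+ 2 * (1 + ln (half_edges.+1%:R)) :> R.
  by rewrite mulr_ge0 ?exprn_ge0// addr_ge0.
rewrite /Sigma -/pi; rewrite /xlnx in h3 h4.
move: (ln (stat_pairs c)%:R) (ln #|stat_labels c|%:R) (ln (\prod_x (c x)`!)%:R) h1 h2 h3 h4 h5 =>
  s1 s2 s3.
move: (ln half_edges%:R) (ln half_edges`!%:R) (ln half_edges.+1%:R) (ln #|config_matchings|%:R) l0
  C0 => l1 l2 l3 l4.
rewrite NE; move: (entropy q) (entropy pi) (#|V|%:R) (#|C|%:R ^+ 2) => e1 e2 n cc.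
lra.
Qed.

End count_labels.
End first_moment.

(** * Non-backtracking walks and the unfolding of a matching *)

Section cover.
Variables (V : finType) (E : nat).
Local Notation H := (V * 'I_E.+2)%type.
Implicit Types (m : {perm H}) (h : H) (U W : {set V}).

(** [h] is the half-edge by which a vertex was entered; [lift] skips it, so that walks never
    backtrack. *)
Definition step m h (j : 'I_E.+1) : H := m (h.1, lift h.2 j).

Definition walk m h (z : seq nat) : H :=
  foldl (fun h i => step m h (inord i.-1)) h z.

(** The covering map from the tree, based at [v]. Labels count offspring from 1, whence [i.-1]. *)
Definition endpoint m v (x : seq nat) : V :=
  if x is i :: z then (walk m (m (v, inord i.-1)) z).1 else v.

Fixpoint neighbourhood m U j : {set V} :=
  if j is j'.+1 then U :|: [set v | [exists i, (m (v, i)).1 \in neighbourhood m U j']] else U.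

(** One step multiplies the size by at most [d + 1], which is [E.+3]. *)
Lemma card_neighbourhood m U j : (#|neighbourhood m U j| <= E.+3 ^ j * #|U|)%N.
Proof.
elim: j => [|j IH]; first by rewrite expn0 mul1n.
apply: leq_trans (leq_of_leqif (leq_card_setU _ _)) _.
rewrite expnS -mulnA [X in (_ <= X)%N]mulSn; apply: leq_add.
  by rewrite -[leqLHS]mul1n leq_mul// expn_gt0.
apply: leq_trans (leq_mul (leqnn E.+2) IH).
set W := neighbourhood m U j.
apply: (@leq_trans #|[set h : H | (m h).1 \in W]|).
  rewrite -[X in (_ <= X)%N]sum1_card (partition_big (fun h : H => h.1)
    [pred v | [exists i, (m (v, i)).1 \in W]]) /=; last first.
    by move=> [v i]; rewrite !inE => vW; apply/existsP; exists i.
  rewrite -sum1_card (eq_bigl (fun v => [exists i, (m (v, i)).1 \in W])) => [|v];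
    last by rewrite !inE.
  apply: leq_sum => v /existsP[i iW]; rewrite sum1_card.
  by apply/card_gt0P; exists (v, i); apply/andP; rewrite !inE /= iW.
have -> : [set h : H | (m h).1 \in W] = m @^-1: (finset.setX W [set: 'I_E.+2]).
  by apply/setP => h; rewrite !inE andbT.
rewrite card_preimset; last exact: perm_inj.
by rewrite cardsX cardsT card_ord mulnC.
Qed.

Lemma neighbourhoodN m U j v : v \notin neighbourhood m U j.+1 ->
  v \notin U /\ forall i, (m (v, i)).1 \notin neighbourhood m U j.
Proof.
rewrite !inE negb_or => /andP[vU /existsPn ?]; split=> //.
Qed.

Lemma neighbourhoodU m U j v : v \notin neighbourhood m U j -> v \notin U.
Proof. by case: j => [|j] // /neighbourhoodN[]. Qed.

Section agree.
Variables (m m0 : {perm H}) (U : {set V}).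
Hypothesis agree : forall v i, v \notin U -> m (v, i) = m0 (v, i).

(** Distance [j] suffices for [j.+1] steps, because no half-edge leaves the vertex where the walk
    ends. *)
Lemma walk_agree j h z : h.1 \notin neighbourhood m U j -> (size z <= j.+1)%N ->
  walk m h z = walk m0 h z.
Proof.
elim: z j h => //= i z IH j h hU zj.
have hm : step m h (inord i.-1) = step m0 h (inord i.-1).
  by apply: agree; exact: neighbourhoodU hU.
rewrite -hm; case: j hU zj => [|j] hU zj; first by case: z zj {IH}.
by apply: (IH j) => //; have [_] := neighbourhoodN hU; exact.
Qed.

Lemma endpoint_agree j v x : v \notin neighbourhood m U j -> (size x <= j.+1)%N ->
  endpoint m v x = endpoint m0 v x.
Proof.
case: x => //= i z vU zj; rewrite -(agree _ (neighbourhoodU vU)); congr fst.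
case: j vU zj => [|j] vU zj; first by case: z zj.
by apply: (@walk_agree j) => //; have [_] := neighbourhoodN vU; exact.
Qed.

End agree.

End cover.

(** * Coloured balls as vertex labels *)

Section branch_types.
Variables (M : finType) (E : nat).

(* Coloured branches and balls of the [d]-regular tree, [d = E.+2]: a vertex that
   is not the root has [E.+1] offspring. *)
Fixpoint branch (k : nat) : finType :=
  if k is k'.+1 then (M * {ffun 'I_E.+1 -> branch k'})%type : finType else M.

(** Index [k] stands for radius [k + 1], as the branches of depth [k] hang from the neighbours of
    the root. *)
Definition ball_type (k : nat) : finType := (M * {ffun 'I_E.+2 -> branch k})%type : finType.

Definition mk_branch k (c : M) (y : {ffun 'I_E.+1 -> branch k}) : branch k.+1 := (c, y).

Definition branch_root k : branch k -> M :=
  if k is k'.+1 return branch k -> M then fun y : M * {ffun 'I_E.+1 -> branch k'} => y.1 else id.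

Fixpoint const_branch k (c : M) : branch k :=
  if k is k'.+1 return branch k then (c, [ffun=> const_branch k' c]) else c.

(** Defined for all depths to avoid casts: a branch that is too shallow is continued by constant
    branches. *)
Fixpoint truncate k j : branch k -> branch j :=
  match k, j return branch k -> branch j with
  | 0, _ => const_branch j
  | k'.+1, 0 => @branch_root k'.+1
  | k'.+1, j'.+1 => fun y : M * {ffun 'I_E.+1 -> branch k'} => (y.1, [ffun i =>
    truncate j' (y.2 i)])
  end.
Arguments truncate : clear implicits.

Lemma root_const_branch k c : branch_root (const_branch k c) = c. Proof. by case: k. Qed.

Lemma root_truncate k j (y : branch k) : branch_root (truncate k j y) = branch_root y.
Proof. by case: k y => [|k] y; [exact: root_const_branch|case: j]. Qed.

Lemma truncate_const_branch k j c : (j <=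
  k)%N -> truncate k j (const_branch k c) = const_branch j c.
Proof.
elim: k j => [|k IH] [|j]//= jk; congr pair.
by apply/ffunP => i; rewrite !ffunE IH.
Qed.

Lemma truncate_id k y : truncate k k y = y.
Proof.
elim: k y => //= k IH [c y] /=; congr pair.
by apply/ffunP => i; rewrite ffunE IH.
Qed.

Lemma truncate_truncate k k' j (y : branch k) : (j <= k')%N ->
  truncate k' j (truncate k k' y) = truncate k j y.
Proof.
elim: k k' j y => [|k IH] k' j y jk; first exact: truncate_const_branch.
case: k' jk => [|k'] jk; first by case: j jk.
case: j jk => [|j] jk //=; congr pair.
by apply/ffunP => i; rewrite !ffunE IH.
Qed.

Fixpoint branch_at (k : nat) (X : seq nat -> M) : branch k :=
  if k is k'.+1 return branch k then
    (X [::], [ffun j : 'I_E.+1 => branch_at k' (fun z => X (j.+1 :: z))])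
  else X [::].

Definition ball_at (k : nat) (X : seq nat -> M) : ball_type k :=
  (X [::], [ffun i : 'I_E.+2 => branch_at k (fun z => X (i.+1 :: z))]).

(** Labels relative to a vertex other than the root, which has [d - 1] offspring. *)
Definition branch_word (z : seq nat) := all (fun i => 0 < i < E.+2)%N z.

Lemma branch_at_eq k X X' : branch_at k X = branch_at k X' <->
  forall z, branch_word z -> (size z <= k)%N -> X z = X' z.
Proof.
elim: k X X' => [|k IH] X X' /=; first by split=> [E0 [|]//|]; apply.
split=> [[E0 E1] [|i z]//= /andP[/andP[i0 iE] zw] zk|E0].
  case: i i0 iE => // i _ iE; rewrite ltnS in iE.
  have := congr1 (fun g : {ffun 'I_E.+1 -> branch k} => g (Ordinal iE)) E1; rewrite !ffunE.
  by move/IH; apply.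
congr pair; first exact: E0.
apply/ffunP => j; rewrite !ffunE; apply/IH => z zw zk; apply: E0 => //=.
by rewrite zw ltnS ltn_ord.
Qed.

Lemma ball_at_eq k X X' : ball_at k X = ball_at k X' <->
  forall x, in_tree E.+2 x -> (size x <= k.+1)%N -> X x = X' x.
Proof.
split=> [[E0 E1] [|i z]//= /andP[/andP[i0 iE] zw] zk|E0].
  case: i i0 iE => // i _ iE.
  have := congr1 (fun g : {ffun 'I_E.+2 -> branch k} => g (Ordinal iE)) E1; rewrite !ffunE.
  by move/branch_at_eq; apply.
congr pair; first exact: E0.
apply/ffunP => j; rewrite !ffunE; apply/branch_at_eq => z zw zk; apply: E0 => //=.
by rewrite ltn_ord; exact: zw.
Qed.

(* The branch seen from the [i]-th neighbour of the root when looking back at the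
   root; matched half-edges must carry swapped labels. *)
Definition own_branch k (s : ball_type k) (i : 'I_E.+2) : branch k :=
  truncate k.+1 k (mk_branch s.1 [ffun j => s.2 (lift i j)]).

Definition edge_label k (s : ball_type k) (i : 'I_E.+2) : branch k * branch k := (own_branch s i,
  s.2 i).

Lemma root_own_branch k (s : ball_type k) i : branch_root (own_branch s i) = s.1.
Proof. exact: root_truncate. Qed.

Section consistent_types.
Variables (V : finType) (k : nat) (F : V -> ball_type k).
Local Notation H := (V * 'I_E.+2)%type.
Variable m : {perm H}.

Definition agreeing (h : H) : bool :=
  edge_label (F (m h).1) (m h).2 == swap (edge_label (F h.1) h.2).

Definition clashing : {set V} := [set v | [exists i, ~~ agreeing (v, i)]].

Lemma agreeingP v i : v \notin clashing -> agreeing (v, i).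
Proof. by rewrite inE => /existsPn/(_ i); rewrite negbK. Qed.

(** Agreement along an edge says that the branch announced across [h] is what the vertex on the
    other side sees when looking away from [h], truncated to depth [k]. Iterating this along a walk
    shows that announced colours are true ones until a clash is met. *)
Lemma branch_at_truncate j h : (j <= k)%N -> h.1 \notin neighbourhood m clashing j ->
  branch_at j (fun z => (F (walk m (m h) z).1).1) = truncate k j ((F h.1).2 h.2).
Proof.
elim: j h => [|j IH] h jk hU.
  have /eqP[ow _] : agreeing h by rewrite [h]surjective_pairing;
    exact: agreeingP (neighbourhoodU hU).
  by rewrite /= -(root_own_branch _ (m h).2) ow /= -(root_truncate 0).
have [hU' hnb] := neighbourhoodN hU.
have /eqP[ow _] : agreeing h by rewrite [h]surjective_pairing; exact: agreeingP.
have hnb' : (m h).1 \notin neighbourhood m clashing j.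
  by have := hnb h.2; rewrite -surjective_pairing.
rewrite -ow /own_branch truncate_truncate//=.
congr pair; apply/ffunP => i; rewrite !ffunE.
have /= <- := IH ((m h).1, lift (m h).2 i) (ltnW jk) hnb'.
congr branch_at; apply/funext => z.
by rewrite /walk/= /step inord_val.
Qed.

(** Why balls may be assigned to vertices before the matching is chosen: away from clashes, the
    assigned ball is the one that the unfolding really has. *)
Lemma ball_types v : v \notin neighbourhood m clashing k ->
  ball_at k (fun x => (F (endpoint m v x)).1) = F v.
Proof.
move=> vU; rewrite [F v]surjective_pairing /ball_at; congr pair.
apply/ffunP => i; rewrite ffunE -[RHS]truncate_id.
rewrite -(@branch_at_truncate k (v, i))//; congr branch_at; apply/funext => z.
by rewrite /endpoint inord_val.
Qed.

End consistent_types.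

End branch_types.

(** * Entropy of product and Markov laws *)

Section entropy_lemmas.
Variable R : realType.

(** The chain rule for entropy; terms of probability 0 vanish on both sides. *)
Lemma entropy_skew (I J : finType) (al : I -> R) (ka : I -> J -> R) :
  (forall i, 0 <= al i) -> (forall i j, 0 <= ka i j) ->
  (forall i, \sum_j ka i j = 1) ->
  - \sum_i \sum_j al i * ka i j * ln (al i * ka i j) =
  entropy al + \sum_i al i * entropy (ka i).
Proof.
move=> al0 ka0 ka1; rewrite /entropy -!sumrN -big_split/=; apply: eq_bigr => i _.
rewrite -[al i * ln (al i)]mulr1 -{1}(ka1 i) mulrN mulr_sumr -opprD; congr (- _).
rewrite mulr_sumr -big_split/=; apply: eq_bigr => j _.
have [->|a0] := eqVneq (al i) 0; first by rewrite !mul0r addr0.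
have [->|k0] := eqVneq (ka i j) 0; first by rewrite !(mulr0,mul0r) addr0.
have ai : 0 < al i by rewrite lt_neqAle eq_sym a0 al0.
have ki : 0 < ka i j by rewrite lt_neqAle eq_sym k0 ka0.
rewrite lnM ?posrE//.
by move: (ln (al i)) (ln (ka i j)) => a b; lra.
Qed.

Lemma prod_sum_ffun (I J : finType) (ka : I -> J -> R) :
  (forall i, \sum_j ka i j = 1) -> \sum_(f : {ffun I -> J}) \prod_i ka i (f i) = 1.
Proof.
by move=> ka1; rewrite -(bigA_distr_bigA ka); apply: big1 => i _; exact: ka1.
Qed.

Lemma entropy_ffun (I J : finType) (ka : J -> R) :
  (forall j, 0 <= ka j) -> \sum_j ka j = 1 ->
  entropy (fun f : {ffun I -> J} => \prod_i ka (f i)) = #|I|%:R * entropy ka.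
Proof.
move=> ka0 ka1; rewrite /entropy mulrN; congr (- _).
transitivity (\sum_(i : I) \sum_(f : {ffun I -> J}) (\prod_i ka (f i)) * ln (ka (f i))).
  rewrite exchange_big/=; apply: eq_bigr => f _.
  have [/existsP[i0 /eqP k0]|/existsPn k0] := boolP [exists i, ka (f i) == 0].
    have -> : \prod_i ka (f i) = 0 by rewrite (bigD1 i0)//= k0 mul0r.
    by rewrite mul0r big1// => i _; rewrite mul0r.
  rewrite -mulr_sumr; congr (_ * _).
  have kp i : 0 < ka (f i) by rewrite lt_neqAle eq_sym k0 ka0.
  apply: expR_inj; rewrite lnK ?posrE ?prodr_gt0// expR_sum.
  by apply: eq_bigr => i _; rewrite lnK ?posrE.
rewrite mulr_natl -sumr_const; apply: eq_bigr => i0 _.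
(* The logarithm sits on the factor [i0] alone, and the other factors sum to 1. *)
pose G i j := if i == i0 then ka j * ln (ka j) else ka j.
transitivity (\sum_(f : {ffun I -> J}) \prod_i G i (f i)).
  apply: eq_bigr => f _; rewrite [RHS](bigD1 i0)//= [in LHS](bigD1 i0)//= /G eqxx.
  rewrite mulrAC; congr (_ * _); apply: eq_bigr => i /negbTE ->.
  by [].
rewrite -(bigA_distr_bigA G) (bigD1 i0)//= [X in _ * X]big1 ?mulr1.
  by apply: eq_bigr => j _; rewrite /G eqxx.
by move=> i /negbTE ii; rewrite /G -[RHS]ka1; apply: eq_bigr => j _; rewrite ii.
Qed.

End entropy_lemmas.

(** * The law of mu(p) on balls and its entropy *)

Section branch_laws.
Variables (R : realType) (M : finType) (E : nat) (p : M * M -> R).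
Hypothesis pL : edge_law p.
Local Notation pi := (vertex_marginal p).
Local Notation branch := (branch M E).
Local Notation ball_type := (ball_type M E).

Let p0 x : 0 <= p x. Proof. by case: pL. Qed.
Let p1 : \sum_x p x = 1. Proof. by case: pL. Qed.
Let pC a b : p (a, b) = p (b, a). Proof. by case: pL. Qed.

Lemma pi_ge0 a : 0 <= pi a. Proof. by apply: sumr_ge0 => b _; exact: p0. Qed.

Lemma sum_pi : \sum_a pi a = 1. Proof. by rewrite -p1 sum_pairE. Qed.

Lemma p_le_pi a b : p (a, b) <= pi a.
Proof. by rewrite /vertex_marginal (bigD1 b)//= lerDl sumr_ge0. Qed.

(* When [pi a = 0] the kernel stays put, so that it is always stochastic. *)
Definition kernel (a c : M) : R := if pi a == 0 then (c == a)%:R else p (a, c) / pi a.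

Lemma kernel_ge0 a c : 0 <= kernel a c.
Proof. by rewrite /kernel; case: ifP => // _; rewrite divr_ge0 ?pi_ge0. Qed.

Lemma sum_kernel a : \sum_c kernel a c = 1.
Proof.
rewrite /kernel; case: eqVneq => [_|pa]; last by rewrite -mulr_suml divff.
by rewrite (bigD1 a)//= eqxx big1 ?addr0// => c /negbTE ->.
Qed.

Lemma pi_kernel a c : pi a * kernel a c = p (a, c).
Proof.
rewrite /kernel; case: eqVneq => [pa|pa]; last by rewrite mulrC divfK.
by rewrite pa mul0r; apply/esym/le_anti; rewrite p0 -pa p_le_pi.
Qed.

Lemma sum_pi_kernel c : \sum_a pi a * kernel a c = pi c.
Proof. by apply: eq_bigr => a _; rewrite pi_kernel pC. Qed.

(** Conditional probability of the colours below the root of a branch, given the colour of that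
    root. *)
Fixpoint subtree_weight k : branch k -> R :=
  if k is k'.+1 return branch k -> R then
    fun y : M * {ffun 'I_E.+1 -> branch k'} =>
      \prod_i (kernel y.1 (branch_root (y.2 i)) * subtree_weight (y.2 i))
  else fun=> 1.

Definition branch_weight k a (y : branch k) := kernel a (branch_root y) * subtree_weight y.
Definition ball_weight k (s : ball_type k) := pi s.1 * \prod_i branch_weight s.1 (s.2 i).
Definition edge_weight k (x : branch k * branch k) := p (branch_root x.1,
  branch_root x.2) * subtree_weight x.1 * subtree_weight x.2.
Definition rooted_weight k (y : branch k) := pi (branch_root y) * subtree_weight y.

Lemma subtree_weight_ge0 k (y : branch k) : 0 <= subtree_weight y.
Proof.
elim: k y => [|k IH] y //=; apply: prodr_ge0 => i _.
by rewrite mulr_ge0 ?kernel_ge0.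
Qed.

Lemma branch_weight_ge0 k a (y : branch k) : 0 <= branch_weight a y.
Proof. by rewrite mulr_ge0 ?kernel_ge0 ?subtree_weight_ge0. Qed.

Lemma ball_weight_ge0 k (s : ball_type k) : 0 <= ball_weight s.
Proof. by rewrite mulr_ge0 ?pi_ge0// prodr_ge0// => i _; exact: branch_weight_ge0. Qed.

Lemma edge_weight_swap k (x : branch k * branch k) : edge_weight (swap x) = edge_weight x.
Proof. by rewrite /edge_weight /= pC -!mulrA [subtree_weight _ * subtree_weight _]mulrC. Qed.

Lemma sum_Br k (F : branch k.+1 -> R) :
  \sum_y F y = \sum_c \sum_(y : {ffun 'I_E.+1 -> branch k}) F (mk_branch c y).
Proof. exact: sum_pairE. Qed.

Lemma sum_Ty k (F : ball_type k -> R) :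
  \sum_y F y = \sum_c \sum_(y : {ffun 'I_E.+2 -> branch k}) F (c, y).
Proof. exact: sum_pairE. Qed.

Lemma branch_weight_mk k a c (y : {ffun 'I_E.+1 -> branch k}) :
  branch_weight a (mk_branch c y) = kernel a c * \prod_i branch_weight c (y i).
Proof. by []. Qed.

Lemma rooted_weight_mk k c (y : {ffun 'I_E.+1 -> branch k}) :
  rooted_weight (mk_branch c y) = pi c * \prod_i branch_weight c (y i).
Proof. by []. Qed.

Lemma sum_branch_weight k a : \sum_(y : branch k) branch_weight a y = 1.
Proof.
elim: k a => [|k IH] a.
  by rewrite -[RHS](sum_kernel a); apply: eq_bigr => c _; rewrite /branch_weight/= mulr1.
rewrite sum_Br -[RHS](sum_kernel a); apply: eq_bigr => c _.
under eq_bigr do rewrite branch_weight_mk.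
by rewrite -mulr_sumr (prod_sum_ffun (ka := fun _ => branch_weight c)) ?mulr1.
Qed.

Lemma sum_ball_weight k : \sum_(s : ball_type k) ball_weight s = 1.
Proof.
rewrite sum_Ty -[RHS]sum_pi; apply: eq_bigr => c _.
rewrite /ball_weight/= -mulr_sumr (prod_sum_ffun (ka := fun _ => branch_weight c)) ?mulr1// => i.
exact: sum_branch_weight.
Qed.

Lemma sum_rooted_weight k (G : M ->
  R) : \sum_(y : branch k) rooted_weight y * G (branch_root y) = \sum_c pi c * G c.
Proof.
case: k => [|k]; first by apply: eq_bigr => c _; rewrite /rooted_weight/= mulr1.
rewrite sum_Br; apply: eq_bigr => c _; rewrite /=.
rewrite -mulr_suml; congr (_ * _); under eq_bigr do rewrite rooted_weight_mk.
rewrite -mulr_sumr (prod_sum_ffun (ka := fun _ => branch_weight c)) ?mulr1// => i.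
exact: sum_branch_weight.
Qed.

(** Consistency of the branch laws: the kernels of the deepest level sum to 1. *)
Lemma sum_branch_weight_truncate k a (x : branch k) :
  \sum_(z : branch k.+1 | truncate k z == x) branch_weight a z = branch_weight a x.
Proof.
elim: k a x => [|k IH] a x.
  rewrite big_mkcond sum_Br (bigD1 x)//= [X in _ + X]big1 ?addr0.
    under eq_bigr do rewrite eqxx branch_weight_mk.
    transitivity (kernel a x * \sum_(y : {ffun 'I_E.+1 -> branch 0}) \prod_i branch_weight x (y i)).
      by rewrite mulr_sumr.
    rewrite (prod_sum_ffun (ka := fun _ => @branch_weight 0 x)) => [|i];
      last exact: sum_branch_weight.
    by rewrite /branch_weight/= mulr1.
  by move=> c /negbTE cx; apply: big1 => y _; rewrite /= cx.
case: x => c x; rewrite -[(c, x)]/(mk_branch c x) branch_weight_mk big_mkcond sum_Br (bigD1 c)//=.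
rewrite [X in _ + X]big1 ?addr0; last first.
  by move=> c' /negbTE cx; apply: big1 => y _; rewrite xpair_eqE /= cx.
rewrite -big_mkcond/=; under eq_bigr do rewrite branch_weight_mk.
rewrite -mulr_sumr; congr (_ * _).
under [RHS]eq_bigr do rewrite -IH.
rewrite bigA_distr_big_dep; apply: eq_bigl => y.
rewrite xpair_eqE eqxx/=; apply/eqP/familyP => [<- i|yx].
  by apply/eqP; rewrite !ffunE.
by apply/ffunP => i; rewrite ffunE; have /eqP := yx i.
Qed.

Lemma edge_weight_rooted k (x y : branch k) : edge_weight (x,
  y) = rooted_weight x * branch_weight (branch_root x) y.
Proof. by rewrite /edge_weight /rooted_weight /branch_weight -pi_kernel /=; lra. Qed.

(** The label along the [i]-th edge has a law independent of [i]. As [edge_weight_swap] makes this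
    law symmetric, half-edges carrying independent copies of the ball law are nearly balanced. *)
Lemma sum_ball_weight_label k (i : 'I_E.+2) (b : branch k * branch k) :
  \sum_(s : ball_type k | edge_label s i == b) ball_weight s = edge_weight b.
Proof.
case: b => x y; rewrite edge_weight_rooted big_mkcond sum_Ty (bigD1 (branch_root x))//=.
rewrite [X in _ + X]big1 ?addr0; last first.
  move=> c cx; apply: big1 => s _; rewrite ifF//; apply: contraNF cx.
  by rewrite /edge_label xpair_eqE => /andP[/eqP <- _]; rewrite root_own_branch.
rewrite /rooted_weight -mulrA.
transitivity (pi (branch_root x) * \sum_(s : {ffun 'I_E.+2 -> branch k})
   (if edge_label (branch_root x, s) i == (x,
     y) then \prod_i branch_weight (branch_root x) (s i) else 0)).
  rewrite mulr_sumr; apply: eq_bigr => s _; rewrite /ball_weight/=.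
  by case: ifP; rewrite ?mulr0.
congr (_ * _).
pose T (z : 'I_E.+1 -> branch k) := truncate k (mk_branch (branch_root x) [ffun j => z j]) == x.
have labE (s : {ffun 'I_E.+2 -> branch k}) :
    (edge_label (branch_root x, s) i == (x, y)) = (s i == y) && T (fun j => s (lift i j)).
  rewrite /edge_label xpair_eqE andbC /own_branch /T /=;
    congr (_ && (truncate _ (mk_branch _ _) == _)).
have step1 : \sum_(s : {ffun 'I_E.+2 -> branch k})
   (if edge_label (branch_root x, s) i == (x,
     y) then \prod_i branch_weight (branch_root x) (s i) else 0) =
   branch_weight (branch_root x) y * \sum_(z : {ffun 'I_E.+1 ->
     branch k} | T z) \prod_j branch_weight (branch_root x) (z j).
  rewrite -big_mkcond/= mulr_sumr.
  (* The branch at [i] splits off; the other [d - 1] branches and the root form the branch seen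
     backwards along that edge. *)
  pose glue (z : {ffun 'I_E.+1 -> branch k}) : {ffun 'I_E.+2 -> branch k} :=
    [ffun l => if unlift i l is Some j then z j else y].
  pose rest (s : {ffun 'I_E.+2 -> branch k}) : {ffun 'I_E.+1 -> branch k} := [ffun j =>
    s (lift i j)].
  rewrite (reindex glue) /=; last first.
    exists rest => [z _|s].
      by apply/ffunP => j; rewrite !ffunE liftK.
    rewrite inE labE => /andP[/eqP sy _]; apply/ffunP => l; rewrite !ffunE.
    by case: unliftP => [j ->|->]; rewrite ?ffunE.
  apply: eq_big => [z|z _].
    rewrite labE /glue ffunE unlift_none eqxx /T /=; congr (truncate _ (mk_branch _ _) == _).
    by apply/ffunP => j; rewrite !ffunE liftK.
  rewrite (bigD1_ord i)//= ffunE unlift_none; congr (_ * _).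
  by apply: eq_bigr => j _; rewrite ffunE liftK.
rewrite step1 mulrC; congr (_ * _).
have H z : T z = (truncate k (mk_branch (branch_root x) [ffun j => z j]) == x) by [].
case: k x y T {labE step1} H => [|k] x y T H.
  rewrite (eq_bigl xpredT) => [|z]; last by rewrite H /= eqxx.
  by rewrite (prod_sum_ffun (ka := fun _ => branch_weight _)) // => i'; exact: sum_branch_weight.
case: x T H => c x T H; rewrite [branch_root _]/= in H *; rewrite [RHS]/=.
transitivity (\prod_j branch_weight c ((x : {ffun 'I_E.+1 -> branch k}) j)); last by [].
under [RHS]eq_bigr => j _ do rewrite -sum_branch_weight_truncate.
rewrite bigA_distr_big_dep; apply: eq_bigl => z.
rewrite H xpair_eqE eqxx/=; apply/eqP/familyP => [<- j|zx].
  by apply/eqP; rewrite !ffunE.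
by apply/ffunP => j; rewrite !ffunE; have /eqP := zx j.
Qed.

Definition branch_entropy k : R := \sum_a pi a * entropy (@branch_weight k a).

Lemma entropy_branch_weight k a :
  entropy (@branch_weight k.+1 a) = entropy (kernel a) + \sum_c kernel a c * (E.+1%:R * entropy
    (@branch_weight k c)).
Proof.
rewrite {1}/entropy sum_Br; under eq_bigr do under eq_bigr do rewrite branch_weight_mk.
rewrite (entropy_skew (al := kernel a) (ka := fun c (y : {ffun 'I_E.+1 -> branch k}) =>
  \prod_i branch_weight c (y i))).
- congr (_ + _); apply: eq_bigr => c _; congr (_ * _).
  by rewrite entropy_ffun ?card_ord//; [exact: branch_weight_ge0|exact: sum_branch_weight].
- exact: kernel_ge0.
- by move=> c y; apply: prodr_ge0 => i _; exact: branch_weight_ge0.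
- by move=> c; apply: (prod_sum_ffun (ka := fun _ => branch_weight c)) => i;
  exact: sum_branch_weight.
Qed.

Let h := \sum_a pi a * entropy (kernel a).

Lemma branch_entropy0 : branch_entropy 0 = h.
Proof.
apply: eq_bigr => a _; congr (_ * _); rewrite /entropy; congr (- _).
by apply: eq_bigr => c _; rewrite /branch_weight/= mulr1.
Qed.

Lemma branch_entropyS k : branch_entropy k.+1 = h + E.+1%:R * branch_entropy k.
Proof.
rewrite /branch_entropy; under eq_bigr do rewrite entropy_branch_weight mulrDr mulr_sumr.
rewrite big_split/=; congr (_ + _); rewrite exchange_big/= mulr_sumr.
apply: eq_bigr => c _; under eq_bigr do rewrite mulrA.
by rewrite -mulr_suml sum_pi_kernel mulrCA.
Qed.

Lemma entropy_p : entropy p = entropy pi + h.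
Proof.
rewrite -(entropy_skew pi_ge0 kernel_ge0 sum_kernel) /entropy sum_pairE; congr (- _).
by apply: eq_bigr => a _; apply: eq_bigr => b _; rewrite pi_kernel.
Qed.

Lemma entropy_ball_weight k : entropy (@ball_weight k) = entropy pi + E.+2%:R * branch_entropy k.
Proof.
rewrite {1}/entropy sum_Ty.
rewrite (entropy_skew (al := pi) (ka := fun c (y : {ffun 'I_E.+2 -> branch k}) =>
  \prod_i branch_weight c (y i))).
- congr (_ + _); rewrite /branch_entropy mulr_sumr; apply: eq_bigr => c _.
  rewrite entropy_ffun ?card_ord;
    [by rewrite mulrCA|exact: branch_weight_ge0|exact: sum_branch_weight].
- exact: pi_ge0.
- by move=> c y; apply: prodr_ge0 => i _; exact: branch_weight_ge0.
- by move=> c; apply: (prod_sum_ffun (ka := fun _ => branch_weight c)) => i;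
  exact: sum_branch_weight.
Qed.

Lemma rooted_weight_ge0 k (y : branch k) : 0 <= rooted_weight y.
Proof. by rewrite mulr_ge0 ?pi_ge0 ?subtree_weight_ge0. Qed.

Lemma entropy_rooted_weight0 : entropy (@rooted_weight 0) = entropy pi.
Proof.
by congr (- _); apply: eq_bigr => c _; rewrite /rooted_weight/= mulr1.
Qed.

Lemma entropy_rooted_weightS k : entropy (@rooted_weight k.+1) = entropy pi + E.+1%:R *
  branch_entropy k.
Proof.
rewrite {1}/entropy sum_Br; under eq_bigr do under eq_bigr do rewrite rooted_weight_mk.
rewrite (entropy_skew (al := pi) (ka := fun c (y : {ffun 'I_E.+1 -> branch k}) =>
  \prod_i branch_weight c (y i))).
- congr (_ + _); rewrite /branch_entropy mulr_sumr; apply: eq_bigr => c _.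
  rewrite entropy_ffun ?card_ord;
    [by rewrite mulrCA|exact: branch_weight_ge0|exact: sum_branch_weight].
- exact: pi_ge0.
- by move=> c y; apply: prodr_ge0 => i _; exact: branch_weight_ge0.
- by move=> c; apply: (prod_sum_ffun (ka := fun _ => branch_weight c)) => i;
  exact: sum_branch_weight.
Qed.

Lemma entropy_edge_weight k : entropy (@edge_weight k) = entropy (@rooted_weight k) +
  branch_entropy k.
Proof.
rewrite {1}/entropy sum_pairE; under eq_bigr do under eq_bigr do rewrite edge_weight_rooted.
rewrite (entropy_skew (al := @rooted_weight k) (ka := fun x => @branch_weight k (branch_root x))).
- by congr (_ + _); rewrite (sum_rooted_weight k (fun c => entropy (@branch_weight k c))).
- exact: rooted_weight_ge0.
- by move=> x y; exact: branch_weight_ge0.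
- by move=> x; exact: sum_branch_weight.
Qed.

(** With [b] the branch entropy and [h] that of one step, the ball has entropy [H(pi) + d b] and the
    edge label [H(pi) + 2 b - h]. Hence [b] cancels, and the radius with it. *)
Lemma Sigma_types k :
  entropy (@ball_weight k) - E.+2%:R / 2 * entropy (@edge_weight k) = Sigma E.+2 p.
Proof.
rewrite /Sigma entropy_ball_weight entropy_edge_weight entropy_p -[E.+2%:R]natr1.
case: k => [|k]; first by rewrite entropy_rooted_weight0 branch_entropy0; lra.
by rewrite entropy_rooted_weightS branch_entropyS; lra.
Qed.

End branch_laws.

(** * Continuity of x ln x *)

Section continuity.
Variable R : realType.

(** This is [ln z <= z - 1] at the inverse of the square root of [y]. *)
Lemma xlnx_small (y : R) : 0 <= y <= 1 -> `|xlnx y| <= 2 * Num.sqrt y.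
Proof.
case/andP=> y0 y1; have [->|yn0] := eqVneq y 0.
  by rewrite xlnx0 normr0 mulr_ge0 ?sqrtr_ge0.
have yp : 0 < y by rewrite lt_neqAle eq_sym yn0.
have sp : 0 < Num.sqrt y by rewrite sqrtr_gt0.
rewrite ler0_norm; last first.
  by rewrite /xlnx mulr_ge0_le0// ln_le0.
have lE : ln y = 2 * ln (Num.sqrt y).
  by rewrite -{1}(sqr_sqrtr y0) lnXn// mulr_natl.
have := @ln_le_sub1 R (Num.sqrt y)^-1; rewrite invr_gt0 => /(_ sp).
rewrite lnV ?posrE// => h.
have h2 : - ln y <= 2 * (Num.sqrt y)^-1 by rewrite lE; lra.
rewrite /xlnx -mulrN; apply: le_trans (ler_wpM2l y0 h2) _.
by rewrite -{1}(sqr_sqrtr y0) expr2 mulrCA -!mulrA divff ?mulr1// gt_eqF.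
Qed.

Lemma xlnx_cont (x eta : R) : 0 <= x -> 0 < eta ->
  exists2 delta : R, 0 < delta &
    forall y : R, 0 <= y -> `|y - x| <= delta -> `|xlnx y - xlnx x| <= eta.
Proof.
move=> x0 eta0; have [->|xn0] := eqVneq x 0.
  exists (Num.min 1 ((eta / 2) ^+ 2)).
    by rewrite lt_min ltr01 exprn_gt0// divr_gt0.
  move=> y y0; rewrite subr0 ger0_norm// le_min => /andP[y1 ye].
  rewrite xlnx0 subr0; apply: le_trans (xlnx_small _) _; first by rewrite y0.
  have : Num.sqrt y <= eta / 2.
    have e2 : 0 <= eta / 2 by rewrite divr_ge0// ltW.
    by rewrite -(ger0_norm e2) -sqrtr_sqr ler_sqrt// exprn_ge0.
  lra.
have xp : 0 < x by rewrite lt_neqAle eq_sym xn0.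
have : {for x, continuous (@xlnx R)}.
  by apply: cvgM; [exact: cvg_id|exact: continuous_ln].
move/cvgrPdist_le => /(_ _ eta0) /nbhs_ballP[e /= e0 eP].
exists (e / 2); first by rewrite divr_gt0.
move=> y y0 yx; rewrite distrC; apply: eP; rewrite /ball/= distrC.
by apply: le_lt_trans yx _; lra.
Qed.

Lemma xlnx_cont_fin (I : finType) (x : I -> R) (eta : R) :
  (forall i, 0 <= x i) -> 0 < eta ->
  exists2 delta : R, 0 < delta &
    forall y : I -> R, (forall i, 0 <= y i) -> (forall i, `|y i - x i| <= delta) ->
      `|\sum_i xlnx (y i) - \sum_i xlnx (x i)| <= eta.
Proof.
move=> x0 eta0; have e0 : 0 < eta / #|I|.+1%:R by rewrite divr_gt0.
have /choice[dl dlP] : forall i, exists delta : R, 0 < delta /\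
    forall y : R, 0 <= y -> `|y - x i| <= delta -> `|xlnx y - xlnx (x i)| <= eta / #|I|.+1%:R.
  by move=> i; have [dl ? ?] := xlnx_cont (x0 i) e0; exists dl.
exists (\big[Num.min/1]_i dl i).
  by elim/big_ind: _ => // [a b a0 b0|i _]; [rewrite lt_min a0|have [] := dlP i].
move=> y y0 yx; rewrite -sumrB; apply: le_trans (ler_norm_sum _ _ _) _.
apply: (@le_trans _ _ (\sum_(i : I) eta / #|I|.+1%:R)).
  apply: ler_sum => i _; have [_] := dlP i; apply => //.
  by apply: le_trans (yx i) _; apply: bigmin_le_cond.
rewrite sumr_const -[leLHS]mulr_natl mulrCA -[leRHS]mulr1 ler_wpM2l ?ltW//.
by rewrite ltr_pdivrMr// mul1r ltr_nat.
Qed.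

Lemma ln_little_o (K eta : R) : 0 < eta -> exists n0, forall n, (n0 <= n)%N ->
  K * (1 + ln n.+1%:R) <= eta * n%:R.
Proof.
move=> eta0; pose K' := `|K| + 1; have K0 : 0 < K' by rewrite ltr_pwDr.
have lnb (n : nat) : ln n.+1%:R <= 2 * Num.sqrt n.+1%:R :> R.
  have n0 : 0 <= n.+1%:R :> R by [].
  rewrite -{1}(sqr_sqrtr n0) lnXn ?sqrtr_gt0// -[ln _ *+ _]mulr_natl; apply: ler_wpM2l => //.
  apply: le_trans (ln_le_sub1 _) _; rewrite ?sqrtr_gt0//; lra.
(* Chosen so that [K' * (2 * (c * n))] is a quarter of [eta * n], through the bounds of the
   logarithm by a square root and of the square root by [c * n]. *)
pose c := eta / (8 * K').
have c0 : 0 < c by rewrite divr_gt0// mulr_gt0.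
exists (Num.truncn (Num.max (c ^- 2) (4 * K' / eta))).+1 => n nN.
have nb : Num.max (c ^- 2) (4 * K' / eta) <= n%:R :> R.
  apply: ltW; apply: lt_le_trans (truncnS_gt _) _.
  by rewrite ler_nat.
move: nb; rewrite ge_max => /andP[nc nk].
have h1 : 2 * K' <= eta / 2 * n%:R.
  by move: nk; rewrite ler_pdivrMr//; lra.
have s0 : 0 < Num.sqrt n.+1%:R :> R by rewrite sqrtr_gt0.
have h2 : 1 <= c * Num.sqrt n.+1%:R.
  have ci : 0 <= c^-1 by rewrite invr_ge0 ltW.
  rewrite mulrC -ler_pdivrMr// mul1r -(ger0_norm ci).
  by rewrite -sqrtr_sqr ler_sqrt// exprVn (le_trans nc)// ler_nat.
have h3 : Num.sqrt n.+1%:R <= c * n.+1%:R.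
  rewrite -[X in _ <= c * X](sqr_sqrtr (ler0n _ _)) expr2 mulrA.
  by rewrite -[leLHS]mul1r ler_wpM2r// ltW.
have h4 : K' * (1 + ln n.+1%:R) <= K' + K' * (2 * (c * n.+1%:R)).
  rewrite mulrDr mulr1 lerD2l; apply: (ler_wpM2l (ltW K0)).
  by apply: le_trans (lnb n) _; rewrite ler_wpM2l.
have h5 : K' * (2 * (c * n.+1%:R)) = eta / 4 * n.+1%:R.
  have Kc : K' * c = eta / 8.
    by rewrite mulrC /c [8 * _]mulrC invfM mulrA mulrAC divfK// gt_eqF.
  have -> : K' * (2 * (c * n.+1%:R)) = 2 * (K' * c) * n.+1%:R by lra.
  by rewrite Kc; lra.
have h6 : K * (1 + ln n.+1%:R) <= K' * (1 + ln n.+1%:R).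
  apply: ler_wpM2r; first by rewrite addr_ge0// ln_nat_ge0.
  by rewrite /K' (le_trans (ler_norm _))// lerDl.
have h7 : 1 <= n%:R :> R by rewrite ler1n; case: n nN {nc nk h1 s0 h2 h3 h4 h5 h6}.
have h8 : 2 <= 2 * K' by rewrite /K' ler_peMr// lerDr.
move: (ln n.+1%:R) h4 h6 => l h4 h6.
move: h5 h4 h1; rewrite -[n.+1%:R]natr1 => h5 h4 h1.
have h9 : eta <= eta * n%:R by rewrite ler_peMr// ltW.
lra.
Qed.

End continuity.

(** * Labellings with prescribed frequencies *)

Section type_class.
Variables V S : finType.

(** A permutation preserving the colours is determined by its restrictions to the colour classes. *)
Lemma card_colour_stabiliser (F0 : V -> S) :
  (#|[set s : {perm V} | [forall v, F0 (s v) == F0 v]]| <=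
   \prod_x (#|[set v | F0 v == x]|)`!)%N.
Proof.
pose A x := [set v | F0 v == x].
set St := [set s | _].
have nA s x : s \in St -> s \in 'N(A x | 'P)%g.
  rewrite inE => /forallP sF; apply/astabsP => v /=.
  by rewrite !inE /aperm (eqP (sF v)).
pose rho (s : {perm V}) : {ffun S -> {perm V}} := [ffun x => restr_perm (A x) s].
have inj : {in St &, injective rho}.
  move=> s t sS tS /ffunP rst; apply/permP => v.
  have := rst (F0 v); rewrite !ffunE => /permP/(_ v).
  by rewrite !restr_permE ?nA// inE.
rewrite -(card_in_imset inj).
have -> : (\prod_x (#|[set v | F0 v == x]|)`! = #|family (fun x => mem (Sym (A x)))|)%N.
  by rewrite card_family foldrE big_map -big_enum/=; apply: eq_bigr => x _; rewrite card_Sym.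
apply: subset_leq_card; apply/fintype.subsetP => _ /imsetP[s sS ->].
apply/familyP => x; rewrite /rho ffunE; suff : restr_perm (A x) s \in Sym (A x) by [].
by rewrite inE restr_perm_on.
Qed.

Definition type_class (ns : S -> nat) : {set {ffun V -> S}} :=
  [set F : {ffun V -> S} | [forall x, #|[set v | F v == x]| == ns x]].

Lemma type_class_ne (s0 : S) ns : (\sum_s ns s = #|V|)%N -> exists F, F \in type_class ns.
Proof.
move=> nsV; pose L := flatten [seq nseq (ns s) s | s <- enum S].
have sL : size L = #|V|.
  rewrite size_flatten /shape -map_comp sumnE big_map -nsV -[RHS]big_enum/=.
  by apply: eq_bigr => s _; rewrite /= size_nseq.
exists [ffun v => nth s0 L (enum_rank v)]; rewrite inE; apply/forallP => x.
have -> : [set v | [ffun v => nth s0 L (enum_rank v)] v == x] =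
    enum_rank @^-1: [set i : 'I_#|V| | nth s0 L i == x].
  by apply/setP => v; rewrite !inE ffunE.
rewrite on_card_preimset; last by exists enum_val => i _; rewrite ?enum_rankK ?enum_valK.
have <- : count_mem x L = ns x.
  rewrite /L count_flatten -map_comp sumnE big_map big_enum/= (bigD1 x)//=.
  rewrite count_nseq/= eqxx mul1n big1 ?addn0// => s sx.
  by rewrite count_nseq/= (negbTE sx).
rewrite -sum1_count (big_nth s0) big_mkord sL -sum1_card; apply/eqP.
by apply: eq_bigl => i; rewrite inE.
Qed.

(** The lower half of the multinomial formula: the fibres of the map sending a permutation [s] to
    [F0 \o s] are translates of the stabiliser of [F0]. *)
Lemma card_type_class ns : (\sum_s ns s = #|V|)%N ->
  ((#|V|)`! <= #|type_class ns| * \prod_s (ns s)`!)%N.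
Proof.
move=> nsV; have [s0 _|S0] := pickP (xpredT : pred S); last first.
  have V0 : #|V| = 0%N by rewrite -nsV big_pred0.
  rewrite V0 fact0 [X in (_ * X)%N]big_pred0// muln1; apply/card_gt0P.
  have e (v : V) : False.
    by have := max_card (pred1 v); rewrite V0 card1.
  exists [ffun v => False_rect S (e v)]; rewrite inE; apply/forallP => s.
  by have := S0 s.
have [F0 F0ns] := type_class_ne s0 nsV.
have := F0ns; rewrite inE => /forallP F0E.
pose Phi (s : {perm V}) : {ffun V -> S} := [ffun v => F0 (s v)].
have cP : #|perm_on [set: V]| = (#|V|)`! by rewrite card_perm cardsT.
rewrite -cP -[X in (X <= _)%N]sum1_card (partition_big Phi (mem (type_class ns))) /=; last first.
  move=> s _; rewrite inE; apply/forallP => x; rewrite -(eqP (F0E x)).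
  have -> : [set v | Phi s v == x] = s @^-1: [set v | F0 v == x].
    by apply/setP => v; rewrite !inE ffunE.
  by rewrite card_preimset//; exact: perm_inj.
rewrite -sum_nat_const; apply: leq_sum => F _; rewrite sum1_card.
have [s0' /andP[_ /eqP F0s]|e] := pickP [pred s | (s \in perm_on [set: V]) && (Phi s == F)];
  last first.
  by rewrite (eq_card0 e).
apply: leq_trans (_ : #|[set s : {perm V} | [forall v, F0 (s v) == F0 v]]| <= _)%N; last first.
  apply: leq_trans (card_colour_stabiliser F0) _; apply: leq_prod => x _.
  by rewrite (eqP (F0E x)).
have inj : injective (fun s : {perm V} => s0'^-1 * s)%g by exact: mulgI.
rewrite -(card_imset _ inj); apply: subset_leq_card.
apply/fintype.subsetP => _ /imsetP[s /andP[_ /eqP Fs] ->]; rewrite inE; apply/forallP => v.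
rewrite permM; have /ffunP/(_ (s0'^-1 v)%g) : Phi s = Phi s0' by rewrite Fs F0s.
by rewrite !ffunE permKV => ->.
Qed.

(** Perform [K] successive updates, each a choice of a vertex and of its new value or no change at
    all; the latter is the [+ 1]. *)
Lemma card_near (G : V -> S) K :
  (#|[set F : {ffun V -> S} | #|[set v | F v != G v]| <= K]| <= (#|V| * #|S|).+1 ^ K)%N.
Proof.
elim: K => [|K IH].
  rewrite expn0 -(card1 [ffun v => G v]); apply: subset_leq_card.
  apply/fintype.subsetP => F; rewrite !inE leqn0 cards_eq0 => /eqP F0.
  apply/eqP/ffunP => v; rewrite ffunE; apply/eqP.
  by have /setP/(_ v) := F0; rewrite !inE => /negbFE.
pose upd (oF : option (V * S) * {ffun V -> S}) : {ffun V -> S} :=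
  if oF.1 is Some vs then [ffun w => if w == vs.1 then vs.2 else oF.2 w] else oF.2.
rewrite expnS.
apply: leq_trans (leq_mul (leqnn _) IH).
have -> : ((#|V| * #|S|).+1 = #|[set: option (V * S)]|)%N.
  by rewrite cardsT card_option card_prod.
rewrite -cardsX.
apply: leq_trans (leq_imset_card upd _); apply: subset_leq_card.
apply/fintype.subsetP => F; rewrite inE => FK; apply/imsetP.
have [le|gt] := leqP #|[set v | F v != G v]| K.
  by exists (None, F) => //; rewrite !inE.
have /card_gt0P[v] : (0 < #|[set v | F v != G v]|)%N by apply: leq_ltn_trans gt.
rewrite inE => Fv.
exists (Some (v, F v), [ffun w => if w == v then G v else F w]); last first.
  by apply/ffunP => w; rewrite /upd !ffunE /=; case: eqVneq => [->|].
rewrite !inE/= -ltnS (leq_trans _ FK)// [X in (_ < X)%N](cardsD1 v) inE Fv add1n ltnS.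
apply: subset_leq_card; apply/fintype.subsetP => w; rewrite !inE ffunE.
by case: (eqVneq w v) => [->|_] /=; rewrite ?eqxx.
Qed.

End type_class.

(** * Matchings for approximately balanced labels *)

Section glue_matchings.
Variable H : finType.
Definition matchings := [pred m : {perm H} | pmatch [set: H] m].
Implicit Types (A : {set H}) (m : {perm H}).

Lemma pmatch_mul A m m1 : pmatch A m -> pmatch (~: A) m1 ->
  pmatch [set: H] (m * m1)%g /\ forall h, h \in A -> (m * m1)%g h = m h.
Proof.
move=> P P1; have [mK mF] := pmatchP _ _ P; have [m1K m1F] := pmatchP _ _ P1.
have mA h : h \in A -> (m * m1)%g h = m h.
  by move=> hA; rewrite permM; apply/eqP; rewrite m1F inE negbK (pmatch_mem _ P).
have mC h : h \notin A -> (m * m1)%g h = m1 h.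
  by move=> hA; rewrite permM; congr (m1 _); apply/eqP; rewrite mF.
split=> //; apply/pmatchP; split=> h; have [hA|hA] := boolP (h \in A).
- by rewrite (mA h)// mA ?(pmatch_mem _ P).
- have mh : m1 h \notin A by have := pmatch_mem h P1; rewrite !inE => ->.
  by rewrite (mC h)// mC.
- by rewrite mA// mF hA inE.
- by rewrite mC// m1F !inE hA.
Qed.

Lemma pmatch_D2 A m h : pmatch A m -> h \in A ->
  pmatch (A :\ h :\ m h) (tperm h (m h) * m)%g.
Proof.
move=> P hA; rewrite -(pmatch_tpermM _ hA (pmatch_neq P hA)).
by rewrite mulgA tperm2 mul1g P eqxx.
Qed.

Lemma pmatch_even A m : pmatch A m -> ~~ odd #|A|.
Proof.
have [N] := ubnP #|A|; elim: N A m => // N IH A m AN P.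
have [->|[h hA]] := set_0Vmem A; first by rewrite cards0.
have mA := pmatch_neq P hA.
have E : #|A| = #|A :\ h :\ m h|.+2 by rewrite (cardsD1 h) hA (cardsD1 (m h)) mA.
rewrite E /= negbK; apply: IH (pmatch_D2 P hA).
by rewrite E in AN; lia.
Qed.

Lemma pmatch_ex A : ~~ odd #|A| -> exists m, pmatch A m.
Proof.
have [N] := ubnP #|A|; elim: N A => // N IH A AN eA.
have [->|[h hA]] := set_0Vmem A; first by exists 1%g; rewrite pmatch0.
have [A0|[k kA]] := set_0Vmem (A :\ h).
  by move: eA; rewrite (cardsD1 h) hA A0 cards0.
have E : #|A| = #|A :\ h :\ k|.+2 by rewrite (cardsD1 h) hA (cardsD1 k) kA.
have [||m P] := IH (A :\ h :\ k).
- by rewrite E in AN; lia.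
- by move: eA; rewrite E /= negbK.
exists (tperm h k * m)%g; have := pmatch_tpermM m hA kA.
by rewrite P => /andP[].
Qed.

Lemma card_index_lt (X : {set H}) q : (q <= #|X|)%N ->
  #|[set h in X | (index h (enum X) < q)%N]| = q.
Proof.
move=> qX; have sz : size (take q (enum X)) = q by rewrite size_take_min -cardE (minn_idPl qX).
rewrite -[RHS]sz -(card_uniqP (take_uniq q (enum_uniq X))).
apply: eq_card => h; rewrite !inE; have [hX|hX] := boolP (h \in X).
  by rewrite in_take// mem_enum.
by apply/esym; apply: contraNF hX => /mem_take; rewrite mem_enum.
Qed.

Variables (B : finType) (star : B -> B) (lb : H -> B).
Hypothesis starK : involutive star.
Let Nb := cnt lb [set: H].

(** How much of the class [b] can be matched consistently: parity may cost one element of a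
    self-paired class, and two exchanged classes are cut to the smaller size. *)
Definition qb b : nat :=
  if star b == b then (Nb b - odd (Nb b))%N else minn (Nb b) (Nb (star b)).

Lemma qb_le b : (qb b <= Nb b)%N.
Proof. by rewrite /qb; case: ifP => _; rewrite ?leq_subr ?geq_minl. Qed.

Definition core : {set H} :=
  [set h | (index h (enum [set h' | lb h' == lb h]) < qb (lb h))%N].

Lemma cnt_core b : cnt lb core b = qb b.
Proof.
have NbE : Nb b = #|[set h | lb h == b]| by apply: eq_card => h; rewrite !inE.
rewrite -(@card_index_lt [set h | lb h == b] (qb b)) -?NbE ?qb_le//.
apply: eq_card => h; rewrite !inE andbC; case: eqVneq => //= hb.
by rewrite hb.
Qed.

Lemma core_balanced : balanced star lb core.
Proof.
move=> b; rewrite !cnt_core /qb; split; last first.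
  by move=> ->; rewrite eqxx oddB ?oddb ?addbb//; case: (Nb b) => // n; case: odd.
rewrite starK [b == star b]eq_sym; case: eqP => [->//|_].
by rewrite minnC.
Qed.

Lemma card_coreC : #|~: core| = (\sum_b (Nb b - qb b))%N.
Proof.
rewrite -sum1_card (partition_big lb xpredT)//=; apply: eq_bigr => b _.
rewrite -cnt_core /Nb /cnt.
rewrite -(cardsID core [set h in [set: H] | lb h == b]).
rewrite (_ : _ :&: core = [set h in core | lb h == b]); last first.
  by apply/setP => h; rewrite !inE /= andbC.
by rewrite addKn -[RHS]sum1_card; apply: eq_bigl => h; rewrite !inE.
Qed.

Definition good_matchings K : {set {perm H}} :=
  [set m in matchings | (#|[set h | lb (m h) != star (lb h)]| <= K)%N].

(** Match the core consistently and the rest by one fixed matching [m1]. Multiplication by [m1] is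
    injective, and only half-edges outside the core can violate consistency. *)
Lemma card_good_matchings K : ~~ odd #|H| -> (\sum_b (Nb b - qb b) <= K)%N ->
  (\prod_b (qb b)`! <= #|good_matchings K| ^ 2 * (\prod_b (qb b).+1) ^ 2)%N.
Proof.
move=> oH qK; have := num_consistent_lower starK core_balanced.
under eq_bigr do rewrite cnt_core.
under [X in (_ <= _ * X ^ 2)%N -> _]eq_bigr do rewrite cnt_core.
set P := (\prod_b _)%N; set Q := (\prod_b _.+1)%N => le.
apply: leq_trans le _; rewrite leq_mul2r leq_sqr; apply/orP; right.
rewrite /num_consistent; have [->//|] := posnP #|consistent star lb core|.
move=> /card_gt0P[m /andP[P0 _]].
have [|m1 P1] := @pmatch_ex (~: core).
  by move: oH; rewrite -(cardsC core) oddD (negbTE (pmatch_even P0)).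
have inj : injective (fun m : {perm H} => m * m1)%g by exact: mulIg.
rewrite -(card_imset _ inj); apply: subset_leq_card.
apply/fintype.subsetP => _ /imsetP[m' /andP[Pm' /forall_inP cm'] ->].
have [PP mE] := pmatch_mul Pm' P1.
rewrite !inE; apply/andP; split; first exact: PP.
apply: leq_trans qK; rewrite -card_coreC; apply: subset_leq_card.
apply/fintype.subsetP => h; rewrite !inE; apply: contraNN => hc.
by rewrite mE ?inE// cm' ?inE.
Qed.

End glue_matchings.

(** * Planted labellings and the matchings consistent with them *)

Section lower_bound.
Variables (R : realType) (S B : finType) (d : nat) (star : B -> B).
Variables (L : S -> 'I_d -> B) (nu : S -> R) (th : B -> R) (s0 : S).
Hypothesis starK : involutive star.
Hypothesis d0 : (0 < d)%N.
Hypothesis nu0 : forall s, 0 <= nu s.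
Hypothesis nu1 : \sum_s nu s = 1.
Hypothesis thE : forall b i, \sum_(s | L s i == b) nu s = th b.
Hypothesis th_star : forall b, th (star b) = th b.

(** Round down everywhere except at [s0], which receives what is missing. *)
Lemma rounding n : exists ns : S -> nat, (\sum_s ns s = n)%N /\
  forall s, `|(ns s)%:R - n%:R * nu s| <= #|S|%:R.
Proof.
pose tr s := Num.truncn (n%:R * nu s).
have trP s : (tr s)%:R <= n%:R * nu s < (tr s).+1%:R.
  by apply: truncn_itv; rewrite mulr_ge0.
pose rest := (\sum_(s | s != s0) tr s)%N.
have nE : \sum_s n%:R * nu s = n%:R by rewrite -mulr_sumr nu1 mulr1.
have restn : (rest <= n)%N.
  rewrite -(ler_nat R) /rest natr_sum -nE [leRHS](bigD1 s0)//=.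
  rewrite -[leLHS]add0r; apply: lerD; first by rewrite mulr_ge0.
  by apply: ler_sum => s _; case/andP: (trP s).
exists (fun s => if s == s0 then n - rest else tr s)%N; split.
  rewrite (bigD1 s0)//= eqxx (eq_bigr tr) ?subnK// => s /negbTE ->.
  by [].
have S1 : 1 <= #|S|%:R :> R by rewrite ler1n; apply/card_gt0P; exists s0.
move=> s; case: eqVneq => [->|_]; last first.
  by have := trP s; rewrite -natr1 ler_norml => /andP[? ?]; apply/andP; split; lra.
rewrite natrB// /rest natr_sum.
have -> : n%:R - \sum_(s | s != s0) (tr s)%:R - n%:R * nu s0 =
    \sum_(s | s != s0) (n%:R * nu s - (tr s)%:R).
  by rewrite sumrB; have := nE; rewrite (bigD1 s0)//=; lra.
rewrite ger0_norm; last by apply: sumr_ge0 => s' _; rewrite subr_ge0; case/andP: (trP s').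
apply: (@le_trans _ _ (\sum_(s : S) 1)); last by rewrite sumr_const.
rewrite [leRHS](bigID (fun s => s != s0))/= -[leLHS]addr0; apply: lerD.
  by apply: ler_sum => s' _; have := trP s'; rewrite -natr1 => /andP[? ?]; lra.
by apply: sumr_ge0.
Qed.

Variable V : finType.
Local Notation H := (V * 'I_d)%type.
Local Notation n := #|V|.
Local Notation N := #|{: H}|.

Definition lbl (F : V -> S) (h : H) : B := L (F h.1) h.2.

Definition good_pairs ns K : {set {perm H} * {ffun V -> S}} :=
  [set mF : {perm H} * {ffun V -> S} | (mF.2 \in type_class V ns) &&
     (mF.1 \in good_matchings star (lbl mF.2) K)].

Variable ns : S -> nat.
Hypothesis ns_sum : (\sum_s ns s = n)%N.
Hypothesis ns_nu : forall s, `|(ns s)%:R - n%:R * nu s| <= #|S|%:R.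

Let NE : N = (n * d)%N. Proof. by rewrite card_prod card_ord. Qed.

(** Error in the size of one class of half-edges: [d] directions and [#|S|] types, each off by at
    most [#|S|]. *)
Let K2 : nat := (d * #|S| ^ 2)%N.

Section one_coloring.
Variable F : {ffun V -> S}.
Hypothesis Fns : F \in type_class V ns.
Local Notation Nb := (cnt (lbl F) [set: H]).
Local Notation q := (qb star (lbl F)).

Lemma cnt_lbl b : (Nb b = \sum_(i : 'I_d) \sum_(s | L s i == b) ns s)%N.
Proof.
move: Fns; rewrite inE => /forallP Fn.
rewrite /cnt -sum1_card (partition_big (fun h : H => h.2) xpredT)//=; apply: eq_bigr => i _.
rewrite (partition_big (fun h : H => F h.1) (fun s => L s i == b)) /=; last first.
  by move=> h; rewrite !inE /lbl => /andP[/eqP <- /eqP ->].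
apply: eq_bigr => s Lsi; rewrite -(eqP (Fn s)).
rewrite (reindex_onto (fun v => (v, i)) (fun h : H => h.1)) /=; last first.
  by move=> [v j] /andP[/andP[_ /eqP /= ->]].
rewrite -sum1_card; apply: eq_bigl => v; rewrite !inE /lbl /= !eqxx !andbT.
by case: (F v =P s) => [->|]; rewrite ?andbF// Lsi.
Qed.

Lemma cnt_lbl_th b : `|(Nb b)%:R - N%:R * th b| <= K2%:R :> R.
Proof.
rewrite cnt_lbl NE natrM natr_sum.
have -> : n%:R * d%:R * th b = \sum_(i : 'I_d) \sum_(s | L s i == b) n%:R * nu s.
  under eq_bigr do rewrite -mulr_sumr thE.
  by rewrite sumr_const card_ord -[RHS]mulr_natl; lra.
rewrite -sumrB; apply: le_trans (ler_norm_sum _ _ _) _.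
apply: (@le_trans _ _ (\sum_(i : 'I_d) (#|S| ^ 2)%N%:R)); last first.
  by rewrite sumr_const card_ord -[leLHS]mulr_natl /K2 natrM.
apply: ler_sum => i _; rewrite natr_sum -sumrB; apply: le_trans (ler_norm_sum _ _ _) _.
apply: (@le_trans _ _ (\sum_(s : S) #|S|%:R)); last first.
  by rewrite sumr_const -[leLHS]mulr_natl -natrM mulnn.
rewrite big_mkcond; apply: ler_sum => s _; by case: ifP.
Qed.

Lemma qb_th b : `|(q b)%:R - N%:R * th b| <= K2.+1%:R :> R.
Proof.
have h1 := cnt_lbl_th b; have h2 := cnt_lbl_th (star b); rewrite th_star in h2.
rewrite /qb -[K2.+1%:R]natr1; case: eqP => _; last first.
  by rewrite /minn; case: ifP => _; [apply: le_trans h1 _|apply: le_trans h2 _]; rewrite lerDl.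
have le : (nat_of_bool (odd (Nb b)) <= Nb b)%N by case: (Nb b) => // k; case: odd.
rewrite natrB//; have : (odd (Nb b))%:R <= 1 :> R by case: odd; rewrite ?ler01.
move=> o1; rewrite addrAC; apply: le_trans (ler_normB _ _) _.
by apply: lerD; [exact: h1|rewrite ger0_norm].
Qed.

Lemma sum_Nb : (\sum_b Nb b = N)%N.
Proof.
rewrite -cardsT -[RHS]sum1_card (partition_big (lbl F) xpredT)//=; apply: eq_bigr => b _.
by rewrite /cnt -sum1_card; apply: eq_bigl => h; rewrite !inE.
Qed.

(** Bounds the number of half-edges outside the core, uniformly in the number of vertices. *)
Let K1 : nat := (#|B| * (2 * K2).+1)%N.

Lemma sum_defect : (\sum_b (Nb b - q b) <= K1)%N.
Proof.
apply: (@leq_trans (\sum_(b : B) (2 * K2).+1)); last by rewrite sum_nat_const.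
apply: leq_sum => b _; rewrite -(ler_nat R) natrB ?qb_le//.
have -> : (Nb b)%:R - (q b)%:R = ((Nb b)%:R - N%:R * th b) - ((q b)%:R - N%:R * th b) :> R.
  by rewrite opprB addrA subrK.
apply: le_trans (ler_norm _) _; apply: le_trans (ler_normB _ _) _.
by apply: (le_trans (lerD (cnt_lbl_th b) (qb_th b))); rewrite -natrD ler_nat; lia.
Qed.

Lemma sum_qb :
  N%:R - K1%:R <= \sum_b (q b)%:R :> R /\ \sum_b (q b)%:R <= N%:R :> R.
Proof.
rewrite -natr_sum ler_nat; split.
  rewrite lerBlDr -natrD ler_nat -sum_Nb -leq_subLR.
  by apply: leq_trans sum_defect; rewrite -sumnB// => b _; exact: qb_le.
by rewrite -sum_Nb leq_sum// => b _; exact: qb_le.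
Qed.

Let l : R := ln N.+1%:R.

Hypothesis oN : ~~ odd N.
Hypothesis n_gt0 : (0 < n)%N.

(** Squares of both counts are compared to factorials, of the class sizes and of [N]. The class
    sizes add up to [N] within [K1], so the terms in [N ln N] cancel and half of the negative
    entropy of the frequencies remains. *)
Lemma ln_good_matchings :
  (0 < #|good_matchings star (lbl F) K1|)%N /\
  N%:R / 2 * \sum_b xlnx ((q b)%:R / N%:R) - (K1%:R + #|B|%:R + 1) * (1 + l) <=
  ln (#|good_matchings star (lbl F) K1|%:R) - ln (#|matchings H|%:R) :> R.
Proof.
have := card_good_matchings starK oN sum_defect.
set g := #|good_matchings _ _ _|; set P := (\prod_b (q b)`!)%N; set Q := (\prod_b _.+1)%N => le.
have P0 : (0 < P)%N by apply: prodn_gt0 => b; exact: fact_gt0.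
have Q0 : (0 < Q)%N by apply: prodn_gt0.
have g0 : (0 < g)%N by move: (leq_trans P0 le); rewrite muln_gt0 expn_gt0 => /andP[/orP[]].
split=> //.
have sqln (k : nat) : (0 < k)%N -> ln ((k ^ 2)%N%:R) = 2 * ln (k%:R) :> R.
  by move=> k0; rewrite natrX lnXn ?ltr0n// mulr_natl.
have h1 : ln (P%:R : R) <= 2 * ln g%:R + 2 * ln Q%:R.
  rewrite -!sqln// -lnM ?posrE ?ltr0n ?expn_gt0 ?g0 ?Q0// -natrM.
  by rewrite ler_ln ?posrE ?ltr0n ?muln_gt0 ?expn_gt0 ?g0 ?Q0// ler_nat.
have lnprod (f : B -> nat) : (forall b, 0 < f b)%N ->
    ln ((\prod_b f b)%N%:R : R) = \sum_b ln (f b)%:R.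
  move=> f0; apply: expR_inj; rewrite expR_sum lnK ?posrE ?ltr0n ?prodn_gt0// natr_prod.
  by apply: eq_bigr => b _; rewrite lnK// posrE ltr0n.
have l0 : 0 <= l by exact: ln_nat_ge0.
have qN b : (q b <= N)%N.
  by apply: leq_trans (qb_le _ _ _) _; rewrite -sum_Nb (bigD1 b)//= leq_addr.
have h2 : ln (Q%:R : R) <= #|B|%:R * l.
  rewrite lnprod// mulr_natl -sumr_const; apply: ler_sum => b _.
  by rewrite ler_ln ?posrE ?ltr0n// ler_nat ltnS.
have N0 : (0 < N)%N by rewrite NE muln_gt0 n_gt0.
have N0R : 0 < N%:R :> R by rewrite ltr0n.
have h3 : N%:R * \sum_b xlnx ((q b)%:R / N%:R) + (\sum_b (q b)%:R) * (ln N%:R - 1) <= ln (P%:R : R).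
  rewrite lnprod => [|b]; last exact: fact_gt0.
  rewrite mulr_sumr mulr_suml -big_split/=; apply: ler_sum => b _.
  apply: le_trans (ln_fact_lower R (q b)); rewrite /xlnx.
  have [->|q0] := posnP (q b); first by rewrite !(mul0r,mulr0) addr0 subr0.
  rewrite mulrA [N%:R * _]mulrC divfK ?gt_eqF// ln_div ?posrE ?ltr0n//; lra.
have h4 : 2 * ln (#|matchings H|%:R : R) <= N%:R * ln N%:R - N%:R + 1 + l.
  have PM0 : (0 < #|matchings H|)%N.
    by have [|m mP] := @pmatch_ex H [set: H]; [rewrite cardsT|apply/card_gt0P; exists m].
  apply: le_trans (ln_fact_upper R N);
    rewrite -sqln// ler_ln ?posrE ?ltr0n ?expn_gt0 ?PM0 ?fact_gt0//.
  rewrite ler_nat.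
  have := @num_consistent_upper H unit id (fun=> tt) (fun=> erefl) [set: H].
  rewrite (bigD1 tt)//= big1 ?muln1 => [|[]//].
  have -> : cnt (fun=> tt) [set: H] tt = N.
    by rewrite /cnt -cardsT; apply: eq_card => h; rewrite !inE.
  apply: leq_trans; rewrite leq_sqr; apply: subset_leq_card.
  by apply/fintype.subsetP => m mP; apply/andP; split=> //; apply/forall_inP.
have [h5 h6] := sum_qb.
have lN : 0 <= ln N%:R :> R by apply: ln_ge0; rewrite ler1n.
have lNl : ln N%:R <= l by rewrite ler_ln ?posrE ?ltr0n// ler_nat.
have h7 : (N%:R - \sum_b (q b)%:R) * ln N%:R <= K1%:R * l.
  apply: (@le_trans _ _ (K1%:R * ln N%:R)); first by apply: ler_wpM2r => //; lra.
  by apply: ler_wpM2l.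
have K10 : 0 <= K1%:R * l by rewrite mulr_ge0.
have B0 : 0 <= #|B|%:R * l by rewrite mulr_ge0.
have K11 : 0 <= K1%:R :> R by [].
have B1 : 0 <= #|B|%:R :> R by [].
clear sqln lnprod qN.
move: (\sum_b xlnx _) (\sum_b _) (ln (P%:R)) (ln (Q%:R)) (ln g%:R) (ln #|matchings H|%:R) h1 h2 h3
  h4 h5 h6 h7.
move: (ln N%:R) lN lNl => lnN lN lNl X Qs a1 a2 a3 a4 h1 h2 h3 h4 h5 h6 h7.
lra.
Qed.

End one_coloring.

Let K1 : nat := (#|B| * (2 * K2).+1)%N.

Lemma ln_type_class : (0 < n)%N -> (0 < #|type_class V ns|)%N /\
  - (n%:R * \sum_s xlnx ((ns s)%:R / n%:R)) - #|S|%:R * (1 + ln n.+1%:R) <=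
  ln (#|type_class V ns|%:R) :> R.
Proof.
move=> n0; have [F0 F0ns] := type_class_ne s0 ns_sum.
have t0 : (0 < #|type_class V ns|)%N by apply/card_gt0P; exists F0.
split=> //; have le := card_type_class ns_sum.
have P0 : (0 < \prod_s (ns s)`!)%N by apply: prodn_gt0 => b; exact: fact_gt0.
have h1 : ln (n`!%:R) <= ln (#|type_class V ns|%:R) + ln ((\prod_s (ns s)`!)%N%:R) :> R.
  rewrite -lnM ?posrE ?ltr0n// -natrM ler_ln ?posrE ?ltr0n ?muln_gt0 ?t0 ?fact_gt0//.
  by rewrite ler_nat.
have n0R : 0 < n%:R :> R by rewrite ltr0n.
have h2 : ln ((\prod_s (ns s)`!)%N%:R) <=
  n%:R * (\sum_s xlnx ((ns s)%:R / n%:R)) + n%:R * (ln n%:R - 1) + #|S|%:R * (1 + ln n.+1%:R) :> R.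
  have -> : ln ((\prod_s (ns s)`!)%N%:R) = \sum_s ln ((ns s)`!%:R) :> R.
    apply: expR_inj; rewrite expR_sum lnK ?posrE ?ltr0n// natr_prod.
    by apply: eq_bigr => b _; rewrite lnK// posrE ltr0n fact_gt0.
  have -> : n%:R * (ln n%:R - 1) = \sum_s (ns s)%:R * (ln n%:R - 1) :> R.
    by rewrite -mulr_suml -natr_sum ns_sum.
  have -> : #|S|%:R * (1 + ln n.+1%:R) = \sum_(s : S) (1 + ln n.+1%:R) :> R.
    by rewrite sumr_const mulr_natl.
  rewrite mulr_sumr -!big_split/=; apply: ler_sum => s _.
  apply: le_trans (ln_fact_upper R (ns s)) _.
  have hl : ln (ns s).+1%:R <= ln n.+1%:R :> R.
    by rewrite ler_ln ?posrE ?ltr0n// ler_nat ltnS -ns_sum (bigD1 s)//= leq_addr.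
  rewrite /xlnx; have [q0|q0] := posnP (ns s).
    by move: hl; rewrite q0 !(mul0r,mulr0) !add0r; lra.
  rewrite mulrA [n%:R * _]mulrC divfK ?gt_eqF// ln_div ?posrE ?ltr0n//; lra.
have h3 := ln_fact_lower R n; rewrite /xlnx in h3.
have h4 : n%:R * (ln n%:R - 1) = n%:R * ln n%:R - n%:R :> R by rewrite mulrBr mulr1.
rewrite {}h4 in h2; move: h1 h2 h3.
move: (n%:R * \sum_s _) (#|S|%:R * _) (n%:R * ln n%:R) (ln (\prod_s _)%:R) (ln n`!%:R).
move: (ln (#|type_class _ _|)%:R) (n%:R) => c g a b e f k h1 h2 h3.
lra.
Qed.

End lower_bound.

Section lower_pairs.
Variables (R : realType) (S B : finType) (d : nat) (star : B -> B).
Variables (L : S -> 'I_d -> B) (nu : S -> R) (th : B -> R) (s0 : S).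
Hypothesis starK : involutive star.
Hypothesis d0 : (0 < d)%N.
Hypothesis nu0 : forall s, 0 <= nu s.
Hypothesis nu1 : \sum_s nu s = 1.
Hypothesis thE : forall b i, \sum_(s | L s i == b) nu s = th b.
Hypothesis th_star : forall b, th (star b) = th b.

(** The entropy of [nu] counts the labellings, and [d / 2] times that of [th] is the cost for a
    matching to respect one of them. The number [K] of tolerated violations does not depend on
    [V]. *)
Theorem lower_pairs (eta : R) : 0 < eta -> exists K n0 : nat, forall V : finType,
  (n0 <= #|V|)%N -> ~~ odd #|{: V * 'I_d}| ->
  exists ns : S -> nat, [/\ (\sum_s ns s = #|V|)%N,
    forall s, `|(ns s)%:R - #|V|%:R * nu s| <= #|S|%:R &
    #|matchings (V * 'I_d)%type|%:R *
      expR (#|V|%:R * (entropy nu - d%:R / 2 * entropy th - eta)) <=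
    #|good_pairs star L V ns K|%:R].
Proof.
move=> eta0; set K2 := (d * #|S| ^ 2)%N; set K1 := (#|B| * (2 * K2).+1)%N.
have th0 b : 0 <= th b.
  by rewrite -(thE b (Ordinal d0)); apply: sumr_ge0.
have d0R : 0 < d%:R :> R by rewrite ltr0n.
have e1 : 0 < eta / 4 by rewrite divr_gt0.
have e2 : 0 < eta / (2 * d%:R) by rewrite divr_gt0// mulr_gt0.
have [dl1 dl10 dl1P] := xlnx_cont_fin nu0 e1.
have [dl2 dl20 dl2P] := xlnx_cont_fin th0 e2.
pose C : R := #|S|%:R + (K1%:R + #|B|%:R + 1).
have [n1 n1P] := ln_little_o C e2.
exists K1, (maxn n1 (maxn 1 (maxn (Num.truncn (#|S|%:R / dl1)).+1 (Num.truncn (K2.+1%:R /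
  dl2)).+1))).
move=> V; rewrite !geq_max => /and4P[nn1 n0 nS nK] oN.
have [ns [nsn nsnu]] := rounding s0 nu0 nu1 #|V|.
exists ns; split=> //.
have n0R : 0 < #|V|%:R :> R by rewrite ltr0n.
have NE : #|{: V * 'I_d}|%:R = #|V|%:R * d%:R :> R by rewrite card_prod card_ord natrM.
have N0R : 0 < #|{: V * 'I_d}|%:R :> R by rewrite NE mulr_gt0.
have nN : (#|V| <= #|{: V * 'I_d}|)%N by rewrite card_prod card_ord leq_pmulr.
have [t0 ht] := ln_type_class R s0 nsn n0.
have hns : - entropy nu - eta / 4 <= \sum_s xlnx ((ns s)%:R / #|V|%:R) <= - entropy nu + eta / 4.
  have -> : - entropy nu = \sum_s xlnx (nu s) by rewrite /entropy opprK.
  rewrite -ler_distl; apply: dl1P => s; first by rewrite divr_ge0.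
  have -> : (ns s)%:R / #|V|%:R - nu s = ((ns s)%:R - #|V|%:R * nu s) / #|V|%:R.
    by rewrite mulrBl [#|V|%:R * _]mulrC mulfK// gt_eqF.
  rewrite normrM normfV (ger0_norm (ltW n0R)) ler_pdivrMr// [leRHS]mulrC.
  apply: le_trans (nsnu s) _; rewrite -ler_pdivrMr//.
  by apply: ltW; apply: lt_le_trans (truncnS_gt _) _; rewrite ler_nat.
pose g (F : {ffun V -> S}) := #|good_matchings star (lbl L F) K1|.
have hF F : F \in type_class V ns ->
  ln #|matchings (V * 'I_d)%type|%:R + #|V|%:R * (- (d%:R / 2 * entropy th) - eta / 4) -
    (K1%:R + #|B|%:R + 1) * (1 + ln #|{: V * 'I_d}|.+1%:R) <= ln (g F)%:R /\ (0 < g F)%N.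
  move=> Fns; have [g0 hg] := ln_good_matchings starK d0 thE th_star nsn nsnu Fns oN n0.
  split=> //.
  have : - entropy th - eta / (2 * d%:R) <=
     \sum_b xlnx ((qb star (lbl L F) b)%:R / #|{: V * 'I_d}|%:R) <= - entropy th + eta / (2 * d%:R).
    have -> : - entropy th = \sum_s xlnx (th s) by rewrite /entropy opprK.
    rewrite -ler_distl; apply: dl2P => b; first by rewrite divr_ge0.
    have -> : (qb star (lbl L F) b)%:R / #|{: V * 'I_d}|%:R - th b =
       ((qb star (lbl L F) b)%:R - #|{: V * 'I_d}|%:R * th b) / #|{: V * 'I_d}|%:R.
      by rewrite mulrBl [#|{: V * 'I_d}|%:R * _]mulrC mulfK// gt_eqF.
    rewrite normrM normfV (ger0_norm (ltW N0R)) ler_pdivrMr// [leRHS]mulrC.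
    apply: le_trans (qb_th thE th_star nsnu Fns b) _; rewrite -ler_pdivrMr//.
    by apply: ltW; apply: lt_le_trans (truncnS_gt _) _; rewrite ler_nat (leq_trans nK).
  move=> /andP[h1 _].
  have h2 : #|{: V * 'I_d}|%:R / 2 * (- entropy th - eta / (2 * d%:R)) =
     #|V|%:R * (- (d%:R / 2 * entropy th) - eta / 4).
    rewrite NE; have : d%:R * (eta / (2 * d%:R)) = eta / 2 :> R.
      by rewrite mulrC [2 * _]mulrC invfM mulrA mulrAC divfK// gt_eqF.
    move: (eta / (2 * d%:R)) => u hu.
    have -> : #|V|%:R * d%:R / 2 * (- entropy th - u) = #|V|%:R * (- (d%:R / 2 * entropy th) -
      (d%:R * u) / 2) by lra.
    by rewrite hu; lra.
  have h3 : #|{: V * 'I_d}|%:R / 2 * (- entropy th - eta / (2 * d%:R)) <=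
     #|{: V * 'I_d}|%:R / 2 * \sum_b xlnx ((qb star (lbl L F) b)%:R / #|{: V * 'I_d}|%:R).
    by apply: ler_wpM2l => //; rewrite divr_ge0// ltW.
  rewrite h2 in h3; move: h3 hg; rewrite -/(g F).
  move: (_ / 2 * _) (ln (g F)%:R) (ln #|matchings _|%:R) (#|V|%:R * _) (_ * (1 + _)) =>
    a1 a2 a3 a4 a5.
  lra.
have PM0 : (0 < #|matchings (V * 'I_d)%type|)%N.
  have [|m mP] := @pmatch_ex _ [set: V * 'I_d]; first by rewrite cardsT.
  by apply/card_gt0P; exists m.
have total : (\sum_(F in type_class V ns) g F <= #|good_pairs star L V ns K1|)%N.
  rewrite -[leqRHS]sum1_card (partition_big (fun mF : {perm V * 'I_d} * {ffun V -> S} => mF.2)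
    (mem (type_class V ns)))/=; last by move=> mF; rewrite !inE => /andP[].
  apply: leq_sum => F Fns; rewrite /g -sum1_card.
  rewrite (reindex_onto (fun m => (m, F)) (fun mF : {perm V * 'I_d} * {ffun V -> S} => mF.1)) /=;
    last first.
    by move=> [m F'] /andP[_ /eqP /= ->].
  rewrite leq_eqVlt; apply/orP; left; apply/eqP; apply: eq_bigl => m.
  by rewrite !inE /= !eqxx !andbT; move: Fns; rewrite inE => ->.
apply: (@le_trans _ _ (#|type_class V ns|%:R * expR (ln #|matchings (V * 'I_d)%type|%:R + #|V|%:R *
  (- (d%:R / 2 * entropy th) - eta / 4) -
    (K1%:R + #|B|%:R + 1) * (1 + ln #|{: V * 'I_d}|.+1%:R)))); last first.
  rewrite -(ler_nat R) natr_sum in total; apply: le_trans total.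
  rewrite mulr_natl -sumr_const; apply: ler_sum => F /hF[hg g0].
  by rewrite -[leRHS]lnK ?posrE ?ltr0n// ler_expR.
rewrite -[X in X * _ <= _]lnK ?posrE ?ltr0n// -[X in _ <= X * _]lnK ?posrE ?ltr0n//.
rewrite -!expRD ler_expR.
have hl : C * (1 + ln #|{: V * 'I_d}|.+1%:R) <= eta / 2 * #|V|%:R.
  apply: le_trans (n1P _ (leq_trans nn1 nN)) _; rewrite NE.
  have : d%:R * (eta / (2 * d%:R)) = eta / 2 :> R.
    by rewrite mulrC [2 * _]mulrC invfM mulrA mulrAC divfK// gt_eqF.
  by move: (eta / (2 * d%:R)) => u <-; rewrite [d%:R * u]mulrC -mulrA [d%:R * _]mulrC.
have hl2 : #|S|%:R * (1 + ln #|V|.+1%:R) <= #|S|%:R * (1 + ln #|{: V * 'I_d}|.+1%:R) :> R.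
  apply: ler_wpM2l => //; rewrite lerD2l ler_ln ?posrE ?ltr0n// ler_nat ltnS.
  by [].
case/andP: hns => _ hns; have := ler_wpM2l (ltW n0R) hns; move: hl ht hl2; rewrite /C.
move: (ln #|{: V * 'I_d}|.+1%:R) (ln #|V|.+1%:R) (ln #|type_class V ns|%:R) (ln #|matchings _|%:R)
  (\sum_s xlnx _).
move: (#|V|%:R) (K1%:R) (#|B|%:R) (#|S|%:R) => n k b s l1 l2 l3 l4 X.
lra.
Qed.

End lower_pairs.

Lemma addr_le_mulr1 (K : realFieldType) (u v : K) :
  0 <= u -> 0 <= v -> u + v <= (1 + u) * (1 + v).
Proof. by move=> u0 v0; have := mulr_ge0 u0 v0; lra. Qed.

(** * Lower bound on the number of colourings with good balls *)

Section planted_lower_bound.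
Variables (R : realType) (M : finType) (E : nat) (p : M * M -> R).
Hypothesis pL : edge_law p.
Variable k : nat.
Local Notation ball_type := (ball_type M E k).

Definition ball_count (V : finType) (m : {perm V * 'I_E.+2}) (f : V -> M) (s : ball_type) : nat :=
  #|[set v | ball_at E k (fun x => f (endpoint m v x)) == s]|.

Definition ball_good (V : finType) (delta : R) (m : {perm V * 'I_E.+2}) (f : V -> M) : bool :=
  [forall s, `|(ball_count m f s)%:R / #|V|%:R - ball_weight p s| <= delta].

Lemma card_diff (V T : finType) (F G : V -> T) s :
  (#|[set v | F v == s]| <= #|[set v | G v == s]| + #|[set v | F v != G v]|)%N.
Proof.
apply: leq_trans (leq_card_setU _ _).1; apply: subset_leq_card.
by apply/fintype.subsetP => v; rewrite !inE; case: (eqVneq (F v) (G v)) => [->->|]; rewrite ?orbT.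
Qed.

(** Keeping only the root colour of each label loses little: the label can be read off from the
    matching and the colours except at boundedly many vertices, so fibres of the projection have
    polynomial size. *)
Lemma planted_lower_bound (delta eta : R) : 0 < delta -> 0 < eta -> exists n0 : nat,
  forall V : finType, (n0 <= #|V|)%N -> ~~ odd #|{: V * 'I_E.+2}| ->
    #|matchings (V * 'I_E.+2)%type|%:R * expR (#|V|%:R * (Sigma E.+2 p - eta)) <=
    #|[set mf : {perm V * 'I_E.+2} * {ffun V -> M} |
        (mf.1 \in matchings (V * 'I_E.+2)%type) && ball_good delta mf.1 mf.2]|%:R.
Proof.
move=> delta0 eta0; have eta2 : 0 < eta / 2 by rewrite divr_gt0.
have [c0|M0] := pickP (xpredT : pred M); last first.
  have : \sum_x p x = 0 by apply: big1 => -[a b] _; have := M0 a.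
  by case: pL => _ -> _ /eqP; rewrite oner_eq0.
move=> _; pose s0 : ball_type := (c0, [ffun=> const_branch E k c0]).
have [K [n0 HK]] := lower_pairs s0 (@swapK _) (ltn0Sn E.+1) (fun s => ball_weight_ge0 pL s)
  (sum_ball_weight E pL k) (fun b i => sum_ball_weight_label pL i b) (fun b =>
    edge_weight_swap pL b) eta2.
pose K' := (E.+3 ^ k * K)%N.
pose S := #|ball_type|.
pose C : R := K'%:R * (1 + ln S.+1%:R).
have [n1 n1P] := ln_little_o C eta2.
(* Beyond this size, [K'] misread labels and the rounding error [S] amount to less than [delta] in
   frequency. *)
exists (maxn n0 (maxn n1 (maxn 1 (Num.truncn ((K'%:R + S%:R) / delta)).+1))).
move=> V; rewrite !geq_max => /and4P[nn0 nn1 n_gt0 nd] oN.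
have n0R : 0 < #|V|%:R :> R by rewrite ltr0n.
have [ns [nsn nsnu HT]] := HK V nn0 oN.
rewrite (Sigma_types E pL k) in HT.
set GP := good_pairs _ _ _ _ _ in HT; set GF := [set mf | _].
pose proj (mF : {perm V * 'I_E.+2} * {ffun V -> ball_type}) : {perm V * 'I_E.+2} * {ffun V -> M} :=
  (mF.1, [ffun v => (mF.2 v).1]).
pose bal (mf : {perm V * 'I_E.+2} * {ffun V -> M}) v := ball_at E k (fun x =>
  mf.2 (endpoint mf.1 v x)).
(* Each clashing vertex carries an inconsistent half-edge, and by [ball_types] a label can be wrong
   only near such a vertex. *)
have near mF : mF \in GP -> (#|[set v | mF.2 v != bal (proj mF) v]| <= K')%N.
  rewrite inE => /andP[_]; rewrite inE => /andP[mP viol].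
  apply: (@leq_trans #|neighbourhood mF.1 (clashing mF.2 mF.1) k|).
    apply: subset_leq_card; apply/fintype.subsetP => v; rewrite inE; apply: contraNT => vU.
    apply/eqP; rewrite -[LHS](ball_types vU) /bal /=.
    by apply: congr1; apply/funext => x; rewrite ffunE.
  apply: leq_trans (card_neighbourhood _ _ _) _; rewrite leq_mul2l; apply/orP; right.
  apply: leq_trans viol.
  have inj : {in clashing mF.2 mF.1 &, injective (fun v =>
    (v, odflt ord0 [pick i | ~~ agreeing mF.2 mF.1 (v, i)]))}.
    by move=> v v' _ _ [].
  rewrite -(card_in_imset inj); apply: subset_leq_card.
  apply/fintype.subsetP => _ /imsetP[v vB ->]; rewrite inE.
  move: vB; rewrite inE => /existsP[i0 iB].
  by case: pickP => [i iP|/(_ i0)]; [exact: iP|rewrite iB].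
have projG mF : mF \in GP -> proj mF \in GF.
  move=> mFG; have nr := near _ mFG; move: mFG; rewrite !inE => /andP[Fns /andP[mP _]].
  apply/andP; split; first exact: mP.
  move/forallP in Fns; apply/forallP => s.
  have Fs : #|[set v | mF.2 v == s]| = ns s by apply/eqP.
  have h1 : (ball_count (proj mF).1 (proj mF).2 s <= ns s + K')%N.
    apply: leq_trans (card_diff _ mF.2 s) _; rewrite Fs leq_add2l.
    by apply: leq_trans nr; apply: subset_leq_card; apply/fintype.subsetP => v; rewrite !inE eq_sym.
  have h2 : (ns s <= ball_count (proj mF).1 (proj mF).2 s + K')%N.
    by rewrite -Fs; apply: leq_trans (card_diff _ (bal (proj mF)) s) _; rewrite leq_add2l.
  have -> : (ball_count (proj mF).1 (proj mF).2 s)%:R / #|V|%:R - ball_weight p s =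
      ((ball_count (proj mF).1 (proj mF).2 s)%:R - #|V|%:R * ball_weight p s) / #|V|%:R.
    by rewrite mulrBl [#|V|%:R * _]mulrC mulfK// gt_eqF.
  rewrite normrM normfV (ger0_norm (ltW n0R)) ler_pdivrMr// [leRHS]mulrC.
  apply: (@le_trans _ _ (K'%:R + S%:R)); last first.
    rewrite -ler_pdivrMr//; apply: ltW; apply: lt_le_trans (truncnS_gt _) _.
    by rewrite ler_nat.
  have -> : (ball_count (proj mF).1 (proj mF).2 s)%:R - #|V|%:R * ball_weight p s =
     ((ball_count (proj mF).1 (proj mF).2 s)%:R - (ns s)%:R) + ((ns s)%:R - #|V|%:R * ball_weight p
       s).
    by rewrite addrA subrK.
  apply: le_trans (ler_normD _ _) _; apply: lerD; last exact: nsnu.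
  rewrite ler_distl lerBlDr -!natrD !ler_nat h1 h2.
  by [].
(* Given the projection, the labelling is within [K'] changes of the actual balls. *)
have fib : (#|GP| <= #|GF| * (#|V| * S).+1 ^ K')%N.
  rewrite -sum1_card (partition_big proj (mem GF)) /=; last exact: projG.
  rewrite -[X in (_ <= X)%N]sum_nat_const; apply: leq_sum => mf _; rewrite sum1_card.
  apply: leq_trans (card_near (bal mf) K').
  have inj : {in [pred mF | (mF \in GP) && (proj mF == mf)] &, injective (fun mF => mF.2)}.
    move=> [m F] [m' F'] /andP[_ /eqP e1] /andP[_ /eqP e2] /= FF.
    by move: e2; rewrite -e1 FF => -[->].
  rewrite -(card_in_image inj); apply: subset_leq_card.
  apply/fintype.subsetP => F /fintype.imageP[mF /andP[mFG /eqP mfE] ->].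
  by rewrite inE -mfE near.
have PMp : 0 < #|matchings (V * 'I_E.+2)%type|%:R :> R.
  rewrite ltr0n; have [|m mP] := @pmatch_ex _ [set: V * 'I_E.+2]; first by rewrite cardsT.
  by apply/card_gt0P; exists m.
have hl : ((#|V| * S).+1 ^ K')%N%:R <= expR (eta / 2 * #|V|%:R) :> R.
  apply: (@le_trans _ _ (expR (C * (1 + ln #|V|.+1%:R)))); last by rewrite ler_expR n1P.
  rewrite natrX -[X in X ^+ _]lnK ?posrE ?ltr0n// -expRM_natl ler_expR.
  rewrite /C -[leRHS]mulrA; apply: ler_wpM2l => //.
  apply: (@le_trans _ _ (ln (S.+1%:R) + ln #|V|.+1%:R)).
    rewrite -lnM ?posrE ?ltr0n// ler_ln ?posrE -?natrM ?ltr0n// ler_nat.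
    by rewrite mulnC; nia.
  have a0 : 0 <= ln S.+1%:R :> R by exact: ln_nat_ge0.
  have b0 : 0 <= ln #|V|.+1%:R :> R by exact: ln_nat_ge0.
  have ab : 0 <= ln S.+1%:R * ln #|V|.+1%:R :> R by exact: mulr_ge0.
  exact: addr_le_mulr1.
have hl0 : 0 < ((#|V| * S).+1 ^ K')%N%:R :> R by rewrite ltr0n expn_gt0.
rewrite -(ler_pM2r (expR_gt0 (eta / 2 * #|V|%:R))).
apply: (@le_trans _ _ #|GP|%:R).
  apply: le_trans HT; rewrite -[leLHS]mulrA -expRD ler_pM2l// ler_expR.
  by move: (Sigma _ _) #|V|%:R => u v; lra.
apply: (@le_trans _ _ (#|GF|%:R * ((#|V| * S).+1 ^ K')%N%:R)); first by rewrite -natrM ler_nat.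
by apply: ler_wpM2l.
Qed.

Lemma edge_count_ball (V : finType) (m : {perm V * 'I_E.+2}) (f : V -> M) a b :
  edge_count m f (a, b) =
  (\sum_(i : 'I_E.+2) \sum_(s : ball_type | (s.1 == a) && (branch_root (s.2 i) == b)) ball_count m
    f s)%N.
Proof.
pose bl v := ball_at E k (fun x => f (endpoint m v x)).
have rtb v i : branch_root ((bl v).2 i) = f (m (v, i)).1.
  by rewrite ffunE; case: k => [|k'] /=; rewrite inord_val.
rewrite /edge_count -sum1_card (partition_big (fun h : V * 'I_E.+2 => h.2) xpredT)//=.
apply: eq_bigr => i _.
rewrite (reindex_onto (fun v => (v, i)) (fun h : V * 'I_E.+2 => h.1)) /=; last first.
  by move=> [v j] /andP[_ /eqP /= ->].
rewrite (partition_big bl (fun s : ball_type => (s.1 == a) && (branch_root (s.2 i) == b))) /=;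
  last first.
  by move=> v; rewrite rtb !inE !eqxx !andbT xpair_eqE.
apply: eq_bigr => s /andP[/eqP sa /eqP sb]; rewrite /ball_count -sum1_card.
apply: eq_bigl => v; rewrite !inE !eqxx !andbT xpair_eqE.
case: (eqVneq (bl v) s) => [e|_]; rewrite ?andbF// andbT.
by rewrite -rtb e sb -sa -e !eqxx.
Qed.

Lemma ball_weight_edge i a b : \sum_(s : ball_type | (s.1 == a) && (branch_root (s.2 i) == b))
  ball_weight p s = p (a, b).
Proof.
rewrite big_mkcond sum_Ty (bigD1 a)//= [X in _ + X]big1 ?addr0; last first.
  by move=> c /negbTE ca; apply: big1 => y _; rewrite ca.
pose G (j : 'I_E.+2) (y : branch M E k) := if j == i then (if branch_root y == b then branch_weight
  p a y else 0) else branch_weight p a y.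
transitivity (vertex_marginal p a * \sum_(y : {ffun 'I_E.+2 -> branch M E k}) \prod_j G j (y j)).
  rewrite mulr_sumr; apply: eq_bigr => y _; rewrite eqxx /= /ball_weight /=.
  rewrite [in RHS](bigD1 i)//= /G eqxx; case: ifP => _; last by rewrite mul0r mulr0.
  rewrite (bigD1 i)//=; congr (_ * (_ * _)); apply: eq_bigr => j /negbTE ->.
  by [].
rewrite -(bigA_distr_bigA G) (bigD1 i)//= [X in _ * (_ * X)]big1 ?mulr1; last first.
  move=> j /negbTE ji.
  transitivity (\sum_(y : branch M E k) branch_weight p a y); last exact: sum_branch_weight.
  by apply: eq_bigr => y _; rewrite /G ji.
rewrite -(pi_kernel pL a b); congr (_ * _).
transitivity (\sum_(y : branch M E k) (kernel p a (branch_root y) * (branch_root y == b)%:R) *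
  subtree_weight p y).
  apply: eq_bigr => y _; rewrite /G eqxx /branch_weight; case: ifP => _; rewrite ?mulr1//.
  by rewrite mulr0 mul0r.
case: k G => [|k'] _.
  rewrite (bigD1 b)//= eqxx !mulr1 big1 ?addr0// => c /negbTE cb.
  by rewrite cb mulr0 mul0r.
rewrite sum_Br (bigD1 b)//= [X in _ + X]big1 ?addr0; last first.
  by move=> c /negbTE cb; apply: big1 => y _; rewrite cb mulr0 mul0r.
rewrite eqxx mulr1 -mulr_sumr.
by rewrite (prod_sum_ffun (ka := fun _ => @branch_weight _ _ _ p k' b)) ?mulr1// => j;
  exact: sum_branch_weight.
Qed.

(** Good balls force the edge statistics to be near [p]. This is what makes a pair of good
    colourings an approximate coupling. *)
Lemma ball_good_edge (V : finType) delta (m : {perm V * 'I_E.+2}) (f : V -> M) x :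
  (0 < #|V|)%N -> 0 <= delta -> ball_good delta m f ->
  `|(edge_count m f x)%:R / #|{: V * 'I_E.+2}|%:R - p x| <= #|ball_type|%:R * delta.
Proof.
case: x => a b n0 d0 /forallP good.
have n0R : 0 < #|V|%:R :> R by rewrite ltr0n.
have -> : (edge_count m f (a, b))%:R / #|{: V * 'I_E.+2}|%:R - p (a, b) =
   (\sum_(i : 'I_E.+2) \sum_(s : ball_type | (s.1 == a) && (branch_root (s.2 i) == b))
     ((ball_count m f s)%:R / #|V|%:R - ball_weight p s)) / E.+2%:R.
  under eq_bigr do rewrite sumrB ball_weight_edge -mulr_suml.
  rewrite sumrB sumr_const card_ord -mulr_suml mulrBl edge_count_ball natr_sum.
  under [in RHS]eq_bigr do rewrite -natr_sum.
  congr (_ - _); last by rewrite -[p _ *+ _]mulr_natr mulfK// pnatr_eq0.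
  by rewrite card_prod card_ord natrM invfM mulrA.
rewrite normrM normfV (@ger0_norm _ E.+2%:R)// ler_pdivrMr ?ltr0n//.
apply: le_trans (ler_norm_sum _ _ _) _.
apply: (@le_trans _ _ (\sum_(i : 'I_E.+2) (#|ball_type|%:R * delta))); last first.
  by rewrite sumr_const card_ord mulr_natr.
apply: ler_sum => i _; apply: le_trans (ler_norm_sum _ _ _) _.
apply: (@le_trans _ _ (\sum_(s : ball_type) delta)); last by rewrite sumr_const mulr_natl.
rewrite big_mkcond; by apply: ler_sum => s _; case: ifP.
Qed.

End planted_lower_bound.

(** * Continuity of Sigma and approximate couplings *)

Section coupling_continuity.
Variables (R : realType).

(** For [x <= y], the upper bound combines [ln y <= 0] with [x * ln (y / x) <= y - x]; the lower one
    is the superadditivity [xlnx (y - x) + xlnx x <= xlnx y], from monotonicity of [ln], and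
    [xlnx_small]. *)
Lemma xlnx_modulus (x y : R) : 0 <= x <= 1 -> 0 <= y <= 1 ->
  `|xlnx x - xlnx y| <= `|x - y| + 2 * Num.sqrt `|x - y|.
Proof.
wlog xy : x y / x <= y.
  move=> W; case: (leP x y) => [|/ltW] h hx hy; first exact: W.
  by rewrite distrC [`|x - y|]distrC; apply: W.
move=> /andP[x0 x1] /andP[y0 y1].
have t0 : 0 <= y - x by rewrite subr_ge0.
rewrite distrC [`|x - y|]distrC (ger0_norm t0).
have [e|xyn] := eqVneq x y.
  by rewrite e !subrr normr0 sqrtr0 mulr0 addr0.
have tp : 0 < y - x by rewrite lt_neqAle eq_sym subr_eq0 eq_sym xyn.
have yp : 0 < y by lra.
have up : xlnx y - xlnx x <= y - x.
  have [->|xn] := eqVneq x 0; first by rewrite xlnx0 !subr0 /xlnx ler_piMr//;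
    have := ln_le_sub1 yp; lra.
  have xp : 0 < x by rewrite lt_neqAle eq_sym xn.
  have h1 : ln (y / x) <= y / x - 1 by apply: ln_le_sub1; rewrite divr_gt0.
  have h2 : x * ln (y / x) <= y - x.
    by apply: le_trans (ler_wpM2l (ltW xp) h1) _; rewrite mulrBr mulr1 mulrCA divff ?mulr1// gt_eqF.
  rewrite ln_div ?posrE// in h2.
  have h3 : (y - x) * ln y <= 0 by apply: mulr_ge0_le0 => //; apply: ln_le0.
  rewrite /xlnx; lra.
have lo : - (2 * Num.sqrt (y - x)) <= xlnx y - xlnx x.
  have h1 : xlnx (y - x) <= xlnx y - xlnx x.
    have h2 : (y - x) * ln (y - x) <= (y - x) * ln y.
      by apply: ler_wpM2l => //; rewrite ler_ln ?posrE//; lra.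
    have h3 : x * ln x <= x * ln y.
      have [->|xn] := eqVneq x 0; first by rewrite !mul0r.
      by apply: ler_wpM2l => //; rewrite ler_ln ?posrE// lt_neqAle eq_sym xn.
    rewrite /xlnx; lra.
  have : `|xlnx (y - x)| <= 2 * Num.sqrt (y - x) by apply: xlnx_small; apply/andP; split; lra.
  by rewrite ler_norml => /andP[]; lra.
have s0 : 0 <= Num.sqrt (y - x) by exact: sqrtr_ge0.
by rewrite ler_norml; apply/andP; split; lra.
Qed.

Lemma xlnx_uniform (eta : R) : 0 < eta -> exists2 delta : R, 0 < delta &
  forall x y : R, 0 <= x <= 1 -> 0 <= y <= 1 -> `|x - y| <= delta ->
    `|xlnx x - xlnx y| <= eta.
Proof.
move=> e0; have e3 : 0 < eta / 3 by rewrite divr_gt0.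
exists (Num.min (eta / 3) ((eta / 3) ^+ 2)); first by rewrite lt_min e3 exprn_gt0.
move=> x y hx hy; rewrite le_min => /andP[h1 h2].
apply: le_trans (xlnx_modulus hx hy) _.
have : Num.sqrt `|x - y| <= eta / 3.
  by rewrite -[leRHS](ger0_norm (ltW e3)) -[leRHS]sqrtr_sqr ler_sqrt// exprn_ge0// ltW.
lra.
Qed.

Section near_coupling.
Variables (M : finType) (p : M * M -> R).
Hypothesis pL : edge_law p.
Local Notation Q := ((M * M) * (M * M))%type.
Implicit Type q : Q -> R.

Definition marg1 q (x : M * M) : R := \sum_b \sum_b' q ((x.1, b), (x.2, b')).
Definition marg2 q (x : M * M) : R := \sum_a \sum_a' q ((a, x.1), (a', x.2)).

Let p0 x : 0 <= p x. Proof. by case: pL. Qed.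

Lemma sum_marg1 q : \sum_x marg1 q x = \sum_x q x.
Proof.
rewrite [LHS]sum_pairE /marg1 /= [RHS]sum_pairE [RHS]sum_pairE; apply: eq_bigr => a _.
rewrite exchange_big /=; apply: eq_bigr => b _.
by rewrite [RHS]sum_pairE; apply: eq_bigr => a' _.
Qed.

Lemma sum_marg2 q : \sum_x marg2 q x = \sum_x q x.
Proof.
rewrite [LHS]sum_pairE /marg2 /=.
under eq_bigr do rewrite exchange_big/=.
rewrite exchange_big/= [RHS]sum_pairE [RHS]sum_pairE; apply: eq_bigr => a _.
apply: eq_bigr => b _; rewrite [RHS]sum_pairE exchange_big/=.
by apply: eq_bigr => a' _.
Qed.

Definition fst_pair (z : Q) : M * M := (z.1.1, z.2.1).
Definition snd_pair (z : Q) : M * M := (z.1.2, z.2.2).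

Lemma marg1E q x : marg1 q x = \sum_(z | fst_pair z == x) q z.
Proof.
rewrite [RHS]big_mkcond [RHS]sum_pairE [RHS]sum_pairE /= [RHS](bigD1 x.1)//= [X in _ = _ + X]big1
  ?addr0; last first.
  move=> a /negbTE ax; apply: big1 => b _; apply: big1 => z _.
  by case: x ax => x1 x2 /= ax; rewrite /fst_pair xpair_eqE ax.
apply: eq_bigr => b _; rewrite [RHS]sum_pairE [RHS](bigD1 x.2)//= [X in _ = _ + X]big1 ?addr0;
  last first.
  move=> a /negbTE ax; apply: big1 => b' _.
  by case: x ax => x1 x2 /= ax; rewrite /fst_pair xpair_eqE ax andbF.
by apply: eq_bigr => b' _; rewrite /fst_pair/= -surjective_pairing eqxx.
Qed.

Lemma marg2E q x : marg2 q x = \sum_(z | snd_pair z == x) q z.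
Proof.
rewrite [RHS]big_mkcond [RHS]sum_pairE [RHS]sum_pairE /=; apply: eq_bigr => a _.
rewrite [RHS](bigD1 x.1)//= [X in _ = _ + X]big1 ?addr0; last first.
  move=> b /negbTE bx; apply: big1 => z _.
  by case: x bx => x1 x2 /= bx; rewrite /snd_pair xpair_eqE bx.
rewrite [RHS]sum_pairE; apply: eq_bigr => a' _.
rewrite [RHS](bigD1 x.2)//= [X in _ = _ + X]big1 ?addr0; last first.
  move=> b /negbTE bx.
  by case: x bx => x1 x2 /= bx; rewrite /snd_pair xpair_eqE bx andbF.
by rewrite /snd_pair/= -surjective_pairing eqxx.
Qed.

(* Scale [q] down so that its marginals are below [p], then complete it with a
   product measure on the deficits. *)
Lemma near_coupling q (eps : R) : edge_law q -> 0 <= eps ->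
  (forall x, `|marg1 q x - p x| <= eps) -> (forall x, `|marg2 q x - p x| <= eps) ->
  exists q', [/\ edge_law q', coupling p p q' &
    forall z, `|q z - q' z| <= 4 * #|{: M * M}|%:R * eps].
Proof.
move=> [q0 q1 qC] e0 m1 m2.
have pC a b : p (a, b) = p (b, a) by case: pL.
have p1 : \sum_x p x = 1 by case: pL.
pose r1 x := if marg1 q x <= p x then 1 else p x / marg1 q x.
pose r2 x := if marg2 q x <= p x then 1 else p x / marg2 q x.
have mg10 x : 0 <= marg1 q x by apply: sumr_ge0 => ? _; apply: sumr_ge0.
have mg20 x : 0 <= marg2 q x by apply: sumr_ge0 => ? _; apply: sumr_ge0.
have rP (mg pp : R) : 0 <= mg -> 0 <= pp -> let r := if mg <= pp then 1 else pp / mg in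
    [/\ 0 <= r, r <= 1, mg * r <= pp & mg * (1 - r) <= `|mg - pp|].
  move=> g0 pp0 /=; case: (leP mg pp) => [h|h].
    by split=> //; rewrite ?mulr1 ?subrr ?mulr0.
  have gp : 0 < mg by exact: le_lt_trans h.
  split; first by rewrite divr_ge0.
  - by rewrite ler_pdivrMr// mul1r ltW.
  - by rewrite mulrCA divff ?mulr1// gt_eqF.
  - by rewrite mulrBr mulr1 mulrCA divff ?mulr1 ?ler_norm// gt_eqF.
pose qq (z : Q) := q z * (r1 (fst_pair z) * r2 (snd_pair z)).
have r1P x : [/\ 0 <= r1 x, r1 x <= 1, marg1 q x * r1 x <= p x &
    marg1 q x * (1 - r1 x) <= `|marg1 q x - p x|] by exact: rP.
have r2P x : [/\ 0 <= r2 x, r2 x <= 1, marg2 q x * r2 x <= p x &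
    marg2 q x * (1 - r2 x) <= `|marg2 q x - p x|] by exact: rP.
have r12 z : 0 <= r1 (fst_pair z) * r2 (snd_pair z) <= 1.
  have [a1 a2 _ _] := r1P (fst_pair z); have [b1 b2 _ _] := r2P (snd_pair z).
  by rewrite mulr_ge0//= mulr_ile1.
have qq0 z : 0 <= qq z by rewrite mulr_ge0//; case/andP: (r12 z).
have qqle z : qq z <= q z by rewrite /qq ler_piMr//; case/andP: (r12 z).
have le1 x : marg1 qq x <= p x.
  have [a1 a2 a3 _] := r1P x; apply: le_trans a3.
  rewrite !marg1E mulr_suml; apply: ler_sum => z /eqP zx; rewrite /qq zx.
  by apply: ler_wpM2l => //; rewrite ler_piMr//; have [] := r2P (snd_pair z).
have le2 x : marg2 qq x <= p x.
  have [a1 a2 a3 _] := r2P x; apply: le_trans a3.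
  rewrite !marg2E mulr_suml; apply: ler_sum => z /eqP zx; rewrite /qq zx.
  by apply: ler_wpM2l => //; rewrite ler_piMl//; have [] := r1P (fst_pair z).
pose D1 x := p x - marg1 qq x; pose D2 x := p x - marg2 qq x.
have D10 x : 0 <= D1 x by rewrite subr_ge0.
have D20 x : 0 <= D2 x by rewrite subr_ge0.
pose D := \sum_x D1 x.
have DE : D = \sum_x D2 x by rewrite /D !sumrB sum_marg1 sum_marg2.
have DE' : D = \sum_z (q z - qq z) by rewrite /D sumrB p1 sum_marg1 sumrB q1.
have D0 : 0 <= D by apply: sumr_ge0.
(* Both deficits have total mass [D]. If [D] is 0 they vanish, and the division by 0 adds
   nothing. *)
pose q' (z : Q) := qq z + D1 (fst_pair z) * D2 (snd_pair z) / D.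
(* The mass removed at [z] is at most [q z] times [(1 - r1) + (1 - r2)], and each marginal exceeds
   [p] by at most [eps] at each pair. *)
have Dle : D <= 2 * #|{: M * M}|%:R * eps.
  rewrite DE'; apply: (@le_trans _ _ (\sum_z (q z * (1 - r1 (fst_pair z)) + q z * (1 - r2 (snd_pair
    z))))).
    apply: ler_sum => z _; rewrite /qq -mulrDr.
    have [a1 a2 _ _] := r1P (fst_pair z); have [b1 b2 _ _] := r2P (snd_pair z).
    have : 0 <= q z * ((1 - r1 (fst_pair z)) * (1 - r2 (snd_pair z))).
      by rewrite !mulr_ge0// subr_ge0.
    move: (r1 _) (r2 _) => u v; lra.
  rewrite big_split/=.
  have -> : \sum_z q z * (1 - r1 (fst_pair z)) = \sum_x marg1 q x * (1 - r1 x).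
    rewrite (partition_big fst_pair xpredT)//=; apply: eq_bigr => x _.
    by rewrite marg1E mulr_suml; apply: eq_bigr => z /eqP ->.
  have -> : \sum_z q z * (1 - r2 (snd_pair z)) = \sum_x marg2 q x * (1 - r2 x).
    rewrite (partition_big snd_pair xpredT)//=; apply: eq_bigr => x _.
    by rewrite marg2E mulr_suml; apply: eq_bigr => z /eqP ->.
  have -> : 2 * #|{: M * M}|%:R * eps = \sum_(x : M * M) eps + \sum_(x : M * M) eps.
    by rewrite sumr_const -[_ *+ _]mulr_natl (eq_card (B := {: M * M}))//; lra.
  apply: lerD; apply: ler_sum => x _.
    by have [_ _ _ h] := r1P x; apply: le_trans h _.
  by have [_ _ _ h] := r2P x; apply: le_trans h _.
have Dx (f : M * M -> R) : (forall x, 0 <= f x) -> D = 0 -> \sum_x f x = D -> forall x, f x = 0.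
  move=> f0 -> sf x; apply/le_anti; rewrite f0 andbT -sf (bigD1 x)//= lerDl.
  by apply: sumr_ge0.
have sc1 x : \sum_(z | fst_pair z == x) D1 (fst_pair z) * D2 (snd_pair z) / D = D1 x.
  rewrite -marg1E /marg1 /fst_pair /snd_pair /=.
  transitivity (D1 x * (\sum_b \sum_b' D2 (b, b')) / D).
    rewrite -surjective_pairing mulr_sumr mulr_suml; apply: eq_bigr => b _.
    by rewrite mulr_sumr mulr_suml.
  rewrite -sum_pairE -DE; have [d0|dn] := eqVneq D 0; last by rewrite mulfK.
  by rewrite (Dx D1)// !mul0r.
have sc2 x : \sum_(z | snd_pair z == x) D1 (fst_pair z) * D2 (snd_pair z) / D = D2 x.
  rewrite -marg2E /marg2 /fst_pair /snd_pair /=.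
  transitivity ((\sum_b \sum_b' D1 (b, b')) * D2 x / D).
    rewrite -surjective_pairing !mulr_suml; apply: eq_bigr => b _.
    by rewrite !mulr_suml.
  rewrite -sum_pairE -/D; have [d0|dn] := eqVneq D 0; last by rewrite mulrAC divff ?mul1r.
  by rewrite (Dx D2)// ?DE// mulr0 mul0r.
have mq1 x : marg1 q' x = p x.
  by rewrite marg1E big_split/= sc1 -marg1E /D1 addrC subrK.
have mq2 x : marg2 q' x = p x.
  by rewrite marg2E big_split/= sc2 -marg2E /D2 addrC subrK.
have r1C a b : r1 (a, b) = r1 (b, a).
  by rewrite /r1 pC; have -> // : marg1 q (a, b) = marg1 q (b, a);
    rewrite /marg1/= exchange_big/=; apply: eq_bigr => ? _; apply: eq_bigr => ? _; exact: qC.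
have r2C a b : r2 (a, b) = r2 (b, a).
  by rewrite /r2 pC; have -> // : marg2 q (a, b) = marg2 q (b, a);
    rewrite /marg2/= exchange_big/=; apply: eq_bigr => ? _; apply: eq_bigr => ? _; exact: qC.
have qqC x y : qq (x, y) = qq (y, x).
  by rewrite /qq qC /fst_pair /snd_pair /= r1C r2C.
have D1C a b : D1 (a, b) = D1 (b, a).
  rewrite /D1 pC; congr (_ - _); rewrite /marg1/= exchange_big/=.
  by apply: eq_bigr => ? _; apply: eq_bigr => ? _; exact: qqC.
have D2C a b : D2 (a, b) = D2 (b, a).
  rewrite /D2 pC; congr (_ - _); rewrite /marg2/= exchange_big/=.
  by apply: eq_bigr => ? _; apply: eq_bigr => ? _; exact: qqC.
have ext0 z : 0 <= D1 (fst_pair z) * D2 (snd_pair z) / D by rewrite divr_ge0// mulr_ge0.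
exists q'; split.
- split.
  + by move=> z; rewrite addr_ge0.
  + by rewrite -sum_marg1; under eq_bigr do rewrite mq1.
  + by move=> x y; rewrite /q' qqC /fst_pair /snd_pair /= D1C D2C.
- by split=> a b; [exact: (mq1 (a, b))|exact: (mq2 (a, b))].
- move=> z; have h1 : q z - qq z <= D.
    rewrite DE' (bigD1 z)//= lerDl; apply: sumr_ge0 => ? _.
    by rewrite subr_ge0.
  have h2 : D1 (fst_pair z) * D2 (snd_pair z) / D <= D.
    have [d0|dn] := eqVneq D 0; first by rewrite d0 invr0 mulr0.
    have Dp : 0 < D by rewrite lt_neqAle eq_sym dn.
    rewrite ler_pdivrMr//; apply: ler_pM => //.
      by rewrite /D (bigD1 (fst_pair z))//= lerDl sumr_ge0.
    by rewrite DE (bigD1 (snd_pair z))//= lerDl sumr_ge0.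
  have h3 := ext0 z; have h4 := qqle z.
  rewrite ler_norml /q'; move: (_ / D) h2 h3 => w h2 h3.
  by apply/andP; split; lra.
Qed.

Lemma edge_law_le1 (C : finType) (q : C * C -> R) x : edge_law q -> 0 <= q x <= 1.
Proof.
by move=> [q0 q1 _]; rewrite q0 -q1 (bigD1 x)//= lerDl sumr_ge0.
Qed.

Lemma marginal_le1 (C : finType) (q : C * C -> R) a : edge_law q -> 0 <= vertex_marginal q a <= 1.
Proof.
move=> [q0 q1 _]; rewrite sumr_ge0//= -q1 [leRHS]sum_pairE (bigD1 a)//= lerDl.
by apply: sumr_ge0 => b _; apply: sumr_ge0.
Qed.

Lemma Sigma_uniform (C : finType) (d : nat) (eta : R) : 0 < eta -> exists2 delta : R, 0 < delta &
  forall q q' : C * C -> R, edge_law q -> edge_law q' ->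
    (forall x, `|q x - q' x| <= delta) -> `|Sigma d q - Sigma d q'| <= eta.
Proof.
move=> e0.
pose c := #|C|%:R + 1 : R; have c1 : 1 <= c by rewrite /c lerDr.
have c0 : 0 < c by apply: lt_le_trans c1.
pose K : R := (d%:R + 1) * 4 * c ^+ 2.
have K0 : 0 < K by rewrite /K mulr_gt0 ?exprn_gt0// mulr_gt0// ltr_wpDl.
have [dl dl0 dlP] := xlnx_uniform (divr_gt0 e0 K0).
exists (dl / c); first by rewrite divr_gt0.
move=> q q' qL qL' qq.
have dlc : dl / c <= dl by rewrite ler_pdivrMr// ler_peMr// ltW.
have cc : #|{: C * C}|%:R <= c ^+ 2 :> R.
  by rewrite card_prod natrM -expr2 /c lerXn2r// ?nnegrE ?addr_ge0// lerDl.
have cc1 : #|C|%:R <= c ^+ 2 :> R.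
  by apply: (@le_trans _ _ c); [rewrite /c lerDl|rewrite expr2 ler_peMr// ltW].
have eK : 0 <= eta / K by rewrite ltW// divr_gt0.
have h1 : `|entropy q - entropy q'| <= c ^+ 2 * (eta / K).
  rewrite /entropy opprK addrC -sumrB; apply: le_trans (ler_norm_sum _ _ _) _.
  apply: (@le_trans _ _ (\sum_(x : C * C) eta / K)).
    apply: ler_sum => x _; apply: dlP; try exact: edge_law_le1.
    by rewrite distrC; apply: le_trans (qq x) _.
  by rewrite sumr_const -[leLHS]mulr_natl ler_wpM2r.
have h2 : `|entropy (vertex_marginal q) - entropy (vertex_marginal q')| <= c ^+ 2 * (eta / K).
  rewrite /entropy opprK addrC -sumrB; apply: le_trans (ler_norm_sum _ _ _) _.
  apply: (@le_trans _ _ (\sum_(x : C) eta / K)).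
    apply: ler_sum => x _; apply: dlP; try exact: marginal_le1.
    rewrite distrC -sumrB; apply: le_trans (ler_norm_sum _ _ _) _.
    apply: (@le_trans _ _ (\sum_(b : C) dl / c)); first by apply: ler_sum => b _; exact: qq.
    rewrite sumr_const -[leLHS]mulr_natl mulrCA; apply: ler_piMr; first exact: ltW.
    by rewrite ler_pdivrMr// mul1r /c lerDl.
  by rewrite sumr_const -[leLHS]mulr_natl ler_wpM2r.
have KE : K * (eta / K) = eta by rewrite mulrC divfK// gt_eqF.
have -> : Sigma d q - Sigma d q' = d%:R / 2 * (entropy q - entropy q') -
   (d%:R - 1) * (entropy (vertex_marginal q) - entropy (vertex_marginal q')).
  by rewrite /Sigma; lra.
have d0 : 0 <= d%:R :> R by [].
have d1 : `|d%:R - 1| <= d%:R + 1 :> R by apply: le_trans (ler_normB _ _) _;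
  rewrite normr1 ger0_norm.
apply: le_trans (ler_normB _ _) _; rewrite !normrM.
have h3 : `|d%:R / 2| * `|entropy q - entropy q'| <= (d%:R + 1) * (c ^+ 2 * (eta / K)).
  apply: ler_pM => //; rewrite ger0_norm ?divr_ge0//; lra.
have h4 : `|d%:R - 1| * `|entropy (vertex_marginal q) - entropy (vertex_marginal q')| <=
   (d%:R + 1) * (c ^+ 2 * (eta / K)) by apply: ler_pM.
have h5 : 2 * ((d%:R + 1) * (c ^+ 2 * (eta / K))) <= eta.
  rewrite -{2}KE /K; have : 0 <= (d%:R + 1) * (c ^+ 2 * (eta / K)).
    by rewrite mulr_ge0 ?addr_ge0// mulr_ge0 ?exprn_ge0// ltW.
  by move: (c ^+ 2) (eta / K) => u v; lra.
rewrite -(normrM d%:R); apply: le_trans (lerD h3 h4) _.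
by move: h5; rewrite mulr_natl mulr2n.
Qed.

(** The hypothesis concerns exact couplings, while pairs of good colourings only provide approximate
    ones. *)
Lemma near_coupling_Sigma (d : nat) (eta : R) : 0 < eta ->
  (forall q, edge_law q -> coupling p p q -> Sigma d q <= 2 * Sigma d p) ->
  exists2 eps : R, 0 < eps & forall q, edge_law q ->
    (forall x, `|marg1 q x - p x| <= eps) -> (forall x, `|marg2 q x - p x| <= eps) ->
    Sigma d q <= 2 * Sigma d p + eta.
Proof.
move=> e0 H; have [dl dl0 dlP] := Sigma_uniform (M * M)%type d e0.
pose K : R := 4 * #|{: M * M}|%:R + 1.
have K0 : 0 < K by rewrite ltr_wpDl// mulr_ge0.
have ep : 0 < dl / K by rewrite divr_gt0.
exists (dl / K) => // q qL m1 m2.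
have [q' [q'L q'c qq']] := near_coupling qL (ltW ep) m1 m2.
have : `|Sigma d q - Sigma d q'| <= eta.
  apply: dlP => // x; apply: le_trans (qq' x) _.
  rewrite mulrCA ler_piMr ?(ltW dl0)// ler_pdivrMr// mul1r /K lerDl.
  by [].
by rewrite ler_norml => /andP[_]; have := H _ q'L q'c; lra.
Qed.

End near_coupling.
End coupling_continuity.

(** * Moments of numbers of colourings *)

Section moments.
Variable R : realType.

Lemma sum_edge_cnt (V : finType) (d : nat) (C : finType) (m : {perm V * 'I_d}) (f : V -> C) :
  (\sum_x edge_count m f x = half_edges V d)%N.
Proof.
rewrite /half_edges -sum1_card (partition_big (fun h : V * 'I_d => (f h.1, f (m h).1)) xpredT)//=.
by apply: eq_bigr => x _; rewrite /edge_count -sum1_card; apply: eq_bigl => h; rewrite inE.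
Qed.

Lemma edge_cnt_sum (V : finType) (d : nat) (C D : finType) (m : {perm V * 'I_d})
    (f : V -> C) (u : C -> D) x :
  edge_count m (u \o f) x = (\sum_(z | (u z.1, u z.2) == x) edge_count m f z)%N.
Proof.
rewrite {1}/edge_count -sum1_card.
rewrite (partition_big (fun h : V * 'I_d => (f h.1, f (m h).1)) (fun z => (u z.1, u z.2) == x))/=.
  apply: eq_bigr => z /eqP zx; rewrite /edge_count -sum1_card; apply: eq_bigl => h.
  rewrite !inE; case: (eqVneq (f h.1, f (m h).1) z) => [zE|_]; rewrite ?andbF// andbT.
  by move: zx; rewrite -zE /= => ->; rewrite eqxx.
by move=> h; rewrite inE.
Qed.

(** Symmetry comes from the matching, which exchanges the half-edges of types [(a, b)] and
    [(b, a)]. *)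
Lemma freq_edge_law (V : finType) (d : nat) (C : finType) (m : {perm V * 'I_d}) (f : V -> C) :
  (0 < half_edges V d)%N -> m \in config_matchings V d -> edge_law (freq R V d (edge_count m f)).
Proof.
move=> N0 /pmatchP[mK _]; split=> [x||a b].
- by rewrite divr_ge0.
- by rewrite /freq -mulr_suml -natr_sum sum_edge_cnt divff// pnatr_eq0 -lt0n.
rewrite /freq; congr (_%:R / _); rewrite /edge_count -(card_imset _ (@perm_inj _ m)).
apply: eq_card => h; apply/imsetP/idP => [[h']|].
  by rewrite !inE => /eqP[<- <-] ->; rewrite mK.
by rewrite inE => /eqP[<- <-]; exists (m h); rewrite ?inE mK.
Qed.

(** The possible statistics number at most [N + 1] to the power [#|C| ^ 2], so that the largest
    exponent governs the sum over them. *)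
Lemma moment_upper (C : finType) (d : nat) (eta : R) : 0 < eta -> exists n0 : nat,
  forall (V : finType) (B : R) (Q : pred ({perm V * 'I_d} * {ffun V -> C})),
  (n0 <= #|V|)%N -> (0 < half_edges V d)%N -> ~~ odd (half_edges V d) ->
  (forall mf, mf.1 \in config_matchings V d -> Q mf ->
     Sigma d (freq R V d (edge_count mf.1 mf.2)) <= B) ->
  #|[set mf : {perm V * 'I_d} * {ffun V -> C} | (mf.1 \in config_matchings V d) && Q mf]|%:R <=
    #|config_matchings V d|%:R * expR (#|V|%:R * (B + eta)).
Proof.
move=> e0; pose c2 : R := #|C|%:R ^+ 2.
pose K : R := (c2 * 2 + 2) * (1 + ln d.+1%:R).
have c20 : 0 <= c2 by rewrite exprn_ge0.
have [n0 n0P] := ln_little_o K e0; exists n0 => V B Q nn N0 oN HQ.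
set S := [set mf | _]; set N := half_edges V d in N0 oN *.
pose ct (mf : {perm V * 'I_d} * {ffun V -> C}) : {ffun C * C -> 'I_N.+1} :=
  [ffun x => inord (edge_count mf.1 mf.2 x)].
have ctE mf x : ct mf x = edge_count mf.1 mf.2 x :> nat.
  rewrite ffunE inordK// ltnS /N -(sum_edge_cnt mf.1 mf.2) (bigD1 x)//=; exact: leq_addr.
pose T := expR (#|V|%:R * B + (c2 + 2) * (1 + ln N.+1%:R)).
have P0 (mf : {perm V * 'I_d} * {ffun V -> C}) : mf \in S -> (0 < #|config_matchings V d|)%N.
  by rewrite inE => /andP[mP _]; apply/card_gt0P; exists mf.1.
have fib c : #|[set mf in S | ct mf == c]|%:R <= #|config_matchings V d|%:R * T.
  have [->|[mf]] := set_0Vmem [set mf in S | ct mf == c];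
    first by rewrite cards0 mulr_ge0 ?expR_ge0.
  rewrite inE => /andP[mfS /eqP mfc].
  pose c' := edge_count mf.1 mf.2.
  have sub : (#|[set mf in S | ct mf == c]| <= stat_pairs V d c')%N.
    apply: subset_leq_card; apply/fintype.subsetP => mf'; rewrite !inE.
    move=> /andP[/andP[-> _] /eqP mfc'] /=; apply/forallP => x.
    by rewrite /c' -!ctE mfc mfc'.
  have sp : (0 < stat_pairs V d c')%N.
    by apply: leq_trans sub; apply/card_gt0P; exists mf; rewrite inE mfS mfc eqxx.
  have ne : stat_labels V d c' != finset.set0.
    apply/set0Pn; exists (mf.2, [ffun h => mf.2 (mf.1 h).1]); rewrite inE.
    apply/forallP => x; apply/eqP; rewrite /c' /edge_count; apply: eq_card => h.
    by rewrite !inE ffunE.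
  apply: (@le_trans _ _ (stat_pairs V d c')%:R); first by rewrite ler_nat.
  have P1 := P0 _ mfS.
  rewrite -ler_ln ?posrE ?ltr0n ?mulr_gt0 ?expR_gt0 ?ltr0n//.
  rewrite lnM ?posrE ?expR_gt0 ?ltr0n// expRK.
  apply: le_trans (stat_pairs_log R N0 ne oN sp) _.
  rewrite -addrA lerD2l lerD2r; apply: ler_wpM2l => //.
  by apply: HQ; move: mfS; rewrite inE => /andP[].
have -> : #|S|%:R = \sum_c #|[set mf in S | ct mf == c]|%:R :> R.
  rewrite -natr_sum -sum1_card (partition_big ct xpredT)//=; congr _%:R.
  by apply: eq_bigr => c _; rewrite -sum1_card; apply: eq_bigl => mf; rewrite inE.
apply: le_trans (ler_sum _ (fun c _ => fib c)) _.
rewrite sumr_const card_ffun card_ord card_prod -[leLHS]mulr_natl mulrCA.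
apply: ler_wpM2l => //; rewrite natrX.
have l0 : 0 < N.+1%:R :> R by rewrite ltr0n.
rewrite -{1}(lnK l0) -expRM_natl -expRD ler_expR natrM -expr2 -/c2.
have lN : ln N.+1%:R <= ln d.+1%:R + ln #|V|.+1%:R :> R.
  rewrite -lnM ?posrE ?ltr0n// ler_ln ?posrE -?natrM ?ltr0n// ler_nat.
  by rewrite /N /half_edges card_prod card_ord; nia.
have a0 : 0 <= ln d.+1%:R :> R by exact: ln_nat_ge0.
have b0 : 0 <= ln #|V|.+1%:R :> R by exact: ln_nat_ge0.
have z0 : 0 <= ln N.+1%:R :> R by exact: ln_nat_ge0.
have h : 1 + ln N.+1%:R <= (1 + ln d.+1%:R) * (1 + ln #|V|.+1%:R) :> R.
  by have := mulr_ge0 a0 b0; move: lN; move: (ln _) (ln _) (ln _) => u v w; lra.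
have := n0P _ nn; rewrite /K -mulrA => h2.
have h3 : (c2 * 2 + 2) * (1 + ln N.+1%:R) <= eta * #|V|%:R.
  by apply: le_trans h2; apply: ler_wpM2l => //; lra.
move: h3 z0 c20; move: (ln N.+1%:R) => u; move: (#|V|%:R : R) => v.
move: {+}c2 => z; clear; lra.
Qed.

End moments.

(** * Second moment method *)

Section many_good.
Variables (R : realType) (M : finType) (E : nat) (p : M * M -> R).
Hypothesis pL : edge_law p.
Hypothesis Hq : forall q : (M * M) * (M * M) -> R,
  edge_law q -> coupling p p q -> Sigma E.+2 q <= 2 * Sigma E.+2 p.
Variable k : nat.

Definition good_set (V : finType) (delta : R) (m : {perm V * 'I_E.+2}) : {set {ffun V -> M}} :=
  [set f : {ffun V -> M} | ball_good p k delta m f].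

Lemma ball_goodW (V : finType) (d1 d2 : R) (m : {perm V * 'I_E.+2}) (f : V -> M) :
  d1 <= d2 -> ball_good p k d1 m f -> ball_good p k d2 m f.
Proof.
by move=> dd /forallP h; apply/forallP => s; exact: le_trans (h s) dd.
Qed.

(** A pair of good colourings is one colouring by [M * M], to which [moment_upper] applies; both
    marginals of its edge statistics are near [p]. *)
Lemma second_moment (eta : R) : 0 < eta -> exists2 delta0 : R, 0 < delta0 &
  forall delta : R, 0 < delta -> delta <= delta0 -> exists n0 : nat, forall V : finType,
  (n0 <= #|V|)%N -> ~~ odd #|{: V * 'I_E.+2}| ->
  \sum_(m in config_matchings V E.+2) #|good_set delta m|%:R ^+ 2 <=
    #|config_matchings V E.+2|%:R * expR (#|V|%:R * (2 * Sigma E.+2 p + eta)).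
Proof.
move=> e0; have e2 : 0 < eta / 2 by rewrite divr_gt0.
have [eps eps0 epsP] := near_coupling_Sigma pL e2 Hq.
have [n0 n0P] := moment_upper (M * M)%type E.+2 e2.
pose c := #|ball_type M E k|%:R : R.
exists (eps / (c + 1)); first by rewrite divr_gt0// ltr_pwDr.
move=> delta dl0 dle; exists (maxn n0 1) => V; rewrite geq_max => /andP[nn n1] oN.
have N0 : (0 < half_edges V E.+2)%N by rewrite /half_edges card_prod card_ord muln_gt0 n1.
have cde : c * delta <= eps.
  apply: le_trans (ler_wpM2l _ dle) _; first by [].
  by rewrite mulrCA; apply: ler_piMr; [exact: ltW|rewrite ler_pdivrMr ?ltr_pwDr// mul1r lerDl].
pose Q (mg : {perm V * 'I_E.+2} * {ffun V -> M * M}) :=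
  ball_good p k delta mg.1 (fst \o mg.2) && ball_good p k delta mg.1 (snd \o mg.2).
have := n0P V (2 * Sigma E.+2 p + eta / 2) Q nn N0 oN.
rewrite -addrA -splitr => HB; apply: le_trans (HB _); last first.
  move=> [m g] /= mP /andP[/= g1 g2].
  apply: epsP; first exact: freq_edge_law.
    move=> x; rewrite marg1E.
    have -> : \sum_(z | fst_pair z == x) freq R V E.+2 (edge_count m g) z =
        (edge_count m (fst \o g) x)%:R / #|{: V * 'I_E.+2}|%:R.
      by rewrite /freq -mulr_suml -natr_sum edge_cnt_sum.
    by apply: le_trans (ball_good_edge pL x n1 (ltW dl0) g1) cde.
  move=> x; rewrite marg2E.
  have -> : \sum_(z | snd_pair z == x) freq R V E.+2 (edge_count m g) z =
      (edge_count m (snd \o g) x)%:R / #|{: V * 'I_E.+2}|%:R.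
    by rewrite /freq -mulr_suml -natr_sum edge_cnt_sum.
  by apply: le_trans (ball_good_edge pL x n1 (ltW dl0) g2) cde.
under eq_bigr do rewrite -natrX.
rewrite -natr_sum ler_nat -sum1_card.
rewrite (partition_big (fun mg : {perm V * 'I_E.+2} * {ffun V -> M * M} =>
  mg.1) (mem (config_matchings V E.+2)))/=; last first.
  by move=> mg; rewrite !inE => /andP[].
apply: leq_sum => m mP; rewrite sum1_card.
pose pr (ff : {ffun V -> M} * {ffun V -> M}) : {perm V * 'I_E.+2} * {ffun V -> M * M} :=
  (m, [ffun v => (ff.1 v, ff.2 v)]).
have prI : injective pr.
  move=> [f f'] [g g'] [/ffunP e]; congr (_, _); apply/ffunP => v.
    by have := e v; rewrite !ffunE => -[].
  by have := e v; rewrite !ffunE => -[].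
rewrite -mulnn -cardsX -(card_imset _ prI); apply: subset_leq_card.
apply/fintype.subsetP => _ /imsetP[[f f'] ff ->]; move: ff; rewrite !inE /= => /andP[g1 g2].
rewrite unfold_in inE /= eqxx andbT; apply/andP; split; first exact: mP.
rewrite /Q /=; apply/andP; split.
  by rewrite (_ : fst \o _ = f)//; apply/funext => v; rewrite /= ffunE.
by rewrite (_ : snd \o _ = f')//; apply/funext => v; rewrite /= ffunE.
Qed.

(* Paley-Zygmund. *)
Lemma many_good (delta eta : R) : 0 < delta -> 0 < eta -> exists n0 : nat, forall V : finType,
  (n0 <= #|V|)%N -> ~~ odd #|{: V * 'I_E.+2}| ->
  #|config_matchings V E.+2|%:R * expR (- (eta * #|V|%:R)) <=
  #|[set m in config_matchings V E.+2 | expR (#|V|%:R * (Sigma E.+2 p - eta)) <=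
    #|good_set delta m|%:R]|%:R :> R.
Proof.
move=> dl0 e0; pose h := eta / 4; have h0 : 0 < h by rewrite divr_gt0.
have [dl1 dl10 H2] := second_moment h0.
pose dl := Order.min delta dl1; have dlp : 0 < dl by rewrite lt_min dl0.
have dll : dl <= delta by rewrite ge_min lexx.
have [|n0 H2'] := H2 dl dlp; first by rewrite ge_min lexx orbT.
have [n1 H1] := planted_lower_bound E pL k dlp h0.
exists (maxn n0 (maxn n1 (Num.truncn (4 / h)).+1)) => V; rewrite !geq_max => /and3P[nn0 nn1 nn2] oN.
have {}H2 := H2' V nn0 oN; have {}H1 := H1 V nn1 oN; clear H2'.
set n := #|V|%:R : R; set P := #|config_matchings V E.+2|%:R : R; set Sg := Sigma E.+2 p in H1 H2 *.
have n4 : 4 <= h * n.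
  rewrite mulrC -ler_pdivrMr//; apply: ltW; apply: lt_le_trans (truncnS_gt _) _.
  by rewrite ler_nat.
have n0' : 0 <= n by [].
have P0 : 0 <= P by [].
pose Z (m : {perm V * 'I_E.+2}) : R := #|good_set dl m|%:R.
have A1 : P * expR (n * (Sg - h)) <= \sum_(m in config_matchings V E.+2) Z m.
  apply: le_trans H1 _; rewrite -natr_sum ler_nat -sum1_card.
  rewrite (partition_big (fun mg : {perm V * 'I_E.+2} * {ffun V -> M} =>
    mg.1) (mem (config_matchings V E.+2)))/=; last first.
    by move=> mg; rewrite !inE => /andP[].
  apply: leq_sum => m mP; rewrite sum1_card.
  have inj : {in [pred i | (i \in [set mf : {perm V * 'I_E.+2} * {ffun V ->
    M} | (mf.1 \in matchings (V * 'I_E.+2)%type) && ball_good p k dl mf.1 mf.2]) && (i.1 == m)] &,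
     injective (fun mf : {perm V * 'I_E.+2} * {ffun V -> M} => mf.2)}.
    by move=> [m1 f1] [m2 f2] /andP[_ /eqP/= ->] /andP[_ /eqP/= ->] /= ->.
  rewrite -(card_in_image inj); apply: subset_leq_card; apply/fintype.subsetP => f.
  move=> /fintype.imageP[[m' f'] /andP[]]; rewrite !inE /= => /andP[_ bg] /eqP <- ->.
  by [].
set W := [set m in config_matchings V E.+2 | _].
(* Level for the inequality [Z <= Z ^+ 2 / (4 * s) + s]; it makes the quadratic term at most a
   quarter of the lower bound on the first moment. *)
pose s := expR (n * (Sg + 2 * h)); have s0 : 0 < s by exact: expR_gt0.
pose t := expR (n * (Sg - eta)); have t0 : 0 < t by exact: expR_gt0.
have Zle m : m \in config_matchings V E.+2 -> Z m <=
  t + (Z m ^+ 2 / (4 * s) + (if m \in W then s else 0)).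
  move=> mP; have Z0 : 0 <= Z m by [].
  have q0 : 0 <= Z m ^+ 2 / (4 * s) by rewrite divr_ge0 ?exprn_ge0// mulr_ge0// ltW.
  case: ifPn => [_|]; last first.
    rewrite inE mP /= -ltNge -/n -/t => /ltW lt.
    apply: (@le_trans _ _ t); last by rewrite addr0 lerDl.
    apply: le_trans lt; rewrite ler_nat; apply: subset_leq_card.
    by apply/fintype.subsetP => f; rewrite !inE; exact: ball_goodW.
  suff : Z m <= Z m ^+ 2 / (4 * s) + s by move=> /le_trans; apply; rewrite lerDr ltW.
  have : 0 <= (Z m - 2 * s) ^+ 2 / (4 * s) by rewrite divr_ge0 ?sqr_ge0// mulr_ge0// ltW.
  rewrite sqrrB mulrDl mulrBl.
  have -> : (2 * s) ^+ 2 / (4 * s) = s.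
    have -> : (2 * s) ^+ 2 = s * (4 * s) by rewrite expr2; move: {+}s => u; lra.
    by rewrite mulfK// gt_eqF// mulr_gt0.
  have -> : (Z m * (2 * s)) *+ 2 / (4 * s) = Z m.
    rewrite -[_ *+ 2]mulr_natl mulrCA (mulrA 2 2 s) -natrM mulfK// gt_eqF// mulr_gt0//.
  by move: (_ / _) => u; lra.
have HS : \sum_(m in config_matchings V E.+2) Z m <=
  P * t + (P * expR (n * (2 * Sg + h)) / (4 * s) + #|W|%:R * s).
  apply: le_trans (ler_sum _ Zle) _; rewrite big_split /= big_split /=.
  apply: lerD; first by rewrite sumr_const [leRHS]mulr_natl.
  apply: lerD.
    by rewrite -mulr_suml ler_wpM2r// invr_ge0 mulr_ge0// ltW.
  rewrite -big_mkcondr /= (eq_bigl (mem W)) => [|m]; first by rewrite sumr_const [leRHS]mulr_natl.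
  by rewrite !inE andbA andbb.
have f1 : expR (n * (2 * Sg + h)) / (4 * s) = expR (n * (Sg - h)) / 4.
  rewrite invfM mulrA mulrAC -[expR _ / s]expRB; congr (expR _ / 4).
  by move: {+}n {+}Sg {+}h => u v w; lra.
(* The matchings outside [W] account for at most another quarter, since [eta] is [4 * h] and
   [4 <= expR (3 * (h * n))]. *)
have f2 : t <= expR (n * (Sg - h)) / 4.
  rewrite ler_pdivlMr//.
  have four : 4 <= expR (3 * (h * n)).
    apply: le_trans (expR_ge1Dx _); lra.
  apply: (@le_trans _ _ (t * expR (3 * (h * n)))); first by rewrite ler_pM2l.
  rewrite -expRD ler_expR /h; move: {+}n {+}Sg => u v; lra.
rewrite -mulrA f1 in HS.
have HW : P * (expR (n * (Sg - h)) / 4) <= #|W|%:R * s.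
  have := le_trans A1 HS; have := ler_wpM2l P0 f2.
  have g0 : 0 <= P * (expR (n * (Sg - h)) / 4) by rewrite mulr_ge0// divr_ge0// expR_ge0.
  have -> : P * expR (n * (Sg - h)) = 4 * (P * (expR (n * (Sg - h)) / 4)).
    by rewrite mulrCA [4 * _]mulrC divfK.
  move: g0; move: (P * (_ / _)) (P * t) (_ * s) => x y z; lra.
rewrite -(ler_pM2r s0); apply: le_trans HW; rewrite -mulrA; apply: ler_wpM2l => //.
rewrite ler_pdivlMr//.
have four : 4 <= expR (h * n) by apply: le_trans (expR_ge1Dx _); lra.
apply: (@le_trans _ _ (expR (- (eta * n)) * s * expR (h * n))).
  by rewrite ler_pM2l// mulr_gt0// expR_gt0.
rewrite -!expRD ler_expR /h; move: {+}n {+}Sg => u v; lra.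
Qed.

End many_good.

(** * Hamming distance and concentration of matchings *)

Section hamming.
Variables (R : realType) (H : finType).
Implicit Types (m s : {perm H}).

Definition matching_dist m s : nat := #|[set h | m h != s h]|.

Lemma conj_tpermN m a b h : a != h -> b != h -> a != m h -> b != m h ->
  (m ^ tperm a b)%g h = m h.
Proof. by move=> *; rewrite conjgE tpermV !permM !tpermD// eq_sym. Qed.

(** A switch affects only [a], [b] and their partners, whence 4. *)
Lemma matching_dist_conj m s a b : involutive m -> (matching_dist (m ^ tperm a b)%g s <=
  matching_dist m s + 4)%N.
Proof.
move=> mK; pose T := [set x in [:: a; b; m a; m b]].
have cT : (#|T| <= 4)%N by rewrite /T cardsE; exact: card_size.
apply: leq_trans (leq_add (leqnn _) cT); apply: leq_trans (leq_of_leqif (leq_card_setU _ _)).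
apply: subset_leq_card; apply/fintype.subsetP => h; rewrite !inE => ne.
apply: contraNT ne; rewrite !negb_or => /and5P[ms ha hb hma hmb].
rewrite negbK in ms; rewrite -(eqP ms) conj_tpermN// 1?eq_sym//.
  by rewrite -(inj_eq (@perm_inj _ m)) mK in hma; rewrite ?[m a]mK in hma *.
by rewrite -(inj_eq (@perm_inj _ m)) mK in hmb.
Qed.

Lemma exists_near (S : {set {perm H}}) : S != finset.set0 -> exists F : {perm H} -> nat,
  (forall m, exists2 s, s \in S & F m = matching_dist m s) /\ forall m s, s \in S -> (F m <=
    matching_dist m s)%N.
Proof.
move=> /set0Pn[s0 s0S]; pose a m := [arg min_(s < s0 in S) matching_dist m s].
exists (fun m => matching_dist m (a m)); split=> [m|m s sS]; rewrite /a; case: arg_minnP => //.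
  by move=> s sS _; exists s.
by move=> s' _; exact.
Qed.

(** Markov's inequality for a weight that is 1 on [S] and exponentially large far from it. With
    [x = delta / 900], the gain [delta * x / 2] per half-edge minus the cost [(15 * x) ^+ 2] is
    exactly [(delta / 60) ^+ 2]. *)
Lemma far_from_large (S : {set {perm H}}) (delta kappa : R) :
  0 < delta <= 1 -> {subset S <= pmatch [set: H]} ->
  #|pmatch [set: H]|%:R * expR (- (kappa * #|H|%:R)) <= #|S|%:R ->
  (0 < #|pmatch [set: H]|)%N ->
  #|[set m | pmatch [set: H] m & [forall s in S, delta * #|H|%:R <= (matching_dist m s)%:R]]|%:R <=
    #|pmatch [set: H]|%:R * expR (- (((delta / 60) ^+ 2 - kappa) * #|H|%:R)).
Proof.
move=> /andP[d0 d1] SP SL P0; set P := #|pmatch _|%:R in SL *; set N := #|H|%:R in SL *.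
have PR : 0 < P by rewrite ltr0n.
have SR : 0 < #|S|%:R :> R by apply: lt_le_trans SL; rewrite mulr_gt0// expR_gt0.
have S0 : S != finset.set0 by rewrite -card_gt0 -(ltr0n R).
have [F [Fs FS]] := exists_near S0.
pose x : R := delta / 30 / 30; have x0 : 0 < x by rewrite /x !divr_gt0.
have x1 : x <= 1.
  rewrite !ler_pdivrMr//; lra.
(* A switch moves the distance by at most 4, hence the weight by a factor of at most
   [(1 + x) ^+ 4]. *)
pose y := (1 + x) ^+ 4 - 1; have x10 : 1 <= 1 + x by rewrite lerDl ltW.
have y0 : 0 <= y by rewrite subr_ge0 exprn_ege1.
have yx : y <= 15 * x.
  rewrite /y (exprM (1 + x) 2 2) sqrrD expr1n mul1r.
  have x2 : x ^+ 2 <= x by rewrite expr2 ler_piMl// ltW.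
  have x20 : 0 <= x ^+ 2 by exact: sqr_ge0.
  have xx : x *+ 2 = 2 * x by rewrite mulr_natl.
  apply: (@le_trans _ _ ((1 + 3 * x) ^+ 2 - 1)).
    by rewrite lerB// ler_sqr ?nnegrE; lra.
  rewrite expr2; rewrite expr2 in x2; move: {+}x {+}x2 {+}x0 => u; lra.
pose W m : R := (1 + x) ^+ F m.
have W0 m : 0 < W m by rewrite exprn_gt0// ltr_wpDr// ltW.
have H1 : (\sum_(m | pmatch [set: H] m) W m) * (\sum_(m | pmatch [set: H] m) (W m)^-1) <=
    P ^+ 2 * (1 + y ^+ 2) ^+ #|H|.
  rewrite -cardsT; apply: isoperimetric => // m a b /pmatchP[mK _] _ _.
  have -> : 1 + y = (1 + x) ^+ 4 by rewrite /y addrC subrK.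
  rewrite /W -exprD; apply: ler_weXn2l => //.
  have [s sS ->] := Fs m; apply: leq_trans (FS _ _ sS) _.
  by rewrite addnC; exact: matching_dist_conj.
have H2 : #|S|%:R <= \sum_(m | pmatch [set: H] m) (W m)^-1.
  rewrite (bigID (mem S))/=; apply: ler_wpDr.
    by apply: sumr_ge0 => m _; rewrite invr_ge0 ltW.
  rewrite (eq_bigl (mem S)) => [|m]; last first.
    by apply/andP/idP => [[]//|mS]; split=> //; exact: SP.
  rewrite -sum1_card natr_sum; apply: ler_sum => m mS.
  rewrite /W (_ : F m = 0%N) ?expr0 ?invr1//; apply/eqP; rewrite -leqn0.
  apply: leq_trans (FS _ _ mS) _; rewrite leqn0 cards_eq0; apply/eqP/setP => h.
  by rewrite !inE eqxx.
have {}H1 : (\sum_(m | pmatch [set: H] m) W m) * #|S|%:R <= P ^+ 2 * (1 + y ^+ 2) ^+ #|H|.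
  apply: le_trans H1; apply: ler_wpM2l => //.
  by apply: sumr_ge0 => m _; exact: ltW.
set B := [set m | _ & _].
have H3 : #|B|%:R * expR (delta * N * (x / 2)) <= \sum_(m | pmatch [set: H] m) W m.
  rewrite mulr_natl -sumr_const (bigID (mem B) (pmatch [set: H]))/=; apply: ler_wpDr.
    by apply: sumr_ge0 => m _; exact: ltW.
  rewrite [leRHS](eq_bigl (mem B)) => [|m]; last first.
    by rewrite /B !inE; case: (pmatch _ m).
  apply: ler_sum => m; rewrite inE => /andP[_ /forallP mB].
  have [s sS Fm] := Fs m; have := mB s; rewrite sS /= -Fm => dF.
  have e0 : 0 <= x / 2 by rewrite divr_ge0// ltW.
  apply: (@le_trans _ _ (expR ((F m)%:R * (x / 2)))).
    by rewrite ler_expR ler_wpM2r.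
  rewrite expRM_natl /W; apply: lerXn2r; rewrite ?nnegrE ?expR_ge0//;
    first by rewrite addr_ge0// ltW.
  rewrite -[1 + x]lnK ?posrE ?ler_expR; last by rewrite ltr_wpDr// ltW.
  have l1 : ln (1 + x)^-1 <= (1 + x)^-1 - 1.
    by apply: ln_le_sub1; rewrite invr_gt0 ltr_wpDr// ltW.
  rewrite lnV ?posrE in l1; last by rewrite ltr_wpDr// ltW.
  have l2 : (1 + x)^-1 <= 1 - x / 2.
    rewrite -[leLHS]mul1r ler_pdivrMr; last by rewrite ltr_wpDr// ltW.
    have : x * x <= x by rewrite ler_piMl// ltW.
    by move: {+}x {+}x0 => u u0; lra.
  lra.
have y2 : (1 + y ^+ 2) ^+ #|H| <= expR ((15 * x) ^+ 2 * N).
  have h : 1 + y ^+ 2 <= expR ((15 * x) ^+ 2).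
    apply: le_trans (expR_ge1Dx _); rewrite lerD2l.
    by rewrite ler_sqr ?nnegrE// mulr_ge0// ltW.
  rewrite [(15 * x) ^+ 2 * _]mulrC expRM_natl; apply: lerXn2r; rewrite ?nnegrE ?expR_ge0//.
  by rewrite addr_ge0// exprn_ge0.
have {}H3 : #|B|%:R * expR (delta * N * (x / 2)) * #|S|%:R <= P ^+ 2 * expR ((15 * x) ^+ 2 * N).
  apply: le_trans (le_trans (ler_wpM2r _ H3) H1) _ => //.
  by apply: ler_wpM2l => //; rewrite exprn_ge0// ltW.
have {}H3 : #|B|%:R * expR (delta * N * (x / 2)) * (P * expR (- (kappa * N))) <=
    P ^+ 2 * expR ((15 * x) ^+ 2 * N).
  by apply: le_trans H3; apply: ler_wpM2l => //; rewrite mulr_ge0 ?expR_ge0.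
rewrite expr2 mulrCA -[leRHS]mulrA ler_pM2l// -[leLHS]mulrA -expRD in H3.
rewrite -(ler_pM2r (expR_gt0 (delta * N * (x / 2) - kappa * N))).
apply: le_trans H3 _; rewrite -[leRHS]mulrA; apply: ler_wpM2l; first exact: ltW.
rewrite -expRD ler_expR /x !expr2.
by move: {+}delta {+}kappa {+}N => u v w; lra.
Qed.

End hamming.

(** * From subexponential to overwhelming probability *)

Section concentration.
Variables (R : realType) (E : nat).

Definition changed_vertices (V : finType) (m s : {perm V * 'I_E.+2}) : {set V} :=
  [set v | [exists i, m (v, i) != s (v, i)]].

Lemma card_changed_vertices (V : finType) (m s : {perm V * 'I_E.+2}) : (#|changed_vertices m s| <=
  matching_dist m s)%N.
Proof.
rewrite /matching_dist -[X in (_ <= X)%N]sum1_card (partition_big (fun h : V * 'I_E.+2 =>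
  h.1) (mem (changed_vertices m s)))/=; last first.
  by move=> [v i]; rewrite !inE => vi; apply/existsP; exists i.
rewrite -sum1_card; apply: leq_sum => v; rewrite inE => /existsP[i vi]; rewrite sum1_card.
by apply/card_gt0P; exists (v, i); apply/andP; rewrite inE.
Qed.

(** One constant [c] serves as hypothesis and as conclusion: half of the exponent in
    [far_from_large] pays for the density of [S], and the other half remains. *)
Lemma concentration (delta : R) : 0 < delta -> exists2 c : R, 0 < c &
  forall V : finType, ~~ odd #|{: V * 'I_E.+2}| ->
  forall S : {set {perm V * 'I_E.+2}}, {subset S <= config_matchings V E.+2} ->
  #|config_matchings V E.+2|%:R * expR (- (c * #|V|%:R)) <= #|S|%:R ->
  #|[set m in config_matchings V E.+2 | [forall s in S,
    delta * #|V|%:R < #|changed_vertices m s|%:R]]|%:R <=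
    #|config_matchings V E.+2|%:R * expR (- (c * #|V|%:R)).
Proof.
move=> dl0; pose D : R := E.+2%:R; have D0 : 0 < D by rewrite ltr0n.
(* Distances are normalised by the number of half-edges there and by the number of vertices here,
   whence the factor [D]; the cap at 1 is required by [far_from_large]. *)
pose dl := Order.min 1 (delta / D).
have dlp : 0 < dl by rewrite lt_min ltr01 divr_gt0.
have dl1 : dl <= 1 by rewrite ge_min lexx.
have dlD : D * dl <= delta by rewrite mulrC -ler_pdivlMr// ge_min lexx orbT.
exists (D * ((dl / 60) ^+ 2 / 2)); first by rewrite mulr_gt0// divr_gt0// exprn_gt0// divr_gt0.
move=> V oN S SP; set n := #|V|%:R : R; set P := #|config_matchings V E.+2|%:R : R => SL.
have NE : #|{: V * 'I_E.+2}|%:R = n * D :> R by rewrite card_prod card_ord natrM.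
have P0 : (0 < #|config_matchings V E.+2|)%N.
  by have [|m mP] := @pmatch_ex _ [set: V * 'I_E.+2]; [rewrite cardsT|apply/card_gt0P; exists m].
have := @far_from_large R _ S dl ((dl / 60) ^+ 2 / 2) _ SP.
rewrite dlp dl1 NE => /(_ isT) H.
have eE u : u * (n * D) = D * u * n by rewrite (mulrC n) mulrA (mulrC u).
have {}H := H _ P0; rewrite [_ / 2 * _]eE in H; have {}H := H SL.
apply: le_trans (_ : _ <= P * expR (- (((dl / 60) ^+ 2 - (dl / 60) ^+ 2 / 2) * (n * D)))) _.
  apply: le_trans H.
  rewrite ler_nat; apply: subset_leq_card; apply/fintype.subsetP => m; rewrite !inE.
  move=> /andP[-> /forallP mS] /=; apply/forallP => s; apply/implyP => sS.
  have := mS s; rewrite sS /= => /ltW h; apply: (@le_trans _ _ (delta * n)).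
    by rewrite eE ler_wpM2r.
  by apply: le_trans h _; rewrite ler_nat card_changed_vertices.
apply: ler_wpM2l => //; rewrite ler_expR lerN2 eE.
by move: ((dl / 60) ^+ 2) => u; have -> : u - u / 2 = u / 2 by lra.
Qed.

Variables (M : finType) (p : M * M -> R).
Hypothesis pL : edge_law p.
Hypothesis Hq : forall q : (M * M) * (M * M) -> R,
  edge_law q -> coupling p p q -> Sigma E.+2 q <= 2 * Sigma E.+2 p.
Variable k : nat.

(** A rewired vertex disturbs the balls in its [k]-neighbourhood only, whose size is bounded by
    [E.+3 ^ k]. *)
Lemma ball_good_diff (V : finType) (m s : {perm V * 'I_E.+2}) (f : V -> M) (dl e : R) :
  (0 < #|V|)%N -> #|changed_vertices m s|%:R <= e * #|V|%:R ->
  ball_good p k dl s f -> ball_good p k (dl + (E.+3 ^ k)%N%:R * e) m f.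
Proof.
move=> n0 ms /forallP g; apply/forallP => t.
have nR : 0 < #|V|%:R :> R by rewrite ltr0n.
pose X (m : {perm V * 'I_E.+2}) v := ball_at E k (fun x => f (endpoint m v x)).
have XE v : v \notin neighbourhood m (changed_vertices m s) k -> X m v = X s v.
  move=> vU; apply/ball_at_eq => x _ sx; congr f; apply: endpoint_agree vU sx.
  move=> u i; rewrite inE => /existsPn/(_ i); rewrite negbK => /eqP.
  by [].
have cd : `|(ball_count m f t)%:R - (ball_count s f t)%:R| <=
  #|neighbourhood m (changed_vertices m s) k|%:R :> R.
  have d1 : (#|[set v | X m v != X s v]| <= #|neighbourhood m (changed_vertices m s) k|)%N.
    by apply: subset_leq_card; apply/fintype.subsetP => v; rewrite inE; apply: contraNT => /XE ->.
  have d2 : [set v | X s v != X m v] = [set v | X m v != X s v].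
    by apply/setP => v; rewrite !inE eq_sym.
  rewrite ler_distl lerBlDr -!natrD !ler_nat; apply/andP; split.
    by apply: leq_trans (card_diff _ (X m) t) _; rewrite leq_add2l d2.
  by apply: leq_trans (card_diff _ (X s) t) _; rewrite leq_add2l.
have -> : (ball_count m f t)%:R / #|V|%:R - ball_weight p t =
   ((ball_count s f t)%:R / #|V|%:R - ball_weight p t) + ((ball_count m f t)%:R - (ball_count s f
     t)%:R) / #|V|%:R.
  by rewrite mulrBl [RHS]addrC subrKA.
apply: le_trans (ler_normD _ _) (lerD (g t) _).
rewrite normrM normfV (ger0_norm (ltW nR)) ler_pdivrMr//.
apply: le_trans cd _; apply: (@le_trans _ _ (E.+3 ^ k * #|changed_vertices m s|)%N%:R).
  by rewrite ler_nat card_neighbourhood.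
by rewrite natrM -mulrA ler_wpM2l.
Qed.

(** The matchings provided by [many_good] have density at least [exp (- c n)], so all but few
    matchings are close to one of them and share its good colourings, at the price of doubling the
    tolerance. *)
Lemma many_good_whp (delta eta : R) : 0 < delta -> 0 < eta ->
  exists2 c : R, 0 < c & exists n0 : nat, forall V : finType,
  (n0 <= #|V|)%N -> ~~ odd #|{: V * 'I_E.+2}| ->
  #|[set m in config_matchings V E.+2 | #|good_set p k delta m|%:R < expR (#|V|%:R * (Sigma E.+2 p
    - eta))]|%:R <=
    #|config_matchings V E.+2|%:R * expR (- (c * #|V|%:R)).
Proof.
move=> dl0 e0; pose L : R := (E.+3 ^ k)%N%:R.
have L0 : 0 < L by rewrite ltr0n expn_gt0.
pose e := delta / 2 / L; have ep : 0 < e by rewrite !divr_gt0.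
have eL : L * e = delta / 2 by rewrite /e mulrC divfK// gt_eqF.
have [c c0 HC] := concentration ep; exists c => //.
have d2 : 0 < delta / 2 by rewrite divr_gt0.
(* The loss in [many_good] must also stay below the rate [c] that concentration allows; [c] was
   fixed by the tolerance alone. *)
have ec : 0 < Order.min eta c by rewrite lt_min e0.
have [n0 n0P] := many_good pL Hq k d2 ec.
exists (maxn n0 1) => V; rewrite geq_max => /andP[nn n1] oN.
have {n0P} := n0P V nn oN; set S := [set m in _ | _] => SL.
apply: le_trans (HC V oN S _ _); last first.
- apply: le_trans SL; apply: ler_wpM2l => //; rewrite ler_expR lerN2 ler_wpM2r//.
  by rewrite ge_min lexx orbT.
- by move=> m; rewrite inE => /andP[].
rewrite ler_nat; apply: subset_leq_card; apply/fintype.subsetP => m; rewrite !inE.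
move=> /andP[-> lt] /=; apply/forallP => s; apply/implyP; rewrite inE => /andP[_ sg].
rewrite ltNge; apply/negP => ms; move: lt; rewrite ltNge => /negP; apply.
apply: (@le_trans _ _ (expR (#|V|%:R * (Sigma E.+2 p - Order.min eta c)))).
  by rewrite ler_expR ler_wpM2l// lerB// ge_min lexx.
apply: le_trans sg _; rewrite ler_nat; apply: subset_leq_card.
apply/fintype.subsetP => f; rewrite !inE => /(ball_good_diff n1 ms).
by apply: ball_goodW; rewrite -/L eL -splitr.
Qed.

End concentration.

Lemma uniq_map_inj (T1 T2 : eqType) (f : T1 -> T2) (s : seq T1) :
  uniq (map f s) -> {in s &, injective f}.
Proof.
elim: s => //= a s IH /andP[as' us] x y; rewrite !inE.
move=> /predU1P[->|xs] /predU1P[->|ys] // e; last exact: IH.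
  by rewrite e map_f in as'.
by rewrite -e map_f in as'.
Qed.

(** * Finite subtrees of labels and the walks along them *)

Section words.
Variable E : nat.
Implicit Types (x y z : seq nat) (L : seq (seq nat)).

(** Subtrees grown one vertex at a time, so that a first collision can be charged to the vertex just
    added. *)
Inductive tree_list : seq (seq nat) -> Prop :=
| tree_list_root : tree_list [:: [::]]
| tree_list_rcons L z i : tree_list L -> z \in L -> rcons z i \notin L ->
    in_tree E.+2 (rcons z i) -> tree_list (rcons L (rcons z i)).

Lemma tree_list_ex r : exists2 L, tree_list L &
  forall x, in_tree E.+2 x -> (size x <= r)%N -> x \in L.
Proof.
elim: r => [|r [L0 tL0 L0P]].
  by exists [:: [::]]; [exact: tree_list_root|case].
have [s sP] := small_words E.+2 r.+1.
suff [L [tL L0L LP]] : exists L, [/\ tree_list L, {subset L0 <= L} &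
    forall x, x \in s -> in_tree E.+2 x -> (size x <= r.+1)%N -> x \in L].
  by exists L => // x tx xr; apply: LP => //; apply: sP xr; exact: in_tree_le.
elim: {sP}s => [|x s [L [tL L0L LP]]]; first by exists L0; split.
have [xL|xL] := boolP (x \in L).
  by exists L; split=> // y; rewrite inE => /predU1P[->//|]; exact: LP.
have [/andP[tx xr]|nx] := boolP (in_tree E.+2 x && (size x <= r.+1)%N); last first.
  exists L; split=> // y; rewrite inE => /predU1P[->|]; last exact: LP.
  by move=> tx xr; rewrite tx xr in nx.
case/lastP: x => [|z i] in xL tx xr *.
  by move: xL; rewrite L0L// L0P.
exists (rcons L (rcons z i)); split.
- apply: tree_list_rcons => //; apply: L0L; apply: L0P; last by rewrite size_rcons in xr.
  by move: tx; rewrite in_tree_rcons => /andP[].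
- by move=> y yL; rewrite mem_rcons inE L0L ?orbT.
move=> y; rewrite inE mem_rcons inE => /predU1P[->|ys ty yr]; first by rewrite eqxx.
by rewrite LP ?orbT.
Qed.

Lemma tree_list0 L : tree_list L -> [::] \in L.
Proof. by elim=> // L' z i _ IH _ _ _; rewrite mem_rcons inE IH orbT. Qed.

Lemma tree_list_parent L z i : tree_list L -> rcons z i \in L -> z \in L.
Proof.
elim=> [|L' z' i' _ IH zL' _ _]; first by rewrite inE -size_eq0 size_rcons.
rewrite !mem_rcons !inE => /predU1P[/rcons_inj[-> _]|/IH ->]; rewrite ?orbT//.
by rewrite zL' orbT.
Qed.

Lemma tree_list_in_tree L x : tree_list L -> x \in L -> in_tree E.+2 x.
Proof.
by elim=> [|L' z' i' _ IH _ _ t]; rewrite ?mem_rcons inE; [move/eqP->|case/predU1P => [->|]].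
Qed.

End words.

Section arrivals.
Variables (V : finType) (E : nat).
Local Notation H := (V * 'I_E.+2)%type.
Implicit Types (m : {perm H}) (v : V) (x z : seq nat) (L : seq (seq nat)).

(* Half-edge by which the walk along [x] enters its last vertex. *)
Definition arrival m v x : H := if x is i :: z then walk m (m (v, inord i.-1)) z else (v, ord0).

(* Half-edge by which the walk along [z] continues to [rcons z i]. *)
Definition departure m v z i : H :=
  if z is [::] then (v, inord i.-1) else ((arrival m v z).1, lift (arrival m v z).2 (inord i.-1)).

Lemma endpoint_arrival m v x : endpoint m v x = (arrival m v x).1.
Proof. by case: x. Qed.

Lemma arrival_rcons m v z i : arrival m v (rcons z i) = m (departure m v z i).
Proof. by case: z => //= j z; rewrite /walk foldl_rcons. Qed.

Lemma departure_fst m v z i : (departure m v z i).1 = endpoint m v z.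
Proof. by rewrite endpoint_arrival; case: z. Qed.

Lemma departure_inj m v z i j : in_tree E.+2 (rcons z i) -> in_tree E.+2 (rcons z j) ->
  departure m v z i = departure m v z j -> i = j.
Proof.
rewrite !in_tree_rcons => /andP[_ zi] /andP[_ zj].
have inj n : (0 < i <= n.+1)%N -> (0 < j <= n.+1)%N ->
    inord i.-1 = inord j.-1 :> 'I_n.+1 -> i = j.
  move=> /andP[i0 ni] /andP[j0 nj] /(congr1 val); rewrite /= !inordK ?prednK//.
  by move=> /(congr1 succn); rewrite !prednK.
case: z zi zj => [|a z] /= zi zj /(congr1 snd)/=; first exact: inj.
by move/lift_inj; exact: inj.
Qed.

(** The walks along [L] read the matching only at their departures, so a switch that leaves these
    partners alone leaves the walks in place. *)
Lemma arrival_eq m m' v L : tree_list E L ->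
  (forall z i, rcons z i \in L -> m' (departure m v z i) = m (departure m v z i)) ->
  forall x, x \in L -> arrival m' v x = arrival m v x.
Proof.
elim=> [|L' z i tL' IH zL' _ _] mm x.
  by rewrite inE => /eqP ->.
have {}IH y : y \in L' -> arrival m' v y = arrival m v y.
  by apply: IH => z' i' zL; apply: mm; rewrite mem_rcons inE zL orbT.
rewrite mem_rcons inE => /predU1P[->|]; last exact: IH.
rewrite !arrival_rcons -mm ?mem_rcons ?mem_head//; congr (m' _).
by rewrite /departure; case: z zL' {mm} => // a z zL'; rewrite IH.
Qed.

(** While [L] embeds, the half-edge leading to a new vertex has been traversed in neither direction:
    the vertex and the half-edge of a departure determine its label, and the way back is excluded by
    [lift]. *)
Lemma departure_fresh m v L z i : tree_list E L -> z \in L -> rcons z i \notin L ->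
  in_tree E.+2 (rcons z i) -> involutive m -> (forall h, m h != h) ->
  {in L &, injective (endpoint m v)} -> forall z' i', rcons z' i' \in L ->
  departure m v z' i' != departure m v z i /\ departure m v z' i' != m (departure m v z i).
Proof.
move=> tL zL yL ty mK mF inj z' i' y'L.
have z'L := tree_list_parent tL y'L; split; apply/eqP => e.
  have zz : z' = z by apply: inj => //; rewrite -(departure_fst m v z' i') e departure_fst.
  case/negP: yL; move: e y'L; rewrite zz => e y'L.
  by rewrite -(departure_inj (tree_list_in_tree tL y'L) ty e).
have e' : arrival m v (rcons z' i') = departure m v z i by rewrite arrival_rcons e mK.
have zz : z = rcons z' i' by apply: inj => //; rewrite [RHS]endpoint_arrival e' departure_fst.
have : (departure m v z i).2 != (arrival m v z).2.
  have : z != [::] by rewrite zz -size_eq0 size_rcons.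
  by rewrite /departure; case: (z) => [|a l] _ //=; rewrite eq_sym neq_lift.
by rewrite {2}zz e' eqxx.
Qed.

End arrivals.

(** * Switching bound for collisions of walks *)

Section switching.
Variables (V : finType) (E : nat).
Local Notation H := (V * 'I_E.+2)%type.
Local Notation PMV := (config_matchings V E.+2).
Implicit Types (m : {perm H}).

Lemma pmatch_conj m a b : m \in PMV -> (m ^ tperm a b)%g \in PMV.
Proof.
move=> /pmatchP[mK mF]; apply/pmatchP; split=> h.
  by rewrite conjgE tpermV !permM tpermK mK tpermK.
rewrite conjgE tpermV !permM -(inj_eq (@perm_inj _ (tperm a b))) tpermK mF.
by rewrite !inE.
Qed.

Lemma conj_tpermK m a b : ((m ^ tperm a b) ^ tperm a b)%g = m.
Proof. by rewrite -conjgM tperm2 conjg1. Qed.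

(** If the next step hits the visited part, switch its arrival with almost any half-edge [g]. The
    walks along [L] survive, [g] is recovered as the new partner of the departure, and the old
    partner is one of at most [size L * d] half-edges. Double counting gives a probability of order
    [1 / n]. *)
Lemma switch_count (v : V) L z i : tree_list E L -> z \in L -> rcons z i \notin L ->
  in_tree E.+2 (rcons z i) ->
  (#|[set m in PMV | uniq (map (endpoint m v) L) && (endpoint m v (rcons z i) \in map (endpoint m
    v) L)]|
    * (#|{: H}| - (2 * size L + 2)) <= #|PMV| * (size L * E.+2))%N.
Proof.
move=> tL zL yL ty; set B := [set m in _ | _].
pose oh m := departure m v z i.
pose outs m := [seq departure m v (rev (behead (rev x))) (head 0%N (rev x)) | x <- L].
have outsP m z' i' : rcons z' i' \in L -> departure m v z' i' \in outs m.
  by move=> y'L; apply/mapP; exists (rcons z' i') => //; rewrite rev_rcons /= revK.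
(* Half-edges at which a switch could disturb the walks already made; there are at most
   [2 * size L + 2]. *)
pose X m := [:: oh m, m (oh m) & outs m ++ [seq m h | h <- outs m]].
pose Psi (mg : {perm H} * H) := ((mg.1 ^ tperm (mg.1 (oh mg.1)) mg.2)%g, mg.1 (oh mg.1)).
pose D := [set mg : {perm H} * H | (mg.1 \in B) && (mg.2 \notin X mg.1)].
have DL : (#|B| * (#|{: H}| - (2 * size L + 2)) <= #|D|)%N.
  rewrite -[X in (_ <= X)%N]sum1_card (partition_big (fun mg : {perm H} * H => mg.1) (mem B)) /=;
    last first.
    by move=> mg; rewrite inE => /andP[].
  rewrite -sum_nat_const; apply: leq_sum => m mB; rewrite sum1_card.
  have inj : injective (fun g : H => (m, g)) by move=> g g' [].
  apply: leq_trans (_ : #|(fun g : H => (m, g)) @: [set g | g \notin X m]| <= _)%N.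
    rewrite card_imset// -(cardsC [set g | g \notin X m]) leq_subLR addnC leq_add2r.
    rewrite (_ : ~: _ = [set g in X m]); last by apply/setP => g; rewrite !inE negbK.
    rewrite cardsE; apply: leq_trans (card_size _) _.
    by rewrite /X /= size_cat !size_map; lia.
  apply: subset_leq_card; apply/fintype.subsetP => _ /imsetP[g gX ->].
  by rewrite unfold_in inE /= mB eqxx andbT; move: gX; rewrite inE.
have key mg : mg \in D ->
    [/\ mg.1 \in PMV, (Psi mg).1 (oh mg.1) = mg.2, (forall x,
      x \in L -> arrival (Psi mg).1 v x = arrival mg.1 v x) &
        (mg.1 (oh mg.1)).1 \in map (endpoint mg.1 v) L].
  case: mg => m g; rewrite !inE /= => /andP[/andP[mP /andP[uL yin]]].
  rewrite !negb_or mem_cat negb_or => /and4P[gh gmh go gmo].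
  have [mK mF'] := pmatchP _ _ mP.
  have mF h : m h != h by rewrite mF' inE.
  have uinj := uniq_map_inj uL.
  split=> //.
  - by rewrite conjgE tpermV !permM (tpermD (mF _) gh) tpermL.
  - apply: arrival_eq => // z' i' y'L.
    have [fr1 fr2] := departure_fresh tL zL yL ty mK mF uinj y'L.
    have oo := outsP m _ _ y'L.
    apply: conj_tpermN.
    + by rewrite eq_sym.
    + by apply: contraNneq go => ->.
    + by rewrite (inj_eq (@perm_inj _ m)) eq_sym.
    + by apply: contraNneq gmo => ->; apply: map_f.
  - by rewrite endpoint_arrival arrival_rcons in yin.
pose T := [set mh : {perm H} * H | (mh.1 \in PMV) && (mh.2.1 \in map (endpoint mh.1 v) L)].
have TL : (#|T| <= #|PMV| * (size L * E.+2))%N.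
  rewrite -sum1_card (partition_big (fun mg : {perm H} * H => mg.1) (mem PMV)) /=; last first.
    by move=> mg; rewrite inE => /andP[].
  rewrite -[X in (_ <= X)%N]sum_nat_const; apply: leq_sum => m mP; rewrite sum1_card.
  apply: leq_trans (_ : #|[set h : H | h.1 \in map (endpoint m v) L]| <= _)%N; last first.
    rewrite (_ : [set h : H | _] = finset.setX [set u in map (endpoint m v) L] [set: 'I_E.+2]);
      last first.
      by apply/setP => -[a b]; rewrite !inE andbT.
    rewrite cardsX cardsT card_ord leq_mul2r cardsE; apply/orP; right.
    by apply: leq_trans (card_size _) _; rewrite size_map.
  have inj : injective (fun g : H => (m, g)) by move=> g g' [].
  rewrite -(card_imset _ inj); apply: subset_leq_card; apply/fintype.subsetP => -[m' h].
  rewrite unfold_in inE /= => /andP[/andP[_ hL] /eqP mm]; apply/imsetP; exists h;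
    last by rewrite mm.
  by rewrite inE -mm.
apply: leq_trans DL _; apply: leq_trans TL.
have Pinj : {in D &, injective Psi}.
  move=> [m g] [m' g'] mD mD' e; have [_ k1 k2 _] := key _ mD; have [_ k1' k2' _] := key _ mD'.
  have az : arrival m v z = arrival m' v z by rewrite -(k2 z zL) -(k2' z zL) e.
  have oo : oh m = oh m' by rewrite /oh /departure az; case: (z).
  have gg : g = g' by rewrite -[g]/((m, g).2) -[g']/((m', g').2) -k1 -k1' e /= oo.
  move: e => [e1 e2]; congr (_, _) => //.
  by rewrite -(conj_tpermK m (m (oh m)) g) e1 e2 gg conj_tpermK.
rewrite -(card_in_imset Pinj); apply: subset_leq_card; apply/fintype.subsetP => _ /imsetP[mg mD ->].
have [k0 _ k2 k3] := key _ mD; rewrite inE pmatch_conj//=.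
have -> : map (endpoint (mg.1 ^ tperm (mg.1 (oh mg.1)) mg.2)%g v) L = map (endpoint mg.1 v) L.
  by apply/eq_in_map => x xL; rewrite !endpoint_arrival -k2.
by [].
Qed.

End switching.

(** * Most vertices have a tree-like neighbourhood *)

Section treelike.
Variables (R : realType) (E : nat).
Local Notation PMV V := (config_matchings V E.+2).

Definition colliding (V : finType) (L : seq (seq nat)) (m : {perm V * 'I_E.+2}) : {set V} :=
  [set v | ~~ uniq (map (endpoint m v) L)].

Lemma collision_count (V : finType) (v : V) L : tree_list E L ->
  (#|[set m in PMV V | ~~ uniq (map (endpoint m v) L)]| * (#|{: V * 'I_E.+2}| - (2 * size L + 2))
     <= #|PMV V| * (size L ^ 2 * E.+2))%N.
Proof.
elim=> [|L' z i tL IH zL yL ty].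
  rewrite (_ : [set m in _ | _] = finset.set0) ?cards0//.
  by apply/setP => m; rewrite !inE /= andbF.
have := switch_count v tL zL yL ty; set B := [set m in _ | _ && _] => HB.
set A := [set m in _ | _] in IH; set C := [set m in _ | _].
have CAB : (#|C| <= #|A| + #|B|)%N.
  apply: leq_trans (leq_of_leqif (leq_card_setU _ _)).
  apply: subset_leq_card; apply/fintype.subsetP => m; rewrite !inE map_rcons rcons_uniq.
  by move=> /andP[-> /=]; rewrite negb_and negbK; case: (uniq _); rewrite ?orbT ?orbF.
rewrite size_rcons; set N := #|{: V * 'I_E.+2}| in IH HB *.
apply: (@leq_trans ((#|A| + #|B|) * (N - (2 * size L' + 2)))%N).
  by apply: leq_mul => //; lia.
rewrite mulnDl; apply: leq_trans (leq_add IH HB) _.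
by rewrite -mulnDr leq_mul2l -mulnDl leq_mul2r; apply/orP; right; apply/orP; right; nia.
Qed.

(** The mean number of colliding vertices is at most [2 * size L ^ 2], uniformly in [V]; Markov's
    inequality then handles half of the matchings. *)
Lemma few_bad_half L : tree_list E L -> exists n0 : nat, forall V : finType,
  (n0 <= #|V|)%N ->
  (#|PMV V| <= 2 * #|[set m in PMV V | (#|colliding L m| <= 4 * size L ^ 2)%N]|)%N.
Proof.
move=> tL; exists (4 * size L + 4)%N => V nn; set S := [set m in _ | _].
set l := size L in nn *; set n := #|V| in nn *; set P := #|PMV V|.
have l0 : (0 < l)%N by rewrite /l; have := tree_list0 tL; case: (L).
have H1 : ((\sum_(m in PMV V) #|colliding L m|) * (n * E.+2 - (2 * l + 2)) <=
  n * (P * (l ^ 2 * E.+2)))%N.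
  have -> : (\sum_(m in PMV V) #|colliding L m| = \sum_(v : V) #|[set m in PMV V | ~~ uniq (map
    (endpoint m v) L)]|)%N.
    under eq_bigr do rewrite -sum1_card big_mkcond /=.
    rewrite exchange_big /=; apply: eq_bigr => v _; rewrite -sum1_card -big_mkcondr /=.
    by apply: eq_bigl => m; rewrite !inE.
  rewrite [X in (_ <= X)%N](_ : _ = \sum_(v : V) P * (l ^ 2 * E.+2))%N;
    last by rewrite sum_nat_const.
  rewrite big_distrl /=; apply: leq_sum => v _.
  have := collision_count v tL; rewrite card_prod card_ord; exact.
have H2 : (n * E.+2 <= 2 * (n * E.+2 - (2 * l + 2)))%N by nia.
have H3 : ((\sum_(m in PMV V) #|colliding L m|) <= 2 * l ^ 2 * P)%N.
  rewrite -(leq_pmul2r (_ : 0 < n * E.+2)%N); last by nia.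
  apply: leq_trans (leq_mul (leqnn _) H2) _; rewrite mulnCA.
  apply: leq_trans (leq_mul (leqnn 2) H1) _; apply/eq_leq; nia.
have H4 : ((4 * l ^ 2) * #|[set m in PMV V | (4 * l ^ 2 < #|colliding L m|)%N]| <= 2 * l ^ 2 * P)%N.
  apply: leq_trans H3; rewrite mulnC -sum_nat_const.
  rewrite [X in (_ <= X)%N](bigID (fun m => 4 * l ^ 2 < #|colliding L m|)%N)/=.
  apply: leq_trans (leq_addr _ _).
  rewrite [X in (X <= _)%N](eq_bigl (fun m =>
    (m \in PMV V) && (4 * l ^ 2 < #|colliding L m|)%N)) => [|m]; last by rewrite !inE.
  by apply: leq_sum => m /andP[_ /ltnW].
have H5 : P = (#|S| + #|[set m in PMV V | (4 * l ^ 2 < #|colliding L m|)%N]|)%N.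
  rewrite /P -(cardID (fun m => #|colliding L m| <= 4 * l ^ 2)%N (PMV V)); congr (_ + _)%N.
    by apply: eq_card => m; rewrite !inE andbC.
  by apply: eq_card => m; rewrite !inE ltnNge andbC.
move: H4 H5; move: #|[set m in PMV V | (4 * l ^ 2 < #|colliding L m|)%N]| => b H4 H5; move: H4.
rewrite (_ : 4 * l ^ 2 = 2 * l ^ 2 * 2)%N; last by nia.
by rewrite -mulnA leq_pmul2l; [move: H5; lia|rewrite muln_gt0 expn_gt0 l0].
Qed.

(** The same upgrade by concentration as for good colourings, starting from density one half:
    rewiring a few vertices creates collisions only near them. *)
Lemma few_bad_whp L (delta : R) : tree_list E L -> 0 < delta ->
  exists2 c : R, 0 < c & exists n0 : nat, forall V : finType,
  (n0 <= #|V|)%N -> ~~ odd #|{: V * 'I_E.+2}| ->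
  #|[set m in PMV V | delta * #|V|%:R < #|colliding L m|%:R]|%:R <=
    #|PMV V|%:R * expR (- (c * #|V|%:R)).
Proof.
move=> tL dl0.
have [r rP] : exists r : nat, forall x, x \in L -> (size x <= r.+1)%N.
  exists (\sum_(x <- L) size x)%N => x xL; rewrite (big_rem x)//=.
  exact: leq_trans (leq_addr _ _) (leqnSn _).
pose K : R := (E.+3 ^ r)%N%:R; have K0 : 0 < K by rewrite ltr0n expn_gt0.
pose e := delta / 2 / K; have ep : 0 < e by rewrite !divr_gt0.
have eK : K * e = delta / 2 by rewrite /e mulrC divfK// gt_eqF.
have [c c0 HC] := concentration E ep; exists c => //.
have [n0 n0P] := few_bad_half tL.
pose l2 : R := (4 * size L ^ 2)%N%:R.
exists (maxn n0 (maxn (Num.truncn (1 / c)).+1 (Num.truncn (l2 / (delta / 2))).+1)) => V.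
rewrite !geq_max => /and3P[nn n1 n2] oN.
have {n1} n1 : 1 <= c * #|V|%:R.
  rewrite mulrC -ler_pdivrMr//; apply: ltW; apply: lt_le_trans (truncnS_gt _) _.
  by rewrite ler_nat.
have {n2} n2 : l2 <= delta / 2 * #|V|%:R.
  rewrite mulrC -ler_pdivrMr ?divr_gt0//; apply: ltW; apply: lt_le_trans (truncnS_gt _) _.
  by rewrite ler_nat.
have := n0P V nn; set S := [set m in _ | _] => SL.
apply: le_trans (HC V oN S _ _); last first.
- have S2 : #|PMV V|%:R / 2 <= #|S|%:R :> R by rewrite ler_pdivrMr// -natrM ler_nat mulnC.
  apply: le_trans S2; apply: ler_wpM2l => //.
  rewrite expRN lef_pV2 ?posrE ?expR_gt0//; apply: le_trans (expR_ge1Dx _); lra.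
- by move=> m; rewrite inE => /andP[].
rewrite ler_nat; apply: subset_leq_card; apply/fintype.subsetP => m; rewrite !inE.
move=> /andP[-> lt] /=; apply/forallP => s; apply/implyP; rewrite inE => /andP[_ sg].
rewrite ltNge; apply/negP => ms; move: lt; rewrite ltNge => /negP; apply.
have sub : colliding L m \subset colliding L s :|: neighbourhood m (changed_vertices m s) r.
  apply/fintype.subsetP => v; rewrite [v \in colliding L m]inE finset.in_setU => vm.
  rewrite -[_ || _]negbK negb_or inE negbK; apply/negP => /andP[vs vn].
  case/negP: vm; rewrite (_ : map (endpoint m v) L = map (endpoint s v) L)//.
  apply/eq_in_map => x xL; apply: endpoint_agree vn (rP _ xL).
  by move=> u i; rewrite inE => /existsPn/(_ i); rewrite negbK => /eqP.
apply: le_trans (_ : _ <= (4 * size L ^ 2 + E.+3 ^ r * #|changed_vertices m s|)%N%:R) _.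
  rewrite ler_nat; apply: leq_trans (subset_leq_card sub) _.
  apply: leq_trans (leq_of_leqif (leq_card_setU _ _)) _.
  by rewrite leq_add// card_neighbourhood.
rewrite natrD -/l2 natrM -/K; apply: le_trans (lerD n2 (ler_wpM2l _ ms)) _; first exact: ltW.
by rewrite mulrA eK -mulrDl -splitr.
Qed.

End treelike.

(** * Probability that the matching gives a simple graph *)

Section simple.
Variables (V : finType) (E : nat).
Local Notation H := (V * 'I_E.+2)%type.
Local Notation PMV := (config_matchings V E.+2).
Implicit Types (m : {perm H}) (h g : H).

Definition multiple_half_edges m : {set H} :=
  [set h | ((m h).1 == h.1) || [exists j, (j != h.2) && ((m (h.1, j)).1 == (m h).1)]].

Definition nbrs m h : {set V} := h.1 |: [set (m (h.1, j)).1 | j : 'I_E.+2].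

Lemma mem_nbrs m h g : g.1 = h.1 -> (m g).1 \in nbrs m h.
Proof.
by case: g => v j /= ->; rewrite !inE; apply/orP; right; apply/imsetP; exists j.
Qed.

Lemma multiple_half_edgesP m h : reflect ((m h).1 = h.1 \/ exists g, [/\ g.1 = h.1,
  g != h & (m g).1 = (m h).1])
  (h \in multiple_half_edges m).
Proof.
rewrite inE; apply: (iffP orP) => [[/eqP|/existsP[j /andP[jh /eqP e]]]|[->|[[v j] [/= e1 e2 e3]]]].
- by left.
- right; exists (h.1, j); split=> //; apply: contraNneq jh => <-.
  by [].
- by left.
right; apply/existsP; exists j; move: e3; rewrite e1 => ->; rewrite eqxx andbT.
by apply: contraNneq e2 => ->; rewrite e1 -surjective_pairing.
Qed.

Section one_switch.
Variables (m m' : {perm H}) (h g : H).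
Hypotheses (mK : involutive m) (m'K : involutive m').
Hypotheses (mh : m' h = m g) (mg : m' g = m h).
Hypothesis rest : forall o, o \notin [:: h; g; m h; m g] -> m' o = m o.
Hypotheses (c1 : (m g).1 \notin nbrs m h) (c2 : g.1 \notin nbrs m (m h)).
Hypothesis c3 : (m g).1 <> g.1.

Let hin : h.1 \in nbrs m h. Proof. by rewrite !inE eqxx. Qed.
Let mhin : (m h).1 \in nbrs m (m h). Proof. by rewrite !inE eqxx. Qed.

(** By [c1], the new partner of [h] sits at a vertex that is neither that of [h] nor one of its
    neighbours. *)
Lemma switched_left : h \notin multiple_half_edges m'.
Proof.
apply/multiple_half_edgesP => -[|[w [wh1 wh]]]; rewrite mh; first by move=> e; move: c1;
  rewrite e hin.
have [|/rest ->] := boolP (w \in [:: h; g; m h; m g]); last first.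
  by move=> e; move: c1; rewrite -e mem_nbrs.
rewrite !inE (negbTE wh) /= => /or3P[]/eqP wE.
- rewrite wE mg => e; move: c1; rewrite -e.
  by rewrite (mem_nbrs m (erefl h.1)).
- rewrite wE -mg m'K => e; exact: c3.
by move: c1; rewrite -wE wh1 hin.
Qed.

Lemma switched_right : g \notin multiple_half_edges m'.
Proof.
apply/multiple_half_edgesP => -[|[w [wh1 wg]]]; rewrite mg; first by move=> e; move: c2;
  rewrite -e mhin.
have [|/rest ->] := boolP (w \in [:: h; g; m h; m g]); last first.
  by move=> e; move: c2; rewrite -wh1 -{1}(mK w) (mem_nbrs m (_ : (m w).1 = (m h).1)).
rewrite !inE (negbTE wg) /= => /or3P[]/eqP wE.
- by rewrite wE mh => e; move: c1; rewrite e (mem_nbrs m (erefl h.1)).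
- by move: c2; rewrite -wh1 wE mhin.
by case: c3; rewrite -wE.
Qed.

End one_switch.

(** The half-edges [g] unsuitable for a switch with [h] are near [h], near its partner, or
    themselves multiple. They are too few to exhaust the half-edges, so some switch removes [h]
    without creating a multiple half-edge. *)
Lemma switch_simple m K : m \in PMV -> (#|multiple_half_edges m| <=
  K)%N -> multiple_half_edges m != finset.set0 ->
  (2 * (E.+3 * E.+2) + K < #|{: H}|)%N ->
  exists m' a b, [/\ m' \in PMV, m = (m' ^ tperm a b)%g & (#|multiple_half_edges m'| <
    #|multiple_half_edges m|)%N].
Proof.
move=> mP mK' /set0Pn[h hB] NK; have [mK mF'] := pmatchP _ _ mP.
have mF o : m o != o by rewrite mF' inE.
have cn o : (#|nbrs m o| <= E.+3)%N.
  apply: leq_trans (leq_of_leqif (leq_card_setU _ _)) _; rewrite cards1 add1n ltnS.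
  by apply: leq_trans (leq_imset_card _ _) _; rewrite card_ord.
pose X1 := m @^-1: finset.setX (nbrs m h) [set: 'I_E.+2].
pose X2 := finset.setX (nbrs m (m h)) [set: 'I_E.+2].
have cX : (#|X1 :|: X2 :|: multiple_half_edges m| < #|{: H}|)%N.
  apply: leq_ltn_trans NK; apply: leq_trans (leq_of_leqif (leq_card_setU _ _)) _.
  apply: leq_add => //; apply: leq_trans (leq_of_leqif (leq_card_setU _ _)) _.
  rewrite /X1 /X2 card_preimset; last exact: perm_inj.
  rewrite !cardsX cardsT card_ord mul2n -addnn; apply: leq_add; exact: leq_mul.
have [g gX] : exists g, g \notin X1 :|: X2 :|: multiple_half_edges m.
  apply/existsP; rewrite -negb_forall; apply: contraL cX => /forallP al.
  by rewrite -leqNgt -cardsT; apply: subset_leq_card; apply/fintype.subsetP => o _; exact: al.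
move: gX; rewrite 2!finset.in_setU !negb_or -andbA => /and3P[gX1 gX2 gB].
have c1 : (m g).1 \notin nbrs m h by move: gX1;
  rewrite inE (surjective_pairing (m g)) finset.in_setX finset.in_setT andbT.
have c2 : g.1 \notin nbrs m (m h) by move: gX2;
  rewrite (surjective_pairing g) finset.in_setX finset.in_setT andbT.
have c3 : (m g).1 <> g.1 by move=> e; case/multiple_half_edgesP: gB; left.
have gh : g != h by apply: contraNneq c1 => ->; exact: mem_nbrs.
have gmh : g != m h by apply: contraNneq c2 => ->; rewrite !inE eqxx.
have hmg : h != m g by apply: contraNneq gmh => ->; rewrite mK.
pose m' := (m ^ tperm h g)%g; have m'P : m' \in PMV by exact: pmatch_conj.
have [m'K _] := pmatchP _ _ m'P.
have e1 : m' h = m g by rewrite /m' conjgE tpermV !permM tpermL tpermD// eq_sym.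
have e2 : m' g = m h by rewrite /m' conjgE tpermV !permM tpermR tpermD// eq_sym.
have rest o : o \notin [:: h; g; m h; m g] -> m' o = m o.
  rewrite !inE !negb_or => /and4P[oh og omh omg].
  apply: conj_tpermN; rewrite 1?eq_sym//.
    by rewrite -(inj_eq (@perm_inj _ m)) mK.
  by rewrite -(inj_eq (@perm_inj _ m)) mK.
have L1 := switched_left m'K e1 e2 rest c1 c3.
have R1 := switched_right mK e1 e2 rest c1 c2 c3.
(* Exchanging the ends of both edges turns the switch into itself, which yields the two other
   half-edges. *)
have e1' : m' (m h) = m (m g) by rewrite mK -e2 m'K.
have e2' : m' (m g) = m (m h) by rewrite mK -e1 m'K.
have rest' o : o \notin [:: m h; m g; m (m h); m (m g)] -> m' o = m o.
  by move=> oN; apply: rest; move: oN; rewrite !mK !inE !negb_or => /and4P[-> -> -> ->].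
have c1' : (m (m g)).1 \notin nbrs m (m h) by rewrite mK.
have c2' : (m g).1 \notin nbrs m (m (m h)) by rewrite mK.
have c3' : (m (m g)).1 <> (m g).1 by rewrite mK => e; case: c3.
have L2 := switched_left m'K e1' e2' rest' c1' c3'.
have R2 := switched_right mK e1' e2' rest' c1' c2' c3'.
exists m', h, g; split=> //; first by rewrite conj_tpermK.
apply: proper_card; apply/properP; split; last by exists h.
have notC o : o \in multiple_half_edges m' -> o \notin [:: h; g; m h; m g].
  move=> oB; rewrite !inE; apply/negP => /or4P[]/eqP oE; move: oB; rewrite oE; exact/negP.
apply/fintype.subsetP => o oB; have oC := notC _ oB.
case/multiple_half_edgesP: (oB) => [|[w' [wh1 ww]]]; rewrite (rest o oC); first by move=> e;
  apply/multiple_half_edgesP; left.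
move=> e; have w'B : w' \in multiple_half_edges m'.
  by apply/multiple_half_edgesP; right; exists o; split; rewrite // 1?eq_sym// e (rest o oC).
by rewrite (rest _ (notC _ w'B)) in e; apply/multiple_half_edgesP; right; exists w'.
Qed.

(** At most [K] switches lead to a simple matching, and each is undone by naming a pair of
    half-edges. *)
Lemma simple_count K : (2 * (E.+3 * E.+2) + K < #|{: H}|)%N ->
  (#|[set m in PMV | (#|multiple_half_edges m| <= K)%N]| <=
   #|[set m in PMV | multiple_half_edges m == finset.set0]| * (#|{: H}| ^ 2) ^ K)%N.
Proof.
move=> NK; suff : forall j, (j <= K)%N -> (#|[set m in PMV | (#|multiple_half_edges m| <= j)%N]| <=
   #|[set m in PMV | multiple_half_edges m == finset.set0]| * (#|{: H}| ^ 2) ^ j)%N by exact.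
have N0 : (0 < #|{: H}|)%N by apply: leq_ltn_trans NK.
elim=> [_|j IH jK].
  rewrite expn0 muln1; apply: subset_leq_card; apply/fintype.subsetP => m.
  by rewrite !inE leqn0 cards_eq0.
rewrite expnS mulnCA mulnC; apply: leq_trans (leq_mul (IH (ltnW jK)) (leqnn _)).
set B := [set m in _ | (_ <= j)%N].
pose ps (x : {perm H} * (H * H)) := (x.1 ^ tperm x.2.1 x.2.2)%g.
apply: (@leq_trans #|ps @: finset.setX B [set: H * H]|); last first.
  by apply: leq_trans (leq_imset_card _ _) _; rewrite cardsX cardsT card_prod mulnn.
apply: subset_leq_card; apply/fintype.subsetP => m; rewrite inE => /andP[mP mj].
have [h0] : exists h : H, h \in predT by apply/card_gt0P.
have [mj' _|mj' _] := leqP #|multiple_half_edges m| j.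
  apply/imsetP; exists (m, (h0, h0)); first by rewrite finset.in_setX finset.in_setT andbT inE mP.
  by rewrite /ps /= tperm1 conjg1.
have ne : multiple_half_edges m != finset.set0 by rewrite -card_gt0 (leq_ltn_trans _ mj').
have [m' [a [b [m'P mE lt]]]] := switch_simple mP (leq_trans mj jK) ne NK.
apply/imsetP; exists (m', (a, b)) => //; rewrite finset.in_setX finset.in_setT andbT inE m'P /=.
by rewrite -ltnS (leq_trans lt).
Qed.

End simple.

Section simple_lower.
Variables (R : realType) (E : nat).

(** A loop or a double edge is a collision of two walks of length at most 1. *)
Lemma multiple_half_edges_colliding (V : finType) L (m : {perm V * 'I_E.+2}) :
  tree_list E L -> (forall x, in_tree E.+2 x -> (size x <= 1)%N -> x \in L) ->
  (#|multiple_half_edges m| <= #|colliding L m| * E.+2)%N.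
Proof.
move=> tL LP; have -> : (#|colliding L m| * E.+2 = #|finset.setX (colliding L m) [set: 'I_E.+2]|)%N.
  by rewrite cardsX cardsT card_ord.
apply: subset_leq_card; apply/fintype.subsetP => -[v i] /multiple_half_edgesP hB.
rewrite finset.in_setX finset.in_setT andbT inE /=; apply/negP => /uniq_map_inj inj.
have jL (j : 'I_E.+2) : [:: j.+1] \in L by apply: LP => //=; rewrite ltn_ord.
have ph (j : 'I_E.+2) : endpoint m v [:: j.+1] = (m (v, j)).1 by rewrite /= inord_val.
case: hB => /= [e|[[u j] /= [-> ne e]]].
  by have := inj [:: i.+1] [::] (jL i) (tree_list0 tL); rewrite ph e => /(_ erefl).
have := inj [:: j.+1] [:: i.+1] (jL j) (jL i); rewrite !ph => /(_ e) [] /val_inj ij.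
by rewrite ij eqxx in ne.
Qed.

(** Half of the matchings have at most [K] multiple half-edges, with [K] independent of [V], so
    simple ones form a polynomial fraction of all. *)
Lemma simple_lower (c : R) : 0 < c -> exists n0 : nat, forall V : finType,
  (n0 <= #|V|)%N ->
  #|config_matchings V E.+2|%:R * expR (- (c * #|V|%:R)) <=
    #|[set m in config_matchings V E.+2 | multiple_half_edges m == finset.set0]|%:R.
Proof.
move=> c0; have [L tL LP] := tree_list_ex E 1.
have [n0 n0P] := few_bad_half tL; pose K := (4 * size L ^ 2 * E.+2)%N.
pose C : R := (2 * K).+1%:R * (1 + ln E.+3%:R).
have [n1 n1P] := ln_little_o C c0.
exists (maxn n0 (maxn n1 (2 * (E.+3 * E.+2) + K).+1)) => V; rewrite !geq_max => /and3P[nn0 nn1 nn2].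
set n := #|V| in nn0 nn1 nn2 *; set N := #|{: V * 'I_E.+2}|.
have NE : N = (n * E.+2)%N by rewrite /N card_prod card_ord.
have N0 : (0 < N)%N by rewrite NE muln_gt0; apply/andP; split=> //; exact: leq_ltn_trans nn2.
have NK : (2 * (E.+3 * E.+2) + K < N)%N by apply: leq_trans nn2 _; rewrite NE leq_pmulr.
have := simple_count NK; set S := [set m in _ | multiple_half_edges m == _];
  set B := [set m in _ | _] => BS.
have hB : (#|config_matchings V E.+2| <= 2 * #|B|)%N.
  apply: leq_trans (n0P V nn0) _; rewrite leq_mul2l /=; apply: subset_leq_card.
  apply/fintype.subsetP => m; rewrite !inE => /andP[-> bm] /=.
  by apply: leq_trans (multiple_half_edges_colliding m tL LP) _; rewrite leq_mul2r bm orbT.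
have P1 : (#|config_matchings V E.+2| <= #|S| * (2 * (N ^ 2) ^ K))%N.
  by apply: leq_trans hB _; rewrite mulnCA leq_mul2l BS orbT.
rewrite expRN ler_pdivrMr ?expR_gt0//.
apply: (@le_trans _ _ (#|S| * (2 * (N ^ 2) ^ K))%N%:R); first by rewrite ler_nat.
rewrite natrM; apply: ler_wpM2l => //.
apply: (@le_trans _ _ ((N.+1 ^ (2 * K).+1)%N%:R)).
  rewrite ler_nat -expnM expnS; apply: leq_mul; first by rewrite ltnS.
  by case: (2 * K)%N => // e; rewrite leq_exp2r.
have l0 : 0 < N.+1%:R :> R by rewrite ltr0n.
rewrite natrX -(lnK l0) -expRM_natl ler_expR; apply: le_trans (n1P _ nn1).
rewrite /C -mulrA; apply: ler_wpM2l => //.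
apply: (@le_trans _ _ (ln E.+3%:R + ln n.+1%:R)).
  by rewrite -lnM ?posrE ?ltr0n// ler_ln ?posrE -?natrM ?ltr0n// ler_nat NE; nia.
by apply: addr_le_mulr1; exact: ln_nat_ge0.
Qed.

End simple_lower.

(** * Uniform regular graphs from simple matchings *)

Section graph_of.
Variables (E n : nat).
Local Notation V := 'I_n.
Local Notation H := (V * 'I_E.+2)%type.
Implicit Types (m : {perm H}) (h g : H) (G : {set {set V}}).

Definition graph_of m : {set {set V}} := [set [set h.1; (m h).1]%SET | h : H]%SET.

Definition simple_matchings : {set {perm H}} := [set m in config_matchings V E.+2 |
  multiple_half_edges m == finset.set0]%SET.

Lemma simple_matching_inv m : m \in simple_matchings -> involutive m.
Proof. by rewrite inE => /andP[/pmatchP[]]. Qed.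

Lemma simple_matching_loop m h : m \in simple_matchings -> (m h).1 != h.1.
Proof.
rewrite inE => /andP[_ /eqP b]; apply/negP => /eqP e.
by have : h \in multiple_half_edges m by [apply/multiple_half_edgesP; left]; rewrite b inE.
Qed.

Lemma simple_matching_inj m h g : m \in simple_matchings -> h.1 = g.1 -> (m h).1 = (m g).1 -> h = g.
Proof.
rewrite inE => /andP[_ /eqP b] hg e; apply/eqP/negPn/negP => ne.
by have : g \in multiple_half_edges m by [apply/multiple_half_edgesP; right; exists h];
  rewrite b inE.
Qed.

Lemma graph_adj_of m x y : m \in simple_matchings ->
  graph_adj (graph_of m) x y = [exists i, (m (x, i)).1 == y].
Proof.
move=> mS; apply/andP/existsP => [[xy /imsetP[h _ e]]|[i /eqP <-]]; last first.
  split; first by rewrite eq_sym (simple_matching_loop (x, i)).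
  by apply/imsetP; exists (x, i).
have : x \in [set h.1; (m h).1]%SET by rewrite -e !inE eqxx.
have : y \in [set h.1; (m h).1]%SET by rewrite -e !inE eqxx orbT.
rewrite !inE => /orP[]/eqP yE /orP[]/eqP xE.
- by rewrite yE xE eqxx in xy.
- by exists (m h).2; rewrite xE -surjective_pairing simple_matching_inv// yE.
- by exists h.2; rewrite xE -surjective_pairing yE.
- by rewrite yE xE eqxx in xy.
Qed.

Lemma graph_of_regular m : m \in simple_matchings -> graph_of m \in regular_graphs E.+2 n.
Proof.
move=> mS; rewrite inE; apply/andP; split.
  apply/forallP => e; apply/implyP => /imsetP[h _ ->].
  by rewrite cards2 (eq_sym h.1) simple_matching_loop.
apply/forallP => x; rewrite -[X in _ == X]card_ord.
have inj : injective (fun i : 'I_E.+2 => (m (x, i)).1).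
  by move=> i j e; have /(_ erefl e)[] := @simple_matching_inj m (x, i) (x, j) mS.
rewrite -(card_imset _ inj); apply/eqP/eq_card => y; rewrite inE graph_adj_of//.
apply/existsP/imsetP => [[i /eqP <-]|[i _ ->]]; by exists i.
Qed.

Lemma regular_adj_inj G G' : G \in regular_graphs E.+2 n -> G' \in regular_graphs E.+2 n ->
  graph_adj G =2 graph_adj G' -> G = G'.
Proof.
suff sub : forall G G', G \in regular_graphs E.+2 n -> graph_adj G =2 graph_adj G' -> G \subset G'.
  move=> r r' e; apply/eqP; rewrite finset.eqEsubset !sub//.
move=> {}G {}G'; rewrite inE => /andP[/forallP G2 _] e; apply/fintype.subsetP => s sG.
have := G2 s; rewrite sG /= => /cards2P[x [y [xy sE]]].
by have := e x y; rewrite /graph_adj xy -sE sG /= => <-.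
Qed.

(* The matchings with a given graph form an orbit of the group of relabellings
   of the half-edges at each vertex, which acts freely. *)
Definition relabel_fun (s : {ffun V -> {perm 'I_E.+2}}) (h : H) : H := (h.1, s h.1 h.2).

Lemma relabel_inj s : injective (relabel_fun s).
Proof. by move=> [u i] [v j] [] /= <- /perm_inj ->. Qed.

Definition relabel s : {perm H} := perm (@relabel_inj s).

Lemma relabel_fst s h : (relabel s h).1 = h.1.
Proof. by rewrite permE. Qed.

Lemma relabelV_fst s h : ((relabel s)^-1 h)%g.1 = h.1.
Proof. by rewrite -[in RHS](permKV (relabel s) h) relabel_fst. Qed.

Lemma relabelJ m s h : (m ^ relabel s)%g h = relabel s (m ((relabel s)^-1 h)%g).
Proof. by rewrite conjgE !permM. Qed.

Lemma simple_matching_conj m s : m \in simple_matchings -> (m ^ relabel s)%g \in simple_matchings.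
Proof.
move=> mS; rewrite inE; apply/andP; split.
  have := mS; rewrite inE => /andP[/pmatchP[mK mF] _]; apply/pmatchP; split=> h.
    by rewrite !relabelJ permK mK permKV.
  rewrite relabelJ -(inj_eq (@perm_inj _ (relabel s)^-1)%g) permK mF.
  by rewrite !inE.
apply/eqP/setP => h; rewrite [RHS]inE; apply/negP => /multiple_half_edgesP[|[g [gh ne]]].
  rewrite relabelJ relabel_fst -(relabelV_fst s h); apply/eqP; exact: simple_matching_loop.
rewrite !relabelJ !relabel_fst => e; case/eqP: ne.
by apply: (@perm_inj _ (relabel s)^-1)%g; apply: simple_matching_inj e => //; rewrite !relabelV_fst.
Qed.

Lemma graph_of_conj m s : m \in simple_matchings -> graph_of (m ^ relabel s)%g = graph_of m.
Proof.
move=> mS; apply: regular_adj_inj; rewrite ?graph_of_regular ?simple_matching_conj// => x y.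
rewrite !graph_adj_of ?simple_matching_conj//; apply/existsP/existsP => -[i /eqP <-].
  exists ((relabel s)^-1 (x, i))%g.2; rewrite relabelJ relabel_fst.
  by rewrite -{1}[x](relabelV_fst s (x, i)) -surjective_pairing.
exists (relabel s (x, i)).2; rewrite -{1}[x](relabel_fst s (x, i)) -surjective_pairing.
by rewrite relabelJ relabel_fst permK.
Qed.

Lemma relabel_free m s t : m \in simple_matchings -> (m ^ relabel s = m ^ relabel t)%g -> s = t.
Proof.
move=> mS /permP e; suff st : relabel s = relabel t.
  apply/ffunP => v; apply/permP => i.
  by move/permP: st => /(_ (v, i)); rewrite !permE => -[].
apply: (@invg_inj _ (relabel s)); apply/permP => h; apply: (simple_matching_inj mS).
  by rewrite !relabelV_fst.
by have := congr1 fst (e h); rewrite !relabelJ !relabel_fst.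
Qed.

Lemma relabel_trans m m' : m \in simple_matchings -> m' \in simple_matchings ->
  graph_of m = graph_of m' ->
  exists s, m' = (m ^ relabel s)%g.
Proof.
move=> mS mS' e.
have ex h : exists j, (m (h.1, j)).1 == (m' h).1.
  apply/existsP; rewrite -graph_adj_of// e graph_adj_of//; apply/existsP; exists h.2.
  by rewrite -surjective_pairing.
(* The half-edge of [m] at the vertex of [h] that leads where [h] leads in [m']. *)
pose t h : 'I_E.+2 := xchoose (ex h).
have tP h : (m (h.1, t h)).1 = (m' h).1 by apply/eqP; exact: (xchooseP (ex h)).
have tinj v : injective (fun i => t (v, i)).
  move=> i j eij; have := tP (v, j); rewrite /= -eij (tP (v, i)) => e'.
  by have /(_ erefl e')[] := @simple_matching_inj m' (v, i) (v, j) mS'.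
pose s : {ffun V -> {perm 'I_E.+2}} := [ffun v => (perm (@tinj v))^-1]%g.
have sv h : relabel s (h.1, t h) = h.
  rewrite permE /relabel_fun /= ffunE; case: h => v i /=; congr (_, _).
  by rewrite -[t (v, i)](permE (@tinj v)) permK.
have ts h : ((relabel s h).1, t (relabel s h)) = h by apply: (@perm_inj _ (relabel s)); rewrite sv.
exists s; suff key h : m' (relabel s h) = relabel s (m h).
  by apply/permP => h; rewrite relabelJ -key permKV.
rewrite -[LHS]sv; congr (relabel s _); apply: (simple_matching_inj mS) => /=.
  by rewrite -tP ts.
by rewrite (tP (m' _)) !simple_matching_inv// relabel_fst.
Qed.

(** Number the neighbours of each vertex in the order of enumeration, and match the two half-edges
    that name each other's vertex. *)
Lemma regular_realized G : G \in regular_graphs E.+2 n -> exists2 m,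
  m \in simple_matchings & graph_of m = G.
Proof.
move=> GR; have := GR; rewrite inE => /andP[_ /forallP dG].
pose N x := [set y | graph_adj G x y]%SET.
have cN x : #|N x| = E.+2 by exact/eqP/dG.
pose F (h : H) : V := enum_val (cast_ord (esym (cN h.1)) h.2).
have FN h : graph_adj G h.1 (F h) by have := enum_valP (cast_ord (esym (cN h.1)) h.2); rewrite inE.
have Finj u i j : F (u, i) = F (u, j) -> i = j by move=> /enum_val_inj/cast_ord_inj.
have ex x y : graph_adj G x y -> exists i, F (x, i) == y.
  move=> xy; have yN : y \in N x by rewrite inE.
  exists (cast_ord (cN x) (enum_rank_in yN y)); rewrite /F /=.
  by rewrite cast_ordK enum_rankK_in.
have exh h : exists i, F (F h, i) == h.1 by apply: ex; rewrite graph_adjC.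
pose mf h : H := (F h, xchoose (exh h)).
have mfF h : F (mf h) = h.1 by apply/eqP; exact: (xchooseP (exh h)).
have mfK : involutive mf.
  move=> h; apply: (_ : forall a b : H, a.1 = b.1 -> F a = F b -> a = b).
  - by move=> [a i] [b j] /= -> /Finj ->.
  - by rewrite /= mfF.
  - by rewrite mfF.
pose m : {perm H} := perm (inv_inj mfK).
have mE h : m h = mf h by rewrite permE.
have mS : m \in simple_matchings.
  rewrite inE; apply/andP; split.
    apply/pmatchP; split=> h; first by rewrite !mE mfK.
    rewrite inE mE; apply/negbTE/eqP => /(congr1 fst)/= e.
    by have := FN h; rewrite e graph_adjI.
  apply/eqP/setP => h; rewrite [RHS]inE; apply/negP => /multiple_half_edgesP[|[g [gh ne]]];
    rewrite !mE /=.
    by move=> e; have := FN h; rewrite e graph_adjI.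
  by case: h g gh ne => u i [w j] /= -> ne /Finj ji; rewrite ji eqxx in ne.
exists m => //; apply: regular_adj_inj => //; first exact: graph_of_regular.
move=> x y; rewrite graph_adj_of//; apply/existsP/idP => [[i /eqP <-]|/ex[i ?]].
  by rewrite mE; exact: FN (x, i).
by exists i; rewrite mE.
Qed.

Lemma card_fibre G : G \in regular_graphs E.+2 n ->
  #|[set m in simple_matchings | graph_of m == G]%SET| = #|{: {ffun V -> {perm 'I_E.+2}}}|.
Proof.
move=> GR; have [m mS mG] := regular_realized GR.
have inj : injective (fun s => m ^ relabel s)%g by move=> s t; exact: relabel_free.
rewrite -(card_imset predT inj); apply: eq_card => m'; rewrite finset.in_set.
apply/andP/imsetP => [[m'S /eqP m'G]|[s _ ->]].
  have [|s ->] := relabel_trans mS m'S; first by rewrite mG m'G.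
  by exists s.
by rewrite graph_of_conj// mG eqxx simple_matching_conj.
Qed.

Lemma card_simple_matchings (A : pred {set {set V}}) :
  (#|[set m in simple_matchings | A (graph_of m)]%SET| =
   #|[set G in regular_graphs E.+2 n | A G]%SET| * #|{: {ffun V -> {perm 'I_E.+2}}}|)%N.
Proof.
rewrite -sum1_card (partition_big graph_of (mem [set G in regular_graphs E.+2 n | A G]%SET))/=;
  last first.
  by move=> m; rewrite finset.in_set => /andP[mS Am]; rewrite finset.in_set Am graph_of_regular.
rewrite -sum_nat_const; apply: eq_bigr => G; rewrite inE => /andP[GR AG].
rewrite sum1_card -(card_fibre GR); apply: eq_card => m.
by rewrite unfold_in !inE -andbA; congr (_ && _); case: eqP => [->|]; rewrite ?AG ?andbF.
Qed.

(** All regular graphs come from the same number of simple matchings, so a uniform matching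
    conditioned to be simple gives a uniform graph. *)
Lemma prob_regularE (R : realType) (A : pred {set {set V}}) :
  prob_regular R E.+2 A = #|[set m in simple_matchings | A (graph_of m)]%SET|%:R /
    #|simple_matchings|%:R.
Proof.
rewrite card_simple_matchings /prob_regular.
have -> : #|simple_matchings| = (#|regular_graphs E.+2 n| * #|{: {ffun V -> {perm 'I_E.+2}}}|)%N.
  have := card_simple_matchings xpredT;
    rewrite (_ : [set m in simple_matchings | _] = simple_matchings)%SET; last first.
    by apply/setP => m; rewrite inE andbT.
  by move=> ->; congr (#|pred_of_set _| * _)%N; apply/setP => G; rewrite inE andbT.
have K0 : #|{: {ffun V -> {perm 'I_E.+2}}}|%:R != 0 :> R.
  by rewrite pnatr_eq0 -lt0n; apply/card_gt0P; exists [ffun=> 1%g].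
by rewrite !natrM -mulf_div divff// mulr1.
Qed.

End graph_of.

(** Conditioning on simplicity divides by at least [exp (- c n / 2)], which costs half of the
    rate. *)
Lemma prob_regular_whp (R : realType) (E : nat) (c : R) : 0 < c -> exists n0 : nat,
  forall n : nat, (n0 <= n)%N ->
  forall (A : pred {set {set 'I_n}}) (B : {set {perm 'I_n * 'I_E.+2}}),
  (forall m, m \in simple_matchings E n -> A (graph_of m) -> m \in B) ->
  #|B|%:R <= #|config_matchings 'I_n E.+2|%:R * expR (- (c * n%:R)) ->
  prob_regular R E.+2 A <= expR (- (c / 2 * n%:R)).
Proof.
move=> c0; have c2 : 0 < c / 2 by rewrite divr_gt0.
have [n0 n0P] := simple_lower E c2; exists n0 => n nn A B AB Bc.
have := n0P 'I_n; rewrite card_ord => /(_ nn) S1; rewrite -/(simple_matchings E n) in S1.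
rewrite prob_regularE; have [S0|S0] := eqVneq #|simple_matchings E n| 0%N.
  by rewrite S0 invr0 mulr0 expR_ge0.
rewrite ler_pdivrMr ?ltr0n ?lt0n//.
apply: (@le_trans _ _ #|B|%:R).
  rewrite ler_nat; apply: subset_leq_card; apply/fintype.subsetP => m.
  by rewrite finset.in_set => /andP[mS Am]; exact: AB.
apply: le_trans Bc _; rewrite mulrC.
apply: le_trans (ler_wpM2l (expR_ge0 _) S1); rewrite mulrCA -expRD mulrC.
apply: ler_wpM2l => //; rewrite ler_expR; move: (n%:R : R) => x; lra.
Qed.

(** * Breadth-first search on a tree-like ball *)

Section bfs_ball.
Variables (V : finType) (adj : rel V) (d : nat) (v : V) (ph : seq nat -> V) (rad : nat).
Hypotheses (adjC : symmetric adj) (adjI : irreflexive adj).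
Hypothesis ph0 : ph [::] = v.
Hypothesis ph_adj : forall x w, in_tree d x -> (size x <= rad)%N ->
  adj (ph x) w <-> exists2 y, tree_adj d x y & w = ph y.
Hypothesis ph_inj : forall x y, in_tree d x -> in_tree d y ->
  (size x <= rad.+1)%N -> (size y <= rad.+1)%N -> ph x = ph y -> x = y.

Lemma tree_adj_size x y : tree_adj d x y -> (size y <= (size x).+1)%N.
Proof. by move=> /and3P[_ _ /orP[]/andP[_ /eqP ->]]//; lia. Qed.

Lemma ph_adjE x y : in_tree d x -> in_tree d y -> (size x <= rad)%N -> (size y <= rad)%N ->
  adj (ph x) (ph y) = tree_adj d x y.
Proof.
move=> tx ty xR yR; apply/idP/idP => [/(ph_adj _ tx xR)[y' xy' /ph_inj]|xy]; last first.
  by apply/(ph_adj _ tx xR); exists y.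
move=> -> //; first by case/and3P: xy'.
  exact: leqW.
by apply: leq_trans (tree_adj_size xy') _.
Qed.

Section one_priority.
Variable s : seq V.
Hypotheses (us : uniq s) (s_all : forall w, w \in s).
Local Notation lab k := (bfs_lab adj s v k).

(** Invariant of the search: labels agree with the tree up to a rooted automorphism. It records
    depth and parenthood only, because the order among siblings depends on the priorities. *)
Record ball_labels (k : nat) : Prop := BallLabels {
  bl_word : forall w l, lab k w = Some l -> [/\ in_tree d l, (size l <= k)%N &
     exists x, [/\ in_tree d x, size x = size l & w = ph x]];
  bl_all : forall x, in_tree d x -> (size x <= k)%N -> exists l, lab k (ph x) = Some l;
  bl_parent : forall z i l', in_tree d (rcons z i) -> (size z < k)%N ->
     lab k (ph (rcons z i)) = Some l' -> exists l j, l' = rcons l j /\ lab k (ph z) = Some l;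
  bl_onto : forall l, in_tree d l -> (size l <= k)%N -> exists w, lab k w = Some l }.

Let nch (z : seq nat) : nat := if z is [::] then d else d.-1.

Lemma ball_labelsP k : (k <= rad)%N -> ball_labels k.
Proof.
elim: k => [_|k IH kR].
  have l0 w l : lab 0 w = Some l -> w = v /\ l = [::].
    by rewrite /bfs_lab /=; case: eqP => // -> [<-].
  have lv : lab 0 v = Some [::] by rewrite /bfs_lab /= eqxx.
  split=> [w l /l0[-> ->]|[|//] _ _|z i l' _|[|//] _ _] //.
  - by split=> //; exists [::].
  - by exists [::]; rewrite ph0.
  - by exists v.
have [IHA IHB IHC IHD] := IH (ltnW kR).
set L := lab k in IHA IHB IHC IHD.
have szL x l : in_tree d x -> (size x <= rad.+1)%N -> L (ph x) = Some l -> size x = size l.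
  move=> tx xR /IHA[_ lk [x' [tx' x'l /ph_inj e]]]; rewrite -x'l e//.
  by rewrite x'l; lia.
have unl x : in_tree d x -> size x = k.+1 -> L (ph x) = None.
  move=> tx xk; case E : (L (ph x)) => [l|//]; have [_ lk _] := IHA _ _ E.
  by move: lk; rewrite -(szL _ _ tx _ E) ?xk ?ltnn// ltnW.
have fl1 w l : L w = None -> first_label adj L w = Some l ->
    exists z i, [/\ in_tree d (rcons z i), size z = k, L (ph z) = Some l & w = ph (rcons z i)].
  move=> Lw /first_labelP[[x xw Lx] _].
  have [_ lk [z [tz zl xE]]] := IHA _ _ Lx; subst x.
  have zk : (size z <= k)%N by rewrite zl.
  have [y zy wE] := (ph_adj w tz (leq_trans zk (ltnW kR))).1 xw.
  have [_ ty] := and3P zy; have yk : (k < size y)%N.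
    rewrite ltnNge; apply/negP => yk; have [l' Ly] := IHB y ty yk.
    by rewrite wE Ly in Lw.
  case/orP => [|/andP[_ /eqP e]]; last by move: zk; rewrite e; lia.
  move=> /is_offspringP[i yE]; exists z, i; rewrite -yE; split=> //.
  by move: yk; rewrite yE size_rcons; lia.
have fl2 z i l : in_tree d (rcons z i) -> size z = k -> L (ph z) = Some l ->
    first_label adj L (ph (rcons z i)) = Some l.
  move=> tzi zk Lz; have tz : in_tree d z by move: tzi; rewrite in_tree_rcons => /andP[].
  have Lw : L (ph (rcons z i)) = None by apply: unl; rewrite // size_rcons zk.
  have zR : (size z <= rad)%N by rewrite zk ltnW.
  have zw : adj (ph z) (ph (rcons z i)).
    apply/(ph_adj _ tz zR); exists (rcons z i) => //; apply/and3P; split=> //.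
    by apply/orP; left; apply/is_offspringP; exists i.
  have := first_label_ex zw (_ : isSome (L (ph z))); rewrite Lz => /(_ isT).
  case E : (first_label adj L _) => [l1|//] _.
  have [z' [i' [tz' zk' Lz' e]]] := fl1 _ _ Lw E.
  have /rcons_inj[zz _] : rcons z i = rcons z' i'.
    by apply: ph_inj => //; rewrite size_rcons ?zk ?zk' ltnS ltnW.
  by rewrite -Lz' -zz Lz.
(* The first labelled neighbour of each child of [z] is the image of [z], so siblings are the images
   of these children, in an order decided by [s]. *)
have offE z l : in_tree d z -> size z = k -> L (ph z) = Some l ->
    perm_eq (offspring adj s L l) [seq ph (rcons z i) | i <- iota 1 (nch z)].
  move=> tz zk Lz; have mi i : (i \in iota 1 (nch z)) = in_tree d (rcons z i).
    by rewrite mem_iota in_tree_rcons tz /= add1n ltnS /nch.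
  apply: uniq_perm; first exact: filter_uniq.
    rewrite map_inj_in_uniq ?iota_uniq// => i j; rewrite !mi => ti tj e.
    by apply: rcons_injr; apply: ph_inj e => //; rewrite size_rcons zk ltnS ltnW.
  move=> w; rewrite mem_filter s_all andbT; apply/andP/mapP => [[Lw /eqP F]|[i]].
    have Lw' : L w = None by case: (L w) Lw.
    have [z' [i [tz' zk' Lz' e]]] := fl1 _ _ Lw' F.
    have zz : z' = z.
      have [_ _ _] := IHA _ _ Lz; apply: ph_inj => //.
      - by move: tz'; rewrite in_tree_rcons => /andP[].
      - by rewrite zk' leqW// ltnW.
      - by rewrite zk leqW// ltnW.
      exact: (bfs_lab_inj s_all Lz' Lz).
    by exists i; rewrite ?mi -zz.
  rewrite mi => ti ->; rewrite unl ?size_rcons ?zk//; split=> //.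
  by apply/eqP; exact: fl2.
have szo z l : in_tree d z -> size z = k -> L (ph z) = Some l -> size (offspring adj s L l) = nch z.
  by move=> tz zk Lz; rewrite (perm_size (offE _ _ tz zk Lz)) size_map size_iota.
have nchE z l : size z = size l -> nch z = nch l by case: z => [|? ?]; case: l.
have stepN w : L w = None -> lab k.+1 w = omap (fun l =>
  rcons l (index w (offspring adj s L l)).+1) (first_label adj L w).
  by move=> Lw; rewrite /bfs_lab iterS /bfs_step -/(bfs_lab adj s v k) -/L Lw.
have stepS w l : L w = Some l -> lab k.+1 w = Some l by exact: bfs_labS.
have par z i : in_tree d (rcons z i) -> in_tree d z by rewrite in_tree_rcons => /andP[].
split.
- move=> w l; case Lw : (L w) => [l1|].
    by rewrite (stepS _ _ Lw) => -[<-]; have [? ? ?] := IHA _ _ Lw; split=> //; exact: leqW.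
  rewrite stepN//; case F : first_label => [l1|//] [<-].
  have [z [i [tz zk Lz wE]]] := fl1 _ _ Lw F; have [tl lk _] := IHA _ _ Lz.
  have zl : size z = size l1 by apply: szL Lz; [exact: par tz|rewrite zk leqW// ltnW].
  rewrite size_rcons -zl zk; split=> //; last by exists (rcons z i); rewrite size_rcons zk.
  rewrite in_tree_rcons tl /= -/(nch l1) -(nchE _ _ zl) -(szo _ _ (par _ _ tz) zk Lz) index_mem.
  by apply: mem_offspring; rewrite ?Lw.
- move=> x tx; rewrite leq_eqVlt => /orP[/eqP xk|xk]; last first.
    by have [l Lx] := IHB x tx xk; exists l; exact: stepS.
  case/lastP: x => [//|z i] in tx xk *; have zk : size z = k by move: xk; rewrite size_rcons => -[].
  have [l Lz] := IHB z (par _ _ tx) (eq_leq zk).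
  by rewrite stepN ?unl// (fl2 _ _ _ tx zk Lz) /=; eexists.
- move=> z i l' tx zk; have [ltzk|] := boolP (size z < k)%N.
    have zik : (size (rcons z i) <= k)%N by rewrite size_rcons.
    have [l1 L1] := IHB _ tx zik.
    rewrite (stepS _ _ L1) => -[<-]; have [l [j [-> Lz]]] := IHC z i l1 tx ltzk L1.
    by exists l, j; split=> //; exact: stepS.
  rewrite -leqNgt => kz; have {kz zk} zk : size z = k by apply/eqP; rewrite eqn_leq kz -ltnS zk.
  have [l Lz] := IHB z (par _ _ tx) (eq_leq zk).
  rewrite stepN; last by rewrite unl// size_rcons zk.
  by rewrite (fl2 _ _ _ tx zk Lz) => -[<-]; eexists; eexists; split; [reflexivity|exact: stepS].
move=> l tl; rewrite leq_eqVlt => /orP[/eqP lk|lk]; last first.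
  by have [w Lw] := IHD l tl lk; exists w; exact: stepS.
case/lastP: l => [//|l j] in tl lk *; have {}lk : size l = k by move: lk; rewrite size_rcons => -[].
have [w0 Lw0] := IHD l (par _ _ tl) (eq_leq lk).
have [_ _ [z [tz zl wE]]] := IHA _ _ Lw0; subst w0; rewrite lk in zl.
set o := offspring adj s L l; move: tl; rewrite in_tree_rcons -/(nch l) => /and3P[tl j0 jn].
have jo : (j.-1 < size o)%N by rewrite (szo _ _ tz zl Lw0) (nchE z l) ?lk// prednK.
exists (nth v o j.-1); have := mem_nth v jo.
rewrite {1}mem_filter => /andP[/andP[N /eqP F] _].
rewrite stepN; last by case: (L _) N.
rewrite F /= -/o index_uniq//; last exact: filter_uniq.
by rewrite prednK.
Qed.

End one_priority.

(** The search runs for [#|V|] rounds, but labels of length at most [rad] are final after [rad]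
    rounds. *)
Lemma bfs_label_ball s w l : (rad <= #|V|)%N ->
  (bfs_label adj s v w == Some l) && (size l <= rad)%N = (bfs_lab adj s v rad w == Some l).
Proof.
move=> nR; apply/andP/eqP => [[/eqP /bfs_lab_size[_ Lw] lR]|Lw]; first exact: bfs_lab_mono lR Lw.
by split; [apply/eqP; exact: bfs_lab_mono nR Lw|have [] := bfs_lab_size Lw].
Qed.

End bfs_ball.

(** * Automorphisms of the finite ball *)

Section ball_automorphisms.
Variables (d rad : nat) (B : seq (seq nat)).
Hypothesis BP : forall x, (x \in B) = in_tree d x && (size x <= rad)%N.
Local Notation T := (seq_sub B).
Implicit Types (x y : T) (t : {perm T}).

(** The relation preserved is directed from parent to offspring, which forces the root and the
    levels to be preserved. *)
Definition ball_aut : {set {perm T}} :=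
  [set t : {perm T} | [forall x : T, forall y : T,
    is_offspring (val (t x)) (val (t y)) == is_offspring (val x) (val y)]]%SET.

Lemma ball_autP t x y : t \in ball_aut ->
  is_offspring (val (t x)) (val (t y)) = is_offspring (val x) (val y).
Proof. by rewrite inE => /forallP/(_ x)/forallP/(_ y)/eqP. Qed.

Lemma ball_in_tree x : in_tree d (val x).
Proof. by have := valP x; rewrite BP => /andP[]. Qed.

Lemma ball_size x : (size (val x) <= rad)%N.
Proof. by have := valP x; rewrite BP => /andP[]. Qed.

Lemma ball_word z : in_tree d z -> (size z <= rad)%N -> exists x : T, val x = z.
Proof. by move=> tz zr; have zB : z \in B by [rewrite BP tz]; exists (SeqSub zB). Qed.

Lemma ball_parent x z i : val x = rcons z i -> exists y : T, val y = z.
Proof.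
move=> e; have := ball_in_tree x; have := ball_size x.
by rewrite e size_rcons in_tree_rcons => zr /andP[tz _]; apply: ball_word => //; exact: ltnW.
Qed.

Lemma is_offspring_rcons z i : is_offspring z (rcons z i).
Proof. by apply/is_offspringP; exists i. Qed.

Lemma ball_autV t : t \in ball_aut -> t^-1%g \in ball_aut.
Proof.
move=> tA; rewrite inE; apply/forallP => x; apply/forallP => y.
by rewrite -(ball_autP (t^-1 x)%g (t^-1 y)%g tA) !permKV.
Qed.

Lemma ball_autM t u : t \in ball_aut -> u \in ball_aut -> (t * u)%g \in ball_aut.
Proof.
move=> tA uA; rewrite inE; apply/forallP => x; apply/forallP => y.
by rewrite !permM !ball_autP.
Qed.

Lemma ball_aut_root t x : t \in ball_aut -> val x = [::] -> val (t x) = [::].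
Proof.
move=> tA x0; case/lastP E : (val (t x)) => [//|z i].
have [y yz] := ball_parent E; have := is_offspring_rcons z i.
rewrite -E -yz -(permKV t y) ball_autP// x0 => /is_offspringP[j].
by case: (val _).
Qed.

Lemma ball_aut_size t x : t \in ball_aut -> size (val (t x)) = size (val x).
Proof.
move=> tA; have [n] := ubnP (size (val x)); elim: n x => // n IH x.
case/lastP xE : (val x) => [|z i]; first by rewrite (ball_aut_root tA xE).
rewrite size_rcons ltnS => zn; have [y yz] := ball_parent xE.
have := is_offspring_rcons z i; rewrite -xE -{1}yz -(ball_autP _ _ tA) => /is_offspringP[j ->].
by rewrite size_rcons IH ?yz.
Qed.

Lemma ball_aut_adj t x y : t \in ball_aut ->
  tree_adj d (val (t x)) (val (t y)) = tree_adj d (val x) (val y).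
Proof. by move=> tA; rewrite /tree_adj !ball_in_tree !ball_autP. Qed.

End ball_automorphisms.

Lemma shortlex_anti : antisymmetric shortlex.
Proof. by move=> x y /le_anti []. Qed.

(** * The random labelling as a uniform automorphism *)

Section ball_law.
Variables (R : realType) (M : pointedFinType) (V : finType) (G : {set {set V}}).
Variables (d : nat) (v : V) (ph : seq nat -> V) (rad : nat).
Local Notation adj := (graph_adj G).
Hypothesis ph0 : ph [::] = v.
Hypothesis ph_adj : forall x w, in_tree d x -> (size x <= rad)%N ->
  adj (ph x) w <-> exists2 y, tree_adj d x y & w = ph y.
Hypothesis ph_inj : forall x y, in_tree d x -> in_tree d y ->
  (size x <= rad.+1)%N -> (size y <= rad.+1)%N -> ph x = ph y -> x = y.
Hypothesis nR : (rad <= #|V|)%N.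
Variable B : seq (seq nat).
Hypothesis BP : forall x, (x \in B) = in_tree d x && (size x <= rad)%N.
Local Notation T := (seq_sub B).
Local Notation A := (ball_aut B).
Local Notation lab s := (bfs_lab adj (priority s) v).

Let blP (s : {perm V}) k : (k <= rad)%N -> ball_labels adj d v ph (priority s) k.
Proof. by apply: ball_labelsP => //;
  first [exact: priority_uniq|exact: mem_priority|exact: graph_adjC|exact: graph_adjI]. Qed.

Let ph_injT (x y : T) : ph (val x) = ph (val y) -> x = y.
Proof.
move=> e; apply: val_inj; apply: ph_inj e; rewrite ?(ball_in_tree BP)//;
  by rewrite leqW// (ball_size BP).
Qed.

(** [u l] is the position in the tree of the vertex that receives the label [l]. *)
Lemma label_perm (s : {perm V}) : exists2 u : {perm T}, u \in A &
  forall l : T, lab s rad (ph (val (u l))) = Some (val l).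
Proof.
have [bA bB bC bD] := blP s (leqnn rad).
have ex (l : T) : exists x : T, lab s rad (ph (val x)) == Some (val l).
  have [w Lw] := bD _ (ball_in_tree BP l) (ball_size BP l).
  have [_ lr [x [tx xl wE]]] := bA _ _ Lw.
  have xr : (size x <= rad)%N by rewrite xl.
  have [y yx] := ball_word BP tx xr.
  by exists y; rewrite yx -wE Lw.
pose uf (l : T) := xchoose (ex l).
have ufP l : lab s rad (ph (val (uf l))) = Some (val l) by apply/eqP; exact: (xchooseP (ex l)).
have uinj : injective uf.
  by move=> l l' e; apply: val_inj; have := ufP l; rewrite e ufP => -[].
pose u : {perm T} := perm uinj.
have uP l : lab s rad (ph (val (u l))) = Some (val l) by rewrite permE.
exists u => //; rewrite inE; apply/forallP => l; apply/forallP => l'; apply/eqP.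
apply/is_offspringP/is_offspringP => -[j e].
  have ul : in_tree d (rcons (val (u l)) j) by rewrite -e (ball_in_tree BP).
  have sl : (size (val (u l)) < rad)%N by have := ball_size BP (u l'); rewrite e size_rcons.
  have := uP l'; rewrite e => /(bC _ _ _ ul sl)[l2 [j2 [-> ]]].
  by rewrite uP => -[<-]; exists j2.
have := uP l'; rewrite e => Lr; have [_ _ [x [tx xl wE]]] := bA _ _ Lr.
have xu : x = val (u l').
  apply: ph_inj => //; rewrite ?(ball_in_tree BP)// ?xl -?e leqW// ?(ball_size BP)//.
have xr : (size x <= rad)%N by rewrite xu (ball_size BP).
rewrite -xu; case/lastP: x => [|z i] in xl tx wE xu xr *; first by rewrite size_rcons in xl.
have sz : (size z < rad)%N by move: xr; rewrite size_rcons.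
rewrite xu -/(rcons z i) in wE; rewrite -xu in Lr.
have [l2 [j2 [/rcons_inj[<- _] Lz]]] := bC _ _ _ tx sz Lr.
exists i; congr rcons; have := bfs_lab_inj (mem_priority s) Lz (uP l).
move=> /ph_inj -> //; rewrite ?(ball_in_tree BP)//.
- by move: tx; rewrite in_tree_rcons => /andP[].
- by rewrite leqW// ltnW.
- by rewrite leqW// (ball_size BP).
Qed.

(** Within the radius the labelled graph is the tree itself, and the only trace of the priorities is
    the permutation [u] of the colours. *)
Lemma restr_labelled (f : V -> M) (X : seq nat -> M) (s : {perm V}) (u : {perm T}) :
  u \in A -> (forall l : T, lab s rad (ph (val (u l))) = Some (val l)) ->
  (restr rad (labelled_graph R G f v s) = restr rad (tree_graph R (fun w : tree_vertex d =>
    X (val w)))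
     :> rooted_graph R M) <->
  forall l : T, f (ph (val (u l))) = X (val l).
Proof.
move=> uA uP; have [bA bB bC bD] := blP s (leqnn rad).
pose L := bfs_label adj (priority s) v.
have LE w x : (size x <= rad)%N -> (L w == Some x) = (lab s rad w == Some x).
  by move=> xr; rewrite -(bfs_label_ball _ _ _ _ _ nR) xr andbT.
have colE (l : T) : lab_col adj (priority s) v f (val l) = Some (f (ph (val (u l)))).
  rewrite /lab_col -/L; case: pickP => [w|/(_ (ph (val (u l))))]; last first.
    by rewrite LE ?(ball_size BP)// uP eqxx.
  rewrite LE ?(ball_size BP)// => /eqP Lw.
  by rewrite (bfs_lab_inj (mem_priority s) Lw (uP l)).
have labT w x : (size x <= rad)%N -> L w == Some x -> exists2 l : T, val l = x & w = ph (val (u l)).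
  move=> xr; rewrite LE// => /eqP Lw; have [tx _ _] := bA _ _ Lw.
  have [l lx] := ball_word BP tx xr; exists l => //.
  by apply: (bfs_lab_inj (mem_priority s) Lw); rewrite -lx.
split=> [e l|e].
  have := congr1 (fun g : rooted_graph R M => gcol g (val l)) e.
  rewrite /= /restr_col (ball_size BP) /= colE /tree_col.
  case: insubP => [w _ wl|/negP[]]; last exact: ball_in_tree.
  by case=> ->; congr X; exact: wl.
apply: bfs_graph_eq; rewrite /=.
  apply/funext => x; rewrite /restr_col /=; case: ifP => // xr.
  have [tx|tx] := boolP (in_tree d x).
    have [l lx] := ball_word BP tx xr; rewrite -lx colE e /tree_col.
    by case: insubP => [w _ /= ->//|/negP[]]; exact: ball_in_tree.
  rewrite /tree_col insubF; last exact/negbTE.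
  rewrite /lab_col -/L; case: pickP => // w /(labT _ _ xr)[l lx _].
  by rewrite -lx (ball_in_tree BP) in tx.
apply/funext => x; apply/funext => y; rewrite /restr_adj /=.
case: (boolP (size x <= rad)%N) => //= xr; case: (boolP (size y <= rad)%N) => //= yr.
apply/existsP/idP => [[w /existsP[w' /and3P[Lx Ly ww]]]|xy].
  have [l lx wE] := labT _ _ xr Lx; have [l' ly wE'] := labT _ _ yr Ly.
  rewrite -lx -ly -(ball_aut_adj BP _ _ uA).
  by rewrite -(ph_adjE ph_adj ph_inj) ?(ball_in_tree BP) ?(ball_size BP)// -wE -wE'.
have [tx ty _] := and3P xy.
have [l lx] := ball_word BP tx xr; have [l' ly] := ball_word BP ty yr.
exists (ph (val (u l))); apply/existsP; exists (ph (val (u l'))).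
rewrite !LE// -lx -ly !uP !eqxx /=.
by rewrite (ph_adjE ph_adj ph_inj) ?(ball_in_tree BP) ?(ball_size BP)// (ball_aut_adj BP)// lx ly.
Qed.

Lemma extend_ball (t : {perm T}) : exists g : {perm V}, forall x, g (ph (val x)) = ph (val (t x)).
Proof.
pose gf (w : V) : V := if [pick x : T | ph (val x) == w] is Some x then ph (val (t x)) else w.
have gfP x : gf (ph (val x)) = ph (val (t x)).
  rewrite /gf; case: pickP => [y /eqP/ph_injT -> //|/(_ x)].
  by rewrite eqxx.
have gfN w : (forall x : T, ph (val x) != w) -> gf w = w.
  by move=> N; rewrite /gf; case: pickP => // y; rewrite (negbTE (N y)).
have dec w : (exists x : T, w = ph (val x)) \/ (forall x : T, ph (val x) != w).
  have [[x /eqP <-]|N] := pselect (exists x : T, ph (val x) == w); first by left; exists x.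
  by right=> x; apply/negP => xw; apply: N; exists x.
have ginj : injective gf.
  move=> w w'; case: (dec w) => [[x ->]|N]; case: (dec w') => [[y ->]|N'].
  - by rewrite !gfP => /ph_injT/perm_inj ->.
  - by rewrite gfP (gfN w')// => e; have := N' (t x); rewrite e eqxx.
  - by rewrite gfP (gfN w)// => e; have := N (t y); rewrite e eqxx.
  by rewrite !gfN.
by exists (perm ginj) => x; rewrite permE.
Qed.

Lemma eq_pmap_filter (C : eqType) (F : V -> option C) (a b : pred V) (r : seq V) :
  (forall x, F x -> a x = b x) -> pmap F [seq x <- r | a x] = pmap F [seq x <- r | b x].
Proof.
move=> ab; elim: r => //= x r IH; have := ab x.
case Fx : (F x) => [c|]; first by move=> /(_ isT) <-; case: (a x); rewrite /= ?Fx/= IH.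
by move=> _; case: (a x); case: (b x); rewrite /= ?Fx /= IH.
Qed.

(** Moving the priorities by an automorphism of the ball moves the labels along. Although [g] is no
    automorphism of the graph, the first [rad] rounds only use edges inside the ball. *)
Lemma bfs_equivariant (s g : {perm V}) (t : {perm T}) k w : t \in A ->
  (forall x, g (ph (val x)) = ph (val (t x))) -> (k <= rad)%N ->
  lab (s * g)%g k (g w) = lab s k w.
Proof.
move=> tA gP; have prE : priority (s * g)%g = map g (priority s).
  by rewrite /priority -map_comp; apply: eq_map => x /=; rewrite permM.
have dec z : (exists x : T, z = ph (val x)) \/ (forall x : T, ph (val x) != z).
  have [[x /eqP <-]|N] := pselect (exists x : T, ph (val x) == z); first by left; exists x.
  by right=> x; apply/negP => xw; apply: N; exists x.
elim: k w => [|k IH] w kR.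
  rewrite /bfs_lab /= -{1}ph0; have [r0 r0E] := ball_word BP (isT : in_tree d [::]) (leq0n rad).
  have -> : ph [::] = g (ph (val r0)) by rewrite gP (ball_aut_root BP tA r0E).
  by rewrite r0E ph0 (inj_eq perm_inj).
have {}IH w' : lab (s * g)%g k (g w') = lab s k w' by apply: IH; exact: ltnW.
have [bA _ _ _] := blP s (ltnW kR).
have flE z : first_label adj (lab (s * g)%g k) (g z) = first_label adj (lab s k) z.
  rewrite /first_label; congr ohead; apply/(perm_sortP shortlex_total shortlex_trans shortlex_anti).
  have -> : pmap (lab s k) [seq x <- enum V | adj x z] =
            pmap (lab s k) [seq x <- enum V | adj (g x) (g z)].
    apply: eq_pmap_filter => y; case Ly : (lab s k y) => [l|//] _.
    have [_ lk [x [tx xl yE]]] := bA _ _ Ly; subst y.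
    (* A vertex labelled before the last round lies strictly inside, so all its neighbours are in
       the ball. *)
    have xR : (size x < rad)%N by rewrite xl (leq_ltn_trans lk).
    have [x' xE] := ball_word BP tx (ltnW xR); rewrite -xE gP.
    case: (dec z) => [[z' ->]|N].
      by rewrite gP !(ph_adjE ph_adj ph_inj) ?(ball_in_tree BP) ?(ball_size BP)// (ball_aut_adj BP).
    have nb (y : T) q : (size (val y) < rad)%N -> adj (ph (val y)) q -> exists q' : T,
      q = ph (val q').
      move=> yR /(ph_adj _ (ball_in_tree BP y) (ltnW yR))[q' yq ->].
      have tq' : in_tree d q' by case/and3P: yq.
      have [q2 <-] := ball_word BP tq' (leq_trans (tree_adj_size yq) yR).
      by exists q2.
    apply/idP/idP => [/nb|/nb]; rewrite ?(ball_aut_size BP)// xE => /(_ xR)[q].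
      by move=> zq; have := N q; rewrite zq eqxx.
    move=> gz; have := N (t^-1 q)%g; rewrite -(inj_eq (@perm_inj _ g)) gP permKV gz.
    by rewrite eqxx.
  have -> : pmap (lab s k) [seq x <- enum V | adj (g x) (g z)] =
            pmap (lab (s * g)%g k) [seq x <- map g (enum V) | adj x (g z)].
    rewrite filter_map; elim: [seq _ <- _ | _] => //= a r ->.
    by rewrite IH.
  apply: perm_pmap; apply: perm_filter; apply: uniq_perm; rewrite ?enum_uniq//.
    by rewrite map_inj_uniq ?enum_uniq//; exact: perm_inj.
  move=> x; rewrite mem_enum; apply/esym/mapP; exists (g^-1 x)%g; rewrite ?mem_enum//.
  by rewrite permKV.
have offE l : offspring adj (priority (s * g)%g) (lab (s * g)%g k) l =
    map g (offspring adj (priority s) (lab s k) l).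
  rewrite /offspring; move: (lab (s * g)%g k) IH flE => L' IH flE.
  rewrite prE filter_map; congr map; apply: eq_filter => z /=.
  by rewrite IH flE.
rewrite {1}/bfs_lab {1}/bfs_lab !iterS /bfs_step.
rewrite -!/(bfs_lab _ _ _ _) IH; case: (lab s k w) => // .
rewrite flE; case: first_label => //= l.
by rewrite offE index_map//; exact: perm_inj.
Qed.

(** The automorphism [u s] is uniform when the priorities are, since its law is invariant under
    translations; the double count expresses this without probabilities. *)
Theorem bfs_count (f : V -> M) (X : seq nat -> M) :
  (#|[set s : {perm V} | (restr rad (labelled_graph R G f v s) : rooted_graph R M) ==
        restr rad (tree_graph R (fun w : tree_vertex d => X (val w)))]%SET| * #|A| =
   #|{perm V}| * #|[set t in A | [forall l : T, f (ph (val (t l))) == X (val l)]]%SET|)%N.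
Proof.
pose F (t : {perm T}) : nat := [forall l : T, f (ph (val (t l))) == X (val l)].
have [u uA uP] : exists2 u : {perm V} -> {perm T}, (forall s, u s \in A) &
    forall s l, lab s rad (ph (val (u s l))) = Some (val l).
  have ex s : exists t : {perm T}, (t \in A) && [forall l : T,
    lab s rad (ph (val (t l))) == Some (val l)].
    by have [t tA tP] := label_perm s; exists t; rewrite tA; apply/forallP => l; rewrite tP.
  exists (fun s => xchoose (ex s)) => s; first by have /andP[] := xchooseP (ex s).
  by move=> l; have /andP[_ /forallP/(_ l)/eqP] := xchooseP (ex s).
have SF : #|[set s : {perm V} | (restr rad (labelled_graph R G f v s) : rooted_graph R M) ==
        restr rad (tree_graph R (fun w : tree_vertex d => X (val w)))]%SET| = (\sum_s F (u s))%N.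
  rewrite -sum1_card big_mkcond /=; apply: eq_bigr => s _; rewrite inE /F.
  have H := restr_labelled f X (uA s) (uP s).
  case: eqP => [/H e|ne]; first by rewrite (_ : [forall _, _] = true)//; apply/forallP => l;
    rewrite e.
  by rewrite (_ : [forall _, _] = false)//; apply/negbTE/negP => /forallP e; apply/ne/H => l;
    apply/eqP.
(* Composing the priorities with [g] multiplies [u] by [t] on the right. *)
have uM t : t \in A -> (\sum_s F (u s) = \sum_s F (u s * t)%g)%N.
  move=> tA; have [g gP] := extend_ball t.
  rewrite (reindex_inj (mulIg g)) /=; apply: eq_bigr => s _; congr F; apply/permP => l.
  rewrite permM; apply: ph_injT; rewrite -gP.
  apply: (@bfs_lab_inj _ adj _ v (mem_priority (s * g)%g) rad _ _ (val l)); first exact: uP.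
  by rewrite (bfs_equivariant _ _ tA gP (leqnn _)) uP.
rewrite SF mulnC -sum_nat_const (eq_bigr (fun t => \sum_s F (u s * t)%g)%N) => [|t]; last exact: uM.
rewrite exchange_big /= -sum_nat_const /=.
apply: eq_bigr => s _; rewrite (reindex_inj (mulgI (u s)^-1%g)) /=.
rewrite (eq_bigr F) => [|t _]; last by rewrite mulKVg.
rewrite -sum1_card [RHS]big_mkcond [LHS]big_mkcond /=; apply: eq_bigr => t _;
  rewrite [in RHS]finset.in_set.
have -> : ((u s)^-1 * t \in A)%g = (t \in A).
  apply/idP/idP => tA; last by apply: ball_autM => //; apply: ball_autV.
  by rewrite -(mulKVg (u s) t); apply: ball_autM.
by rewrite /F; case: (t \in A); case: [forall l, _].
Qed.

End ball_law.

(** * Automorphisms of the infinite tree *)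

Section lifting.
Variable d : nat.

Lemma offspring_adj x y : in_tree d x -> in_tree d y -> is_offspring x y -> tree_adj d x y.
Proof. by move=> tx ty xy; rewrite /tree_adj tx ty xy. Qed.

Lemma tree_adjC x y : tree_adj d x y = tree_adj d y x.
Proof. by rewrite /tree_adj andbCA orbC. Qed.

Lemma lift_automorphism (f g : seq nat -> seq nat) :
  (forall x, in_tree d x -> in_tree d (f x)) -> (forall x, in_tree d x -> in_tree d (g x)) ->
  (forall x, in_tree d x -> g (f x) = x) -> (forall x, in_tree d x -> f (g x) = x) ->
  (forall x y, in_tree d x -> in_tree d y -> is_offspring x y -> tree_adj d (f x) (f y)) ->
  (forall x y, in_tree d x -> in_tree d y -> is_offspring x y -> tree_adj d (g x) (g y)) ->
  exists t : tree_vertex d -> tree_vertex d,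
    [/\ tree_automorphism t, forall w, val (t w) = f (val w) & exists t',
      cancel t t' /\ cancel t' t].
Proof.
move=> ft gt gf fg fo go.
pose t (w : tree_vertex d) : tree_vertex d := Sub (f (val w)) (ft _ (valP w)).
pose t' (w : tree_vertex d) : tree_vertex d := Sub (g (val w)) (gt _ (valP w)).
have tv w : val (t w) = f (val w) by [].
have t'v w : val (t' w) = g (val w) by [].
have tK : cancel t t' by move=> w; apply: val_inj; rewrite t'v tv gf//; exact: valP.
have t'K : cancel t' t by move=> w; apply: val_inj; rewrite tv t'v fg//; exact: valP.
have adjf h (w w' : tree_vertex d) : (forall x y,
  in_tree d x -> in_tree d y -> is_offspring x y -> tree_adj d (h x) (h y)) ->
    tree_adj d (val w) (val w') -> tree_adj d (h (val w)) (h (val w')).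
  move=> ho /and3P[tx ty /orP[|] xy]; first exact: ho.
  by rewrite tree_adjC; apply: ho.
exists t; split=> //; last by exists t'.
split; first by exists t'.
move=> w w'; rewrite /vertex_adj !tv; apply/idP/idP; last exact: adjf.
by move=> h; have := adjf g (t w) (t w') go h; rewrite !tv !gf//; exact: valP.
Qed.

Lemma in_tree_cons i z : in_tree d (i :: z) = (0 < i <= d)%N && all (fun j => 0 < j < d)%N z.
Proof. by []. Qed.

Lemma swap_first (i : nat) : (0 < i <= d)%N -> exists t : tree_vertex d -> tree_vertex d,
  [/\ tree_automorphism t, (forall w, val w = [::] -> val (t w) = [::]) &
      forall w, val w = [:: 1%N] -> val (t w) = [:: i]].
Proof.
move=> id; pose sw j := if j == 1%N then i else if j == i then 1%N else j.
have swK j : sw (sw j) = j.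
  rewrite /sw; case: (eqVneq j 1%N) => [->|j1].
    by rewrite eqxx; case: eqP.
  case: (eqVneq j i) => [->|ji]; first by rewrite eqxx.
  by rewrite (negbTE j1) (negbTE ji).
have swd j : (0 < j <= d)%N -> (0 < sw j <= d)%N.
  by rewrite /sw; case: eqP => // _; case: eqP => // _; case/andP: id; lia.
pose f (x : seq nat) := if x is j :: z then sw j :: z else x.
have ft x : in_tree d x -> in_tree d (f x).
  by case: x => // j z; rewrite /f !in_tree_cons => /andP[/swd -> ->].
have fK x : in_tree d x -> f (f x) = x by case: x => //= j z _; rewrite swK.
have fo x y : in_tree d x -> in_tree d y -> is_offspring x y -> tree_adj d (f x) (f y).
  move=> tx ty /is_offspringP[j yE]; apply: offspring_adj; rewrite ?ft//.
  by apply/is_offspringP; rewrite yE; case: (x) => [|a z] /=; [exists (sw j)|exists j].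
have [t [tA tv _]] := lift_automorphism ft ft fK fK fo fo.
by exists t; split=> // w e; rewrite tv e //= /sw eqxx.
Qed.

(** Exchanges the root with its neighbour 1. The other offspring of the root become offspring of 1,
    with labels lowered by one because a non-root vertex has one offspring less. *)
Lemma flip_edge : (1 < d)%N -> exists t : tree_vertex d -> tree_vertex d,
  [/\ tree_automorphism t, (forall w, val w = [::] -> val (t w) = [:: 1%N]) &
      forall w, val w = [:: 1%N] -> val (t w) = [::]].
Proof.
move=> d1; pose f (x : seq nat) : seq nat :=
  match x with
  | [::] => [:: 1%N]
  | 1%N :: z => if z is j :: z' then j.+1 :: z' else [::]
  | i :: z => [:: 1%N, i.-1 & z]
  end.
have ft x : in_tree d x -> in_tree d (f x).
  case: x => [|[|[|i]] z] //; first by rewrite /= andbT; lia.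
    case: z => // j z; rewrite !in_tree_cons /= => /andP[_ /andP[/andP[j0 jd] ->]].
    by rewrite andbT.
  rewrite /f !in_tree_cons /= => /andP[id ->]; rewrite id andbT /=; lia.
have fK x : in_tree d x -> f (f x) = x.
  by case: x => [|[|[|i]] [|[|j] z]] //=; rewrite andbF.
have fo x y : in_tree d x -> in_tree d y -> is_offspring x y -> tree_adj d (f x) (f y).
  move=> tx ty /is_offspringP[j yE].
  have [x0|x0] := eqVneq x [::].
    subst x; subst y; move: ty; case: j => [|[|j]] // ty.
      rewrite tree_adjC; apply: offspring_adj => //=; rewrite andbT; lia.
    by move: ty; rewrite /= andbT => jd; apply: offspring_adj => //=; rewrite ?andbT; lia.
  apply: offspring_adj; rewrite ?ft//; apply/is_offspringP; rewrite yE.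
  case: x x0 tx {yE} => [//|[|[|i]] [|b z]] //= _ _; first [by exists j|by exists j.+1].
have [t [tA tv _]] := lift_automorphism ft ft fK fK fo fo.
by exists t; split=> // w e; rewrite tv e.
Qed.

(** By induction on depth: flip the edge already reached, so that the root goes to its far end, then
    choose among the neighbours by [swap_first]. *)
Lemma move_edge (z : seq nat) (i : nat) : (1 < d)%N -> in_tree d (rcons z i) ->
  exists t : tree_vertex d -> tree_vertex d, [/\ tree_automorphism t,
    (forall w, val w = [::] -> val (t w) = z) & forall w,
      val w = [:: 1%N] -> val (t w) = rcons z i].
Proof.
move=> d1; have comp t u : @tree_automorphism d t -> @tree_automorphism d u ->
  tree_automorphism (t \o u).
  move=> [tb ta] [ub ua]; split; first exact: bij_comp.
  by move=> x y; rewrite /= ta ua.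
have [n] := ubnP (size z); elim: n z i => // n IH z i.
case/lastP: z => [_|z' i']; first by rewrite /= andbT; exact: swap_first.
rewrite size_rcons ltnS => zn tz; have tz' : in_tree d (rcons z' i') by move: tz;
  rewrite in_tree_rcons => /andP[].
have [t [tA t0 t1]] := IH z' i' zn tz'; have [fl [flA fl0 fl1]] := flip_edge d1.
pose u := t \o fl; have uA : tree_automorphism u by exact: comp.
have u0 w : val w = [::] -> val (u w) = rcons z' i' by move=> w0; rewrite /u /= t1// fl0.
pose root : tree_vertex d := Sub [::] isT.
pose x : tree_vertex d := Sub (rcons (rcons z' i') i) tz.
have [[u' uK u'K] ua] := uA.
have : vertex_adj (u root) x.
  rewrite /vertex_adj u0//; apply: offspring_adj => //; apply/is_offspringP.
  by exists i.
rewrite -(u'K x) ua /vertex_adj => /and3P[_ tj /orP[/is_offspringP[j jE]|/is_offspringP[j]]];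
  last first.
  by move/(congr1 size); rewrite size_rcons.
have {}jE : val (u' x) = [:: j] by rewrite jE.
rewrite jE /= andbT in tj; have [s [sA s0 s1]] := swap_first tj.
exists (u \o s); split; first exact: comp.
  by move=> w w0 /=; rewrite u0// s0.
move=> w w1 /=; have -> : s w = u' x by apply: val_inj; rewrite s1// jE.
by rewrite u'K.
Qed.

End lifting.

Section extension.
Variables (d k : nat) (B : seq (seq nat)).
Hypothesis BP : forall x, (x \in B) = in_tree d x && (size x <= k.+1)%N.
Local Notation T := (seq_sub B).

Lemma in_tree_cat x z : x != [::] ->
  in_tree d (x ++ z) = in_tree d x && all (fun j => 0 < j < d)%N z.
Proof. by case: x => // i x _; rewrite cat_cons !in_tree_cons all_cat andbA. Qed.

Lemma in_tree_take x n : in_tree d x -> in_tree d (take n x).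
Proof.
case: n x => [|n] [|i x] //=; rewrite ?take0// => /andP[-> h] /=.
by apply/allP => j /mem_take; exact: (allP h).
Qed.

(** Act on the first [k + 1] letters of a label and keep the others. *)
Lemma extend_automorphism (t : {perm T}) : t \in ball_aut B ->
  exists u : tree_vertex d -> tree_vertex d, tree_automorphism u /\
    forall (w : tree_vertex d) (l : T), val w = val l -> val (u w) = val (t l).
Proof.
move=> tA.
pose nd (x : seq nat) : seq nat := take k.+1 x.
have ndT x : in_tree d x -> nd x \in B.
  by move=> tx; rewrite BP in_tree_take//= size_take; case: ltnP.
pose e (t : {perm T}) (x : seq nat) : seq nat :=
  if insub (nd x) is Some l then val (t l) ++ drop k.+1 x else x.
have eE (s : {perm T}) x (l : T) : val l = nd x -> e s x = val (s l) ++ drop k.+1 x.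
  move=> lx; rewrite /e; case: insubP => [l' _ l'x|]; last by rewrite -lx (valP l).
  by congr (val (s _) ++ _); apply: val_inj; rewrite l'x lx.
have ex x : in_tree d x -> exists l : T, val l = nd x.
  by move=> tx; exists (SeqSub (ndT x tx)).
have dropN x (l : T) : val l = nd x -> (size (val l) < k.+1)%N -> drop k.+1 x = [::].
  move=> ->; have [xk _|kx] := leqP (size x) k.+1; first exact: drop_oversize.
  by rewrite size_takel ?ltnn// ltnW.
have et (s : {perm T}) x : s \in ball_aut B -> in_tree d x -> in_tree d (e s x).
  move=> sA tx; have [l lx] := ex x tx; rewrite (eE _ _ _ lx).
  have ls := ball_aut_size BP l sA; have [lk|lk] := ltnP (size (val l)) k.+1.
    by rewrite (dropN _ _ lx lk) cats0 (ball_in_tree BP).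
  rewrite in_tree_cat ?(ball_in_tree BP)//=; last by rewrite -size_eq0 ls -lt0n (leq_trans _ lk).
  have : val l != [::] by rewrite -size_eq0 -lt0n (leq_trans _ lk).
  move: tx; rewrite -{1}(cat_take_drop k.+1 x) -/(nd x) -lx => tx ln.
  by move: tx; rewrite in_tree_cat// => /andP[].
have ek (s : {perm T}) x : s \in ball_aut B -> in_tree d x -> e s^-1%g (e s x) = x.
  move=> sA tx; have [l lx] := ex x tx; rewrite [e s x](eE _ _ _ lx).
  have ls := ball_aut_size BP l sA.
  have lsk : val (s l) = nd (val (s l) ++ drop k.+1 x).
    have [lk|lk] := ltnP (size (val l)) k.+1.
      by rewrite (dropN _ _ lx lk) cats0 /nd take_oversize// ls ltnW.
    rewrite /nd take_cat ls; have -> : size (val l) = k.+1.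
      by apply/eqP; rewrite eqn_leq lk (ball_size BP).
    by rewrite ltnn subnn take0 cats0.
  rewrite (eE _ _ _ lsk) permK; have [lk|lk] := ltnP (size (val l)) k.+1.
    rewrite (dropN _ _ lx lk) cats0 drop_oversize ?ls ?cats0; last exact: ltnW.
    by rewrite lx -[RHS](cat_take_drop k.+1) (dropN _ _ lx lk) cats0.
  have lk' : size (val (s l)) = k.+1 by rewrite ls; apply/eqP; rewrite eqn_leq lk (ball_size BP).
  by rewrite drop_cat lk' ltnn subnn drop0 lx cat_take_drop.
have eo (s : {perm T}) x y : s \in ball_aut B -> in_tree d x -> in_tree d y -> is_offspring x y ->
    tree_adj d (e s x) (e s y).
  move=> sA tx ty /is_offspringP[i yE]; apply: offspring_adj; rewrite ?et//.
  have [l lx] := ex x tx; have [l' ly] := ex y ty.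
  rewrite (eE _ _ _ lx) (eE _ _ _ ly); have [xk|xk] := ltnP (size x) k.+1.
    have lxE : val l = x by rewrite lx /nd take_oversize// ltnW.
    have lyE : val l' = y by rewrite ly /nd take_oversize// yE size_rcons.
    rewrite !drop_oversize ?yE ?size_rcons ?cats0//; last exact: ltnW.
    by rewrite (ball_autP _ _ sA) lxE lyE; apply/is_offspringP; exists i.
  have -> : l' = l.
    by apply: val_inj; rewrite lx ly yE /nd -cats1 takel_cat.
  apply/is_offspringP; exists i; rewrite yE -cats1 drop_cat.
  case: ltnP => [_|kx]; first by rewrite -cats1 catA.
  have {xk} xk : size x = k.+1 by apply/eqP; rewrite eqn_leq xk kx.
  by rewrite xk subnn drop0 [drop k.+1 x]drop_oversize ?xk// cats0 cats1.
have tVA := ball_autV tA.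
have ek' x : in_tree d x -> e t (e t^-1%g x) = x.
  by move=> tx; have := ek _ x tVA tx; rewrite invgK.
have [u [uA uv _]] := lift_automorphism (fun x => @et t x tA) (fun x => @et _ x tVA)
  (fun x => @ek t x tA) ek' (fun x y => @eo t x y tA) (fun x y => @eo _ x y tVA).
exists u; split=> // w l wl; rewrite uv (eE _ _ l).
  by rewrite wl drop_oversize ?cats0// (ball_size BP).
by rewrite wl /nd take_oversize// (ball_size BP).
Qed.

End extension.

(** * Ball marginals of a vertex-Markov process *)

Section process_balls.
Local Open Scope classical_set_scope.
Local Open Scope ring_scope.
Variables (R : realType) (E : nat) (M : pointedFinType).
Local Notation d := E.+2.
Local Notation Om := (process_space d M).
Implicit Types (X : Om) (x z : seq nat).

Lemma prob_partition disp (T : measurableType disp) (Q : probability T R) (C : finType)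
    (A : set T) (g : T -> C) : (forall c, measurable (A `&` [set t | g t = c])) ->
  fine (Q A) = \sum_c fine (Q (A `&` [set t | g t = c])).
Proof.
move=> mA; have -> : A = \bigcup_(c in [set: C]) (A `&` [set t | g t = c]).
  by apply/seteqP; split=> [t At|t [c _ []]]//; exists (g t).
have F : finite_set [set: C] by exact: finite_finset.
rewrite (measure_fin_bigcup Q F)//; last by move=> c c' _ _ [t [[_ <-] [_ <-]]].
rewrite (_ : [set: C] = [set` enum C]); last first.
  by apply/seteqP; split=> c // _; rewrite /= mem_enum.
rewrite -fsbig_seq ?enum_uniq// big_enum /= -sum_fine; last first.
  by move=> c _; apply: fin_num_measure.
apply: eq_bigr => c _; congr (fine (Q _)); apply/seteqP; split=> t.
  by move=> [At gc]; split=> //; exists c; rewrite //= mem_enum.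
by move=> [[c' _ [At gc']] /= gc].
Qed.

(** Reads colours at arbitrary words, with a default value off the tree, so that events can be
    stated without the subtype of vertices. *)
Definition read_word X x : M := odflt point (omap X (insub x)).

Lemma read_wordE X (w : tree_vertex d) x : val w = x -> read_word X x = X w.
Proof. by move=> <-; rewrite /read_word valK. Qed.

Lemma measurable_words (W : seq (seq nat)) (A : set Om) :
  (forall X X', (forall x, x \in W -> read_word X x = read_word X' x) -> A X -> A X') ->
    measurable A.
Proof.
move=> H; apply: (@measurable_finite_support d M (pmap insub W)) => X X' e.
apply: H => x xW; rewrite /read_word; case: insubP => //= w tx wx.
by apply: e; rewrite mem_pmap_sub (_ : val w = x).
Qed.

Definition branch_event x k (y : branch M E k) : set Om := [set X | branch_at E k (fun z =>
  read_word X (x ++ z)) = y].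

Lemma branch_event_sigma (S : set (tree_vertex d)) x k (y : branch M E k) :
  (forall z, branch_word E z -> (size z <=
    k)%N -> exists2 w : tree_vertex d, val w = x ++ z & S w) ->
  <<s color_events S >> (branch_event x y).
Proof.
elim: k x y => [|k IH] x y H.
  have [w wx Sw] := H [::] isT (leqnn _); apply: sub_gen_smallest; exists w => //; exists y.
  by apply/seteqP; split=> X /=; rewrite /branch_event /= (read_wordE _ wx).
case: y => c y; have [w wx Sw] := H [::] isT (leq0n _); rewrite cats0 in wx.
rewrite (_ : branch_event x _ = [set X | X w = c] `&`
    \bigcap_(j in [set: 'I_E.+1]) branch_event (rcons x j.+1) (y j)); last first.
  apply/seteqP; split=> X; rewrite /branch_event /= cats0 (read_wordE _ wx).
    move=> [Xc e]; split=> // j _ /=; rewrite -e ffunE.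
    by congr branch_at; apply/funext => z; rewrite cat_rcons.
  move=> [Xw h]; rewrite Xw; congr pair; apply/ffunP => j.
  rewrite ffunE -(h j)//; congr branch_at; apply/funext => z.
  by rewrite cat_rcons.
apply: (@measurableI _ (g_sigma_algebraType (color_events S))).
  by apply: sub_gen_smallest; exists w => //; exists c.
apply: (@fin_bigcap_measurable _ (g_sigma_algebraType (color_events S))) => // j _.
apply: IH => z zb zk; rewrite cat_rcons; apply: H => //=.
by rewrite zb ltnS ltn_ord.
Qed.

Lemma measurable_branch_event x k (y : branch M E k) : in_tree d x -> x != [::] ->
  measurable (branch_event x y).
Proof.
move=> tx x0; apply: branch_event_sigma => z zb zk.
have txz : in_tree d (x ++ z) by rewrite in_tree_cat// tx.
by exists (Sub (x ++ z) txz).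
Qed.

Lemma pending_below (v u : tree_vertex d) (x z : seq nat) i : val v = x -> val u = rcons x i ->
  forall w : tree_vertex d, val w = rcons x i ++ z -> pending_subtree v u w.
Proof.
move=> vx ux; elim/last_ind: z => [|z j IH] w wE.
  exists [::]; split=> //; first by apply: val_inj; rewrite ux wE cats0.
  by rewrite inE; apply/negP => /eqP e; move: ux; rewrite -e vx => /(congr1 size);
    rewrite size_rcons; lia.
have tw : in_tree d (rcons (rcons x i ++ z) j) by rewrite rcons_cat -wE (valP w).
have tw' : in_tree d (rcons x i ++ z) by move: tw; rewrite in_tree_rcons => /andP[].
have [s [ps ls vs]] := IH (Sub _ tw') erefl.
exists (rcons s w); split; last first.
- rewrite -rcons_cons mem_rcons inE negb_or vs andbT; apply/negP => /eqP e.
  by move: wE; rewrite -e vx => /(congr1 size); rewrite size_cat !size_rcons; lia.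
- by rewrite last_rcons.
rewrite rcons_path ps ls /= /vertex_adj /= wE -rcons_cat; apply: offspring_adj => //.
exact: is_offspring_rcons.
Qed.

Variables (p : M * M -> R) (mu : probability Om R).
Hypothesis pL : edge_law p.
Hypothesis muP : is_markov_process p mu.
Local Notation P A := (fine (mu A)).
Local Notation pi := (vertex_marginal p).

Lemma muE A : measurable A -> mu A = (P A)%:E.
Proof. by move=> mA; rewrite fineK// fin_num_measure. Qed.

Lemma measurable_edge x y a b : measurable [set X | read_word X x = a /\ read_word X y = b].
Proof.
apply: (measurable_words (W := [:: x; y])) => X X' e [/= <- <-].
by rewrite !e// !inE eqxx ?orbT.
Qed.

Lemma measurable_site x a : measurable [set X | read_word X x = a].
Proof. by apply: (measurable_words (W := [:: x])) => X X' e /= <-; rewrite e// inE. Qed.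

Lemma edge_prob z i a b : in_tree d (rcons z i) ->
  P [set X | read_word X z = a /\ read_word X (rcons z i) = b] = p (a, b).
Proof.
move=> tz; have [mI _ mE] := muP; have [t [tA t0 t1]] := move_edge (isT : (1 < d)%N) tz.
pose o : tree_vertex d := Sub [::] isT; pose v1 : tree_vertex d := Sub [:: 1%N] isT.
have := mE o v1 erefl erefl a b; set A := [set X | _] => HA.
have mA : measurable A.
  rewrite /A (_ : [set X | _] = [set X | read_word X [::] = a /\ read_word X [:: 1%N] = b]);
    first exact: measurable_edge.
  by apply/seteqP; split=> X /=; rewrite (read_wordE X (_ : val o = [::])) ?(read_wordE X (_ : val
    v1 = [:: 1%N])).
have := mI t tA A mA; rewrite HA => e; have -> : p (a, b) = fine (p (a, b))%:E by [].
rewrite -e; congr (fine (mu _)); apply/seteqP; split=> X; rewrite /A /=.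
  by rewrite (read_wordE X (t0 o erefl)) (read_wordE X (t1 v1 erefl)).
by rewrite (read_wordE X (t0 o erefl)) (read_wordE X (t1 v1 erefl)).
Qed.

Lemma site_prob z a : in_tree d z -> P [set X | read_word X z = a] = pi a.
Proof.
move=> tz; rewrite (@prob_partition _ _ mu _ _ (fun X => read_word X (rcons z 1%N))) => [|c];
  last first.
  by apply: measurableI; exact: measurable_site.
apply: eq_bigr => b _; rewrite -(@edge_prob z 1%N)//.
by rewrite in_tree_rcons tz; case: z tz.
Qed.

(** Induction by the Markov property at [rcons z i]: the colour of its parent is an event of one
    pending subtree, and the branches below it belong to the others. *)
Lemma branch_prob k z i a (y : branch M E k) : in_tree d (rcons z i) ->
  P ([set X | read_word X z = a] `&` branch_event (rcons z i) y) = pi a * branch_weight p a y.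
Proof.
have [_ mM _] := muP.
elim: k z i a y => [|k IH] z i a y tz.
  rewrite /branch_weight /= mulr1 pi_kernel//= -(edge_prob a y tz); congr (fine (mu _)).
  by apply/seteqP; split=> X; rewrite /branch_event /= cats0.
have tz0 : in_tree d z by move: tz; rewrite in_tree_rcons => /andP[].
case: y => c y; pose x := rcons z i; pose v : tree_vertex d := Sub x tz.
have vx : val v = x by [].
have x0 : x != [::] by rewrite /x -size_eq0 size_rcons.
have tc (j : 'I_E.+1) : in_tree d (rcons x j.+1).
  by rewrite in_tree_rcons tz /=; case: (x) x0 => //= _ _ _; exact: ltn_ord.
pose B := [set X : Om | X v = c].
have BE : B = [set X | read_word X x = c] by apply/seteqP; split=> X;
  rewrite /B /= (read_wordE X vx).
have PB : P B = pi c by rewrite BE site_prob.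
pose A0 := [set X | read_word X z = a].
have LE : A0 `&` branch_event x ((c, y) : branch M E k.+1) =
    (A0 `&` \bigcap_(j in [set: 'I_E.+1]) branch_event (rcons x j.+1) (y j)) `&` B.
  apply/seteqP; split=> X; rewrite BE /branch_event /= cats0.
    move=> [Xa [Xc e]]; split=> //; split=> // j _ /=; rewrite -e ffunE.
    by congr branch_at; apply/funext => w; rewrite cat_rcons.
  move=> [[Xa h] Xc]; split=> //; rewrite Xc; congr pair; apply/ffunP => j.
  by rewrite ffunE -(h j)//; congr branch_at; apply/funext => w; rewrite cat_rcons.
have mB : measurable B by rewrite BE; exact: measurable_site.
have mbr (j : 'I_E.+1) : measurable (branch_event (rcons x j.+1) (y j)).
  by apply: measurable_branch_event => //; rewrite -size_eq0 size_rcons.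
have mA0 : measurable A0 by exact: measurable_site.
have mI : measurable (A0 `&` \bigcap_(j in [set: 'I_E.+1]) branch_event (rcons x j.+1) (y j)).
  by apply: measurableI => //; apply: fin_bigcap_measurable.
have A0B : P (A0 `&` B) = p (a, c).
  rewrite -(edge_prob a c tz); congr (fine (mu _)); rewrite BE.
  by apply/seteqP; split.
rewrite LE branch_weight_mk mulrA pi_kernel//=.
(* A null colour cannot be conditioned on; both sides are 0. *)
have [c0|c0] := eqVneq (pi c) 0.
  have pz : p (a, c) = 0.
    have [pp _ pC] := pL; apply/le_anti; rewrite pp pC -c0 andbT.
    exact: (p_le_pi pL).
  rewrite pz mul0r; apply/le_anti; rewrite fine_ge0 ?measure_ge0// andbT.
  rewrite -c0 -PB; apply: fine_le; rewrite ?fin_num_measure//; first exact: measurableI.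
  by apply: le_measure; rewrite ?inE//; exact: measurableI.
have muB : mu B != 0%E by rewrite (muE mB) PB eqe.
pose zv : tree_vertex d := Sub z tz0.
(* Index 0 is the parent and the others are the offspring. *)
pose u (j : 'I_d) : tree_vertex d := if unlift ord0 j is Some j' then Sub (rcons x j'.+1) (tc j')
  else zv.
pose A (j : 'I_d) : set Om := if unlift ord0 j is Some j' then branch_event (rcons x j'.+1) (y j')
  else A0.
have uinj : injective u.
  move=> j j'; rewrite /u; case: unliftP => [j1 ->|->]; case: unliftP => [j2 ->|->] //.
  - by move/(congr1 val) => /= /rcons_inj[] /val_inj ->.
  - by move/(congr1 val)/(congr1 size); rewrite /= !size_rcons; lia.
  - by move/(congr1 val)/(congr1 size); rewrite /= !size_rcons; lia.
have uadj j : vertex_adj v (u j).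
  rewrite /u /vertex_adj; case: unliftP => [j1 _|_] /=.
    by apply: offspring_adj => //; exact: is_offspring_rcons.
  by rewrite tree_adjC; apply: offspring_adj => //; exact: is_offspring_rcons.
have AS j : <<s color_events (pending_subtree v (u j)) >> (A j).
  rewrite /A /u; case: unliftP => [j1 _|_].
    apply: branch_event_sigma => w wb wk.
    have tw : in_tree d (rcons x j1.+1 ++ w).
      by rewrite in_tree_cat ?tc// -size_eq0 size_rcons.
    by exists (Sub _ tw) => //; apply: (pending_below vx).
  apply: sub_gen_smallest; exists zv.
    exists [::]; split=> //; rewrite inE; apply/negP => /eqP /(congr1 val)/(congr1 size).
    by rewrite /= size_rcons; lia.
  by exists a; apply/seteqP; split=> X; rewrite /A0 /= (read_wordE X (_ : val zv = z)).
have := mM v c u uinj uadj muB A AS; rewrite -/B /cond_prob PB.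
rewrite big_ord_recl /=.
have -> : A ord0 = A0 by rewrite /A unlift_none.
rewrite A0B (eq_bigr (fun j => branch_weight p c (y j))) => [|j _]; last first.
  rewrite /A liftK BE setIC (IH x j.+1 c (y j) (tc j)) mulrAC divff ?mul1r//.
have -> : \bigcap_i A i = A0 `&` \bigcap_(j in [set: 'I_E.+1]) branch_event (rcons x j.+1) (y j).
  apply/seteqP; split=> X h.
    split=> [|j _]; first by have := h ord0 I; rewrite /A unlift_none.
    by have := h (lift ord0 j) I; rewrite /A liftK.
  by move=> j _; rewrite /A; case: unliftP => [j1 _|_]; [exact: (h.2 j1 I)|exact: h.1].
by move=> e; rewrite -[LHS](divfK c0) e mulrAC divfK.
Qed.

Definition ball_event k (s : ball_type M E k) : set Om := [set X | ball_at E k (read_word X) = s].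

Lemma ball_prob k (s : ball_type M E k) : P (ball_event s) = ball_weight p s.
Proof.
have [_ mM _] := muP; case: s => c y.
pose v : tree_vertex d := Sub [::] isT; have vx : val v = [::] by [].
have tc (j : 'I_d) : in_tree d [:: j.+1] by rewrite /= ltn_ord.
pose B := [set X : Om | X v = c].
have BE : B = [set X | read_word X [::] = c] by apply/seteqP; split=> X;
  rewrite /B /= (read_wordE X vx).
have PB : P B = pi c by rewrite BE site_prob.
pose A (j : 'I_d) : set Om := branch_event [:: j.+1] (y j).
have LE : ball_event ((c, y) : ball_type M E k) = (\bigcap_i A i) `&` B.
  apply/seteqP; split=> X; rewrite BE /ball_event /ball_at /=.
    by move=> [Xc e]; split=> // j _; rewrite /A /branch_event /= -e ffunE.
  move=> [h Xc]; rewrite Xc; congr pair; apply/ffunP => j.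
  by rewrite ffunE; exact: h.
have mB : measurable B by rewrite BE; exact: measurable_site.
have mI : measurable (\bigcap_i A i).
  by apply: fin_bigcap_measurable => // j _; exact: measurable_branch_event.
rewrite LE /ball_weight /=.
have [c0|c0] := eqVneq (pi c) 0.
  rewrite c0 mul0r; apply/le_anti; rewrite fine_ge0 ?measure_ge0// andbT.
  rewrite -c0 -PB; apply: fine_le; rewrite ?fin_num_measure//; first exact: measurableI.
  by apply: le_measure; rewrite ?inE//; exact: measurableI.
have muB : mu B != 0%E by rewrite (muE mB) PB eqe.
pose u (j : 'I_d) : tree_vertex d := Sub [:: j.+1] (tc j).
have uinj : injective u by move=> j j' /(congr1 val)[] /val_inj.
have uadj j : vertex_adj v (u j).
  by apply: offspring_adj => //; exact: tc.
have AS j : <<s color_events (pending_subtree v (u j)) >> (A j).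
  apply: branch_event_sigma => w wb wk.
  have tw : in_tree d ([:: j.+1] ++ w) by rewrite in_tree_cat ?tc.
  by exists (Sub _ tw) => //; apply: (@pending_below v (u j) [::] w j.+1).
have := mM v c u uinj uadj muB A AS; rewrite -/B /cond_prob PB.
rewrite (eq_bigr (fun j => branch_weight p c (y j))) => [|j _]; last first.
  by rewrite /A BE setIC (@branch_prob k [::] j.+1 c (y j) (tc j)) mulrAC divff ?mul1r.
by move=> e; rewrite -[LHS](divfK c0) e mulrC.
Qed.

Variables (k : nat) (B : seq (seq nat)).
Hypothesis BP : forall x, (x \in B) = in_tree d x && (size x <= k.+1)%N.

(** The product formula refers to the order of the branches; the invariance is inherited from [mu],
    after extending [t] to the whole tree. *)
Lemma ball_weight_aut (t : {perm seq_sub B}) (Y Y' : seq nat -> M) : t \in ball_aut B ->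
  (forall l : seq_sub B, Y' (val l) = Y (val (t l))) ->
  ball_weight p (ball_at E k Y') = ball_weight p (ball_at E k Y).
Proof.
move=> tA YY; have [mI _ _] := muP; have [u [uA uv]] := extend_automorphism BP tA.
have bE (Z : seq nat -> M) X : ball_event (ball_at E k Z) X <-> forall l : seq_sub B,
  read_word X (val l) = Z (val l).
  rewrite /ball_event /= ball_at_eq; split=> h; first by move=> l; apply: h;
    [exact: (ball_in_tree BP)|exact: (ball_size BP)].
  by move=> x tx xk; have [l <-] := ball_word BP tx xk; exact: h.
have mB (Z : seq nat -> M) : measurable (ball_event (ball_at E k Z)).
  apply: (measurable_words (W := B)) => X X' e /bE h; apply/bE => l.
  by rewrite -h e// (valP l).
rewrite -!ball_prob -(mI u uA _ (mB Y')); congr (fine (mu _)).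
have tv (l : seq_sub B) X : read_word (fun w => X (u w)) (val l) = read_word X (val (t l)).
  pose w : tree_vertex d := Sub (val l) (ball_in_tree BP l).
  by rewrite (read_wordE _ (_ : val w = val l))// (read_wordE X (uv w l erefl)).
apply/seteqP; split=> X /=.
  move=> /bE h; apply/bE => l; have := h (t^-1 l)%g.
  by rewrite tv permKV YY permKV.
by move=> /bE h; apply/bE => l; rewrite tv h YY.
Qed.

End process_balls.

(** * Empirical cylinder masses against the tree law *)

Section cylinders.
Local Open Scope classical_set_scope.
Local Open Scope ring_scope.
Variables (R : realType) (E : nat) (M : pointedFinType) (p : M * M -> R).
Hypothesis pL : edge_law p.
Local Notation d := E.+2.
Variable mu : probability (process_space d M) R.
Hypothesis muP : is_markov_process p mu.
Local Notation RG := (rooted_graph R M).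
Local Notation law := (probability RG R).
Variables (k : nat) (B : seq (seq nat)).
Hypothesis BP : forall x, (x \in B) = in_tree d x && (size x <= k.+1)%N.
Local Notation T := (seq_sub B).

Definition ball_ext (X : {ffun T -> M}) (x : seq nat) : M :=
  if insub x is Some l then X l else point.

Lemma ball_extE X (l : T) : ball_ext X (val l) = X l.
Proof. by rewrite /ball_ext valK. Qed.

Definition ball_graph (X : {ffun T -> M}) : RG := tree_graph R (fun w : tree_vertex d =>
  ball_ext X (val w)).

Definition cylinder (X : {ffun T ->
  M}) : set RG := [set g | restr k.+1 g = restr k.+1 (ball_graph X)].

Lemma measurable_restr_invariant (U : set RG) r :
  (forall g h, restr r g = restr r h -> U g -> U h) -> measurable U.
Proof. by move=> H; apply: sub_sigma_algebra; apply: open_restr H. Qed.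

Lemma measurable_cylinder X : measurable (cylinder X).
Proof. by apply: (@measurable_restr_invariant _ k.+1) => g h e; rewrite /cylinder /= e. Qed.

Lemma tree_graph_restr (X : process_space d M) (Y : {ffun T -> M}) :
  cylinder Y (tree_graph R X) <-> forall l : T, read_word X (val l) = Y l.
Proof.
have colE (Z : process_space d M) x : tree_col Z x = if in_tree d x then Some (read_word Z x) else
  None.
  by rewrite /tree_col /read_word; case: insubP => [w -> //|/negbTE ->].
have eY (l : T) : read_word (fun w : tree_vertex d => ball_ext Y (val w)) (val l) = Y l.
  by rewrite (read_wordE _ (_ : val (Sub (val l) (ball_in_tree BP l) : tree_vertex d) = val l))//=
    ball_extE.
split=> [e l|e].
  have := congr1 (fun g : RG => gcol g (val l)) e; rewrite /= /restr_col (ball_size BP) /=.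
  by rewrite !colE (ball_in_tree BP) eY => -[].
apply: bfs_graph_eq => //=; apply/funext => x; rewrite /restr_col /=.
case: ifP => // xk; rewrite !colE; case: ifP => // tx.
by have [l <-] := ball_word BP tx xk; rewrite e eY.
Qed.

Lemma tree_law_cylinder X : fine (tree_law mu (cylinder X)) = ball_weight p (ball_at E k (ball_ext
  X)).
Proof.
rewrite -(ball_prob pL muP); congr (fine (mu _)).
apply/seteqP; split=> Z.
  move=> /tree_graph_restr e; apply/ball_at_eq => x tx xk.
  by have [l <-] := ball_word BP tx xk; rewrite e ball_extE.
move=> /ball_at_eq e; apply/tree_graph_restr => l.
by rewrite e ?(ball_in_tree BP) ?(ball_size BP)// ball_extE.
Qed.

Lemma mixtureE disp (S : measurableType disp) (I : finType) (Q : I -> probability S R) A :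
  (0 < #|I|)%N -> measurable A -> fine (mixture Q A) = #|I|%:R^-1 * \sum_i fine (Q i A).
Proof.
move=> I0 mA; rewrite /mixture; case: eqP => [e|_]; first by rewrite e in I0.
rewrite (eq_bigr (fun i => (fine (Q i A))%:E)) => [|i _]; last by rewrite fineK// fin_num_measure.
by rewrite sumEFin -EFinM.
Qed.

Section graph.
Variables (n : nat) (m : {perm 'I_n * 'I_d}) (f : {ffun 'I_n -> M}).
Hypothesis n0 : (0 < n)%N.
Hypothesis mS : m \in simple_matchings E n.
Local Notation V := 'I_n.

Lemma distr_cylinder X : fine (distr R (graph_of m) f (cylinder X)) =
  n%:R^-1 * \sum_v (#|{perm V}|%:R^-1 *
     #|[set s : {perm V} | (restr k.+1 (labelled_graph R (graph_of m) f v s) : RG) ==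
        restr k.+1 (ball_graph X)]%SET|%:R).
Proof.
rewrite /distr mixtureE ?card_ord//; last exact: measurable_cylinder.
congr (_ * _); apply: eq_bigr => v _; rewrite /distr_at mixtureE; last exact: measurable_cylinder.
  congr (_ * _); rewrite -sum1_card natr_sum [RHS]big_mkcond /=; apply: eq_bigr => s _.
  rewrite indicE [in RHS]finset.in_set; case: eqP => [e|ne].
    by rewrite mem_set.
  by rewrite memNset.
by apply/card_gt0P; exists 1%g.
Qed.

(** The covering property: the half-edges at an endpoint are the one by which it was entered, which
    leads to the parent, and the lifts, which lead to the offspring. *)
Lemma endpoint_adj v x w : in_tree d x -> (size x <= k.+1)%N ->
  graph_adj (graph_of m) (endpoint m v x) w <-> exists2 y, tree_adj d x y & w = endpoint m v y.
Proof.
move=> tx xk; rewrite graph_adj_of//; have mK := simple_matching_inv mS.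
split=> [/existsP[i /eqP <-]|[y]].
  case/lastP: x tx {xk} => [_|z j tx].
    exists [:: i.+1]; last by rewrite /= inord_val.
    by apply: offspring_adj; rewrite //= ?ltn_ord//.
  have [z0 jd] : in_tree d z /\ (0 < j <= (if z is [::] then d else d.-1))%N.
    by move: tx; rewrite in_tree_rcons => /andP[].
  rewrite endpoint_arrival; case: (unliftP (arrival m v (rcons z j)).2 i) => [i' ->|->].
    exists (rcons (rcons z j) i'.+1).
      apply: offspring_adj => //; last exact: is_offspring_rcons.
      rewrite in_tree_rcons tx /=; case Ez : (rcons z j) => [|a b]; last exact: ltn_ord.
      by move: Ez => /(congr1 size); rewrite size_rcons.
    rewrite [RHS]endpoint_arrival [in RHS]arrival_rcons /departure;
      case Ez : (rcons z j) => [|a b]; last by rewrite /= inord_val.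
    by move: Ez => /(congr1 size); rewrite size_rcons.
  exists z; first by rewrite tree_adjC; apply: offspring_adj => //; exact: is_offspring_rcons.
  by rewrite -surjective_pairing arrival_rcons mK departure_fst.
move=> /and3P[_ ty /orP[|] /is_offspringP[j]].
  move=> -> ->; apply/existsP; exists (departure m v x j).2.
  by rewrite -(departure_fst m v x j) -surjective_pairing endpoint_arrival arrival_rcons.
move=> -> ->; apply/existsP; exists (arrival m v (rcons y j)).2.
by rewrite endpoint_arrival -surjective_pairing arrival_rcons mK departure_fst.
Qed.

Variable L : seq (seq nat).
Hypothesis LP : forall x, in_tree d x -> (size x <= k.+2)%N -> x \in L.
Hypothesis kn : (k < n)%N.

Definition colour_at v (l : T) : M := f (endpoint m v (val l)).

(** Injectivity is required up to radius [k + 2], one more than the ball, to rule out edges between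
    two of its boundary vertices. *)
Lemma good_vertex_mass v X : v \notin colliding L m ->
  #|{perm V}|%:R^-1 * #|[set s : {perm V} | (restr k.+1 (labelled_graph R (graph_of m) f v s) : RG)
    ==
        restr k.+1 (ball_graph X)]%SET|%:R =
  #|ball_aut B|%:R^-1 * #|[set t in ball_aut B | [forall l : T,
    colour_at v (t l) == X l]]%SET|%:R :> R.
Proof.
rewrite inE negbK => /uniq_map_inj inj.
have A0 : #|ball_aut B|%:R != 0 :> R.
  rewrite pnatr_eq0 -lt0n; apply/card_gt0P; exists 1%g; rewrite inE.
  by apply/forallP => x; apply/forallP => y; rewrite !perm1.
have S0 : #|{perm V}|%:R != 0 :> R by rewrite pnatr_eq0 -lt0n; apply/card_gt0P; exists 1%g.
have := @bfs_count R M V (graph_of m) d v (endpoint m v) k.+1 erefl (@endpoint_adj v) _ _ B BP f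
  (ball_ext X).
rewrite card_ord => /(_ _ kn) H.
have {}H := H (fun x y tx ty xk yk e => inj x y (LP tx xk) (LP ty yk) e).
apply: (mulfI S0); rewrite mulVKf//; apply: (mulIf A0); rewrite -natrM H.
rewrite natrM -mulrA; congr (_ * _); rewrite mulrAC mulVf// mul1r; congr _%:R.
apply: eq_card => t; rewrite !inE; congr (_ && _).
by apply: eq_forallb => l; rewrite ball_extE.
Qed.

Lemma distr_near X : `|fine (distr R (graph_of m) f (cylinder X)) -
    n%:R^-1 * \sum_v (#|ball_aut B|%:R^-1 * #|[set t in ball_aut B | [forall l : T,
      colour_at v (t l) == X l]]%SET|%:R)|
  <= #|colliding L m|%:R / n%:R.
Proof.
have nR : 0 < n%:R :> R by rewrite ltr0n.
rewrite distr_cylinder -mulrBr normrM normfV (ger0_norm (ltW nR)) mulrC; apply: ler_wpM2r;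
  first by rewrite invr_ge0 ltW.
rewrite -sumrB; apply: le_trans (ler_norm_sum _ _ _) _.
rewrite -[#|colliding L m|]sum1_card natr_sum [leRHS]big_mkcond /=; apply: ler_sum => v _.
have [vB|vB] := boolP (v \in colliding L m); last by rewrite good_vertex_mass// subrr normr0.
have rng (a b : nat) : (a <= b)%N -> 0 <= (b%:R^-1 * a%:R : R) <= 1.
  move=> ab; rewrite mulr_ge0 ?invr_ge0//=; case: b ab => [|b] ab.
    by rewrite invr0 mul0r.
  by rewrite mulrC ler_pdivrMr ?ltr0n// mul1r ler_nat.
have /andP[a0 a1] := rng #|[set s : {perm V} | (restr k.+1 (labelled_graph R (graph_of m) f v s) :
  RG) ==
        restr k.+1 (ball_graph X)]%SET| #|{perm V}| (max_card _).
have le : (#|[set t in ball_aut B | [forall l : T, colour_at v (t l) == X l]]%SET| <=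
  #|ball_aut B|)%N.
  by apply: subset_leq_card; apply/fintype.subsetP => t; rewrite finset.in_set => /andP[].
have /andP[b0 b1] := rng _ _ le.
by rewrite ler_norml; move: a0 a1 b0 b1; move: (_ * _) (_ * _) => x y; lra.
Qed.

Lemma symmetrized_count X :
  n%:R^-1 * \sum_v (#|ball_aut B|%:R^-1 * #|[set t in ball_aut B | [forall l : T,
    colour_at v (t l) == X l]]%SET|%:R) =
  #|ball_aut B|%:R^-1 * \sum_(t in ball_aut B)
     (#|[set v | [forall l : T, colour_at v (t l) == X l]]%SET|%:R / n%:R) :> R.
Proof.
rewrite -mulr_sumr mulrCA -mulr_suml [_ / n%:R]mulrC; congr (_ * (_ * _)).
under eq_bigr do rewrite -sum1_card natr_sum big_mkcond /=.
rewrite exchange_big /= [RHS]big_mkcond /=; apply: eq_bigr => t _.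
rewrite -sum1_card natr_sum [in RHS]big_mkcond /=.
case: ifP => tA; last by apply: big1 => v _; rewrite finset.in_set tA.
by apply: eq_bigr => v _; rewrite finset.in_set [in RHS]finset.in_set tA.
Qed.

(** Up to the colliding vertices, the empirical mass is an average over automorphisms [t] of ball
    frequencies. By [ball_weight_aut] these are all within [delta] of one and the same weight. *)
Lemma distr_cylinder_near (delta : R) X : ball_good p k delta m f ->
  `|fine (distr R (graph_of m) f (cylinder X)) - fine (tree_law mu (cylinder X))| <=
    delta + #|colliding L m|%:R / n%:R.
Proof.
move=> /forallP bg; have := distr_near X; rewrite symmetrized_count.
set D := fine _; set S := _ * _; rewrite tree_law_cylinder; set N := ball_weight p _ => h.
suff h2 : `|S - N| <= delta.
  have -> : D - N = (S - N) + (D - S) by rewrite [RHS]addrC subrKA.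
  exact: le_trans (ler_normD _ _) (lerD h2 h).
have A0 : 0 < #|ball_aut B|%:R :> R.
  rewrite ltr0n; apply/card_gt0P; exists 1%g; rewrite inE.
  by apply/forallP => x; apply/forallP => y; rewrite !perm1.
have -> : S - N = #|ball_aut B|%:R^-1 * \sum_(t in ball_aut B)
     (#|[set v | [forall l : T, colour_at v (t l) == X l]]%SET|%:R / n%:R - N).
  rewrite sumrB sumr_const mulrBr -/S; congr (_ - _).
  by rewrite -[N *+ _]mulr_natl mulKf// gt_eqF.
rewrite normrM normfV (ger0_norm (ltW A0)) mulrC ler_pdivrMr//.
apply: le_trans (ler_norm_sum _ _ _) _; rewrite mulr_natr -sumr_const.
apply: ler_sum => t tA.
(* The pattern that the ball must show before relabelling by [t]. *)
pose Y x : M := if insub x is Some l then X (t^-1 l)%g else point.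
have YE (l : T) : Y (val l) = X (t^-1 l)%g by rewrite /Y valK.
have <- : ball_weight p (ball_at E k Y) = N.
  apply/esym; apply: (ball_weight_aut pL muP BP tA) => l.
  by rewrite ball_extE YE permK.
have := bg (ball_at E k Y); rewrite card_ord.
rewrite (_ : ball_count _ _ _ = #|[set v | [forall l : T, colour_at v (t l) == X l]]%SET|)//.
apply: eq_card => v; rewrite !finset.in_set; apply/eqP/forallP => [/ball_at_eq e l|e].
  by rewrite /colour_at e ?YE ?permK ?(ball_in_tree BP) ?(ball_size BP).
apply/ball_at_eq => x tx xk; have [l <-] := ball_word BP tx xk.
by have /eqP := e (t^-1 l)%g; rewrite /colour_at permKV YE.
Qed.

(* The edge statistics are read off from the balls of radius 1. *)
Definition star_edges (X : {ffun T -> M}) a b : nat :=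
  (\sum_(r : T | size (val r) == 0) \sum_(l : T | size (val l) == 1) ((X r == a) && (X l == b)))%N.

(** Counting neighbours of the root is insensitive to automorphisms of the ball, so the random
    labelling does not disturb it; the error comes from colliding vertices. *)
Lemma sum_star_edges_distr a b :
  `|(edge_count m f (a, b))%:R / n%:R -
     \sum_X (star_edges X a b)%:R * fine (distr R (graph_of m) f (cylinder X))| <=
   (\sum_X star_edges X a b)%N%:R * (#|colliding L m|%:R / n%:R).
Proof.
have nR : 0 < n%:R :> R by rewrite ltr0n.
have A0 : #|ball_aut B|%:R != 0 :> R.
  rewrite pnatr_eq0 -lt0n; apply/card_gt0P; exists 1%g; rewrite inE.
  by apply/forallP => x; apply/forallP => y; rewrite !perm1.
pose cv v : {ffun T -> M} := [ffun l => colour_at v l].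
have [r0 r0E] := ball_word BP (isT : in_tree d [::]) (leq0n _).
have cvE v : star_edges (cv v) a b = (\sum_(i : 'I_d) ((f v == a) && (f (m (v, i)).1 == b)))%N.
  rewrite /star_edges (big_pred1 r0) => [|r]; last first.
    by rewrite size_eq0 -r0E; exact: val_eqE.
  have ti (i : 'I_d) : in_tree d [:: i.+1] by rewrite /= ltn_ord.
have nb (i : 'I_d) : exists l : T, val l = [:: i.+1] := ball_word BP (ti i) (ltn0Sn k).
  have [h hE] : exists h : 'I_d -> T, forall i, val (h i) = [:: i.+1].
    have [h hP] := choice nb; by exists h.
  have hI : injective h by move=> i j e; have := hE i; rewrite e hE => -[] /val_inj.
  rewrite (reindex h) /=; last first.
    exists (fun l : T => inord (head 1%N (val l)).-1) => [i _|l].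
      by rewrite hE /= inord_val.
    rewrite inE => /eqP l1; apply: val_inj; rewrite hE.
    have l1' : size (val l) = 1%N by exact: l1.
    move: l1' (ball_in_tree BP l); case: (val l) => [|i [|]]//= _; rewrite andbT => /andP[i0 id].
    by rewrite inordK ?prednK.
  rewrite (eq_bigl xpredT) => [|i]; last by rewrite hE.
  apply: eq_bigr => i _; rewrite !ffunE /colour_at r0E hE /=.
  by rewrite inord_val.
have symE (X : {ffun T -> M}) t : t \in ball_aut B -> star_edges [ffun l =>
  X (t l)] a b = star_edges X a b.
  move=> tA; rewrite /star_edges [RHS](reindex_inj (@perm_inj _ t)) /=.
  apply: eq_big => [r|r _]; first by rewrite (ball_aut_size BP).
  rewrite [RHS](reindex_inj (@perm_inj _ t)) /=.
  by apply: eq_big => [l|l _]; rewrite ?(ball_aut_size BP)// !ffunE.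
have <- : \sum_X (star_edges X a b)%:R * (n%:R^-1 * \sum_v (#|ball_aut B|%:R^-1 *
     #|[set t in ball_aut B | [forall l : T, colour_at v (t l) == X l]]%SET|%:R)) =
   (edge_count m f (a, b))%:R / n%:R :> R.
  under eq_bigr do rewrite mulrCA; rewrite -mulr_sumr mulrC; congr (_ * _).
  under eq_bigr do rewrite -mulr_sumr mulrCA mulr_sumr; rewrite -mulr_sumr exchange_big /=.
  have -> : edge_count m f (a, b) = (\sum_v star_edges (cv v) a b)%N.
    under [RHS]eq_bigr do rewrite cvE.
    rewrite pair_big /edge_count -sum1_card big_mkcond /=; apply: eq_bigr => -[v i] _ /=.
    by rewrite finset.in_set /= xpair_eqE; case: (_ && _).
  rewrite natr_sum mulr_sumr; apply: eq_bigr => v _.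
  apply: (mulfI A0); rewrite mulVKf//.
  under eq_bigr do rewrite -sum1_card natr_sum mulr_sumr big_mkcond /=.
  rewrite exchange_big /= mulr_natl -sumr_const [RHS]big_mkcond /=; apply: eq_bigr => t _.
  have eqc (X : {ffun T -> M}) : [forall l : T, colour_at v (t l) == X l] = (X == [ffun l =>
    cv v (t l)]).
    apply/forallP/eqP => [e|-> l]; last by rewrite !ffunE.
    by apply/ffunP => l; rewrite !ffunE (eqP (e l)).
  case: ifP => tA; last by apply: big1 => X _; rewrite finset.in_set tA.
  rewrite (bigD1 [ffun l => cv v (t l)]) //= finset.in_set tA eqc eqxx mulr1 symE// big1 ?addr0//
    => X.
  by rewrite finset.in_set eqc => /negbTE ->; rewrite andbF.
rewrite -sumrB natr_sum mulr_suml; apply: le_trans (ler_norm_sum _ _ _) _.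
apply: ler_sum => X _; rewrite -mulrBr normrM normr_nat; apply: ler_wpM2l => //.
by rewrite distrC distr_near.
Qed.

End graph.
Lemma sum_star_edges_tree a b :
  \sum_X (star_edges X a b)%:R * fine (tree_law mu (cylinder X)) = d%:R * p (a, b).
Proof.
have cylE X : fine (tree_law mu (cylinder X)) = fine (mu [set Z | forall l : T,
  read_word Z (val l) = X l]).
  by congr (fine (mu _)); apply/seteqP; split=> Z /tree_graph_restr.
have [r0 r0E] := ball_word BP (isT : in_tree d [::]) (leq0n _).
have edge l : size (val l) == 1 -> \sum_(X : {ffun T ->
  M}) ((X r0 == a) && (X l == b))%:R * fine (tree_law mu (cylinder X)) = p (a, b).
  move=> l1; have [i lE] : exists i, val l = [:: i].
    by case: (val l) l1 => [|i [|]]// _; exists i.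
  have tl : in_tree d (rcons [::] i) by have := ball_in_tree BP l; rewrite lE.
  rewrite -(edge_prob muP a b tl).
  pose g (Z : process_space d M) : {ffun T -> M} := [ffun l => read_word Z (val l)].
  have gE X : [set Z | g Z = X] = [set Z | forall l : T, read_word Z (val l) = X l].
    by apply/seteqP; split=> Z /=; [move=> <- l'; rewrite /g ffunE|move=> h; apply/ffunP => l';
      rewrite /g ffunE; exact: h].
  have mg X : measurable [set Z | g Z = X].
    rewrite gE; apply: (@measurable_words _ _ B) => Z Z' e h l'.
    by rewrite -h e// (valP l').
  rewrite (@prob_partition _ _ _ mu _ _ g) => [|X]; last by apply: measurableI => //;
    exact: measurable_edge.
  apply: eq_bigr => X _; rewrite cylE -gE.
  have [/andP[/eqP ra /eqP lb]|nab] := boolP ((X r0 == a) && (X l == b)).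
    rewrite mul1r; congr (fine (mu _)); apply/seteqP; split=> Z; last by case.
    move=> gZ; split=> //=; rewrite -ra -lb -gZ !ffunE r0E lE.
    by [].
  rewrite mul0r (_ : _ `&` _ = set0) ?measure0//; apply/seteqP; split=> // Z [/= [Za Zb] gZ].
  by case/negP: nab; rewrite -gZ !ffunE r0E lE Za Zb !eqxx.
have starE X : star_edges X a b = (\sum_(l : T | size (val l) == 1) ((X r0 == a) && (X l == b)))%N.
  by rewrite /star_edges (big_pred1 r0) // => r; rewrite size_eq0 -r0E; exact: val_eqE.
under eq_bigr do rewrite starE natr_sum mulr_suml.
rewrite exchange_big /= (eq_bigr (fun=> p (a, b))) => [|l]; last exact: edge.
rewrite sumr_const -[LHS]mulr_natl; congr (_%:R * _).
have ti (i : 'I_d) : in_tree d [:: i.+1] by rewrite /= ltn_ord.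
have nb (i : 'I_d) : exists l : T, val l = [:: i.+1] := ball_word BP (ti i) (ltn0Sn k).
have [h hE] := choice nb.
have hI : injective h by move=> i j e; have := hE i; rewrite e hE => -[] /val_inj.
rewrite -[RHS]card_ord -(card_imset predT hI); apply: eq_card => l; rewrite [LHS]inE;
  apply/idP/imsetP => [l1|[i _ ->]]; last by rewrite hE.
have l1' : size (val l) == 1%N by exact: l1.
have [i lE] : exists i, val l = [:: i] by case: (val l) l1' => [|i [|]]// _; exists i.
have := ball_in_tree BP l; rewrite lE /= andbT => /andP[i0 id].
have id' : (i.-1 < d)%N by rewrite prednK.
by exists (Ordinal id') => //; apply: val_inj; rewrite hE lE /= prednK.
Qed.

End cylinders.

(** * Test functions and restrictions to balls *)

Section weak_convergence.
Local Open Scope classical_set_scope.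
Local Open Scope ring_scope.
Variables (R : realType) (M : pointedFinType).
Local Notation RG := (rooted_graph R M).
Local Notation law := (probability RG R).

Lemma continuous_graph_measurable (phi : RG -> R) : continuous phi -> measurable_fun setT phi.
Proof.
move=> /continuousP cf; apply: (measurability _ (RGenOpens.measurableE R)) => //.
move=> _ [_ [a [b ->]] <-]; rewrite setTI; apply: sub_sigma_algebra.
exact/cf/interval_open.
Qed.

Lemma bounded_integrable (nu : law) (phi : RG -> R) C :
  measurable_fun setT phi -> (forall g, `|phi g| <= C) -> nu.-integrable setT (EFin \o phi).
Proof.
move=> mf bf; apply: measurable_bounded_integrable => //.
  by rewrite -ge0_fin_numE// fin_num_measure.
exists C; split; first exact: num_real.
by move=> x Cx g _; apply: le_trans (bf g) (ltW Cx).
Qed.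

Lemma bounded_continuous_integrable (nu : law) (phi : RG -> R) :
  bounded_continuous phi -> nu.-integrable setT (EFin \o phi).
Proof.
by move=> [cf [C bf]]; exact: (@bounded_integrable nu phi C (continuous_graph_measurable cf) bf).
Qed.

Lemma restr_invariant_continuous (phi : RG -> R) r :
  (forall g h, restr r g = restr r h -> phi g = phi h) -> continuous phi.
Proof.
move=> H; apply/continuousP => U _; apply: (@open_restr _ _ _ r) => g h /H.
by rewrite /preimage /= => ->.
Qed.

Lemma ball_law_integral r (nu : law) (phi : RG -> R) : bounded_continuous phi ->
  \int[ball_law r nu]_g phi g = \int[nu]_g phi (restr r g).
Proof.
move=> [cf [C bf]]; rewrite /Rintegral; congr fine.
apply: (@integral_distribution _ _ _ _ _ nu (@rrestr R M r) (EFin \o phi)).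
  by apply/measurable_EFinP; exact: continuous_graph_measurable.
apply: (@bounded_integrable nu (phi \o @rrestr R M r) C) => [|g]; last exact: bf.
by apply: measurableT_comp; [exact: continuous_graph_measurable|exact: measurable_rrestr].
Qed.

(** Restriction is continuous, so test functions can be pulled back along it. *)
Lemma weak_nbhs_ball_law r (nu : law) (W : set law) : weak_nbhs (ball_law r nu) W ->
  weak_nbhs nu [set nu' | W (ball_law r nu')].
Proof.
move=> [s [e [e0 sbc H]]].
exists [seq (fun g => phi (restr r g)) | phi <- s], e; rewrite size_map.
have nE j g : (j < size s)%N -> nth (functions.cst 0) [seq (fun g =>
  phi (restr r g)) | phi <- s] j g =
    nth (functions.cst 0) s j (restr r g).
  by move=> js; rewrite (nth_map (functions.cst 0)).
split=> // [j js|nu' close].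
  have [cf [C bf]] := sbc j js; rewrite (nth_map (functions.cst 0))//; split; last by exists C.
  by apply: (@restr_invariant_continuous _ r) => g h ->.
apply: H => j js; rewrite !ball_law_integral//; try exact: sbc.
have := close j js; rewrite (nth_map (functions.cst 0))//.
Qed.

Variable dist : law -> law -> R.
Hypothesis Hdist : weak_distance dist.

Lemma dist_ball_nbhs (nu : law) e : 0 < e -> weak_nbhs nu [set nu' | dist nu' nu <= e].
Proof.
move=> e0; apply/(wdist_nbhs Hdist); exists e => // nu' /=.
by rewrite (wdist_sym Hdist) => /ltW.
Qed.

End weak_convergence.

(** * Weak neighbourhoods of the tree law *)

Section tree_nbhs.
Local Open Scope classical_set_scope.
Local Open Scope ring_scope.
Variables (R : realType) (E : nat) (M : pointedFinType).
Local Notation d := E.+2.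
Variable mu : probability (process_space d M) R.
Local Notation RG := (rooted_graph R M).
Local Notation law := (probability RG R).
Local Notation tau := (tree_law mu).

Lemma ball_list_ex k : exists B : seq (seq nat),
  forall x, (x \in B) = in_tree d x && (size x <= k)%N.
Proof.
have [s sP] := small_words d k; exists [seq x <- s | in_tree d x && (size x <= k)%N] => x.
rewrite mem_filter andb_idr// => /andP[tx xk]; apply: sP => //.
exact: in_tree_le.
Qed.

Section fixed_radius.
Variables (k : nat) (B : seq (seq nat)).
Hypothesis BP : forall x, (x \in B) = in_tree d x && (size x <= k.+1)%N.
Local Notation T := (seq_sub B).
Local Notation I := {ffun T -> M}.
Local Notation cyl := (@cylinder R E M k B).
Local Notation bgr := (@ball_graph R E M B).

Lemma cylinder_disjoint X Y g : cyl X g -> cyl Y g -> X = Y.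
Proof.
rewrite /cylinder /= => -> e; apply/ffunP => l.
have /(tree_graph_restr R BP _ _) h : cyl Y (bgr X) by exact: e.
have /(tree_graph_restr R BP _ _) h' : cyl X (bgr X) by [].
by rewrite -h -h'.
Qed.

(** Cylinders are disjoint, so the value is [c0 + c X] on the cylinder of a listed [X] and [c0]
    elsewhere. Test functions are squeezed between two such functions. *)
Definition step_fun (c0 : R) (r : seq I) (c : I -> R) (g : RG) : R :=
  c0 + \sum_(X <- r) c X * \1_(cyl X) g.

Lemma step_fun_integral (nu : law) c0 (r : seq I) c :
  nu.-integrable setT (EFin \o step_fun c0 r c) /\
  \int[nu]_g step_fun c0 r c g = c0 + \sum_(X <- r) c X * fine (nu (cyl X)).
Proof.
have bI X : nu.-integrable setT (EFin \o (fun g => c X * \1_(cyl X) g)).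
  rewrite (_ : EFin \o _ = (fun g => (c X)%:E * (\1_(cyl X) g)%:E)%E); last by apply/funext.
  apply: integrableZl => //; apply: integrable_indic; exact: measurable_cylinder.
elim: r => [|X r [iI iE]].
  rewrite (_ : step_fun c0 [::] c = functions.cst c0); last first.
    by apply/funext => g; rewrite /step_fun big_nil addr0.
  split; first by apply: (@bounded_integrable _ _ nu (functions.cst c0) `|c0|).
  rewrite big_nil addr0; apply: etrans (Rintegral_cst nu measurableT c0) _.
  by rewrite [X in _ * fine X](_ : _ = 1%E) ?mulr1//; exact: probability_setT.
have eS : step_fun c0 (X :: r) c = (fun g => c X * \1_(cyl X) g + step_fun c0 r c g).
  by apply/funext => g; rewrite /step_fun big_cons addrCA.
rewrite eS; split.
  rewrite (_ : EFin \o _ = (EFin \o (fun g =>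
    (c X * \1_(cyl X) g)%R)) \+ (EFin \o step_fun c0 r c))%E; last by apply/funext.
  exact: integrableD.
rewrite RintegralD// iE big_cons addrCA; congr (_ + (_ + _)).
rewrite RintegralZl//; last by apply: integrable_indic; exact: measurable_cylinder.
congr (_ * _); rewrite /Rintegral integral_indic//; last exact: measurable_cylinder.
by rewrite setIT.
Qed.

Lemma step_fun_in c0 (P : pred I) c X g : cyl X g -> P X ->
  step_fun c0 [seq Y <- enum I | P Y] c g = c0 + c X.
Proof.
move=> gX PX; congr (_ + _); rewrite big_filter big_enum_cond /= (bigD1 X)//=.
rewrite indicE mem_set// mulr1 big1 ?addr0// => Y /andP[_ YX].
rewrite indicE memNset ?mulr0// => gY; move: YX.
by rewrite (cylinder_disjoint gX gY) eqxx.
Qed.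

Lemma step_fun_out c0 (P : pred I) c g : (forall X, P X -> ~ cyl X g) ->
  step_fun c0 [seq Y <- enum I | P Y] c g = c0.
Proof.
move=> N; rewrite /step_fun big_filter big_enum_cond /= big1 ?addr0// => X PX.
by rewrite indicE memNset ?mulr0//; exact: N.
Qed.

Lemma sum_cylinders_tree (U : set RG) : (forall g h, restr k.+1 g = restr k.+1 h -> U g -> U h) ->
  fine (tau U) <= \sum_(X : I | `[< U (bgr X) >]) fine (tau (cyl X)).
Proof.
move=> Uinv; have mU : measurable U by exact: measurable_restr_invariant Uinv.
pose g (Z : process_space d M) : I := [ffun l => read_word Z (val l)].
have cylg X Z : g Z = X <-> cyl X (tree_graph R Z).
  rewrite (tree_graph_restr R BP); split=> [<- l|h]; first by rewrite /g ffunE.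
  by apply/ffunP => l; rewrite /g ffunE h.
have mt (A : set RG) : measurable A -> measurable (@tree_graph R d M @^-1` A).
  by move=> mA; rewrite -[X in measurable X]setTI;
    exact: (@measurable_tree_graph R d M measurableT A mA).
have gE X : [set Z | g Z = X] = @tree_graph R d M @^-1` cyl X.
  by apply/seteqP; split=> Z /cylg.
rewrite -[fine (tau U)]/(fine (mu (@tree_graph R d M @^-1` U))).
rewrite (@prob_partition _ _ _ mu _ _ g) => [|X]; last first.
  by apply: measurableI; [exact: mt|rewrite gE; apply: mt; exact: measurable_cylinder].
rewrite [leRHS]big_mkcond /=; apply: ler_sum => X _; rewrite gE.
case: asboolP => [UX|NUX].
  rewrite -[tau (cyl X)]/(mu (@tree_graph R d M @^-1` cyl X)).
  apply: fine_le; rewrite ?fin_num_measure//.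
  - by apply: measurableI; apply: mt => //; exact: measurable_cylinder.
  - by apply: mt; exact: measurable_cylinder.
  apply: le_measure; rewrite ?inE//.
  - by apply: measurableI; apply: mt => //; exact: measurable_cylinder.
  - by apply: mt; exact: measurable_cylinder.
rewrite (_ : _ `&` _ = set0) ?measure0//; apply/seteqP; split=> // Z [UZ cZ].
by apply: NUX; apply: Uinv UZ; exact: cZ.
Qed.

(** The two step functions are [phi (bgr X)] plus or minus [a] on the selected cylinders, and plus
    or minus [a + C] elsewhere. *)
Lemma integral_near_sum (phi : RG -> R) (U : set RG) (a C : R) (nu : law) :
  bounded_continuous phi -> 0 <= a -> (forall g, `|phi g| <= C) ->
  (forall X g, U (bgr X) -> cyl X g -> `|phi g - phi (bgr X)| <= a) ->
  `|\int[nu]_g phi g - \sum_(X : I | `[< U (bgr X) >]) phi (bgr X) * fine (nu (cyl X))| <=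
  a + C * (1 - \sum_(X : I | `[< U (bgr X) >]) fine (nu (cyl X))).
Proof.
move=> bc a0 bC osc; set S1 := \sum_(X | _) _; set S2 := \sum_(X | _) _.
pose P (X : I) := `[< U (bgr X) >]; pose r := [seq Y <- enum I | P Y].
have ip := bounded_continuous_integrable nu bc.
have C0 : 0 <= C by apply: le_trans (bC point).
have sumE (c : I -> R) : \sum_(X <- r) c X = \sum_(X | P X) c X by rewrite big_filter big_enum_cond.
have [i1 e1] := step_fun_integral nu (a + C) r (fun X => phi (bgr X) - C).
have [i2 e2] := step_fun_integral nu (- (a + C)) r (fun X => phi (bgr X) + C).
have cases g : (exists2 X, P X & cyl X g) \/ (forall X, P X -> ~ cyl X g).
  have [h|h] := pselect (exists2 X, P X & cyl X g); [by left|right].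
  by move=> X PX gX; apply: h; exists X.
have up g : phi g <= step_fun (a + C) r (fun X => phi (bgr X) - C) g.
  have [[X PX gX]|N] := cases g.
    rewrite (step_fun_in _ _ gX PX); have := osc X g (asboolW PX) gX.
    by rewrite ler_norml; lra.
  by rewrite step_fun_out//; have := bC g; rewrite ler_norml; lra.
have dn g : step_fun (- (a + C)) r (fun X => phi (bgr X) + C) g <= phi g.
  have [[X PX gX]|N] := cases g.
    rewrite (step_fun_in _ _ gX PX); have := osc X g (asboolW PX) gX.
    by rewrite ler_norml; lra.
  by rewrite step_fun_out//; have := bC g; rewrite ler_norml; lra.
have := le_Rintegral (mu := nu) measurableT ip i1 (fun g _ => up g).
have := le_Rintegral (mu := nu) measurableT i2 ip (fun g _ => dn g).
rewrite e1 e2 !sumE.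
under eq_bigr do rewrite mulrDl; rewrite big_split /= -mulr_sumr -/S1 -/S2.
under [X in _ -> _ <= _ + X -> _]eq_bigr do rewrite mulrBl; rewrite sumrB -mulr_sumr -/S1 -/S2.
by rewrite ler_norml; move: (\int[nu]_g phi g) => y; move: S1 S2 => u w; lra.
Qed.

End fixed_radius.

(** At a large enough radius, the cylinders on which the test functions barely vary carry almost all
    the mass of the tree law. They are finitely many, and a law close to it on each of them also has
    little mass elsewhere. *)
Lemma tree_weak_nbhs (W : set law) : weak_nbhs tau W ->
  exists k B (delta : R), [/\ forall x, (x \in B) = in_tree d x && (size x <= k.+1)%N, 0 < delta &
    forall nu : law, (forall X : {ffun seq_sub B -> M},
       `|fine (nu (@cylinder R E M k B X)) - fine (tau (@cylinder R E M k B X))| <= delta) -> W nu].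
Proof.
move=> [s [e [e0 sbc HW]]].
have [C C1 bC] : exists2 C : R, 1 <=
  C & forall j g, (j < size s)%N -> `|nth (functions.cst 0) s j g| <= C.
  have [b bP] : exists b : 'I_(size s) -> R, forall (j : 'I_(size s)) g,
    `|nth (functions.cst 0) s j g| <= b j.
    have : forall j : 'I_(size s), exists b : R, forall g, `|nth (functions.cst 0) s j g| <= b.
      by move=> j; have [_ [b bb]] := sbc j (ltn_ord j); exists b.
    by move=> h; have [b bP] := choice h; exists b.
  exists (1 + \sum_j `|b j|) => [|j g js]; first by rewrite lerDl sumr_ge0.
  apply: le_trans (bP (Ordinal js) g) _; apply: le_trans (ler_norm _) _.
  rewrite (bigD1 (Ordinal js))//= addrCA lerDl addr_ge0// sumr_ge0//.
have Cp : 0 < C by exact: lt_le_trans C1.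
(* The errors below add up to [6 * e8]. *)
pose e8 := e / 8; have e80 : 0 < e8 by rewrite divr_gt0.
(* By continuity of the test functions these sets increase to the whole space, so one of them has
   mass close to 1. *)
pose U (k : nat) : set RG := [set g | forall h h' j, restr k.+1 g = restr k.+1 h ->
   restr k.+1 g = restr k.+1 h' -> (j < size s)%N ->
     `|nth (functions.cst 0) s j h - nth (functions.cst 0) s j h'| <= e8].
have Uinv k g h : restr k.+1 g = restr k.+1 h -> U k g -> U k h.
  by move=> e1 Ug a b j; rewrite -e1; exact: Ug.
have mU k : measurable (U k) by exact: measurable_restr_invariant (@Uinv k).
have UT : \bigcup_k U k = setT.
  apply/seteqP; split=> // g _.
  have [rr rrP] : exists rr : 'I_(size s) -> nat, forall (j : 'I_(size s)) h,
    restr (rr j) g = restr (rr j) h ->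
      `|nth (functions.cst 0) s j g - nth (functions.cst 0) s j h| <= e8 / 2.
    have : forall j : 'I_(size s), exists r, forall h, restr r g = restr r h ->
        `|nth (functions.cst 0) s j g - nth (functions.cst 0) s j h| <= e8 / 2.
      move=> j; have [cf _] := sbc j (ltn_ord j).
      have e16 : 0 < e8 / 2 by rewrite divr_gt0.
      have := cf g; move/cvgrPdist_le => /(_ _ e16) /nbhs_restr[r rP].
      by exists r => h /rP.
    by move=> h; have [b bP] := choice h; exists b.
  exists (\sum_j rr j)%N => // h h' j eh eh' js.
  have le : (rr (Ordinal js) <= (\sum_j rr j).+1)%N.
    by rewrite (bigD1 (Ordinal js))//=; lia.
  have rs q : restr (\sum_j rr j)%N.+1 g = restr (\sum_j rr j)%N.+1 q ->
      `|nth (functions.cst 0) s j g - nth (functions.cst 0) s j q| <= e8 / 2.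
    move=> eq; apply: (rrP (Ordinal js) q).
    by rewrite -(restr_restr g le) eq restr_restr.
  have := rs h eh; have := rs h' eh'.
  by rewrite !ler_norml; lra.
have ndU : {homo U : i j / (i <= j)%N >-> (i <= j)%O}.
  move=> i j ij; apply/subsetPset => g Ug h h' l eh eh'; apply: Ug.
    by rewrite -(restr_restr g (ij : (i.+1 <= j.+1)%N)) eh restr_restr.
  by rewrite -(restr_restr g (ij : (i.+1 <= j.+1)%N)) eh' restr_restr.
have [k kP] : exists k, 1 - e8 / C <= fine (tau (U k)).
  have mUT : measurable (\bigcup_k U k) by rewrite UT.
  have := @nondecreasing_cvg_mu _ _ _ tau U mU mUT ndU.
  rewrite [X in _ --> X](_ : _ = 1%:E); last by rewrite UT; exact: probability_setT.
  move=> /fine_cvg /cvgrPdist_le /(_ (e8 / C)).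
  rewrite divr_gt0// => /(_ isT)[k _ /(_ k (leqnn _))] /=.
  by move=> h; exists k; move: h; rewrite ler_norml; lra.
have [B BP] := ball_list_ex k.+1.
pose I := {ffun seq_sub B -> M}; pose K : R := #|{: I}|%:R + 1.
have K0 : 0 < K by rewrite ltr_wpDl.
exists k, B, (e8 / C / K); split=> //; first by rewrite !divr_gt0.
move=> nu close; apply: HW => j js.
pose ph := nth (functions.cst 0) s j.
have osc (X : I) g : U k (@ball_graph R E M B X) -> @cylinder R E M k B X g ->
  `|ph g - ph (@ball_graph R E M B X)| <= e8.
  by move=> UX gX; apply: UX => //; exact: esym.
have n1 := integral_near_sum BP nu (sbc j js) (ltW e80) (fun g => bC j g js) osc.
have n2 := integral_near_sum BP tau (sbc j js) (ltW e80) (fun g => bC j g js) osc.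
have st := sum_cylinders_tree BP (@Uinv k).
move: n1 n2 st; set A1 := \sum_(X | _) _; set A2 := \sum_(X | _) fine (nu _).
set T1 := \sum_(X | _) _; set T2 := \sum_(X | _) _ => n1 n2 st.
have dsum (c : I -> R) c1 : 0 <= c1 -> (forall X, `|c X| <= c1) ->
   `|\sum_(X | `[< U k (@ball_graph R E M B X) >]) c X * fine (nu (@cylinder R E M k B X)) -
     \sum_(X | `[< U k (@ball_graph R E M B X) >]) c X * fine (tau (@cylinder R E M k B X))| <=
       c1 * (e8 / C).
  move=> c10 cc; rewrite -sumrB; apply: le_trans (ler_norm_sum _ _ _) _.
  apply: (@le_trans _ _ (\sum_(X : I) c1 * (e8 / C / K))).
    rewrite big_mkcond /=; apply: ler_sum => X _; case: ifP => _; last first.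
      by rewrite mulr_ge0// ltW// !divr_gt0.
    by rewrite -mulrBr normrM; apply: ler_pM.
  rewrite sumr_const -[leLHS]mulr_natl mulrCA; apply: ler_wpM2l => //.
  rewrite (eq_card (B := {: I}))// mulrCA; apply: ler_piMr; first by rewrite ltW// divr_gt0.
  by rewrite ler_pdivrMr// mul1r /K lerDl.
have a1 := dsum (fun X => ph (@ball_graph R E M B X)) C (ltW Cp) (fun X => bC j _ js).
have a2 : `|A2 - T2| <= e8 / C.
  have one (X : I) : `|1 : R| <= 1 by rewrite normr1.
  have := dsum (fun=> 1) 1 ler01 one; rewrite mul1r.
  by under eq_bigr do rewrite mul1r; under [X in _ - X]eq_bigr do rewrite mul1r.
have Ce : C * (e8 / C) = e8 by rewrite mulrC divfK// gt_eqF.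
rewrite Ce in a1.
have b2 : C * (1 - T2) <= e8.
  by rewrite -[leRHS]Ce ler_pM2l//; move: kP st; lra.
have b1 : C * (1 - A2) <= 2 * e8.
  have : C * (T2 - A2) <= e8.
    by rewrite -[leRHS]Ce ler_pM2l//; move: a2; rewrite ler_norml; lra.
  move: b2; rewrite !mulrBr mulr1; lra.
have -> : \int[nu]_g ph g - \int[tau]_g ph g = (\int[nu]_g ph g - A1) + (A1 - T1) - (\int[tau]_g ph
  g - T1).
  by move: (\int[nu]_g ph g) (\int[tau]_g ph g) => u v; lra.
have ee : e = 8 * e8 by rewrite /e8 mulrC divfK.
apply: le_lt_trans (ler_normB _ _) _.
apply: le_lt_trans (lerD (ler_normD _ _) (lexx _)) _.
move: n1 n2 a1; rewrite -/ph -/A1 -/T1.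
by move: `|_ - A1| `|A1 - T1| `|_ - T1| => x y z; lra.
Qed.

End tree_nbhs.

(** * Probabilities over uniform regular graphs *)

Section probabilities.
Variables (R : realType) (E : nat).
Local Notation prob n := (@prob_regular R E.+2 n).

Lemma expR_small (c e : R) : 0 < c -> 0 < e -> exists n0 : nat,
  forall n, (n0 <= n)%N -> expR (- (c * n%:R)) <= e.
Proof.
move=> c0 e0; exists (Num.truncn (e^-1 / c)).+1 => n nn.
have h : e^-1 <= c * n%:R.
  rewrite mulrC -ler_pdivrMr//; apply: ltW; apply: lt_le_trans (truncnS_gt _) _.
  by rewrite ler_nat.
rewrite expRN -[leRHS]invrK lef_pV2 ?posrE ?expR_gt0 ?invr_gt0//.
apply: le_trans h _; apply: le_trans (expR_ge1Dx _); rewrite lerDr.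
by [].
Qed.

Lemma prob_le n (A A' : pred {set {set 'I_n}}) : (forall G, A G -> A' G) -> prob n A <= prob n A'.
Proof.
move=> h; rewrite /prob_regular ler_wpM2r ?invr_ge0// ler_nat.
by apply: subset_leq_card; apply/fintype.subsetP => G; rewrite !finset.in_set => /andP[-> /h ->].
Qed.

Lemma prob_le1 n (A : pred {set {set 'I_n}}) : prob n A <= 1.
Proof.
rewrite /prob_regular; have [->|r0] := posnP #|regular_graphs E.+2 n|; first by rewrite invr0 mulr0.
rewrite ler_pdivrMr ?ltr0n// mul1r ler_nat; apply: subset_leq_card.
by apply/fintype.subsetP => G; rewrite finset.in_set => /andP[].
Qed.

Lemma probC n (A : pred {set {set 'I_n}}) : (0 < #|regular_graphs E.+2 n|)%N ->
  prob n A + prob n (fun G => ~~ A G) = 1.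
Proof.
move=> r0; rewrite /prob_regular -mulrDl -natrD.
rewrite (_ : (_ + _)%N = #|regular_graphs E.+2 n|) ?divff ?pnatr_eq0 -?lt0n//.
rewrite -(cardID (fun G => A G) (regular_graphs E.+2 n)); congr (_ + _)%N; apply: eq_card => G.
  by rewrite finset.in_set !inE.
by rewrite finset.in_set [RHS]andbC.
Qed.

Lemma odd_half n : odd #|{: 'I_n * 'I_E.+2}| = odd (n * E.+2).
Proof. by rewrite card_prod !card_ord. Qed.

Lemma regular_graphs_gt0 : exists n0 : nat, forall n, (n0 <= n)%N -> ~~ odd (n * E.+2) ->
  (0 < #|regular_graphs E.+2 n|)%N.
Proof.
have [n0 n0P] := simple_lower E (@ltr01 R); exists n0 => n nn on.
have [m mP] : exists m, pmatch [set: 'I_n * 'I_E.+2] m.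
  by apply: pmatch_ex; rewrite cardsT odd_half.
have : 0 < #|simple_matchings E n|%:R :> R.
  have := n0P 'I_n; rewrite card_ord => /(_ nn); apply: lt_le_trans.
  by rewrite mulr_gt0 ?expR_gt0// ltr0n; apply/card_gt0P; exists m.
rewrite ltr0n => /card_gt0P[m' m'S]; apply/card_gt0P; exists (graph_of m').
exact: graph_of_regular.
Qed.

End probabilities.

(** * Exponential bounds for typical colourings, from below and from above *)

Section typical.
Variables (R : realType) (E : nat) (M : pointedFinType) (p : M * M -> R).
Hypothesis pL : edge_law p.
Local Notation d := E.+2.
Variable mu : probability (process_space d M) R.
Hypothesis muP : is_markov_process p mu.
Local Notation law := (probability (rooted_graph R M) R).
Local Notation prob n := (@prob_regular R d n).
Local Notation Sg := (Sigma d p).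

Section lower.
Hypothesis Hq : forall q : (M * M) * (M * M) -> R,
  edge_law q -> coupling p p q -> Sigma d q <= 2 * Sigma d p.

(** Two rare events must be avoided: too few colourings with good balls, and too many colliding
    vertices. Otherwise every good colouring has its empirical law in [W]. *)
Lemma many_typical (W : classical_sets.set law) (eta : R) :
  weak_nbhs (tree_law mu) W -> 0 < eta ->
  exists2 c : R, 0 < c & exists n0 : nat, forall n, (n0 <= n)%N -> ~~ odd (n * d) ->
    prob n (fun G => ~~ (expR (n%:R * (Sg - eta)) <=
       #|[set f : {ffun 'I_n -> M} | `[< W (distr R G f) >]]|%:R)) <= expR (- (c * n%:R)).
Proof.
move=> WW eta0; have [k [B [delta [BP dl0 close]]]] := tree_weak_nbhs WW.
have [L tL LP] := tree_list_ex E k.+2.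
have dl2 : 0 < delta / 2 by rewrite divr_gt0.
have [c1 c10 [n1 H1]] := many_good_whp pL Hq k dl2 eta0.
have [c2 c20 [n2 H2]] := few_bad_whp tL dl2.
(* Half of the smaller rate, so that the sum of the two exponentials is at most one exponential. *)
pose c := Order.min c1 c2 / 2; have c0 : 0 < c by rewrite divr_gt0// lt_min c10.
have [n3 H3] := prob_regular_whp E c0.
have e2 : 0 < 2^-1 :> R by rewrite invr_gt0.
have [n4 H4] := expR_small c0 e2.
exists (c / 2); first by rewrite divr_gt0.
exists (maxn n1 (maxn n2 (maxn n3 (maxn n4 k.+2)))) => n;
  rewrite !geq_max => /and5P[nn1 nn2 nn3 nn4 nk] on.
have n0 : (0 < n)%N by exact: leq_trans nk.
pose B1 := [set m in config_matchings 'I_n d | #|good_set p k (delta / 2) m|%:R < expR (n%:R * (Sg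
  - eta))].
pose B2 := [set m in config_matchings 'I_n d | delta / 2 * n%:R < #|colliding L m|%:R].
have oh : ~~ odd #|{: 'I_n * 'I_d}| by rewrite odd_half.
have h1 := H1 'I_n; rewrite card_ord in h1; have {h1} h1 := h1 nn1 oh.
have h2 := H2 'I_n; rewrite card_ord in h2; have {h2} h2 := h2 nn2 oh.
apply: (H3 n nn3 _ (B1 :|: B2)).
  move=> m mS; apply: contraR; rewrite finset.in_setU negb_or => /andP[mB1 mB2].
  have mP : m \in config_matchings 'I_n d by move: mS; rewrite inE => /andP[].
  have g1 : expR (n%:R * (Sg - eta)) <= #|good_set p k (delta / 2) m|%:R.
    by move: mB1; rewrite finset.in_set mP /= -leNgt.
  have g2 : #|colliding L m|%:R <= delta / 2 * n%:R.
    by move: mB2; rewrite finset.in_set mP /= -leNgt.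
  apply: le_trans g1 _; rewrite ler_nat; apply: subset_leq_card; apply/fintype.subsetP => f.
  rewrite !finset.in_set => bg; apply/asboolP/close => X.
  have LP' x : in_tree d x -> (size x <= k.+2)%N -> x \in L by exact: LP.
  have := distr_cylinder_near pL muP BP n0 mS LP' _ X bg.
  move=> /(_ (leq_trans (leqnSn _) nk)) h; apply: le_trans h _.
  rewrite [leRHS](splitr delta) lerD2l ler_pdivrMr ?ltr0n//.
have P0 : 0 <= #|config_matchings 'I_n d|%:R :> R by [].
apply: (@le_trans _ _ (#|B1|%:R + #|B2|%:R)).
  by rewrite -natrD ler_nat; exact: (leq_of_leqif (leq_card_setU _ _)).
apply: le_trans (lerD h1 h2) _; rewrite -mulrDr; apply: ler_wpM2l => //.
have half c' : 2 * c <= c' -> expR (- (c' * n%:R)) <= expR (- (c * n%:R)) * 2^-1.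
  move=> cc; apply: le_trans (_ : _ <= expR (- (c * n%:R)) * expR (- (c * n%:R))) _.
    rewrite -expRD ler_expR -opprD lerN2 -mulrDl ler_wpM2r//.
    by move: cc; rewrite mulr_natl mulr2n.
  by apply: ler_wpM2l; [exact: expR_ge0|exact: H4].
have cc : 2 * c = Order.min c1 c2 by rewrite /c mulrC divfK.
rewrite [leRHS](_ : _ = expR (- (c * n%:R)) * 2^-1 + expR (- (c * n%:R)) * 2^-1); last first.
  by rewrite -mulrDr -[2^-1]mul1r -splitr mulr1.
by apply: lerD; apply: half; rewrite cc ge_min lexx ?orbT.
Qed.

End lower.

Variable dist : law -> law -> R.
Hypothesis Hdist : weak_distance dist.

Lemma ball_law_cylinder k r (B : seq (seq nat)) (nu : law) (X : {ffun seq_sub B -> M}) :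
  (k.+1 <= r)%N -> fine (ball_law r nu (@cylinder R E M k B X)) = fine (nu (@cylinder R E M k B X)).
Proof.
move=> kr; rewrite -[ball_law r nu _]/(nu (@rrestr R M r @^-1` _)%classic).
congr (fine (nu _)); apply/seteqP; split=> g; rewrite /cylinder /preimage /= /rrestr restr_restr//.
Qed.

(** Indicators of cylinders are continuous because membership depends on a finite ball, so they are
    legitimate test functions. *)
Lemma dist_cylinders k r (B : seq (seq nat)) (delta : R) :
  (forall x, (x \in B) = in_tree d x && (size x <= k.+1)%N) -> (k.+1 <= r)%N -> 0 < delta ->
  exists2 e : R, 0 < e & forall nu : law, dist (ball_law r nu) (ball_law r (tree_law mu)) <= e ->
    forall X : {ffun seq_sub B -> M},
    `|fine (nu (@cylinder R E M k B X)) - fine (tree_law mu (@cylinder R E M k B X))| <= delta.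
Proof.
move=> BP kr dl0; pose I := {ffun seq_sub B -> M}.
pose s := [seq (\1_(@cylinder R E M k B X) : rooted_graph R M -> R) | X <- enum I].
pose W := [set nu : law | forall X : I,
  `|fine (nu (@cylinder R E M k B X)) - fine (tree_law mu (@cylinder R E M k B X))| <
    delta]%classic.
have intE (nu : law) (X : I) : (\int[nu]_g (\1_(@cylinder R E M k B X) g : R))%R = fine (nu
  (@cylinder R E M k B X)).
  rewrite /Rintegral integral_indic//; last exact: measurable_cylinder.
  by rewrite setIT.
have /(wdist_nbhs Hdist)[e e0 eW] : weak_nbhs (ball_law r (tree_law mu)) W.
  exists s, delta; split=> // [j js|nu close X].
    have [X ->] : exists X, nth (functions.cst 0) s j = \1_(@cylinder R E M k B X).
      have : nth (functions.cst 0) s j \in s by rewrite mem_nth.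
      by case/mapP => X _ ->; exists X.
    split; last first.
      by exists 1 => g; rewrite indicE; case: (_ \in _); rewrite ?normr1 ?normr0.
    apply: (@restr_invariant_continuous R M _ k.+1) => g h gh.
    rewrite !indicE; congr ((nat_of_bool _)%:R).
    by apply/idP/idP; rewrite !inE /cylinder /= gh.
  have js : (index X (enum I) < size s)%N by rewrite size_map index_mem mem_enum.
  have := close _ js; rewrite (nth_map X) ?nth_index ?mem_enum//; last by rewrite size_map in js.
  by rewrite !intE ball_law_cylinder.
exists (e / 2); first by rewrite divr_gt0.
move=> nu near X; apply: ltW; rewrite -(ball_law_cylinder nu X kr).
apply: (eW (ball_law r nu)) => /=; rewrite (wdist_sym Hdist); apply: le_lt_trans near _.
by rewrite ltr_pdivrMr// ltr_pMr// ltr1n.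
Qed.

(** Markov's inequality for the first moment over colourings with edge statistics near [p]. Any
    positive radius shows the edges at the root, and few collisions allow their statistics to be
    read off from the empirical law. *)
Lemma few_good_colorings (r : nat) (eta : R) : (0 < r)%N -> 0 < eta ->
  exists2 e0 : R, 0 < e0 & exists2 c : R, 0 < c & exists n0 : nat, forall n, (n0 <=
    n)%N -> ~~ odd (n * d) ->
    prob n (fun G => expR (n%:R * (Sg + eta)) <= #|good_colorings dist mu G r e0|%:R) <=
      expR (- (c * n%:R)).
Proof.
have expo (u v e : R) : u * (v + e / 3 + e / 3) = - (e / 3 * u) + u * (v + e) by lra.
move=> r0 eta0; have eta3 : 0 < eta / 3 by rewrite divr_gt0.
have [dl dl0 dlP] := Sigma_uniform M d eta3.
have [B BP] := ball_list_ex E 1.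
pose K : R := (\sum_a \sum_b \sum_(X : {ffun seq_sub B -> M}) star_edges X a b)%N%:R + 1.
have K0 : 0 < K by rewrite ltr_wpDl.
(* Half of the tolerance [dl] is spent on the deviation of cylinder masses, the other half on
   colliding vertices. *)
pose de := dl / 2 / K; have de0 : 0 < de by rewrite !divr_gt0.
have [e0 e00 e0P] := dist_cylinders BP r0 de0.
have [n1 H1] := moment_upper M d eta3.
have [L tL LP] := tree_list_ex E 2.
have [c2 c20 [n2 H2]] := few_bad_whp tL de0.
(* One third of [eta] goes to the continuity of [Sigma], one to [moment_upper], and the last is the
   rate left in Markov's inequality. *)
pose c1 := eta / 3; pose c := Order.min c1 c2 / 2;
  have c0 : 0 < c by rewrite divr_gt0// lt_min eta3.
have [n3 H3] := prob_regular_whp E c0.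
have e2 : 0 < 2^-1 :> R by rewrite invr_gt0.
have [n4 H4] := expR_small c0 e2.
exists e0 => //; exists (c / 2); first by rewrite divr_gt0.
exists (maxn n1 (maxn n2 (maxn n3 (maxn n4 1)))) => n;
  rewrite !geq_max => /and5P[nn1 nn2 nn3 nn4 n0] on.
have nR : 0 < n%:R :> R by rewrite ltr0n.
have oh : ~~ odd #|{: 'I_n * 'I_d}| by rewrite odd_half.
have NE : half_edges 'I_n d = (n * d)%N by rewrite /half_edges card_prod !card_ord.
pose Q (mf : {perm 'I_n * 'I_d} * {ffun 'I_n -> M}) := [forall x,
  `|(edge_count mf.1 mf.2 x)%:R / (half_edges 'I_n d)%:R - p x| <= dl].
pose ZQ m := #|[set f : {ffun 'I_n -> M} | Q (m, f)]|.
pose B1 := [set m in config_matchings 'I_n d | expR (n%:R * (Sg + eta)) <= (ZQ m)%:R].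
pose B2 := [set m in config_matchings 'I_n d | de * n%:R < #|colliding L m|%:R].
have h2 := H2 'I_n; rewrite card_ord in h2; have {h2} h2 := h2 nn2 oh.
have h1 : #|B1|%:R <= #|config_matchings 'I_n d|%:R * expR (- (c1 * n%:R)).
  have := H1 'I_n (Sg + eta / 3) Q; rewrite card_ord => /(_ nn1).
  rewrite NE => /(_ _ _) H.
  have {}H := H _ _ _; have := H; rewrite muln_gt0 n0 => /(_ isT on) {}H.
  have HB mf : mf.1 \in config_matchings 'I_n d -> Q mf ->
    Sigma d (freq R 'I_n d (edge_count mf.1 mf.2)) <= Sg + eta / 3.
    move=> mP /forallP q; rewrite -lerBlDl; apply: le_trans (ler_norm _) _.
    by apply: dlP => //; apply: freq_edge_law => //; rewrite NE muln_gt0 n0.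
  have {}H := H HB.
  rewrite -(ler_pM2r (expR_gt0 (n%:R * (Sg + eta)))) -mulrA -expRD.
  apply: le_trans (le_trans _ H) _; last first.
    apply: ler_wpM2l => //; by rewrite ler_expR /c1 expo.
  apply: (@le_trans _ _ (\sum_(m in B1) (ZQ m)%:R)).
    rewrite [leLHS](_ : _ = \sum_(m in B1) expR (n%:R * (Sg + eta))); last first.
      by rewrite sumr_const [LHS]mulr_natl.
    apply: ler_sum => m; rewrite finset.in_set.
    by case/andP.
  rewrite -natr_sum ler_nat -[X in (_ <= X)%N]sum1_card.
  rewrite [X in (_ <= X)%N](partition_big (fun mf : {perm 'I_n * 'I_d} * {ffun 'I_n -> M} =>
    mf.1) (mem (config_matchings 'I_n d)))/=; last first.
    by move=> mf; rewrite finset.in_set => /andP[].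
  rewrite [X in (_ <= X)%N](bigID (mem B1))/=; apply: leq_trans (leq_addr _ _).
  rewrite [X in (X <= _)%N](eq_bigl (fun m => (m \in config_matchings 'I_n d) && (m \in B1))) =>
    [|m]; last first.
    by rewrite finset.in_set andbA andbb.
  apply: leq_sum => m /andP[mP _]; rewrite sum1_card /ZQ.
  have inj : injective (fun f : {ffun 'I_n -> M} => (m, f)) by move=> f g [].
  rewrite -(card_imset _ inj); apply: subset_leq_card; apply/fintype.subsetP => _ /imsetP[f fQ ->].
  by rewrite unfold_in finset.in_set mP /= eqxx andbT; move: fQ; rewrite finset.in_set.
apply: (H3 n nn3 _ (B1 :|: B2)).
  move=> m mS A1; rewrite finset.in_setU; apply/negPn/negP; rewrite negb_or => /andP[mB1 mB2].
  have mP : m \in config_matchings 'I_n d by move: mS; rewrite inE => /andP[].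
  have g2 : #|colliding L m|%:R <= de * n%:R.
    by move: mB2; rewrite finset.in_set mP /= -leNgt.
  move: mB1; rewrite finset.in_set mP /= => /negP; apply; apply: le_trans A1 _.
  rewrite ler_nat; apply: subset_leq_card; apply/fintype.subsetP => f.
  rewrite !finset.in_set => /e0P close; apply/forallP => -[a b] /=.
  have LP' x : in_tree d x -> (size x <= 2)%N -> x \in L by exact: LP.
  have := sum_star_edges_distr R BP f n0 mS LP' n0 a b; have := sum_star_edges_tree muP BP a b.
  set S1 := \sum_X _; set S2 := \sum_X _ => e1 e2'.
  have KS : (\sum_(X : {ffun seq_sub B -> M}) star_edges X a b)%N%:R <= K.
    rewrite /K ler_wpDr// ler_nat (bigD1 a)//= (bigD1 b)//= -addnA; exact: leq_addr.
  have s12 : `|S2 - S1| <= K * de.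
    rewrite -sumrB; apply: le_trans (ler_norm_sum _ _ _) _.
    apply: (@le_trans _ _ ((\sum_(X : {ffun seq_sub B -> M}) star_edges X a b)%N%:R * de));
      last by rewrite ler_wpM2r// ltW.
    rewrite natr_sum mulr_suml; apply: ler_sum => X _.
    by rewrite -mulrBr normrM normr_nat; apply: ler_wpM2l => //; exact: close.
  have s2 : `|(edge_count m f (a, b))%:R / n%:R - S2| <= K * de.
    apply: le_trans e2' _; apply: ler_pM => //; by rewrite ?divr_ge0 ?ler_pdivrMr.
  have Kde : K * de = dl / 2 by rewrite /de mulrC divfK// gt_eqF.
  have dR : 1 <= d%:R :> R by rewrite ler1n.
  have d0 : 0 < d%:R :> R by rewrite ltr0n.
  rewrite NE natrM invfM mulrA.
  have -> : (edge_count m f (a, b))%:R / n%:R / d%:R - p (a, b) = ((edge_count m f (a,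
    b))%:R / n%:R - S1) / d%:R.
    by rewrite mulrBl e1 [d%:R * _]mulrC mulfK// gt_eqF.
  rewrite normrM normfV (ger0_norm (ltW d0)) ler_pdivrMr//.
  apply: (@le_trans _ _ dl); last by rewrite ler_peMr// ltW.
  have -> : (edge_count m f (a, b))%:R / n%:R - S1 = ((edge_count m f (a,
    b))%:R / n%:R - S2) + (S2 - S1).
    by rewrite subrKA.
  by apply: le_trans (ler_normD _ _) _; apply: le_trans (lerD s2 s12) _; rewrite Kde -splitr.
apply: (@le_trans _ _ (#|B1|%:R + #|B2|%:R)).
  by rewrite -natrD ler_nat; exact: (leq_of_leqif (leq_card_setU _ _)).
apply: le_trans (lerD h1 h2) _; rewrite -mulrDr; apply: ler_wpM2l => //.
have half c' : 2 * c <= c' -> expR (- (c' * n%:R)) <= expR (- (c * n%:R)) * 2^-1.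
  move=> cc; apply: le_trans (_ : _ <= expR (- (c * n%:R)) * expR (- (c * n%:R))) _.
    rewrite -expRD ler_expR -opprD lerN2 -mulrDl ler_wpM2r//.
    by move: cc; rewrite mulr_natl mulr2n.
  by apply: ler_wpM2l; [exact: expR_ge0|exact: H4].
have cc : 2 * c = Order.min c1 c2 by rewrite /c mulrC divfK.
rewrite [leRHS](_ : _ = expR (- (c * n%:R)) * 2^-1 + expR (- (c * n%:R)) * 2^-1); last first.
  by rewrite -mulrDr -[2^-1]mul1r -splitr mulr1.
by apply: lerD; apply: half; rewrite cc ge_min lexx ?orbT.
Qed.

End typical.

Local Open Scope classical_set_scope.
Local Open Scope ring_scope.

(** * Limits in the tolerance and along admissible sizes *)

Lemma lim_right_squeeze (R : realType) (F : R -> \bar R) (s : R) :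
  (forall eta : R, 0 < eta -> exists2 e0 : R, 0 < e0 & forall e : R, 0 < e -> e <= e0 ->
    ((s - eta)%:E <= F e)%E /\ (F e <= (s + eta)%:E)%E) ->
  lim (F e @[e --> 0^'+]) = s%:E.
Proof.
move=> H; apply: cvg_lim; first exact: ereal_hausdorff.
apply/fine_cvgP; split.
  have [e0 e00 H0] := H 1 ltr01; near=> e.
  have [] := H0 e; [by near: e; exact: nbhs_right_gt|by near: e; exact: nbhs_right_le|].
  by case: (F e).
apply/cvgrPdist_le => eta eta0; have [e0 e00 H0] := H eta eta0; near=> e.
have [] := H0 e; [by near: e; exact: nbhs_right_gt|by near: e; exact: nbhs_right_le|].
rewrite /=; case: (F e) => // y; rewrite !lee_fin => sy ys; rewrite /= ler_distlC.
by apply/andP.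
Unshelve. all: by end_near. Qed.

Section admissible_limits.
Variables (R : realType) (d : nat).
Implicit Types (u : nat -> \bar R) (x : \bar R).

Lemma near_admissible (P : set nat) (n0 : nat) :
  (forall n, (n0 <= n)%N -> (d < n)%N -> ~~ odd (n * d) -> P n) -> admissible d P.
Proof. by move=> H; exists n0 => // n /= nn /andP[dn on]; exact: H. Qed.

(** The filter is proper, because large even sizes are admissible for every [d]. *)
Lemma admissible_ex (P : set nat) : admissible d P -> exists n, P n.
Proof.
move=> [N _ NP]; exists (2 * (N + d).+1)%N; apply: NP => /=; first lia.
by rewrite oddM oddM /= andbT; lia.
Qed.

Lemma limf_esup_admissible_le u x : admissible d [set n | (u n <= x)%E] ->
  (limf_esup u (admissible d) <= x)%E.
Proof.
move=> H; apply: (@le_trans _ _ (ereal_sup (u @` [set n | (u n <= x)%E]))).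
  by apply: ereal_inf_lbound; exists [set n | (u n <= x)%E].
by apply: ge_ereal_sup => _ [n /= ? <-].
Qed.

Lemma limf_esup_admissible_ge u x : admissible d [set n | (x <= u n)%E] ->
  (x <= limf_esup u (admissible d))%E.
Proof.
move=> H; apply: le_ereal_inf_tmp => _ [A AF <-].
have [n [An xn]] : exists n, A n /\ (x <= u n)%E.
  apply: (@admissible_ex [set n | A n /\ (x <= u n)%E]).
  have := @filterI _ (admissible d) _ _ _ AF H; exact.
by apply: le_trans xn _; apply: ereal_sup_ubound; exists n.
Qed.

Lemma limf_einf_admissible_le u x : admissible d [set n | (u n <= x)%E] ->
  (limf_einf u (admissible d) <= x)%E.
Proof.
move=> H; rewrite /limf_einf leeNl; apply: limf_esup_admissible_ge.
by apply: filterS H => n /=; rewrite leeN2.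
Qed.

Lemma limf_einf_admissible_ge u x : admissible d [set n | (x <= u n)%E] ->
  (x <= limf_einf u (admissible d))%E.
Proof.
move=> H; rewrite /limf_einf leeNr; apply: limf_esup_admissible_le.
by apply: filterS H => n /=; rewrite leeN2.
Qed.

End admissible_limits.

(** * Sofic entropy as a quantile of the number of colourings *)

Section sofic_entropy.
Variables (R : realType) (E : nat) (M : pointedFinType).
Local Notation d := E.+2.
Local Notation law := (probability (rooted_graph R M) R).
Variables (dist : law -> law -> R) (mu : probability (process_space d M) R).
Local Notation prob n := (@prob_regular R d n).

Lemma graph_entropy_ge n (G : {set {set 'I_n}}) r (eps x : R) : (0 < n)%N ->
  (x%:E <= graph_entropy dist mu G r eps)%E =
  (expR (n%:R * x) <= #|good_colorings dist mu G r eps|%:R).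
Proof.
move=> n0; have nR : 0 < n%:R :> R by rewrite ltr0n.
rewrite /graph_entropy; case: (posnP #|good_colorings dist mu G r eps|) => [->|c0].
  by rewrite le0_lneNy// mulrNy gtr0_sg ?invr_gt0// mul1e leeNy_eq [RHS]leNgt expR_gt0.
have cR : 0 < #|good_colorings dist mu G r eps|%:R :> R by rewrite ltr0n.
rewrite lne_EFin// -EFinM lee_fin mulrC ler_pdivlMr// -[in RHS](lnK cR) ler_expR mulrC.
by [].
Qed.

Lemma sofic_h_le n r (eps alpha x : R) : (0 < n)%N ->
  prob n (fun G => expR (n%:R * x) <= #|good_colorings dist mu G r eps|%:R) < alpha ->
  (sofic_h dist mu n r eps alpha <= x%:E)%E.
Proof.
move=> n0 H; apply: ge_ereal_sup => h /= [[->|[y _ ->]] ah]; first exact: leNye.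
rewrite lee_fin leNgt; apply/negP => xy.
have := le_lt_trans ah (le_lt_trans _ H); rewrite ltxx => /(_ _)/negP; apply; last by [].
apply: prob_le => G; rewrite graph_entropy_ge//; apply: le_trans.
by rewrite ler_expR ler_wpM2l// ltW.
Qed.

Lemma sofic_h_ge n r (eps alpha x : R) : (0 < n)%N ->
  alpha <= prob n (fun G => expR (n%:R * x) <= #|good_colorings dist mu G r eps|%:R) ->
  (x%:E <= sofic_h dist mu n r eps alpha)%E.
Proof.
(* The supremum runs over minus infinity and nonnegative reals, and a nonzero number of colourings
   is at least 1: a negative [x] may be replaced by 0. *)
move=> n0 H; apply: (@le_trans _ _ (Order.max 0 x)%:E); first by rewrite lee_fin le_max lexx orbT.
apply: ereal_sup_ubound; split; first by right; exists (Order.max 0 x) => //; rewrite le_max lexx.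
apply: le_trans H _; apply: prob_le => G; rewrite graph_entropy_ge// => h.
case: (leP x 0) => // _; rewrite mulr0 expR0 ler1n -(ltr0n R).
exact: lt_le_trans (expR_gt0 _) h.
Qed.

End sofic_entropy.

(** * Values of the sofic entropies and strong typicality *)

Section conclusion.
Variables (R : realType) (E : nat) (M : pointedFinType) (p : M * M -> R).
Local Notation d := E.+2.
Local Notation law := (probability (rooted_graph R M) R).
Variables (dist : law -> law -> R) (mu : probability (process_space d M) R).
Hypotheses (Hdist : weak_distance dist) (pL : edge_law p) (muP : is_markov_process p mu).
Hypothesis Hq : forall q : (M * M) * (M * M) -> R,
  edge_law q -> coupling p p q -> Sigma d q <= 2 * Sigma d p.
Local Notation prob n := (@prob_regular R d n).
Local Notation Sg := (Sigma d p).

Lemma many_typical_prob (W : set law) (eta a : R) :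
  weak_nbhs (tree_law mu) W -> 0 < eta -> a < 1 ->
  exists n0 : nat, forall n, (n0 <= n)%N -> ~~ odd (n * d) ->
    a <= prob n (fun G => expR (n%:R * (Sg - eta)) <=
       #|[set f : {ffun 'I_n -> M} | `[< W (distr R G f) >]]%SET|%:R).
Proof.
move=> WW eta0 a1; have [c c0 [n1 H1]] := many_typical pL muP Hq WW eta0.
have [n2 H2] := regular_graphs_gt0 R E.
have a0 : 0 < 1 - a by rewrite subr_gt0.
have [n3 H3] := expR_small c0 a0.
exists (maxn n1 (maxn n2 n3)) => n; rewrite !geq_max => /and3P[nn1 nn2 nn3] on.
set A := fun G => _; have := probC R A (H2 n nn2 on).
have := H1 n nn1 on; rewrite -/A => h1 e; have := H3 n nn3.
rewrite -/(A _) in h1.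
move: h1 e; set u := prob n A; set v := prob n _; set w := expR _; lra.
Qed.

(** The lower bound holds with probability at least [a]; the event that would violate the upper
    bound has probability at most [a / 2]. Hence the same value for every quantile. *)
Lemma sofic_h_close r (eta a : R) : (0 < r)%N -> 0 < eta -> 0 < a < 1 ->
  exists2 e0 : R, 0 < e0 & forall e : R, 0 < e -> e <= e0 ->
    admissible d [set n | ((Sg - eta)%:E <= sofic_h dist mu n r e a)%E /\
                          (sofic_h dist mu n r e a <= (Sg + eta)%:E)%E].
Proof.
move=> r0 eta0 /andP[a0 a1]; have [e0 e00 [c c0 [n1 H1]]] := few_good_colorings pL muP Hdist r0
  eta0.
exists e0 => // e ep ee.
have a20 : 0 < a / 2 by rewrite divr_gt0.
have [n2 H2] := expR_small c0 a20.
have WW := weak_nbhs_ball_law (dist_ball_nbhs Hdist (ball_law r (tree_law mu)) ep).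
have [n3 H3] := many_typical_prob WW eta0 a1.
apply: (@near_admissible d _ (maxn n1 (maxn n2 n3))) => n;
  rewrite !geq_max => /and3P[nn1 nn2 nn3] dn on.
have n0 : (0 < n)%N by exact: leq_ltn_trans dn.
split.
  apply: sofic_h_ge => //; apply: le_trans (H3 n nn3 on) _; apply: prob_le => G.
  move=> h; apply: le_trans h _; rewrite ler_nat; apply: subset_leq_card;
    apply/fintype.subsetP => f.
  by rewrite !finset.in_set => /asboolP.
apply: sofic_h_le => //; apply: (@le_lt_trans _ _ (a / 2));
  last by rewrite ltr_pdivrMr// ltr_pMr// ltr1n.
apply: le_trans (H2 n nn2); apply: le_trans (H1 n nn1 on); apply: prob_le => G h.
apply: le_trans h _; rewrite ler_nat; apply: subset_leq_card; apply/fintype.subsetP => f.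
by rewrite !finset.in_set => /le_trans; apply.
Qed.

(** At radius 0 only vertex frequencies are tested and the value can be larger; the limit in [r]
    sees positive radii. *)
Lemma upper_sofic_atE r a : (0 < r)%N -> 0 < a < 1 -> upper_sofic_at dist mu r a = Sg%:E.
Proof.
move=> r0 aP; apply: lim_right_squeeze => eta eta0.
have [e0 e00 H] := sofic_h_close r0 eta0 aP; exists e0 => // e ep ee; have := H e ep ee.
by move=> {}H; split; [apply: limf_esup_admissible_ge|apply: limf_esup_admissible_le];
  apply: filterS H => n /= [].
Qed.

Lemma lower_sofic_atE r a : (0 < r)%N -> 0 < a < 1 -> lower_sofic_at dist mu r a = Sg%:E.
Proof.
move=> r0 aP; apply: lim_right_squeeze => eta eta0.
have [e0 e00 H] := sofic_h_close r0 eta0 aP; exists e0 => // e ep ee; have := H e ep ee.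
by move=> {}H; split; [apply: limf_einf_admissible_ge|apply: limf_einf_admissible_le];
  apply: filterS H => n /= [].
Qed.

Lemma upper_soficE a : 0 < a < 1 -> upper_sofic dist mu a = Sg%:E.
Proof.
move=> aP; apply: lim_near_cst; first exact: ereal_hausdorff.
by exists 1%N => // r /= r0; exact: upper_sofic_atE.
Qed.

Lemma lower_soficE a : 0 < a < 1 -> lower_sofic dist mu a = Sg%:E.
Proof.
move=> aP; apply: lim_near_cst; first exact: ereal_hausdorff.
by exists 1%N => // r /= r0; exact: lower_sofic_atE.
Qed.

Lemma markov_strongly_typical : strongly_typical dist mu.
Proof.
exists (functions.cst 1); split; last exact: cvg_cst.
move=> eps eps0; apply/cvgrPdist_le => e e0.
have a1 : 1 - e < 1 by rewrite ltrBlDr ltrDl.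
have [n1 H1] := many_typical_prob (dist_ball_nbhs Hdist (tree_law mu) eps0) (@ltr01 R) a1.
apply: (@near_admissible d _ n1) => n nn _ on /=.
rewrite ger0_norm ?subr_ge0; last exact: prob_le1.
rewrite lerBlDr -lerBlDl; apply: le_trans (H1 n nn on) _; apply: prob_le => G h.
have : (0 < #|[set f : {ffun 'I_n -> M} | `[< (dist (distr R G f) (tree_law mu) <=
  eps)%R >]]%SET|)%N.
  by rewrite -(ltr0n R); apply: lt_le_trans h; exact: expR_gt0.
by case/card_gt0P => f; rewrite finset.in_set => /asboolP fP; apply/existsP; exists f.
Qed.

End conclusion.

Theorem theorem1p15 (R : realType) (d : nat) (M : pointedFinType)
    (dist : probability (rooted_graph R M) R ->
            probability (rooted_graph R M) R -> R)
    (p : M * M -> R) (mu : probability (process_space d M) R) :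
  weak_distance dist ->
  (3 <= d)%N ->
  edge_law p ->
  (forall q : (M * M) * (M * M) -> R,
     edge_law q -> coupling p p q -> Sigma d q <= 2 * Sigma d p) ->
  is_markov_process p mu ->
  (forall alpha : R, 0 < alpha < 1 ->
     lower_sofic dist mu alpha = upper_sofic dist mu alpha /\
     upper_sofic dist mu alpha = (Sigma d p)%:E) /\
  strongly_typical dist mu.
Proof.
(* Excluding 0 and 1 leaves [d = E.+2], the form in which walks and branches are indexed. *)
case: d mu => [|[|E]] // mu Hdist _ pL Hq muP; split=> [a aP|].
  by rewrite (lower_soficE Hdist pL muP Hq aP) (upper_soficE Hdist pL muP Hq aP).
exact: markov_strongly_typical Hdist pL muP Hq.
Qed.
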